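(* Let $G$ be a locally compact Abelian group with Haar measure $m$ and dual group $\widehat G$ with Haar measure $\widehat m$. Let $\{F_N\}_{N\ge1}$ be a Følner sequence in $\widehat G$, and define $$\mathcal H_N=\{f\in L^2(G):\operatorname{supp}(\widehat f)\subset F_N\},\qquad c(N)=\widehat m(F_N).$$ Let $\sigma\in L^1(G,m)$ be real-valued and let $T_\sigma^N$ be the Toeplitz operator $T_\sigma^Nf=P_N(\sigma f)$ on $\mathcal H_N$, where $P_N:L^2(G)\to\mathcal H_N$ is the orthogonal projection. If either (a) $\sigma$ is bounded, $\sigma\in L^1(G)$, and $\psi$ is a real-valued continuous function on $[\operatorname{ess\,inf}\sigma,\operatorname{ess\,sup}\sigma]$; or (b) $\sigma\ge0$, $\sigma\in L^2(G)$, and $\psi\in C([0,\infty))$ is real-valued and such that the limit $\lim_{x\to\infty}\psi(x)/x$ exists and is finite, then $$\lim_{N\to\infty}\frac1{c(N)}\operatorname{Tr}\bigl(T_\sigma^N\psi(T_\sigma^N)\bigr)=\int_G\sigma(x)\psi(\sigma(x))\,dm(x).$$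
   Context: A Følner sequence in $\widehat G$ is a sequence of measurable sets $F_N\subset\widehat G$ with $0<\widehat m(F_N)<\infty$ and $\widehat m((F_N+\gamma)\triangle F_N)/\widehat m(F_N)\to0$ as $N\to\infty$ for every $\gamma\in\widehat G$. $\widehat f$ is the Fourier transform of $f$, and $\widehat m$ is the dual Haar measure, normalized so that the Plancherel formula $\|f\|_{L^2(G,m)}=\|\widehat f\|_{L^2(\widehat G,\widehat m)}$ and the inversion formula hold. The condition $\operatorname{supp}(\widehat f)\subset F_N$ means that $\widehat f=0$ almost everywhere outside $F_N$. With this normalization $\mathcal H_N$ is a reproducing kernel Hilbert space with kernel $K_N(x,y)=\int_{F_N}\xi(x-y)\,d\widehat m(\xi)$. $\psi(T_\sigma^N)$ is defined by functional calculus of the self-adjoint operator $T_\sigma^N$. *)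

(* Defs.v *)
From HB Require Import structures.
From mathcomp Require Import all_boot all_order all_algebra.
From mathcomp Require Import all_classical all_reals all_analysis.
From mathcomp.real_closed Require Import complex.

Set Implicit Arguments.
Unset Strict Implicit.
Unset Printing Implicit Defensive.

Import Order.TTheory GRing.Theory Num.Theory.
Import numFieldNormedType.Exports.

Local Open Scope classical_set_scope.
Local Open Scope complex_scope.
Local Open Scope quotient_scope.
Local Open Scope ring_scope.

Local Notation Re := complex.Re.
Local Notation Im := complex.Im.

Section complex_Lebesgue.
Context d (T : measurableType d) (R : realType).
Variable mu : {measure set T -> \bar R}.

Definition cLfun (p : \bar R) : {pred T -> R[i]} :=
  [pred f : T -> R[i] | ((fun x => Re (f x)) \in Lfun mu p) &&
           ((fun x => Im (f x)) \in Lfun mu p)].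

Definition cintegral (f : T -> R[i]) : R[i] :=
  (\int[mu]_x Re (f x)) +i* (\int[mu]_x Im (f x)).

Lemma cLfun_submod_closed p : (1 <= p)%E -> submod_closed (cLfun p).
Proof.
move=> p1; have [L0 LD] := Lfun_submod_closed mu p1.
have LZ a f : f \in Lfun mu p -> a *: f \in Lfun mu p.
  by move=> Lf; rewrite -[_ *: _]addr0 LD.
have LA f g : f \in Lfun mu p -> g \in Lfun mu p -> f + g \in Lfun mu p.
  by move=> Lf Lg; rewrite -[f]scale1r LD.
split; first by rewrite !inE; apply/andP.
move=> a f g /andP[fr fi] /andP[gr gi]; apply/andP; split.
- rewrite (_ : (fun x => _) = (Re a *: (fun x => Re (f x))
      + - Im a *: (fun x => Im (f x))) + (fun x => Re (g x)));
    first by rewrite LA// LA// LZ.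
  apply/funext => x; rewrite !fctE/= raddfD/=; congr (_ + _).
  by case: (f x) (a) => u v [b c]; rewrite scaleNr.
- rewrite (_ : (fun x => _) = (Re a *: (fun x => Im (f x))
      + Im a *: (fun x => Re (f x))) + (fun x => Im (g x)));
    first by rewrite LA// LA// LZ.
  apply/funext => x; rewrite !fctE/= raddfD/=; congr (_ + _).
  by case: (f x) (a) => u v [b c].
Qed.

(* A constant of its own, so that the closure instances below have a key. *)
Definition cLfun2 : {pred T -> R[i]} := cLfun 2%:E.

Lemma cLfun2_submod_closed : submod_closed cLfun2.
Proof. by apply: cLfun_submod_closed; rewrite lee_fin ler1n. Qed.

HB.instance Definition _ :=
  GRing.isSubmodClosed.Build R[i] (T -> R[i]) cLfun2 cLfun2_submod_closed.

Definition L2fun := {f : T -> R[i] | f \in cLfun2}.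
HB.instance Definition _ := SubChoice.on L2fun.
HB.instance Definition _ := [SubChoice_isSubLmodule of L2fun by <:].

Definition L2null : {pred L2fun} :=
  [pred f : L2fun | `[< {ae mu, forall x, \val f x = 0} >]].

Lemma L2null_submod_closed : submod_closed L2null.
Proof.
split; first by apply/asboolP/nearW.
move=> a f g /asboolP f0 /asboolP g0; apply/asboolP.
near=> x.
have fx : \val f x = 0 by near: x.
have gx : \val g x = 0 by near: x.
rewrite !linearP /=.
by rewrite !fctE fx gx scaler0 addr0.
Unshelve. all: by end_near. Qed.

HB.instance Definition _ :=
  GRing.isSubmodClosed.Build R[i] L2fun L2null L2null_submod_closed.

(* Complex-valued square-integrable functions modulo a.e. equality; [repr]
   selects a representative. *)
Definition L2 := {ideal_quot L2null}.
HB.instance Definition _ := GRing.Zmodule.on L2.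


Implicit Types (a b : R[i]) (u v : L2).

Definition L2scale a u : L2 := \pi_L2 (a *: repr u).

Lemma pi_L2scale a (f : L2fun) : L2scale a (\pi_L2 f) = \pi_L2 (a *: f).
Proof.
apply/eqP; rewrite -[_ == _]Quotient.idealrBE -scalerBr.
by apply: rpredZ; rewrite Quotient.idealrBE reprK.
Qed.

Let L2scaleA a b v : L2scale a (L2scale b v) = L2scale (a * b) v.
Proof. by rewrite -[v]reprK (pi_L2scale b) !pi_L2scale scalerA. Qed.

Let L2scale1 : left_id 1 L2scale.
Proof. by move=> v; rewrite -[v]reprK pi_L2scale scale1r. Qed.

Let L2scaleDr : right_distributive L2scale +%R.
Proof.
move=> a u v; rewrite -[u]reprK -[v]reprK -raddfD !pi_L2scale -raddfD.
by rewrite scalerDr.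
Qed.

Let L2scaleDl v : {morph L2scale^~ v : a b / a + b}.
Proof.
by move=> a b /=; rewrite -[v]reprK !pi_L2scale -raddfD scalerDl.
Qed.

HB.instance Definition _ := GRing.Zmodule_isLmodule.Build R[i] L2
  L2scaleA L2scale1 L2scaleDr L2scaleDl.

Definition L2inner u v : R[i] :=
  cintegral (fun x => \val (repr u) x * (\val (repr v) x)^*).

(* The class of [f], or 0 if [f] is not square-integrable. *)
Definition toL2 (f : T -> R[i]) : L2 := \pi_L2 (insubd (0 : L2fun) f).

End complex_Lebesgue.

(* Operators on a closed subspace [H] of a Hilbert space [V] are functions
   [V -> V] of which only the restriction to [H] matters. *)
Section operators.
Context (R : realType) (V : lmodType R[i]).
Variables (dot : V -> V -> R[i]) (H : set V).
Implicit Types (S T B : V -> V) (E : set V).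

Definition hnorm (u : V) : R := Num.sqrt (Re (dot u u)).

Definition bounded_operator T :=
  [/\ forall u, H u -> H (T u),
      forall (a : R[i]) u v, H u -> H v -> T (a *: u + v) = a *: T u + T v &
      exists C : R, forall u, H u -> hnorm (T u) <= C * hnorm u].

Definition positive_operator T :=
  bounded_operator T /\ forall u, H u -> 0 <= dot (T u) u.

Definition spectrum T : set R[i] :=
  [set z | ~ exists2 S, bounded_operator S &
     forall u, H u -> S (T u - z *: u) = u /\ T (S u) - z *: S u = u].

Definition poly_operator (p : {poly R}) T (u : V) : V :=
  \sum_(i < size p) (p`_i)%:C *: iter i T u.

(* Continuous functional calculus of a bounded self-adjoint operator [T], whose
   spectrum is real: [psi T] is the limit in operator norm of [p_n T] whenever
   the polynomials [p_n] converge to [psi] uniformly on the spectrum. *)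
Definition is_functional_calculus (psi : R -> R) T B :=
  bounded_operator B /\
  forall p : nat -> {poly R},
    {uniform [set x : R | spectrum T x%:C],
      (fun n x => (p n).[x]) @ \oo --> psi} ->
    forall e : R, 0 < e -> \forall n \near \oo,
      forall u, H u -> hnorm (poly_operator (p n) T u - B u) <= e * hnorm u.

Definition functional_calculus (psi : R -> R) T : V -> V :=
  xget (fun=> 0) [set B | is_functional_calculus psi T B].

Definition orthogonal_projection (u : V) : V :=
  xget 0 [set v | H v /\ forall w, H w -> dot (u - v) w = 0].

Definition hilbert_basis E :=
  [/\ E `<=` H,
      forall e f, E e -> E f -> dot e f = (e == f)%:R &
      forall u, H u -> (forall e, E e -> dot u e = 0) -> u = 0].

(* Unordered sums over an index set that may be uncountable. *)
Definition has_sum E (a : V -> R[i]) (s : R[i]) :=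
  forall eps : R, 0 < eps -> exists2 E0 : set V, finite_set E0 /\ E0 `<=` E &
    forall E1 : set V, finite_set E1 -> E0 `<=` E1 -> E1 `<=` E ->
      `|\sum_(e \in E1) a e - s| < eps%:C.

(* [A] is the absolute value of [S]: it is positive and [A^2 = S^* S]. *)
Definition trace_class S :=
  bounded_operator S /\
  exists A, [/\ positive_operator A,
    forall u v, H u -> H v -> dot (A u) (A v) = dot (S u) (S v) &
    exists2 E, hilbert_basis E & exists s, has_sum E (fun e => dot (A e) e) s].

Definition trace S : R[i] :=
  xget 0 [set t | forall E, hilbert_basis E -> has_sum E (fun e => dot (S e) e) t].

End operators.

(* An alias of [G], because a [topologicalZmodType] is not a [pointedType], as
   the measurable types of the library are. *)
Definition borel (G : PreTopologicalZmodule.type) : Type := G.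

Section borel.
Variable G : PreTopologicalZmodule.type.
HB.instance Definition _ := Choice.on (borel G).
HB.instance Definition _ := isPointed.Build (borel G) (0 : G).
HB.instance Definition _ :=
  Measurable.copy (borel G) (g_sigma_algebraType (open : set (set (borel G)))).
End borel.

Section haar.
Context (R : realType) (G : PreTopologicalZmodule.type).

(* Radon measures are outer regular on Borel sets and inner regular on open
   sets; [G] need not be sigma-compact. *)
Definition haar_measure (mu : {measure set (borel G) -> \bar R}) :=
  [/\ (0 < mu setT)%E,
      forall K : set G, compact K -> (mu K < +oo)%E,
      forall A : set (borel G), measurable A ->
        mu A = ereal_inf [set mu U | U in [set U : set G | open U /\ A `<=` U]],
      forall U : set G, open U ->
        mu U = ereal_sup [set mu K | K in [set K : set G | compact K /\ K `<=` U]] &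
      forall (x : G) (A : set (borel G)), measurable A ->
        mu [set y + x | y in (A : set G)] = mu A].

Definition folner_sequence (mu : {measure set (borel G) -> \bar R})
    (F : nat -> set (borel G)) :=
  [/\ forall N, measurable (F N),
      forall N, (0 < mu (F N) < +oo)%E &
      forall x : G,
        fine (mu ([set y + x | y in (F N : set G)] `+` F N)) / fine (mu (F N))
          @[N --> \oo] --> (0 : R)].

End haar.

Section dual_group.
Context (R : realType) (G : topologicalZmodType).

(* The dual group is written additively and carries the compact-open
   topology. *)
Record dual := Character {
  char_fun :> G -> R[i] ;
  char_continuous : continuous (char_fun : G -> R[i]^o) ;
  char_norm : forall x, `|char_fun x| = 1 ;
  charD : forall x y, char_fun (x + y) = char_fun x * char_fun y }.

HB.instance Definition _ := gen_eqMixin dual.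
HB.instance Definition _ := gen_choiceMixin dual.

Lemma dual_eq (xi eta : dual) : char_fun xi = char_fun eta -> xi = eta.
Proof.
by case: xi eta => f ? ? ? [g ? ? ?] /= fg; subst g; congr Character;
  exact: Prop_irrelevance.
Qed.

Program Definition dual_zero : dual := @Character (fun=> 1) _ _ _.
Next Obligation. exact: cst_continuous. Qed.
Next Obligation. by move=> x; rewrite normr1. Qed.
Next Obligation. by move=> x y; rewrite mulr1. Qed.

Program Definition dual_add (xi eta : dual) : dual :=
  @Character (fun x => xi x * eta x) _ _ _.
Next Obligation.
move=> xi eta x; apply: (@cvgM R[i] G _ _ (xi : G -> R[i]^o)).
- exact: char_continuous.
- exact: char_continuous.
Qed.
Next Obligation. by move=> xi eta x; rewrite normrM !char_norm mulr1. Qed.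
Next Obligation. by move=> xi eta x y; rewrite /= !charD mulrACA. Qed.

Program Definition dual_opp (xi : dual) : dual :=
  @Character (fun x => (xi x)^-1) _ _ _.
Next Obligation.
move=> xi x; apply: (@cvgV R[i] G _ _ (xi : G -> R[i]^o)).
- by rewrite -normr_eq0 char_norm oner_eq0.
- exact: char_continuous.
Qed.
Next Obligation. by move=> xi x; rewrite normfV char_norm invr1. Qed.
Next Obligation. by move=> xi x y; rewrite /= charD invfM. Qed.

Let dual_addA : associative dual_add.
Proof. by move=> x y z; apply/dual_eq/funext => t /=; rewrite mulrA. Qed.

Let dual_addC : commutative dual_add.
Proof. by move=> x y; apply/dual_eq/funext => t /=; rewrite mulrC. Qed.

Let dual_add0 : left_id dual_zero dual_add.
Proof. by move=> x; apply/dual_eq/funext => t /=; rewrite mul1r. Qed.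

Let dual_addN : left_inverse dual_zero dual_opp dual_add.
Proof.
move=> x; apply/dual_eq/funext => t /=.
by rewrite mulVf// -normr_eq0 char_norm oner_eq0.
Qed.

HB.instance Definition _ :=
  GRing.isZmodule.Build dual dual_addA dual_addC dual_add0 dual_addN.

HB.instance Definition _ := Topological.copy dual
  (initial_topology (fun xi : dual => (xi : {compact-open, G -> R[i]^o}))).

End dual_group.

Section Fourier.
Context (R : realType) (G : topologicalZmodType).
Variables (m : {measure set (borel G) -> \bar R})
  (mh : {measure set (borel (dual R G)) -> \bar R}).

Definition fourier (f : borel G -> R[i]) (xi : borel (dual R G)) : R[i] :=
  cintegral m (fun x => f x * ((xi : dual R G) (x : G))^*).

(* [mh] is the Haar measure of the dual group normalized with respect to [m] by
   the Plancherel and inversion formulas. *)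
Definition dual_haar_measure :=
  [/\ haar_measure mh,
      forall f, f \in cLfun m 1 -> f \in cLfun m 2%:E ->
        (\int[mh]_xi (Normc.normc (fourier f xi) ^+ 2)%:E =
         \int[m]_x (Normc.normc (f x) ^+ 2)%:E)%E &
      forall f, f \in cLfun m 1 -> fourier f \in cLfun mh 1 ->
        {ae m, forall x, f x =
          cintegral mh (fun xi => fourier f xi * (xi : dual R G) (x : G))}].

(* The Fourier-Plancherel transform: the extension by continuity of [fourier]
   from the intersection of L^1 and L^2 to all of L^2. *)
Definition is_fourier2 (f : L2 m) (g : L2 mh) :=
  exists u : nat -> borel G -> R[i],
    [/\ forall n, u n \in cLfun m 1 /\ u n \in cLfun m 2%:E,
        forall n, fourier (u n) \in cLfun mh 2%:E,
        hnorm (@L2inner _ _ _ m) (toL2 m (u n) - f) @[n --> \oo] --> 0 &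
        hnorm (@L2inner _ _ _ mh) (toL2 mh (fourier (u n)) - g)
          @[n --> \oo] --> 0].

Definition fourier2 (f : L2 m) : L2 mh := xget 0 [set g | is_fourier2 f g].

Definition band_limited (F : set (borel (dual R G))) : set (L2 m) :=
  [set f | {ae mh, forall xi, ~ F xi -> \val (repr (fourier2 f)) xi = 0}].

Definition toeplitz (F : set (borel (dual R G))) (sigma : borel G -> R)
    (f : L2 m) : L2 m :=
  orthogonal_projection (@L2inner _ _ _ m) (band_limited F)
    (toL2 m (fun x => (sigma x)%:C * \val (repr f) x)).

End Fourier.

Arguments band_limited {R G} m mh F _.
Arguments toeplitz {R G} m mh F sigma f.

(* Main.v *)
Require Import Defs.
From mathcomp Require Import all_boot all_order all_algebra.
From mathcomp Require Import all_classical all_reals all_analysis ess_sup_inf.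
From mathcomp.real_closed Require Import complex.
From mathcomp Require Import finmap measurable_realfun ring lra.

(** The space of band-limited functions has a reproducing kernel [K] with [|K y|^2 = c(N)], so that
    every orthonormal basis [e] of it satisfies [sum_e |e(y)|^2 = c(N)].  The operator with symbol
    [sigma] is compact and self-adjoint; its eigenvalues are the means [lam_e] of [sigma] for the
    probability densities [|e|^2], and their variances add up to
    [c(N) int sigma^2 - sum_e lam_e^2].  The function [psi] is, up to a small multiple of
    [1 + |x| + |y|], Lipschitz on the range of [sigma]; the distance from
    [sum_e lam_e psi(lam_e)] to [c(N) int sigma psi(sigma)] is therefore controlled by this total
    variance, and it remains to see that the latter is [o(c(N))].  Here the Fourier transform of
    [sum_e lam_e |e|^2] at [gamma] is that of [sigma] times the measure of
    [F_N cap (F_N - gamma)], whose quotient by [c(N)] tends to 1 by the Folner condition; hence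
    [liminf_N (1/c(N)) sum_e lam_e^2 >= int sigma^2] by Plancherel's formula. *)

Set Implicit Arguments.
Unset Strict Implicit.
Unset Printing Implicit Defensive.
Import Order.TTheory GRing.Theory Num.Theory.
Import numFieldNormedType.Exports.

Local Open Scope classical_set_scope.
Local Open Scope complex_scope.
Local Open Scope quotient_scope.
Local Open Scope ring_scope.

Local Notation Re := complex.Re.
Local Notation Im := complex.Im.
Local Notation normc := Normc.normc.

(** * Inner product spaces *)

(** Nothing makes [G] or its dual sigma-compact or second countable. Hence Hilbert bases may be
    uncountable and sums run along finite sets; Fubini's theorem for the two Haar measures is
    replaced by approximation on compact sets, where the characters that matter are equicontinuous;
    and the kernel at [y], prescribed by its transform, comes from the surjectivity of the
    Plancherel transform, itself a consequence of the uniqueness of Fourier integrals.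

    The trace of [T B], for [B] bounded, is computed in every basis at once, as the integral of
    [sigma y] times [<B K_y, K_y>]. The same identity for [B] the identity bounds the total
    variance; for [B] the compression of a conjugate character it gives the Fourier transform of
    [sum_e lam_e |e|^2], because [<B K_y, K_y>] is then a constant times the value of that conjugate
    character at [y].

    Plancherel's formula is applied only to finite partial sums of this series: their L^2 norms are
    at most [c(N)] times that of [sigma], and their transforms converge uniformly because the
    eigenvalues are absolutely summable. *)

Section complex_numbers.
Variable R : realType.
Implicit Types (z w : R[i]) (x : R).

Lemma ReD z w : Re (z + w) = Re z + Re w. Proof. by case: z; case: w. Qed.
Lemma ImD z w : Im (z + w) = Im z + Im w. Proof. by case: z; case: w. Qed.
Lemma ReN z : Re (- z) = - Re z. Proof. by case: z. Qed.
Lemma ImN z : Im (- z) = - Im z. Proof. by case: z. Qed.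
Lemma ReM z w : Re (z * w) = Re z * Re w - Im z * Im w.
Proof. by case: z; case: w. Qed.
Lemma ImM z w : Im (z * w) = Re z * Im w + Im z * Re w.
Proof. by case: z; case: w. Qed.
Lemma ReJ z : Re z^* = Re z. Proof. by case: z. Qed.
Lemma ImJ z : Im z^* = - Im z. Proof. by case: z. Qed.
Lemma complex_eqP z w : Re z = Re w -> Im z = Im w -> z = w.
Proof. by case: z => a b; case: w => c d /= -> ->. Qed.

Lemma Re_sum (I : Type) (s : seq I) (P : pred I) (F : I -> R[i]) :
  Re (\sum_(i <- s | P i) F i) = \sum_(i <- s | P i) Re (F i).
Proof. exact: (big_morph _ ReD). Qed.
Lemma normc_ge0 z : 0 <= normc z. Proof. by case: z => a b; exact: sqrtr_ge0. Qed.

Lemma normc_sqr z : normc z ^+ 2 = Re z ^+ 2 + Im z ^+ 2.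
Proof. by case: z => a b /=; rewrite sqr_sqrtr// addr_ge0// sqr_ge0. Qed.

Lemma mulJ z : z * z^* = (normc z ^+ 2)%:C.
Proof.
apply: complex_eqP; rewrite ?ReM ?ImM ?ReJ ?ImJ ?normc_sqr /=; ring.
Qed.

Lemma normcJ z : normc z^* = normc z.
Proof. by case: z => a b /=; rewrite sqrrN. Qed.

Lemma normr_normc z : `|z| = (normc z)%:C. Proof. by case: z. Qed.

Lemma normc_real x : normc x%:C = `|x|.
Proof. by rewrite /= expr0n/= addr0 sqrtr_sqr. Qed.

Lemma Re_le_normc z : `|Re z| <= normc z.
Proof.
case: z => a b /=; rewrite -sqrtr_sqr ler_sqrt ?lerDl ?sqr_ge0//.
by rewrite addr_ge0// sqr_ge0.
Qed.

Lemma Im_le_normc z : `|Im z| <= normc z.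
Proof.
case: z => a b /=; rewrite -sqrtr_sqr ler_sqrt ?lerDr ?sqr_ge0//.
by rewrite addr_ge0// sqr_ge0.
Qed.

Lemma normc_le_ReIm z : normc z <= `|Re z| + `|Im z|.
Proof.
rewrite -(@ler_pXn2r _ 2)// ?nnegrE ?normc_ge0 ?addr_ge0//.
rewrite normc_sqr sqrrD !real_normK ?num_real//.
by rewrite addrAC lerDl mulrn_wge0// mulr_ge0.
Qed.

Lemma ge0_complexE z : 0 <= z -> z = (Re z)%:C.
Proof. by move=> z0; apply: complex_eqP => //=; exact: ger0_Im. Qed.

Lemma normc0 : normc (0 : R[i]) = 0.
Proof. exact: Normc.normc0. Qed.

Lemma normc_sum (I : Type) (s : seq I) (P : pred I) (F : I -> R[i]) :
  normc (\sum_(i <- s | P i) F i) <= \sum_(i <- s | P i) normc (F i).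
Proof.
elim/big_ind2: _ => //; first by rewrite normc0.
move=> z1 a z2 b h1 h2; apply: (le_trans (le_normcD _ _)); exact: lerD.
Qed.

Lemma normc_distC z w : normc (z - w) = normc (w - z).
Proof. by rewrite -normcN opprB. Qed.

Lemma null_seq : exists2 d : nat -> R, forall n, 0 < d n &
  forall e : R, 0 < e -> exists N, forall n, (N <= n)%N -> d n < e.
Proof.
exists (fun n => n.+1%:R^-1) => [n|e e0]; first by rewrite invr_gt0.
exists (Num.bound e^-1) => n Nn.
rewrite invf_plt ?posrE//; apply: (lt_le_trans (archi_boundP _)).
  by rewrite invr_ge0 ltW.
by rewrite ler_nat ltnW.
Qed.

Lemma exp_lt_exists (q e : R) : 0 <= q < 1 -> 0 < e -> exists n, q ^+ n < e.
Proof.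
move=> /andP[q0 q1] e0.
have /cvgrPdist_lt/(_ e e0)[N _ /(_ N (leqnn _))] := @cvg_expr _ q (ltac:(by rewrite ger0_norm)).
by rewrite sub0r normrN ger0_norm ?exprn_ge0// => h; exists N.
Qed.

Lemma le_epsilon x y : (forall e : R, 0 < e -> x <= y + e) -> x <= y.
Proof. by move=> h; apply/ler_addgt0Pr. Qed.

Lemma normc_eq0_eps z : (forall e : R, 0 < e -> normc z <= e) -> z = 0.
Proof.
move=> h; apply: Normc.eq0_normc; apply/eqP; rewrite eq_le normc_ge0 andbT.
by apply: le_epsilon => e /h; rewrite add0r.
Qed.

End complex_numbers.

Section inner_product.
Context (R : realType) (V : lmodType R[i]).

Definition inner_product (dot : V -> V -> R[i]) :=
  [/\ forall a u v w, dot (a *: u + v) w = a * dot u w + dot v w,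
      forall u v, dot v u = (dot u v)^*,
      forall u, 0 <= dot u u &
      forall u, dot u u = 0 -> u = 0].

Definition subspace (H : set V) :=
  H 0 /\ forall a u v, H u -> H v -> H (a *: u + v).

Definition cauchy_seq dot (u : nat -> V) :=
  forall e : R, 0 < e -> exists N, forall n m, (N <= n)%N -> (N <= m)%N ->
    hnorm dot (u n - u m) < e.

Definition hcvg dot (u : nat -> V) (v : V) :=
  forall e : R, 0 < e -> exists N, forall n, (N <= n)%N -> hnorm dot (u n - v) < e.

(** Completeness of [H] in itself stands in for closedness, since the ambient [V] is not assumed
    complete. *)
Definition hcomplete dot (H : set V) :=
  forall u : nat -> V, (forall n, H (u n)) -> cauchy_seq dot u ->
    exists2 v, H v & hcvg dot u v.

Context (dot : V -> V -> R[i]) (ip : inner_product dot).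
Implicit Types (u v w e f : V) (a : R[i]) (H W E : set V) (A B : {fset V}).
Local Notation nm := (hnorm dot).

Lemma dot_linl a u v w : dot (a *: u + v) w = a * dot u w + dot v w.
Proof. by case: ip. Qed.
Lemma dotC u v : dot v u = (dot u v)^*. Proof. by case: ip. Qed.
Lemma dotDl u v w : dot (u + v) w = dot u w + dot v w.
Proof. by rewrite -[u]scale1r dot_linl mul1r scale1r. Qed.
Lemma dot0l w : dot 0 w = 0.
Proof. by apply: (addrI (dot 0 w)); rewrite -dotDl !addr0. Qed.
Lemma dotZl a u w : dot (a *: u) w = a * dot u w.
Proof. by rewrite -[_ *: _]addr0 dot_linl dot0l addr0. Qed.
Lemma dotNl u w : dot (- u) w = - dot u w.
Proof. by rewrite -scaleN1r dotZl mulN1r. Qed.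
Lemma dotBl u v w : dot (u - v) w = dot u w - dot v w.
Proof. by rewrite dotDl dotNl. Qed.
Lemma dotDr u v w : dot w (u + v) = dot w u + dot w v.
Proof. by rewrite dotC dotDl rmorphD /= -!dotC. Qed.
Lemma dotZr a u w : dot w (a *: u) = a^* * dot w u.
Proof. by rewrite dotC dotZl rmorphM /= -dotC. Qed.
Lemma dotNr u w : dot w (- u) = - dot w u.
Proof. by rewrite dotC dotNl rmorphN /= -dotC. Qed.
Lemma dotBr u v w : dot w (u - v) = dot w u - dot w v.
Proof. by rewrite dotDr dotNr. Qed.
Lemma dot0r w : dot w 0 = 0. Proof. by rewrite dotC dot0l rmorph0. Qed.
Lemma dot_suml (I : Type) (s : seq I) (F : I -> V) w :
  dot (\sum_(i <- s) F i) w = \sum_(i <- s) dot (F i) w.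
Proof. by apply: (big_morph (dot^~ w)) => [x y|]; rewrite ?dotDl ?dot0l. Qed.
Lemma dot_sumr (I : Type) (s : seq I) (F : I -> V) w :
  dot w (\sum_(i <- s) F i) = \sum_(i <- s) dot w (F i).
Proof. by apply: (big_morph (dot w)) => [x y|]; rewrite ?dotDr ?dot0r. Qed.

Lemma dot_ge0 u : 0 <= dot u u. Proof. by case: ip. Qed.
Lemma hnorm_ge0 u : 0 <= nm u. Proof. exact: sqrtr_ge0. Qed.
Lemma hnorm_sqr u : nm u ^+ 2 = Re (dot u u).
Proof. by rewrite sqr_sqrtr//; have := dot_ge0 u; rewrite lecE => /andP[]. Qed.
Lemma dot_self u : dot u u = (nm u ^+ 2)%:C.
Proof. by rewrite hnorm_sqr -ge0_complexE// dot_ge0. Qed.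
Lemma hnorm0 : nm 0 = 0. Proof. by rewrite /hnorm dot0l sqrtr0. Qed.
Lemma hnorm_eq0 u : nm u = 0 -> u = 0.
Proof. by move=> u0; case: ip => _ _ _; apply; rewrite dot_self u0 expr0n. Qed.
Lemma hnorm_gt0 u : u != 0 -> 0 < nm u.
Proof.
move=> u0; rewrite lt_neqAle hnorm_ge0 andbT eq_sym.
by apply: contraNneq u0 => /hnorm_eq0 ->.
Qed.
Lemma hnormZ a u : nm (a *: u) = normc a * nm u.
Proof.
apply/eqP; rewrite -(@eqrXn2 _ 2)// ?mulr_ge0 ?hnorm_ge0 ?normc_ge0//.
rewrite hnorm_sqr dotZl dotZr mulrA mulJ dot_self -rmorphM/=.
by rewrite exprMn.
Qed.
Lemma hnormN u : nm (- u) = nm u. Proof. by rewrite /hnorm dotNl dotNr opprK. Qed.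
Lemma hnorm_distC u v : nm (u - v) = nm (v - u).
Proof. by rewrite -hnormN opprB. Qed.
Lemma hnormD_sqr u v :
  nm (u + v) ^+ 2 = nm u ^+ 2 + nm v ^+ 2 + 2 * Re (dot u v).
Proof.
rewrite !hnorm_sqr dotDl !dotDr (dotC u v) !ReD ReJ; ring.
Qed.
Lemma hnormB_sqr u v :
  nm (u - v) ^+ 2 = nm u ^+ 2 + nm v ^+ 2 - 2 * Re (dot u v).
Proof. by rewrite hnormD_sqr hnormN dotNr ReN mulrN. Qed.

Lemma cauchy_schwarz u v : normc (dot u v) <= nm u * nm v.
Proof.
have [->|v0] := eqVneq v 0; first by rewrite dot0r normc0 hnorm0 mulr0.
have vp := hnorm_gt0 v0.
rewrite -(@ler_pXn2r _ 2)// ?nnegrE ?mulr_ge0 ?hnorm_ge0 ?normc_ge0//.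
rewrite exprMn.
(* This vector is [|v|^2] times the component of [u] orthogonal to [v]; scaling avoids a
   division. *)
have : 0 <= nm ((nm v ^+ 2)%:C *: u - dot u v *: v) ^+ 2 by exact: sqr_ge0.
rewrite hnormB_sqr !hnormZ normc_real ger0_norm ?sqr_ge0//.
rewrite dotZl dotZr [_^* * _]mulrC mulJ -rmorphM/=.
set d := normc _; set p := nm u; set q := nm v.
have -> : (q ^+ 2 * p) ^+ 2 + (d * q) ^+ 2 - 2 * (q ^+ 2 * d ^+ 2) =
  q ^+ 2 * (p ^+ 2 * q ^+ 2 - d ^+ 2) by ring.
by rewrite pmulr_rge0 ?exprn_gt0// subr_ge0.
Qed.

Lemma hnormD u v : nm (u + v) <= nm u + nm v.
Proof.
rewrite -(@ler_pXn2r _ 2)// ?nnegrE ?addr_ge0 ?hnorm_ge0//.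
rewrite hnormD_sqr; have := cauchy_schwarz u v; have := Re_le_normc (dot u v).
have := ler_norm (Re (dot u v)).
nra.
Qed.
Lemma hnormB u v : nm (u - v) <= nm u + nm v.
Proof. by rewrite -[nm v]hnormN; exact: hnormD. Qed.
Lemma hnorm_dist u v w : nm (u - w) <= nm (u - v) + nm (v - w).
Proof. by rewrite (le_trans _ (hnormD _ _))// addrA subrK. Qed.
Lemma hnorm_le_dist u v : nm u <= nm v + nm (u - v).
Proof. by rewrite (le_trans _ (hnormD _ _))// addrC subrK. Qed.
Lemma hnorm_sum (I : Type) (s : seq I) (F : I -> V) :
  nm (\sum_(i <- s) F i) <= \sum_(i <- s) nm (F i).
Proof.
elim/big_ind2: _ => //; first by rewrite hnorm0.
by move=> u x v y ux vy; rewrite (le_trans (hnormD _ _))// lerD.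
Qed.
Lemma hnorm_eq0_eps u : (forall e : R, 0 < e -> nm u <= e) -> u = 0.
Proof.
move=> h; apply: hnorm_eq0; apply/eqP; rewrite eq_le hnorm_ge0 andbT.
by apply: le_epsilon => e /h; rewrite add0r.
Qed.
Lemma subspaceD H u v : subspace H -> H u -> H v -> H (u + v).
Proof. by move=> [_ sH] Hu Hv; rewrite -[u]scale1r; exact: sH. Qed.
Lemma subspaceZ H a u : subspace H -> H u -> H (a *: u).
Proof. by move=> [H0 sH] Hu; rewrite -[_ *: _]addr0; exact: sH. Qed.
Lemma subspaceB H u v : subspace H -> H u -> H v -> H (u - v).
Proof. by move=> sH Hu Hv; rewrite -scaleN1r; apply: subspaceD => //; exact: subspaceZ. Qed.
Lemma subspace_sum H (I : eqType) (s : seq I) (F : I -> V) :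
  subspace H -> (forall i, i \in s -> H (F i)) -> H (\sum_(i <- s) F i).
Proof.
move=> sH h; rewrite big_seq; elim/big_rec: _ => [|i x si Hx]; first by case: sH.
by apply: subspaceD => //; exact: h.
Qed.

(** * Orthonormal families *)

Definition orthonormal E := forall e f, E e -> E f -> dot e f = (e == f)%:R.

Definition comb A (a : V -> R[i]) : V := \sum_(e <- A) a e *: e.

Lemma dot_comb E A (a : V -> R[i]) f : orthonormal E -> [set` A] `<=` E -> E f ->
  dot (comb A a) f = if f \in A then a f else 0.
Proof.
move=> oE AE Ef; rewrite dot_suml.
case: ifPn => fA.
  rewrite (big_fsetD1 _ fA)/= big_seq big1 ?addr0.
    by rewrite dotZl oE// eqxx mulr1.
  move=> e; rewrite !inE => /andP[ef eA].
  by rewrite dotZl oE// ?(negbTE ef) ?mulr0//; exact: AE.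
rewrite big_seq big1// => e eA; rewrite dotZl oE//; last exact: AE.
by case: eqP => [ef|]; rewrite ?mulr0//; rewrite -ef eA in fA.
Qed.

Lemma dot_comb_comb E A B (a b : V -> R[i]) : orthonormal E -> [set` A] `<=` E ->
  [set` B] `<=` E -> {subset A <= B} ->
  dot (comb B b) (comb A a) = \sum_(e <- A) b e * (a e)^*.
Proof.
move=> oE AE BE AB; rewrite [X in dot _ X]/comb dot_sumr.
rewrite big_seq [RHS]big_seq; apply: eq_bigr => e eA.
by rewrite dotZr (dot_comb _ oE)//; [rewrite AB// mulrC|exact: AE].
Qed.

Lemma hnorm_comb E A (a : V -> R[i]) : orthonormal E -> [set` A] `<=` E ->
  nm (comb A a) ^+ 2 = \sum_(e <- A) normc (a e) ^+ 2.
Proof.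
move=> oE AE; rewrite hnorm_sqr (dot_comb_comb _ _ oE)// Re_sum.
by apply: eq_bigr => e _; rewrite mulJ.
Qed.

Lemma comb_dist E A B (a : V -> R[i]) : orthonormal E -> [set` A] `<=` E ->
  [set` B] `<=` E -> {subset A <= B} ->
  nm (comb B a - comb A a) ^+ 2 =
  \sum_(e <- B) normc (a e) ^+ 2 - \sum_(e <- A) normc (a e) ^+ 2.
Proof.
move=> oE AE BE AB; rewrite hnormB_sqr !(hnorm_comb _ oE)//.
rewrite (dot_comb_comb _ _ oE)// Re_sum.
under [X in _ - _ * X]eq_bigr do rewrite mulJ /=.
ring.
Qed.

Definition proj A u := comb A (dot u).

Lemma hnorm_sub_proj E A u : orthonormal E -> [set` A] `<=` E ->
  nm (u - proj A u) ^+ 2 = nm u ^+ 2 - \sum_(e <- A) normc (dot u e) ^+ 2.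
Proof.
move=> oE AE; rewrite hnormB_sqr (hnorm_comb _ oE)// dot_sumr.
under [X in Re X]eq_bigr do rewrite dotZr mulrC mulJ.
rewrite Re_sum /=; ring.
Qed.

Lemma bessel E A u : orthonormal E -> [set` A] `<=` E ->
  \sum_(e <- A) normc (dot u e) ^+ 2 <= nm u ^+ 2.
Proof.
by move=> oE AE; rewrite -subr_ge0 -(hnorm_sub_proj _ oE)// sqr_ge0.
Qed.

Lemma dot_sub_proj E A u f : orthonormal E -> [set` A] `<=` E -> f \in A ->
  dot (u - proj A u) f = 0.
Proof.
move=> oE AE fA; rewrite dotBl (dot_comb _ oE)// ?fA ?subrr//; exact: AE.
Qed.

Lemma proj_subspace H E A u : subspace H -> E `<=` H -> [set` A] `<=` E ->
  H (proj A u).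
Proof.
move=> sH EH AE; apply: subspace_sum => // e eA; apply: subspaceZ => //.
by apply/EH/AE.
Qed.

Lemma hnorm_sub_proj_le E A u : orthonormal E -> [set` A] `<=` E ->
  nm (u - proj A u) <= nm u.
Proof.
move=> oE AE; rewrite -(@ler_pXn2r _ 2)// ?nnegrE ?hnorm_ge0//.
rewrite (hnorm_sub_proj _ oE)// gerBl.
by apply: sumr_ge0 => e _; exact: sqr_ge0.
Qed.

Lemma hnorm_orthonormal E e : orthonormal E -> E e -> nm e = 1.
Proof.
move=> oE Ee; apply/eqP; rewrite -(@eqrXn2 _ 2)// ?hnorm_ge0//.
by rewrite hnorm_sqr oE// eqxx expr1n.
Qed.

(* The partial sums over finite sets that almost realize the supremum of the
   square sums converge, whatever the cardinality of [E]. *)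
Lemma riesz_fischer H E (a : V -> R[i]) (C : R) :
  subspace H -> hcomplete dot H -> E `<=` H -> orthonormal E ->
  (forall A, [set` A] `<=` E -> \sum_(e <- A) normc (a e) ^+ 2 <= C) ->
  exists v, [/\ H v, forall e, E e -> dot v e = a e & nm v ^+ 2 <= C].
Proof.
move=> sH cH EH oE aC; have [d d0 dl] := null_seq R.
pose S : set R := [set x | exists2 A : {fset V}, [set` A] `<=` E &
  x = \sum_(e <- A) normc (a e) ^+ 2].
have S0 : S 0 by exists fset0; [move=> x /=; rewrite inE|rewrite big_seq_fset0].
have hS : has_sup S.
  by split; [exists 0|exists C => _ [A AE ->]; exact: aC].
have Sub A : [set` A] `<=` E -> \sum_(e <- A) normc (a e) ^+ 2 <= sup S.
  by move=> AE; apply: sup_upper_bound => //; exists A.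
have SC : sup S <= C by apply: sup_le_ub; [exists 0|move=> _ [A AE ->]; exact: aC].
have /choice[A hA] (n : nat) : exists A : {fset V}, [set` A] `<=` E /\
    sup S - d n ^+ 2 < \sum_(e <- A) normc (a e) ^+ 2.
  have e0 : (0 : R) < d n ^+ 2 by rewrite exprn_gt0.
  by have [_ [A AE ->] hA] := sup_adherent e0 hS; exists A.
have AE n := (hA n).1.
(* The square sum over [A n] is within [d n ^+ 2] of the supremum, so that whatever is added to
   [A n] has norm at most [d n]. *)
have dU n B : [set` B] `<=` E -> {subset A n <= B} ->
    nm (comb B a - comb (A n) a) <= d n.
  move=> BE AB; rewrite -(@ler_pXn2r _ 2)// ?nnegrE ?hnorm_ge0 ?(ltW (d0 n))//.
  rewrite (comb_dist _ oE)//; apply: (le_trans (lerB (Sub _ BE) (lexx _))).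
  by rewrite lerBlDr -lerBlDl ltW//; case: (hA n).
have uE n m : [set` (A n `|` A m)%fset] `<=` E.
  by move=> x; rewrite /= inE => /orP[]; apply: AE.
have dnm n m : nm (comb (A n) a - comb (A m) a) <= d n + d m.
  apply: (le_trans (hnorm_dist _ (comb (A n `|` A m)%fset a) _)).
  rewrite (hnorm_distC (comb (A n) a)); apply: lerD; apply: dU => // x xA.
  - by rewrite inE xA.
  - by rewrite inE xA orbT.
have Hc n : H (comb (A n) a).
  by apply: subspace_sum => // e eA; apply: subspaceZ => //; apply/EH/(AE n).
have [|v Hv vl] := cH (fun n => comb (A n) a) Hc.
  move=> e e0; have [N hN] := dl _ (divr_gt0 e0 (ltr0n R 2)).
  by exists N => n m /hN + /hN; have := dnm n m; lra.
exists v; split => //.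
- move=> f Ef; apply: subr0_eq; apply: normc_eq0_eps => e e0.
  have e2 : 0 < e / 2 by rewrite divr_gt0.
  have [N hN] := vl _ e2; have [M hM] := dl _ e2.
  pose n := maxn N M; have := hN n (leq_maxl _ _) => h1.
  have h2 : normc (dot (comb (A n) a) f - a f) <= d n.
    rewrite (dot_comb _ oE)//; case: ifPn => fA; first by rewrite subrr normc0 ltW.
    rewrite sub0r normcN -(@ler_pXn2r _ 2)// ?nnegrE ?normc_ge0 ?(ltW (d0 n))//.
    (* If [f] lies outside [A n], adjoining it keeps the square sum below [sup S], which forces
       [|a f| <= d n]. *)
    have fE : [set` (f |` A n)%fset] `<=` E.
      by move=> x; rewrite /= !inE => /orP[/eqP->//|]; apply: AE.
    have := Sub _ fE; rewrite big_fsetU1//=; have := (hA n).2; lra.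
  have h3 : normc (dot (v - comb (A n) a) f) <= e / 2.
    apply: (le_trans (cauchy_schwarz _ _)); rewrite (hnorm_orthonormal oE Ef) mulr1.
    by rewrite hnorm_distC ltW.
  have := hM n (leq_maxr _ _).
  have := le_normcD (dot (v - comb (A n) a) f) (dot (comb (A n) a) f - a f).
  rewrite dotBl addrA subrK; move: h3; rewrite dotBl; lra.
- have C0 : 0 <= C by apply: le_trans SC; apply: sup_upper_bound.
  rewrite -[C]sqr_sqrtr// ler_pXn2r ?nnegrE ?hnorm_ge0 ?sqrtr_ge0//.
  apply: le_epsilon => e e0; have [N hN] := vl _ e0.
  have := hN N (leqnn _) => h1; have := hnorm_le_dist v (comb (A N) a).
  rewrite hnorm_distC.
  have : nm (comb (A N) a) <= Num.sqrt C.
    rewrite -(@ler_pXn2r _ 2)// ?nnegrE ?hnorm_ge0 ?sqrtr_ge0// (sqr_sqrtr C0).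
    by rewrite (hnorm_comb _ oE)//; exact: aC.
  lra.
Qed.

End inner_product.

Section hilbert_basis.
Context (R : realType) (V : lmodType R[i]) (dot : V -> V -> R[i]).
Context (ip : inner_product dot) (H : set V) (sH : subspace H)
  (cH : hcomplete dot H) (E : set V) (bE : hilbert_basis dot H E).
Implicit Types (u v w e f : V) (a : R[i]) (A B : {fset V}) (phi : V -> R).
Local Notation nm := (hnorm dot).
Let EH : E `<=` H. Proof. by case: bE. Qed.
Let oE : orthonormal dot E. Proof. by case: bE. Qed.

Lemma basis_eq u v : H u -> H v -> (forall e, E e -> dot u e = dot v e) -> u = v.
Proof.
move=> Hu Hv uv; apply: subr0_eq; case: bE => _ _; apply.
  exact: subspaceB.
by move=> e Ee; rewrite (dotBl ip) uv// subrr.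
Qed.

(** Riesz-Fischer rebuilds from the coefficients of [u] a vector of squared norm at most [C]; by
    maximality of the basis it is [u]. *)
Lemma parseval_le u (C : R) : H u ->
  (forall A, [set` A] `<=` E -> \sum_(e <- A) normc (dot u e) ^+ 2 <= C) ->
  nm u ^+ 2 <= C.
Proof.
move=> Hu uC; have [v [Hv vE vC]] := riesz_fischer ip sH cH EH oE uC.
by rewrite (@basis_eq u v)// => e Ee; rewrite vE.
Qed.

(** If no finite set worked, all square sums would stay below [|u|^2 - eps^2], against
    [parseval_le]. *)
Lemma parseval_proj u (eps : R) : H u -> 0 < eps ->
  exists2 A0 : {fset V}, [set` A0] `<=` E & forall A, [set` A] `<=` E -> {subset A0 <= A} ->
    nm (u - proj dot A u) < eps.
Proof.
move=> Hu e0.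
have [//|e1] := pselect (exists2 A0 : {fset V}, [set` A0] `<=` E &
  nm u ^+ 2 - eps ^+ 2 < \sum_(e <- A0) normc (dot u e) ^+ 2).
  case=> A0 A0E hA0; exists A0 => // A AE A0A.
  rewrite -(@ltr_pXn2r _ 2)// ?nnegrE ?hnorm_ge0 ?(ltW e0)//.
  rewrite (hnorm_sub_proj ip _ oE)// ltrBlDr -ltrBlDl.
  apply: (lt_le_trans hA0); rewrite -subr_ge0 -(comb_dist ip (dot u) oE)//.
  exact: sqr_ge0.
exfalso.
have : nm u ^+ 2 <= nm u ^+ 2 - eps ^+ 2.
  apply: parseval_le => // A AE; rewrite leNgt; apply/negP => h.
  by apply: e1; exists A.
by move=> h; have := exprn_gt0 2 e0; lra.
Qed.

(** Parseval's identity as a comparison of two inner products, so that no infinite sum has to be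
    written. It serves for the positivity of diagonal operators and for the absolute value of
    [T psi(T)]. *)
Lemma parseval_eq u v u' v' : H u -> H v -> H u' -> H v' ->
  (forall e, E e -> dot u e * (dot v e)^* = dot u' e * (dot v' e)^*) ->
  dot u v = dot u' v'.
Proof.
move=> Hu Hv Hu' Hv' uv; apply: subr0_eq; apply: normc_eq0_eps => eps eps0.
pose K : R := nm v + nm v' + 1.
have K0 : 0 < K by rewrite ltr_wpDl// addr_ge0// hnorm_ge0.
have [A0 A0E h0] := parseval_proj Hu (divr_gt0 eps0 K0).
have [A1 A1E h1] := parseval_proj Hu' (divr_gt0 eps0 K0).
pose A := (A0 `|` A1)%fset.
have AE : [set` A] `<=` E.
  by move=> x; rewrite /= inE => /orP[xA|xA]; [exact: A0E|exact: A1E].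
have {}h0 : nm (u - proj dot A u) < eps / K.
  by apply: h0 => // x xA; rewrite inE xA.
have {}h1 : nm (u' - proj dot A u') < eps / K.
  by apply: h1 => // x xA; rewrite inE xA orbT.
have pp : dot (proj dot A u) v = dot (proj dot A u') v'.
  rewrite /proj /comb !(dot_suml ip); rewrite big_seq [RHS]big_seq.
  apply: eq_bigr => e eA; rewrite !(dotZl ip) (dotC ip v) (dotC ip v').
  by apply: uv; exact: AE.
have -> : dot u v - dot u' v' =
    dot (u - proj dot A u) v - dot (u' - proj dot A u') v'.
  by rewrite !(dotBl ip) pp opprB addrA subrK.
apply: (le_trans (le_normcD _ _)); rewrite normcN.
apply: (@le_trans _ _ (eps / K * nm v + eps / K * nm v')).
  by apply: lerD; apply: (le_trans (cauchy_schwarz ip _ _));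
    apply: ler_wpM2r; rewrite ?hnorm_ge0 ?ltW.
rewrite -mulrDr -mulrA ler_piMr ?(ltW eps0)//.
by rewrite mulrC ler_pdivrMr// mul1r lerDl.
Qed.

(** * Diagonal operators *)

(** Prescribed by its coefficients rather than by a series over the basis. For bounded [phi] such a
    vector exists for every [u], in [H] or not, by Bessel's inequality and Riesz-Fischer. *)
Definition diagonal phi u : V :=
  xget 0 [set v | H v /\ forall e, E e -> dot v e = (phi e)%:C * dot u e].

Section bounded_diagonal.
Context (phi : V -> R) (M : R) (M0 : 0 <= M) (phiM : forall e, E e -> `|phi e| <= M).

Lemma diagonal_spec u :
  [/\ H (diagonal phi u), forall e, E e -> dot (diagonal phi u) e = (phi e)%:C * dot u e &
    nm (diagonal phi u) <= M * nm u].
Proof.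
have hS A : [set` A] `<=` E ->
    \sum_(e <- A) normc ((phi e)%:C * dot u e) ^+ 2 <= M ^+ 2 * nm u ^+ 2.
  move=> AE; apply: (@le_trans _ _ (\sum_(e <- A) M ^+ 2 * normc (dot u e) ^+ 2)).
    rewrite big_seq [leRHS]big_seq; apply: ler_sum => e eA.
    rewrite Normc.normcM normc_real exprMn; apply: ler_wpM2r; first exact: sqr_ge0.
    have := phiM (AE _ eA); have := normr_ge0 (phi e).
    by move=> a b; rewrite ler_pXn2r// nnegrE (le_trans a b).
  by rewrite -mulr_sumr; apply: ler_wpM2l; [exact: sqr_ge0|exact: (bessel ip u oE)].
have [v [Hv vE vM]] := riesz_fischer ip sH cH EH oE hS.
rewrite /diagonal; case: xgetP => [w _ [Hw wE]|]; last first.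
  by move/(_ v) => h; exfalso; apply: h.
split => //; rewrite (@basis_eq w v)//; last by move=> e Ee; rewrite wE// vE.
by rewrite -(@ler_pXn2r _ 2)// ?nnegrE ?hnorm_ge0 ?mulr_ge0 ?hnorm_ge0// exprMn.
Qed.

Lemma diagonal_in u : H (diagonal phi u). Proof. by case: (diagonal_spec u). Qed.
Lemma dot_diagonal u e : E e -> dot (diagonal phi u) e = (phi e)%:C * dot u e.
Proof. by case: (diagonal_spec u) => _ h _; exact: h. Qed.
Lemma hnorm_diagonal u : nm (diagonal phi u) <= M * nm u.
Proof. by case: (diagonal_spec u). Qed.

Lemma diagonal_bounded : bounded_operator dot H (diagonal phi).
Proof.
split; [by move=> u _; exact: diagonal_in| |by exists M => u _; exact: hnorm_diagonal].
move=> a u v Hu Hv; apply: basis_eq.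
- exact: diagonal_in.
- by case: sH => _; apply; exact: diagonal_in.
- by move=> e Ee; rewrite dot_diagonal// !(dot_linl ip) !dot_diagonal// mulrDr mulrCA.
Qed.

Lemma diagonal_uniq u v : H v -> (forall e, E e -> dot v e = (phi e)%:C * dot u e) ->
  v = diagonal phi u.
Proof.
move=> Hv vE; apply: basis_eq => //; first exact: diagonal_in.
by move=> e Ee; rewrite vE// dot_diagonal.
Qed.

End bounded_diagonal.

(** The quadratic form is the squared norm of the image of [u] under the diagonal operator with
    entries [sqrt (phi e)]. *)
Lemma diagonal_positive phi (M : R) : 0 <= M -> (forall e, E e -> `|phi e| <= M) ->
  (forall e, E e -> 0 <= phi e) -> positive_operator dot H (diagonal phi).
Proof.
move=> M0 phiM phi0; split; first exact: (diagonal_bounded M0 phiM).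
move=> u Hu.
(* The crude bound [sqrt t <= 1 + t] suffices: only boundedness of the entries is at stake. *)
have sM e : E e -> `|Num.sqrt (phi e)| <= 1 + M.
  move=> Ee; have /(_ e Ee) := phiM; rewrite !ger0_norm ?sqrtr_ge0 ?phi0// => pM.
  have := sqr_sqrtr (phi0 _ Ee); have := sqrtr_ge0 (phi e).
  nra.
have M1 : 0 <= 1 + M by rewrite addr_ge0.
suff -> : dot (diagonal phi u) u = dot (diagonal (fun e => Num.sqrt (phi e)) u)
    (diagonal (fun e => Num.sqrt (phi e)) u) by exact: dot_ge0.
apply: parseval_eq; rewrite ?(diagonal_in M0 phiM) ?(diagonal_in M1 sM)//.
- exact: (diagonal_in M0 phiM).
- exact: (diagonal_in M1 sM).
- exact: (diagonal_in M1 sM).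
move=> e Ee; rewrite (dot_diagonal M0 phiM)// (dot_diagonal M1 sM)//.
rewrite rmorphM/= -[in LHS](sqr_sqrtr (phi0 _ Ee)).
have -> : (Num.sqrt (phi e))%:C^* = (Num.sqrt (phi e))%:C by apply: complex_eqP; rewrite ?ReJ ?ImJ/= ?oppr0.
by rewrite expr2 rmorphM/=; ring.
Qed.

(** * Functional calculus of a diagonal operator *)

Section functional_calculus.
Context (T : V -> V) (lam : V -> R) (M : R).
Context (M0 : 0 <= M) (lamM : forall e, E e -> `|lam e| <= M)
  (TH : forall u, H u -> H (T u))
  (TE : forall u e, H u -> E e -> dot (T u) e = (lam e)%:C * dot u e).

Lemma iter_in i u : H u -> H (iter i T u).
Proof. by move=> Hu; elim: i => //= i; exact: TH. Qed.

Lemma dot_iter i u e : H u -> E e -> dot (iter i T u) e = (lam e ^+ i)%:C * dot u e.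
Proof.
move=> Hu Ee; elim: i => [|i IH] /=; first by rewrite expr0 mul1r.
by rewrite TE ?IH//; [rewrite exprS rmorphM/= mulrA|exact: iter_in].
Qed.

Lemma poly_operator_in p u : H u -> H (poly_operator p T u).
Proof.
move=> Hu; apply: subspace_sum => // i _; apply: subspaceZ => //; exact: iter_in.
Qed.

Lemma dot_poly_operator p u e : H u -> E e ->
  dot (poly_operator p T u) e = (p.[lam e])%:C * dot u e.
Proof.
move=> Hu Ee; rewrite (dot_suml ip) horner_coef rmorph_sum/= mulr_suml.
by apply: eq_bigr => i _; rewrite (dotZl ip) dot_iter// rmorphM/= mulrA.
Qed.

Lemma eigenvector e : E e -> T e = (lam e)%:C *: e.
Proof.
move=> Ee; apply: basis_eq; [exact/TH/EH|by apply: subspaceZ => //; exact: EH|].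
move=> f Ef; rewrite TE//; last exact: EH.
rewrite (dotZl ip); case: (eqVneq e f) => [->//|ef].
by rewrite oE// (negbTE ef) !mulr0.
Qed.

Lemma eigenvalue_spectrum e : E e -> spectrum dot H T (lam e)%:C.
Proof.
move=> Ee [S [SH Slin _]] /(_ e (EH Ee)) [].
rewrite eigenvector// subrr => S0 _.
have H0 : H 0 by case: sH.
have := Slin 1 0 0 H0 H0; rewrite scaler0 addr0 scale1r -[LHS]addr0 => /addrI.
rewrite S0 => e0; have := oE Ee Ee; rewrite -e0 (dot0l ip) eqxx => /eqP.
by rewrite eq_sym oner_eq0.
Qed.

(** The resolvent is written down: it is the diagonal operator with entries [(lam e - x)^-1],
    bounded by [delta^-1]. *)
Lemma spectrum_dist (x delta : R) : 0 < delta ->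
  (forall e, E e -> delta <= `|lam e - x|) -> ~ spectrum dot H T x%:C.
Proof.
move=> d0 hd; apply.
have bM e : E e -> `|(lam e - x)^-1| <= delta^-1.
  move=> Ee; rewrite normfV lef_pV2 ?posrE ?hd//.
  exact: (lt_le_trans d0 (hd _ Ee)).
have D0 : 0 <= delta^-1 by rewrite invr_ge0 ltW.
have nz e : E e -> lam e - x != 0.
  by move=> Ee; rewrite -normr_gt0 (lt_le_trans d0)// hd.
exists (diagonal (fun e => (lam e - x)^-1)); first exact: (diagonal_bounded D0 bM).
move=> u Hu; split; (apply: basis_eq; rewrite // ?(diagonal_in D0 bM)//).
- exact: (diagonal_in D0 bM).
- move=> e Ee; rewrite (dot_diagonal D0 bM)// (dotBl ip) (dotZl ip) TE// -mulrBl mulrA.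
  by rewrite -rmorphB -rmorphM/= mulVf ?mul1r// nz.
- apply: subspaceB => //; first exact/TH/(diagonal_in D0 bM).
  by apply: subspaceZ => //; exact: (diagonal_in D0 bM).
- move=> e Ee; rewrite (dotBl ip) (dotZl ip) TE//; last exact: (diagonal_in D0 bM).
  rewrite -mulrBl (dot_diagonal D0 bM)// mulrA.
  by rewrite -rmorphB -rmorphM/= mulfV ?mul1r// nz.
Qed.

Lemma poly_operator_dist (p : {poly R}) (psi : R -> R) (C eps : R) u : 0 <= C -> 0 <= eps -> H u ->
  (forall e, E e -> `|psi (lam e)| <= C) ->
  (forall e, E e -> `|p.[lam e] - psi (lam e)| <= eps) ->
  nm (poly_operator p T u - diagonal (psi \o lam) u) <= eps * nm u.
Proof.
move=> C0 eps0 Hu psiC peps.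
rewrite (@diagonal_uniq (fun e => p.[lam e] - psi (lam e)) eps eps0 peps u (poly_operator p T u - _))//.
- exact: hnorm_diagonal.
- by apply: subspaceB; [|exact: poly_operator_in|exact: (diagonal_in C0 psiC)].
- move=> e Ee; rewrite (dotBl ip) dot_poly_operator// (dot_diagonal C0 psiC)//.
  by rewrite -mulrBl -rmorphB.
Qed.

Lemma diagonal_functional_calculus (psi : R -> R) (C : R) : 0 <= C ->
  (forall e, E e -> `|psi (lam e)| <= C) ->
  is_functional_calculus dot H psi T (diagonal (psi \o lam)).
Proof.
move=> C0 psiC; split; first exact: (@diagonal_bounded _ C).
move=> p pu e e0.
have nb : nbhs (psi : {uniform` [set x | spectrum dot H T x%:C] -> R})
    [set h | forall y, spectrum dot H T y%:C -> ball (psi y) e (h y)].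
  by apply/uniform_nbhs; exists [set xy | ball xy.1 e xy.2]; split => //; exact: (entourage_ball _ (PosNum e0)).
have [N _ hN] := pu _ nb; exists N => // n /hN /= hn u Hu.
apply: (poly_operator_dist C0 (ltW e0)) => // f Ef.
by rewrite distrC ltW//; apply: hn; exact: eigenvalue_spectrum.
Qed.

(** [functional_calculus] selects some operator that meets a condition on all polynomial sequences
    converging to [psi] on the spectrum. One such sequence is needed for the condition not to be
    vacuous; along it the selected operator and the diagonal one have the same limit on [H]. *)
Lemma functional_calculusE (psi : R -> R) (C : R) : 0 <= C ->
  (forall e, E e -> `|psi (lam e)| <= C) ->
  (forall eps : R, 0 < eps -> exists p : {poly R},
     forall x, spectrum dot H T x%:C -> `|p.[x] - psi x| < eps) ->
  forall u, H u -> functional_calculus dot H psi T u = diagonal (psi \o lam) u.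
Proof.
move=> C0 psiC happ u Hu; rewrite /functional_calculus.
case: xgetP => [B _ [_ hB]|]; last first.
  by move/(_ _ (diagonal_functional_calculus C0 psiC)).
have [d d0 dl] := null_seq R.
have /choice[p hp] n := happ _ (d0 n).
have pu : {uniform [set x : R | spectrum dot H T x%:C],
      (fun n x => (p n).[x]) @ \oo --> psi}.
  move=> P /uniform_nbhs[U [+ UP]]; rewrite -entourage_ballE => -[eps /= eps0 epsU].
  have [N hN] := dl _ eps0; exists N => // n /= Nn; apply/UP => x xs /=.
  apply: epsU; rewrite /= /ball/= distrC; exact: (lt_trans (hp _ _ xs) (hN _ Nn)).
apply: subr0_eq; apply: (hnorm_eq0_eps ip) => e e0.
pose K := nm u + 1.
have K0 : 0 < K by rewrite ltr_wpDl// hnorm_ge0.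
have e2 : 0 < e / 2 / K by rewrite !divr_gt0.
have [n [h1 h2]] := filter_ex (filterI (hB p pu _ e2)
   ((diagonal_functional_calculus C0 psiC).2 p pu _ e2)).
have {}h1 := h1 u Hu; have {}h2 := h2 u Hu.
apply: (le_trans (hnorm_dist ip _ (poly_operator (p n) T u) _)).
rewrite (hnorm_distC ip (B u)); apply: (le_trans (lerD h1 h2)).
have : e / 2 / K * nm u <= e / 2 / K * K by apply: ler_wpM2l; [exact: ltW|rewrite lerDl].
rewrite divfK ?gt_eqF//; lra.
Qed.

End functional_calculus.

End hilbert_basis.

(** * Unordered sums and the trace *)

Section summation.
Context (R : realType) (V : lmodType R[i]).
Implicit Types (E : set V) (A B : {fset V}).

Lemma has_sumP E (a : V -> R[i]) s : has_sum E a s <->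
  forall eps : R, 0 < eps -> exists2 A0 : {fset V}, [set` A0] `<=` E &
    forall A, [set` A] `<=` E -> {subset A0 <= A} ->
      normc (\sum_(e <- A) a e - s) < eps.
Proof.
split => h eps eps0; have [A0 h0 h1] := h _ eps0.
- exists (fset_set A0) => [|A AE A0A]; first by rewrite fset_setK; case: h0.
  have := h1 [set` A] (finite_fset A); rewrite fsbig_finite//= set_fsetK.
  rewrite normr_normc ltcR; apply=> // x xA; apply: A0A.
  rewrite in_fset_set ?inE//; [exact/mem_set|by case: h0].
- exists [set` A0]; first by split.
  move=> E1 fE1 A0E1 E1E; rewrite fsbig_finite// normr_normc ltcR.
  apply: h1 => [|x xA]; first by rewrite fset_setK.
  by rewrite in_fset_set//; apply/mem_set/A0E1.
Qed.

Lemma has_sum_unique E (a : V -> R[i]) s t : has_sum E a s -> has_sum E a t -> s = t.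
Proof.
move=> /has_sumP hs /has_sumP ht; apply: subr0_eq; apply: normc_eq0_eps => e e0.
have [A AE hA] := hs _ (divr_gt0 e0 (ltr0n R 2)).
have [B BE hB] := ht _ (divr_gt0 e0 (ltr0n R 2)).
have CE : [set` (A `|` B)%fset] `<=` E.
  by move=> x; rewrite /= inE => /orP[xA|xA]; [exact: AE|exact: BE].
have h1 : normc (\sum_(e <- (A `|` B)%fset) a e - s) < e / 2.
  by apply: hA => // x xA; rewrite inE xA.
have h2 : normc (\sum_(e <- (A `|` B)%fset) a e - t) < e / 2.
  by apply: hB => // x xA; rewrite inE xA orbT.
have := le_normcD (s - \sum_(e <- (A `|` B)%fset) a e) (\sum_(e <- (A `|` B)%fset) a e - t).
rewrite addrA subrK normc_distC; move: h1 h2; lra.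
Qed.

Lemma sum_fset_le (a : V -> R) E A B : (forall e, E e -> 0 <= a e) ->
  [set` A] `<=` E -> [set` B] `<=` E -> {subset A <= B} ->
  \sum_(e <- A) a e <= \sum_(e <- B) a e.
Proof.
move=> a0 AE BE AB.
rewrite [leRHS](big_fsetID _ (mem A))/=.
have -> : [fset x in B | x \in A]%fset = A.
  apply/fsetP => x; rewrite !inE /=; case: (boolP (x \in A)) => xA; rewrite ?andbF// andbT.
  exact: AB.
rewrite lerDl big_seq; apply: sumr_ge0 => e; rewrite !inE => /andP[eB _].
by apply/a0/BE.
Qed.

(** The sum is the supremum of the finite partial sums, whence also the last clause. *)
Lemma has_sum_ge0 E (a : V -> R) (C : R) : (forall e, E e -> 0 <= a e) ->
  (forall A, [set` A] `<=` E -> \sum_(e <- A) a e <= C) ->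
  exists s : R, [/\ has_sum E (fun e => (a e)%:C) s%:C, s <= C &
    forall A, [set` A] `<=` E -> \sum_(e <- A) a e <= s].
Proof.
move=> a0 aC; pose S : set R := [set x | exists2 A : {fset V}, [set` A] `<=` E &
  x = \sum_(e <- A) a e].
have S0 : S 0 by exists fset0; [move=> x /=; rewrite inE|rewrite big_seq_fset0].
have hS : has_sup S.
  by split; [exists 0|exists C => _ [A AE ->]; exact: aC].
have Sub A : [set` A] `<=` E -> \sum_(e <- A) a e <= sup S.
  by move=> AE; apply: sup_upper_bound => //; exists A.
exists (sup S); split=> //; last first.
  by apply: sup_le_ub; [exists 0|move=> _ [A AE ->]; exact: aC].
apply/has_sumP => e e0; have [_ [A AE ->] hA] := sup_adherent e0 hS.
exists A => // B BE AB; rewrite -rmorph_sum -rmorphB normc_real distrC ger0_norm.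
  by have := sum_fset_le a0 AE BE AB; move: hA; lra.
by rewrite subr_ge0 Sub.
Qed.

(** A trace must be the sum in every basis, but uniqueness of sums in a single basis already
    identifies it. *)
Lemma traceE dot H (S : V -> V) t E :
  hilbert_basis dot H E ->
  (forall E', hilbert_basis dot H E' -> has_sum E' (fun e => dot (S e) e) t) ->
  trace dot H S = t.
Proof.
move=> bE h; rewrite /trace; case: xgetP => [t' _ ht'|/(_ t)[]//].
exact: (has_sum_unique (ht' _ bE) (h _ bE)).
Qed.

End summation.

(** * Compact self-adjoint operators *)

Section spectral.
Context (R : realType) (V : lmodType R[i]) (dot : V -> V -> R[i]).
Context (ip : inner_product dot) (H : set V) (sH : subspace H).
Implicit Types (u v w e f : V) (a : R[i]) (A B : {fset V}) (W E : set V).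
Local Notation nm := (hnorm dot).

(** Only the inclusion of orthogonal complements is recorded: it is what lets the test vectors of
    [compact_operator] be replaced by an orthonormal set. *)
Lemma gram_schmidt (s : seq V) : (forall v, v \in s -> H v) ->
  exists A : {fset V}, [/\ orthonormal dot [set` A], [set` A] `<=` H &
    forall u, (forall e, e \in A -> dot u e = 0) -> forall v, v \in s -> dot u v = 0].
Proof.
elim: s => [|v s IH] sH'.
  by exists fset0; split => // [e f|e]; rewrite /= inE.
have [|A [oA AH hA]] := IH; first by move=> x xs; apply: sH'; rewrite inE xs orbT.
pose w := v - proj dot A v.
have Hw : H w.
  apply: subspaceB => //; first by apply: sH'; rewrite inE eqxx.
  exact: (@proj_subspace _ _ dot H [set` A] A).
have [w0|w0] := eqVneq w 0.
  exists A; split => // u uA x; rewrite inE => /orP[/eqP->|]; last exact: hA.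
  have -> : v = proj dot A v by apply: subr0_eq.
  rewrite /proj /comb (dot_sumr ip) big_seq big1// => e eA.
  by rewrite (dotZr ip) uA// mulr0.
have wp := hnorm_gt0 ip w0.
pose e := ((nm w)^-1)%:C *: w.
have ee : dot e e = 1.
  rewrite (dot_self ip) (hnormZ ip) normc_real ger0_norm ?invr_ge0 ?hnorm_ge0//.
  by rewrite mulVf ?gt_eqF// expr1n.
have ef f : f \in A -> dot e f = 0.
  by move=> fA; rewrite (dotZl ip) (dot_sub_proj ip _ oA)// mulr0.
exists (e |` A)%fset; split.
- move=> x y /=; rewrite !inE => /orP[/eqP->|xA] /orP[/eqP->|yA].
  + by rewrite eqxx ee.
  + rewrite ef//; case: eqP => // ey; move: (ef _ yA).
    by rewrite -ey ee => /eqP; rewrite oner_eq0.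
  + rewrite (dotC ip) ef// rmorph0; case: eqP => // ey; move: (ef _ xA).
    by rewrite ey ee => /eqP; rewrite oner_eq0.
  + exact: oA.
- move=> x /=; rewrite !inE => /orP[/eqP->|]; last exact: AH.
  exact: subspaceZ.
- move=> u uA x; rewrite inE => /orP[/eqP->|xs]; last first.
    by apply: hA => // f fA; apply: uA; rewrite !inE fA orbT.
  have ue : dot u e = 0 by apply: uA; rewrite !inE eqxx.
  have uw : dot u w = 0.
    move/eqP: ue; rewrite (dotZr ip) mulf_eq0 => /orP[|/eqP//].
    by rewrite conjC_eq0 => /eqP/complexI/eqP; rewrite invr_eq0 gt_eqF.
  have -> : v = w + proj dot A v by rewrite subrK.
  rewrite (dotDr ip) uw add0r /proj /comb (dot_sumr ip) big_seq big1// => f fA.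
  by rewrite (dotZr ip) uA ?mulr0// !inE fA orbT.
Qed.

(** Compactness expressed by smallness of [T] on a subspace of finite codimension: composing with
    the projection on the span of [s] approximates [T] in norm by operators of finite rank. *)
Definition compact_operator (T : V -> V) := forall eps : R, 0 < eps ->
  exists2 s : seq V, forall v, v \in s -> H v &
    forall u, H u -> (forall v, v \in s -> dot u v = 0) -> nm (T u) <= eps * nm u.

Context (T : V -> V) (bT : bounded_operator dot H T)
  (saT : forall u v, H u -> H v -> dot (T u) v = dot u (T v))
  (kT : compact_operator T).

Let TD u v : H u -> H v -> T (u + v) = T u + T v.
Proof. by move=> Hu Hv; case: bT => _ /(_ 1 u v Hu Hv); rewrite !scale1r. Qed.
Let T0 : T 0 = 0.
Proof. by have [H0 _] := sH; apply: (addrI (T 0)); rewrite -TD// !addr0. Qed.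
Let TZ a u : H u -> T (a *: u) = a *: T u.
Proof.
move=> Hu; have H0 : H 0 by case: sH.
by case: bT => _ /(_ a u 0 Hu H0); rewrite T0 !addr0.
Qed.
Let TB u v : H u -> H v -> T (u - v) = T u - T v.
Proof.
move=> Hu Hv; rewrite -scaleN1r TD// ?TZ// ?scaleN1r//.
by rewrite -scaleN1r; apply: subspaceZ.
Qed.
Let TH u : H u -> H (T u). Proof. by case: bT => h _ _; exact: h. Qed.

Section approximate_eigenvectors.
Context (U : set_system V) (uU : UltraFilter U) (U1 : U [set u | H u /\ nm u = 1]).

(** An ultrafilter on the unit sphere replaces the extraction of a weakly convergent subsequence:
    the bounded scalars [Re (dot u v)] and [Im (dot u v)] have limits along it by compactness of a
    segment. *)
Lemma ultra_dot v (eps : R) : 0 < eps -> exists2 A, U A &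
  forall u u', A u -> A u' -> normc (dot (u - u') v) < eps.
Proof.
move=> e0; have pU := @ultra_proper _ _ uU.
have key (f : R[i] -> R) : (forall z, `|f z| <= normc z) ->
    exists l : R, U [set u | `|l - f (dot u v)| < eps / 4].
  move=> fz; have cK := @segment_compact R (- nm v) (nm v).
  have KI : U ((fun u => f (dot u v)) @^-1` `[- nm v, nm v]%classic).
    apply: (filterS _ U1) => u [_ u1] /=; rewrite in_itv/= -ler_norml.
    apply: (le_trans (fz _)); apply: (le_trans (cauchy_schwarz ip _ _)).
    by rewrite u1 mul1r.
  have [l [_ cl]] := cK _ (fmap_proper_filter (fun u => f (dot u v)) pU) KI.
  exists l; have e4 : 0 < eps / 4 by rewrite divr_gt0.
  have [//|nU] := in_ultra_setVsetC [set u | `|l - f (dot u v)| < eps / 4] uU.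
  have [x [/= h1 h2]] := cl [set x | ~ `|l - x| < eps / 4] _ nU (nbhsx_ballx l _ e4).
  by case: h1.
have [l hl] := key _ (@Re_le_normc R); have [k hk] := key _ (@Im_le_normc R).
exists ([set u | `|l - Re (dot u v)| < eps / 4] `&` [set u | `|k - Im (dot u v)| < eps / 4]).
  exact: filterI.
move=> u u' [/= a b] [/= c d]; apply: (le_lt_trans (normc_le_ReIm _)).
rewrite (dotBl ip) ReD ReN ImD ImN.
have := ler_distD l (Re (dot u v)) (Re (dot u' v)).
have := ler_distD k (Im (dot u v)) (Im (dot u' v)).
rewrite (distrC (Re _) l) (distrC (Im _) k); lra.
Qed.

Lemma ultra_dot_seq (s : seq V) (eps : R) : 0 < eps -> exists2 A, U A &
  forall u u', A u -> A u' -> forall v, v \in s -> normc (dot (u - u') v) < eps.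
Proof.
move=> e0; have pU := @ultra_proper _ _ uU.
elim: s => [|v s [A UA hA]]; first by exists setT; [exact: filterT|].
have [B UB hB] := ultra_dot v e0; exists (A `&` B); first exact: filterI.
move=> u u' [Au Bu] [Au' Bu'] w; rewrite inE => /orP[/eqP->|]; first exact: hB.
exact: hA.
Qed.

(** A compact operator turns weak convergence into norm convergence. The difference [u - u'] is
    split into its projection on a finite orthonormal set, whose coefficients are small along [U],
    and a remainder on which [T] is small. *)
Lemma ultra_image_small (eps : R) : 0 < eps -> exists2 A, U A &
  forall u u', A u -> A u' -> nm (T u - T u') < eps.
Proof.
move=> e0; have pU := @ultra_proper _ _ uU.
have e8 : 0 < eps / 8 by rewrite divr_gt0.
have [s sH' hs] := kT e8; have [A [oA AH hA]] := gram_schmidt sH'.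
have [_ _ [C hC]] := bT.
(* With [size A] coefficients below [eps / 8 / D] each and [|C| + 1] bounding [T], the projected
   part has image of norm at most [eps / 8]. *)
pose D := (`|C| + 1) * (size A)%:R + 1.
have D0 : 0 < D by rewrite ltr_wpDl// mulr_ge0// addr_ge0.
have [S US hS] := ultra_dot_seq A (divr_gt0 e8 D0).
exists (S `&` [set u | H u /\ nm u = 1]); first exact: filterI.
move=> u u' [Su [Hu u1]] [Su' [Hu' u1']].
have Hd : H (u - u') by apply: subspaceB.
have Hp : H (proj dot A (u - u')) by exact: (@proj_subspace _ _ dot H [set` A] A).
have -> : T u - T u' = T (proj dot A (u - u')) + T (u - u' - proj dot A (u - u')).
  rewrite -TD//; last exact: subspaceB.
  by rewrite [X in _ = T X]addrC subrK TB.
apply: (le_lt_trans (hnormD ip _ _)).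
have h1 : nm (T (u - u' - proj dot A (u - u'))) <= eps / 8 * 2.
  apply: (le_trans (hs _ _ _)).
  - exact: subspaceB.
  - move=> v vs; apply: hA vs => e eA; apply: (dot_sub_proj ip _ oA) => //.
  - apply: ler_wpM2l; first exact: ltW.
    apply: (le_trans (hnorm_sub_proj_le ip _ oA _)) => //.
    by apply: (le_trans (hnormB ip _ _)); rewrite u1 u1'.
have h2 : nm (proj dot A (u - u')) <= (size A)%:R * (eps / 8 / D).
  apply: (le_trans (hnorm_sum ip _ _)).
  apply: (@le_trans _ _ (\sum_(e <- A) (eps / 8 / D))).
    rewrite big_seq [leRHS]big_seq; apply: ler_sum => e eA.
    rewrite (hnormZ ip) (hnorm_orthonormal ip oA)// mulr1 ltW//; exact: hS.
  by rewrite big_const_seq count_predT iter_addr_0 mulr_natl.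
have h3 : nm (T (proj dot A (u - u'))) <= (`|C| + 1) * nm (proj dot A (u - u')).
  apply: (le_trans (hC _ Hp)); apply: ler_wpM2r; first exact: hnorm_ge0.
  by rewrite (le_trans (ler_norm _))// lerDl.
have h4 : (`|C| + 1) * ((size A)%:R * (eps / 8 / D)) <= eps / 8.
  set x := eps / 8 / D; have x0 : 0 <= x by rewrite divr_ge0// ltW.
  have xD : x * D = eps / 8 by rewrite divfK// gt_eqF.
  have : (`|C| + 1) * (size A)%:R * x <= D * x by apply: ler_wpM2r => //; rewrite lerDl.
  by move: xD; rewrite /D; lra.
have h5 : (`|C| + 1) * nm (proj dot A (u - u')) <= (`|C| + 1) * ((size A)%:R * (eps / 8 / D)).
  by apply: ler_wpM2l => //; rewrite addr_ge0.
by lra.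
Qed.

End approximate_eigenvectors.

(** Let [M] be the norm of [T] on [W]. Along a maximizing sequence of unit vectors
    [T^2 u_n - M^2 u_n] tends to 0 and [T u_n] is Cauchy by compactness; if [M > 0], so is [u_n].
    Its limit [v] satisfies [T^2 v = M^2 v], and factoring [T^2 - M^2] yields an eigenvector for [M]
    or [-M]. The case of a subspace [W] is what [spectral_theorem] needs for orthogonal
    complements. *)
Lemma exists_eigenvector W : subspace W -> hcomplete dot W -> W `<=` H ->
  (forall u, W u -> W (T u)) -> (exists2 u, W u & u != 0) ->
  exists e (l : R), [/\ W e, dot e e = 1 & T e = l%:C *: e].
Proof.
move=> sW cW WH TW [u0 Wu0 u0n].
have unit w : W w -> w != 0 -> exists a, [/\ W (a *: w), dot (a *: w) (a *: w) = 1 & a != 0].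
  move=> Ww w0; have wp := hnorm_gt0 ip w0; exists ((nm w)^-1)%:C; split.
  - exact: subspaceZ.
  - rewrite (dot_self ip) (hnormZ ip) normc_real ger0_norm ?invr_ge0 ?hnorm_ge0//.
    by rewrite mulVf ?gt_eqF// expr1n.
  - by apply/eqP => /complexI/eqP; rewrite invr_eq0 gt_eqF.
have nm1 u : dot u u = 1 -> nm u = 1.
  by move=> u1; rewrite /hnorm u1 sqrtr1.
pose S : set R := [set x | exists2 u, W u /\ nm u = 1 & x = nm (T u)].
have [_ _ [C hC]] := bT.
have [a0 [Wa0 /nm1 a01 _]] := unit _ Wu0 u0n.
have hS : has_sup S.
  split; first by exists (nm (T (a0 *: u0))), (a0 *: u0).
  by exists C => _ [u [Wu u1] ->]; rewrite -[C]mulr1 -u1; apply/hC/WH.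
pose M := sup S.
have SM u : W u -> nm u = 1 -> nm (T u) <= M.
  by move=> Wu u1; apply: sup_upper_bound => //; exists u.
have M0 : 0 <= M by apply: (le_trans (hnorm_ge0 _ _)); apply: (SM (a0 *: u0)).
have TM u : W u -> nm (T u) <= M * nm u.
  move=> Wu; have [->|un] := eqVneq u 0.
    by rewrite T0 (hnorm0 ip) mulr0.
  have up := hnorm_gt0 ip un; rewrite -ler_pdivrMr//.
  have := SM (((nm u)^-1)%:C *: u) (subspaceZ _ sW Wu).
  rewrite TZ; last exact: WH.
  rewrite !(hnormZ ip) normc_real ger0_norm ?invr_ge0 ?hnorm_ge0//.
  by rewrite mulVf ?gt_eqF// [_ * nm (T u)]mulrC; apply.
(* If [M = 0] then [T] vanishes on [W] and any unit vector will do. *)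
have := M0; rewrite le_eqVlt => /orP[/eqP M00|Mp].
  exists (a0 *: u0), 0; split => //; first by rewrite (dot_self ip) a01 expr1n.
  by rewrite scale0r; apply: (hnorm_eq0 ip); apply/eqP; rewrite eq_le hnorm_ge0 andbT M00 SM.
have [d d0 dl] := null_seq R.
(* The sequence [d] is not known to be monotone; asking the bound for all [k <= n] makes the sets
   nested, hence a filter base. *)
pose F := filter_from [set: nat] (fun n => [set u | [/\ W u, nm u = 1 &
  forall k, (k <= n)%N -> M - d k < nm (T u)]]).
have pF : ProperFilter F.
  apply: filter_from_proper; last first.
    move=> n _; pose dm := \big[Num.min/d 0]_(k < n.+1) d k.
    have dm0 : 0 < dm.
      by rewrite /dm; elim/big_ind: _ => // x y x0 y0; rewrite lt_min x0.
    have [_ [u [Wu u1] ->] hu] := sup_adherent dm0 hS.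
    exists u; split=> // k kn; apply: le_lt_trans hu; rewrite lerD2l lerN2.
    have kn1 : (k < n.+1)%N by [].
    exact: (bigmin_le (d 0) (Ordinal kn1)).
  apply: filter_fromT_filter; first by exists 0.
  move=> i j; exists (maxn i j) => u [Wu u1 hu]; split; split=> // k ki; apply: hu.
    by rewrite (leq_trans ki)// leq_maxl.
  by rewrite (leq_trans ki)// leq_maxr.
have [U [uU FU]] := ultraFilterLemma pF.
have pU := @ultra_proper _ _ uU.
have UN n : U [set u | [/\ W u, nm u = 1 & M - d n < nm (T u)]].
  by apply: FU; exists n => // u [Wu u1 hu]; split => //; exact: hu.
have U1 : U [set u | H u /\ nm u = 1].
  by apply: (filterS _ (UN 0)) => u [Wu u1 _]; split=> //; exact: WH.
have /choice[A hA] (n : nat) : exists A : set V, U A /\ forall u u', A u -> A u' -> nm (T u - T u') < d n.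
  by have [A UA hA] := ultra_image_small uU U1 (d0 n); exists A.
have /choice[u hu] (n : nat) : exists u, [/\ W u, nm u = 1, M - d n < nm (T u) & A n u].
  have [u [[Wu u1 hu] Au]] := filter_ex (filterI (UN n) (hA n).1).
  by exists u.
have Wu n : W (u n) by case: (hu n).
have Hu n : H (u n) by exact: WH.
have u1 n : nm (u n) = 1 by case: (hu n).
have dT n m : nm (T (u n) - T (u m)) < d n + d m.
  have [v [An Am]] := filter_ex (filterI (hA n).1 (hA m).1).
  apply: (le_lt_trans (hnorm_dist ip _ (T v) _)); apply: ltrD.
    by apply: (hA n).2 => //; case: (hu n).
  by apply: (hA m).2 => //; case: (hu m).
(* Self-adjointness makes the cross term [|T u_n|^2]; with [|T (T u_n)| <= M |T u_n|] the squared
   norm is at most [M^2 (M^2 - |T u_n|^2)]. *)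
have small n : nm (T (T (u n)) - (M ^+ 2)%:C *: u n) ^+ 2 <= M ^+ 2 * (2 * M * d n).
  rewrite (hnormB_sqr ip) (hnormZ ip) normc_real ger0_norm ?sqr_ge0// u1.
  rewrite (dotZr ip) saT//; last exact: TH.
  rewrite (dot_self ip).
  have -> : ((M ^+ 2)%:C)^* = (M ^+ 2)%:C :> R[i].
    by apply: complex_eqP; rewrite ?ReJ ?ImJ //= oppr0.
  rewrite -rmorphM/= mulr1.
  have t1 : nm (T (T (u n))) <= M * nm (T (u n)) by apply/TM/TW.
  have t2 := SM _ (Wu n) (u1 n).
  have t3 : M - d n < nm (T (u n)) by case: (hu n).
  have t4 : nm (T (T (u n))) ^+ 2 <= M ^+ 2 * nm (T (u n)) ^+ 2.
    by rewrite -exprMn ler_pXn2r// ?nnegrE ?mulr_ge0 ?hnorm_ge0.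
  have : M ^+ 2 * (M ^+ 2 - nm (T (u n)) ^+ 2) <= M ^+ 2 * (2 * M * d n).
    apply: ler_wpM2l; first exact: sqr_ge0.
    have t5 := hnorm_ge0 dot (T (u n)); have := d0 n; nra.
  lra.
have smallE (eps : R) : 0 < eps -> exists N, forall n, (N <= n)%N ->
    nm (T (T (u n)) - (M ^+ 2)%:C *: u n) < eps.
  move=> e0; pose q := M ^+ 2 * (2 * M).
  have q0 : 0 < q by rewrite !mulr_gt0// exprn_gt0.
  have [|N hN] := dl (eps ^+ 2 / q); first by rewrite divr_gt0// exprn_gt0.
  exists N => n /hN; rewrite ltr_pdivlMr// => h.
  rewrite -(@ltr_pXn2r _ 2)// ?nnegrE ?hnorm_ge0 ?(ltW e0)//.
  by apply: (le_lt_trans (small n)); rewrite mulrA mulrC.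
have M2 : 0 < M ^+ 2 by rewrite exprn_gt0.
have cu : cauchy_seq dot u.
  move=> e e0; have e1 : 0 < e * M ^+ 2 / 4 by rewrite divr_gt0// mulr_gt0.
  have [N hN] := smallE _ e1.
  have e2 : 0 < e * M / 4 / 2 by rewrite divr_gt0// divr_gt0// mulr_gt0.
  have [N' hN'] := dl _ e2.
  exists (maxn N N') => n m; rewrite !geq_max => /andP[/hN Nn /hN' Nn'] /andP[/hN Nm /hN' Nm'].
  rewrite -(ltr_pM2l M2).
  have -> : M ^+ 2 * nm (u n - u m) = nm ((M ^+ 2)%:C *: u n - (M ^+ 2)%:C *: u m).
    by rewrite -scalerBr (hnormZ ip) normc_real ger0_norm// ltW.
  apply: (le_lt_trans (hnorm_dist ip _ (T (T (u n))) _)).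
  rewrite (hnorm_distC ip _ (T (T (u n)))).
  have := hnorm_dist ip (T (T (u n))) (T (T (u m))) ((M ^+ 2)%:C *: u m).
  have : nm (T (T (u n)) - T (T (u m))) <= M * nm (T (u n) - T (u m)).
    rewrite -TB; [|exact: TH|exact: TH].
    by apply: TM; apply: subspaceB => //; exact: TW.
  have : M * nm (T (u n) - T (u m)) <= M * (e * M / 4).
    by apply: ler_wpM2l => //; have := dT n m; move: Nn' Nm'; lra.
  move: Nn Nm; rewrite expr2; lra.
have [v Wv uv] := cW _ Wu cu.
have Hv := WH _ Wv.
have v1 : nm v = 1.
  apply/eqP; rewrite -subr_eq0 -normr_eq0; apply/eqP/le_anti; rewrite normr_ge0 andbT.
  apply: le_epsilon => e e0; have [N hN] := uv _ e0; have := hN N (leqnn _).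
  have := hnorm_le_dist ip v (u N); have := hnorm_le_dist ip (u N) v.
  rewrite (hnorm_distC ip v) u1 add0r ler_norml; lra.
have T2 : T (T v) = (M ^+ 2)%:C *: v.
  apply: subr0_eq; apply: (hnorm_eq0_eps ip) => e e0.
  have e1 : 0 < e / 2 by rewrite divr_gt0.
  have e2 : 0 < e / 4 / M ^+ 2 by rewrite !divr_gt0.
  have [N hN] := smallE _ e1; have [N' hN'] := uv _ e2.
  pose n := maxn N N'; have h1 := hN n (leq_maxl _ _); have := hN' n (leq_maxr _ _).
  rewrite ltr_pdivlMr// => h2.
  have h3 : nm (T (T v) - T (T (u n))) <= nm (u n - v) * M ^+ 2.
    rewrite -TB; [|exact: TH|exact: TH]; rewrite -TB// (hnorm_distC ip (u n)).
    have Wd : W (v - u n) by exact: subspaceB.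
    have t1 := TM _ (TW _ Wd); have t2 := ler_wpM2l M0 (TM _ Wd); rewrite expr2; lra.
  have h4 : nm ((M ^+ 2)%:C *: u n - (M ^+ 2)%:C *: v) = nm (u n - v) * M ^+ 2.
    by rewrite -scalerBr (hnormZ ip) normc_real ger0_norm ?ltW// mulrC.
  apply: (le_trans (hnorm_dist ip _ (T (T (u n))) _)).
  have := hnorm_dist ip (T (T (u n))) ((M ^+ 2)%:C *: u n) ((M ^+ 2)%:C *: v).
  move: h1 h2 h3; rewrite h4; lra.
(* Since [(T - M) (T + M) v = 0], either [T v + M v] is an eigenvector for [M], or it vanishes and
   [v] is one for [- M]. *)
have [wz|wn] := eqVneq (T v + M%:C *: v) 0.
  exists v, (- M); split => //; first by rewrite (dot_self ip) v1 expr1n.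
  by rewrite rmorphN scaleNr; apply/eqP; rewrite -addr_eq0 wz.
have Ww : W (T v + M%:C *: v).
  by apply: (subspaceD sW); [exact: TW|exact: subspaceZ].
have [a [Wa aa _]] := unit _ Ww wn.
exists (a *: (T v + M%:C *: v)), M; split => //.
rewrite TZ; last exact: WH.
rewrite TD; [|exact: TH|exact: subspaceZ].
rewrite TZ// T2 !scalerA mulrC -scalerA; congr (_ *: _).
by rewrite scalerDr addrC scalerA -rmorphM -expr2.
Qed.

(* A maximal orthonormal set of eigenvectors is a basis, since its orthogonal
   complement is invariant. *)
Lemma spectral_theorem : hcomplete dot H ->
  exists2 E, hilbert_basis dot H E &
    exists lam : V -> R, forall e, E e -> T e = (lam e)%:C *: e.
Proof.
move=> cH.
pose P : set (set V) := [set E | [/\ E `<=` H, orthonormal dot E &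
  forall e, E e -> exists l : R, T e = l%:C *: e]].
have [|E [[EH oE eE] maxE]] := @Zorn_bigcup V P.
  move=> F FP tF; split.
  - by move=> e [X FX Xe]; have [XH _ _] := FP _ FX; exact: XH.
  - move=> e f [X FX Xe] [Y FY Yf].
    have [XY|YX] := tF _ _ FX FY.
      by have [_ oY _] := FP _ FY; apply: oY => //; exact: XY.
    by have [_ oX _] := FP _ FX; apply: oX => //; exact: YX.
  - by move=> e [X FX Xe]; have [_ _ h] := FP _ FX; exact: h.
exists E; last first.
  have /choice[lam hlam] e : exists l : R, E e -> T e = l%:C *: e.
    by have [/eE[l hl]|nE] := pselect (E e); [exists l|exists 0].
  by exists lam.
split=> // u Hu uE; apply/eqP/negPn/negP => un.
pose W : set V := [set w | H w /\ forall e, E e -> dot w e = 0].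
have sW : subspace W.
  split; first by split; [case: sH|move=> e _; rewrite (dot0l ip)].
  move=> a x y [Hx xE] [Hy yE]; split; first by case: sH => _; apply.
  by move=> e Ee; rewrite (dot_linl ip) xE// yE// mulr0 addr0.
have cW : hcomplete dot W.
  move=> s Ws cs; have [|v Hv sv] := cH s _ cs; first by move=> n; case: (Ws n).
  exists v => //; split => // e Ee; apply: normc_eq0_eps => eps eps0.
  have [N hN] := sv _ eps0; have := hN N (leqnn _).
  have -> : dot v e = - dot (s N - v) e by rewrite (dotBl ip) (Ws N).2// sub0r opprK.
  move=> h; rewrite normcN; apply: (le_trans (cauchy_schwarz ip _ _)).
  by rewrite (hnorm_orthonormal ip oE Ee) mulr1 ltW.
have [|||e [l [[He eW] ee Te]]] := exists_eigenvector sW cW.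
- by move=> w [].
- move=> w [Hw wE]; split; first exact: TH.
  move=> e Ee; rewrite saT//; last exact: EH.
  by have [l ->] := eE _ Ee; rewrite (dotZr ip) wE// mulr0.
- by exists u.
have nEe : ~ E e by move=> /eW; rewrite ee => /eqP; rewrite oner_eq0.
apply: (maxE (E `|` [set e])).
  by split; [move=> x; left|move=> /(_ e (or_intror erefl))].
split.
- by move=> x [/EH//|->].
- move=> x y [Ex|->] [Ey|->]; [exact: oE| | |by rewrite eqxx].
  + by rewrite (dotC ip) eW// rmorph0; case: eqP => // xe; rewrite xe in Ex.
  + by rewrite eW//; case: eqP => // xe; rewrite -xe in Ey.
- by move=> x [/eE//|->]; exists l.
Qed.

End spectral.

(** * Existence of bases and of orthogonal projections *)

Section projection.
Context (R : realType) (V : lmodType R[i]) (dot : V -> V -> R[i]).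
Context (ip : inner_product dot) (W : set V) (sW : subspace W) (cW : hcomplete dot W).
Local Notation nm := (hnorm dot).

(** The zero operator is compact and self-adjoint, so the spectral theorem already contains the
    existence of bases. *)
Lemma hilbert_basis_exists : exists E, hilbert_basis dot W E.
Proof.
have W0 : W 0 by case: sW.
have bZ : bounded_operator dot W (fun=> 0).
  split => //; first by move=> a u v _ _; rewrite scaler0 addr0.
  by exists 0 => u _; rewrite (hnorm0 ip) mul0r.
have [|e e0|E bE _] := spectral_theorem ip sW bZ _ _ cW.
- by move=> u v _ _; rewrite (dot0l ip) (dot0r ip).
- by exists [::] => // u Wu _; rewrite (hnorm0 ip) mulr_ge0 ?hnorm_ge0 ?ltW.
- by exists E.
Qed.

(** Bessel's inequality holds for the coefficients of any [u], and Riesz-Fischer turns them into an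
    element of [W]; orthogonality to [w] is checked on the basis and extended by finite projections
    of [w]. *)
Lemma projection_exists u : exists2 v, W v & forall w, W w -> dot (u - v) w = 0.
Proof.
have [E bE] := hilbert_basis_exists; have [EW oE _] := bE.
have [v [Wv vE _]] := riesz_fischer ip sW cW EW oE (fun A AE => bessel ip u oE AE).
exists v => // w Ww; apply: normc_eq0_eps => e e0.
pose K := nm (u - v) + 1; have K0 : 0 < K by rewrite ltr_wpDl// hnorm_ge0.
have [A AE /(_ A AE (fun x xA => xA)) hA] := parseval_proj ip sW cW bE Ww (divr_gt0 e0 K0).
have -> : dot (u - v) w = dot (u - v) (w - proj dot A w).
  rewrite [RHS](dotBr ip) [dot _ (proj _ _ _)](dot_sumr ip) big_seq big1 ?subr0// => f fA.
  by rewrite (dotZr ip) (dotBl ip) vE ?subrr ?mulr0//; exact: AE.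
apply: (le_trans (cauchy_schwarz ip _ _)).
have : nm (u - v) * nm (w - proj dot A w) <= K * (e / K).
  by apply: ler_pM; rewrite ?hnorm_ge0 ?lerDl// ltW.
by rewrite [K * _]mulrC divfK// gt_eqF.
Qed.

Lemma orthogonal_projectionP u : W (orthogonal_projection dot W u) /\
  forall w, W w -> dot (u - orthogonal_projection dot W u) w = 0.
Proof.
rewrite /orthogonal_projection; case: xgetP => [v _ //|].
by have [v Wv hv] := projection_exists u; move=> /(_ v) []; split.
Qed.

End projection.

(** * Integrable functions *)

Section complex_integrals.
Context d (T : measurableType d) (R : realType) (mu : {measure set T -> \bar R}).
Implicit Types (f g : T -> R[i]) (h k : T -> R).

Local Notation rI h := (Rintegral mu setT h).
Local Notation cI := (cintegral mu).

Definition rintegrable h := mu.-integrable setT (EFin \o h).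
Definition cmeasurable f := measurable_fun setT (fun x => Re (f x)) /\
  measurable_fun setT (fun x => Im (f x)).
Definition cintegrable f := rintegrable (fun x => Re (f x)) /\
  rintegrable (fun x => Im (f x)).

Lemma rintegrable_measurable h : rintegrable h -> measurable_fun setT h.
Proof. by move=> /integrableP[/measurable_EFinP]. Qed.

Lemma le_rintegrable h k : measurable_fun setT h -> rintegrable k ->
  (forall x, `|h x| <= k x) -> rintegrable h.
Proof.
move=> mh ik hk; apply: le_integrable ik => //; first exact/measurable_EFinP.
by move=> x _ /=; rewrite lee_fin (le_trans (hk x))// ler_norm.
Qed.

Lemma rintegrable_norm h : rintegrable h -> rintegrable (fun x => `|h x|).
Proof. exact: integrable_norm. Qed.

Lemma rintegrableD h k : rintegrable h -> rintegrable k ->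
  rintegrable (fun x => h x + k x).
Proof. by move=> ih ik; apply: (integrableD _ ih ik). Qed.

Lemma rintegrableB h k : rintegrable h -> rintegrable k ->
  rintegrable (fun x => h x - k x).
Proof. by move=> ih ik; apply: (integrableB _ ih ik). Qed.

Lemma rintegrableZ (c : R) h : rintegrable h -> rintegrable (fun x => c * h x).
Proof. by move=> ih; apply: (integrableZl _ c ih). Qed.

Lemma rintegrable0 : rintegrable (fun=> 0).
Proof. exact: integrable0. Qed.

Lemma RintD h k : rintegrable h -> rintegrable k ->
  rI (fun x => h x + k x) = rI h + rI k.
Proof. by move=> ih ik; rewrite RintegralD. Qed.
Lemma RintB h k : rintegrable h -> rintegrable k ->
  rI (fun x => h x - k x) = rI h - rI k.
Proof. by move=> ih ik; rewrite RintegralB. Qed.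
Lemma RintZ (c : R) h : rintegrable h -> rI (fun x => c * h x) = c * rI h.
Proof. by move=> ih; rewrite RintegralZl. Qed.
Lemma RintN h : rintegrable h -> rI (fun x => - h x) = - rI h.
Proof.
move=> ih; rewrite -mulN1r -RintZ//; apply: eq_Rintegral => x _; by rewrite mulN1r.
Qed.
Lemma Rint0 : rI (fun=> 0) = 0.
Proof. by rewrite /Rintegral integral0. Qed.
Lemma le_Rint h k : rintegrable h -> rintegrable k -> (forall x, h x <= k x) ->
  rI h <= rI k.
Proof. by move=> ih ik hk; apply: le_Rintegral. Qed.
Lemma Rint_ge0 h : (forall x, 0 <= h x) -> 0 <= rI h.
Proof. by move=> h0; apply: Rintegral_ge0. Qed.
Lemma le_norm_Rint h : rintegrable h -> `|rI h| <= rI (fun x => `|h x|).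
Proof. by move=> ih; apply: le_normr_Rintegral. Qed.
Lemma Rint_EFin h : rintegrable h -> (\int[mu]_x (h x)%:E)%E = (rI h)%:E.
Proof. by move=> ih; rewrite fineK//; apply: integrable_fin_num. Qed.

Lemma Rint_ae h k : measurable_fun setT h -> measurable_fun setT k ->
  {ae mu, forall x, h x = k x} -> rI h = rI k.
Proof.
move=> mh mk hk; congr fine; apply: ae_eq_integral => //; try exact/measurable_EFinP.
by apply: filterS hk => x /= ->.
Qed.

Lemma rintegrable_ae h k : measurable_fun setT k -> rintegrable h ->
  {ae mu, forall x, h x = k x} -> rintegrable k.
Proof.
move=> mk /integrableP[mh ih] hk; apply/integrableP; split; first exact/measurable_EFinP.
rewrite -(ge0_ae_eq_integral _ _ _ _ _ _ : (\int[mu]_x `|(h x)%:E|)%E = _)//.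
- exact: measurableT_comp.
- by apply: measurableT_comp => //; exact/measurable_EFinP.
- by apply: filterS hk => x /= ->.
Qed.

Lemma Rint_eq0 h : rintegrable h -> (forall x, 0 <= h x) -> rI h = 0 ->
  {ae mu, forall x, h x = 0}.
Proof.
move=> ih h0 hI.
have /integrableP[mh _] := ih.
have := Rint_EFin ih; rewrite hI => h1.
have : (\int[mu]_x `|(h x)%:E|)%E = 0.
  by rewrite -[RHS]h1; apply: eq_integral => x _; rewrite /= ger0_norm.
move=> /(ae_eq_integral_abs mu measurableT mh); apply: filterS => x /= /(_ I).
by case.
Qed.

Lemma dominated_Rint (f_ : nat -> T -> R) h k :
  (forall n, measurable_fun setT (f_ n)) ->
  (forall x, f_ n x @[n --> \oo] --> h x) -> rintegrable k ->
  (forall n x, `|f_ n x| <= k x) ->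
  rintegrable h /\ rI (f_ n) @[n --> \oo] --> rI h.
Proof.
move=> mf fh ik fk.
have mh : measurable_fun setT h by apply: (measurable_fun_cvg mf) => x _; exact: fh.
have hk x : `|h x| <= k x.
  by apply: (cvgr_to_le (cvg_norm (fh x))); apply: nearW => n; exact: fk.
have ih : rintegrable h by apply: le_rintegrable mh ik hk.
split => //; apply: fine_cvg; rewrite -/(Rintegral _ _ _) -Rint_EFin//.
apply: (dominated_cvg measurableT _ _ _ ik).
- by move=> n; exact/measurable_EFinP.
- by move=> x _; apply: cvg_EFin; [exact: nearW|exact: fh].
- by [].
- by move=> n x _ /=; rewrite lee_fin.
Qed.

(** * Complex-valued functions *)

Lemma cmeasurableD f g : cmeasurable f -> cmeasurable g -> cmeasurable (fun x => f x + g x).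
Proof.
move=> [fr fi] [gr gi]; split.
- by rewrite (_ : (fun x => _) = fun x => Re (f x) + Re (g x));
    [exact: measurable_funD|apply/funext => x; rewrite ReD].
- by rewrite (_ : (fun x => _) = fun x => Im (f x) + Im (g x));
    [exact: measurable_funD|apply/funext => x; rewrite ImD].
Qed.

Lemma cmeasurableM f g : cmeasurable f -> cmeasurable g -> cmeasurable (fun x => f x * g x).
Proof.
move=> [fr fi] [gr gi]; split.
- rewrite (_ : (fun x => _) = fun x => Re (f x) * Re (g x) - Im (f x) * Im (g x)).
    by apply: measurable_funB; exact: measurable_funM.
  by apply/funext => x; rewrite ReM.
- rewrite (_ : (fun x => _) = fun x => Re (f x) * Im (g x) + Im (f x) * Re (g x)).
    by apply: measurable_funD; exact: measurable_funM.
  by apply/funext => x; rewrite ImM.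
Qed.

Lemma cmeasurableJ f : cmeasurable f -> cmeasurable (fun x => (f x)^*).
Proof.
move=> [fr fi]; split.
- by rewrite (_ : (fun x => _) = fun x => Re (f x))//; apply/funext => x; rewrite ReJ.
- rewrite (_ : (fun x => _) = fun x => - Im (f x)); first exact: measurableT_comp.
  by apply/funext => x; rewrite ImJ.
Qed.

Lemma cmeasurable_cst (c : R[i]) : cmeasurable (fun=> c).
Proof. by split; exact: measurable_cst. Qed.

Lemma cmeasurable_real h : measurable_fun setT h -> cmeasurable (fun x => (h x)%:C).
Proof. by split => //; exact: measurable_cst. Qed.

Lemma cmeasurableN f : cmeasurable f -> cmeasurable (fun x => - f x).
Proof.
move=> mf; rewrite (_ : (fun x => _) = fun x => -1 * f x).
  by apply: cmeasurableM => //; exact: cmeasurable_cst.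
by apply/funext => x; rewrite mulN1r.
Qed.

Lemma cmeasurableB f g : cmeasurable f -> cmeasurable g -> cmeasurable (fun x => f x - g x).
Proof. by move=> mf mg; apply: cmeasurableD => //; exact: cmeasurableN. Qed.

Lemma measurable_normc_sqr f : cmeasurable f ->
  measurable_fun setT (fun x => normc (f x) ^+ 2).
Proof.
move=> [fr fi].
rewrite (_ : (fun x => _) = fun x => Re (f x) ^+ 2 + Im (f x) ^+ 2).
  by apply: measurable_funD; exact: measurable_funX.
by apply/funext => x; rewrite normc_sqr.
Qed.

Lemma measurable_normc f : cmeasurable f -> measurable_fun setT (fun x => normc (f x)).
Proof.
move=> /measurable_normc_sqr mf.
rewrite (_ : (fun x => _) = Num.sqrt \o (fun x => normc (f x) ^+ 2)).
  by apply: measurableT_comp => //; apply: continuous_measurable_fun; exact: sqrt_continuous.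
by apply/funext => x /=; rewrite sqrtr_sqr ger0_norm ?normc_ge0.
Qed.

Lemma cintegrable_measurable f : cintegrable f -> cmeasurable f.
Proof. by move=> [fr fi]; split; exact: rintegrable_measurable. Qed.

Lemma le_cintegrable f h : cmeasurable f -> rintegrable h ->
  (forall x, normc (f x) <= h x) -> cintegrable f.
Proof.
move=> [fr fi] ih fh; split; apply: (le_rintegrable _ ih) => // x;
  apply: le_trans (fh x); [exact: Re_le_normc|exact: Im_le_normc].
Qed.

Lemma rintegrable_normc f : cintegrable f -> rintegrable (fun x => normc (f x)).
Proof.
move=> [fr fi]; have mf := cintegrable_measurable (conj fr fi).
apply: (@le_rintegrable _ (fun x => `|Re (f x)| + `|Im (f x)|)).
- exact: measurable_normc.
- by apply: rintegrableD; exact: rintegrable_norm.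
- by move=> x; rewrite ger0_norm ?normc_ge0// normc_le_ReIm.
Qed.

Lemma cLfun1P f : f \in cLfun mu 1 <-> cintegrable f.
Proof.
split; first by move=> /andP[/Lfun1_integrable fr /Lfun1_integrable fi].
by move=> [fr fi]; apply/andP; split; apply/Lfun1_integrable.
Qed.

Lemma cintegrableD f g : cintegrable f -> cintegrable g -> cintegrable (fun x => f x + g x).
Proof.
move=> fi gi; apply: (@le_cintegrable _ (fun x => normc (f x) + normc (g x))).
- by apply: cmeasurableD; exact: cintegrable_measurable.
- by apply: rintegrableD; exact: rintegrable_normc.
- by move=> x; exact: le_normcD.
Qed.

Lemma cintegrableZ (c : R[i]) f : cintegrable f -> cintegrable (fun x => c * f x).
Proof.
move=> fi; apply: (@le_cintegrable _ (fun x => normc c * normc (f x))).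
- by apply: cmeasurableM; [exact: cmeasurable_cst|exact: cintegrable_measurable].
- by apply: rintegrableZ; exact: rintegrable_normc.
- by move=> x; rewrite Normc.normcM.
Qed.

Lemma cintegrableN f : cintegrable f -> cintegrable (fun x => - f x).
Proof.
move=> /(cintegrableZ (-1)); congr cintegrable.
by apply/funext => x; rewrite mulN1r.
Qed.

Lemma cintegrableB f g : cintegrable f -> cintegrable g -> cintegrable (fun x => f x - g x).
Proof. by move=> fi gi; apply: cintegrableD => //; exact: cintegrableN. Qed.

Lemma cintegrableJ f : cintegrable f -> cintegrable (fun x => (f x)^*).
Proof.
move=> fi; apply: (le_cintegrable _ (rintegrable_normc fi)).
- exact/cmeasurableJ/cintegrable_measurable.
- by move=> x; rewrite normcJ.
Qed.

Lemma cintegrable_real h : rintegrable h -> cintegrable (fun x => (h x)%:C).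
Proof. by split => //; exact: rintegrable0. Qed.

Lemma cintegrable0 : cintegrable (fun=> 0).
Proof. by split; exact: rintegrable0. Qed.

Lemma cintegrableM_bounded f g (C : R) : cintegrable f -> cmeasurable g ->
  (forall x, normc (g x) <= C) -> cintegrable (fun x => f x * g x).
Proof.
move=> fi mg gC; apply: (@le_cintegrable _ (fun x => C * normc (f x))).
- by apply: cmeasurableM => //; exact: cintegrable_measurable.
- by apply: rintegrableZ; exact: rintegrable_normc.
- by move=> x; rewrite Normc.normcM mulrC; apply: ler_wpM2r => //; exact: normc_ge0.
Qed.

Lemma cintegrable_sum (I : Type) (s : seq I) (F : I -> T -> R[i]) :
  (forall i, cintegrable (F i)) -> cintegrable (fun x => \sum_(i <- s) F i x).
Proof.
move=> iF; elim: s => [|i s IH].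
  have -> : (fun x => \sum_(i <- [::]) F i x) = fun=> 0 by apply/funext => x; rewrite big_nil.
  exact: cintegrable0.
rewrite (_ : (fun x => _) = fun x => F i x + \sum_(j <- s) F j x).
  exact: cintegrableD.
by apply/funext => x; rewrite big_cons.
Qed.

Lemma eq_cint f g : f =1 g -> cI f = cI g.
Proof. by move=> fg; congr (_ +i* _); apply: eq_Rintegral => x _; rewrite fg. Qed.

Lemma cint0 : cI (fun=> 0) = 0.
Proof. by rewrite /cintegral /= Rint0. Qed.

Lemma cintD f g : cintegrable f -> cintegrable g -> cI (fun x => f x + g x) = cI f + cI g.
Proof.
move=> [fr fi] [gr gi]; apply: complex_eqP; rewrite ?ReD ?ImD /=.
- by rewrite -RintD//; apply: eq_Rintegral => x _; rewrite ReD.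
- by rewrite -RintD//; apply: eq_Rintegral => x _; rewrite ImD.
Qed.

Lemma cintZ (c : R[i]) f : cintegrable f -> cI (fun x => c * f x) = c * cI f.
Proof.
move=> [fr fi]; apply: complex_eqP; rewrite ?ReM ?ImM /=.
- rewrite -!RintZ// -RintB; try exact: rintegrableZ.
  by apply: eq_Rintegral => x _; rewrite ReM.
- rewrite -!RintZ// -RintD; try exact: rintegrableZ.
  by apply: eq_Rintegral => x _; rewrite ImM.
Qed.

Lemma cintN f : cintegrable f -> cI (fun x => - f x) = - cI f.
Proof.
by move=> fi; rewrite -mulN1r -cintZ//; apply: eq_cint => x; rewrite mulN1r.
Qed.

Lemma cintB f g : cintegrable f -> cintegrable g -> cI (fun x => f x - g x) = cI f - cI g.
Proof. by move=> fi gi; rewrite cintD ?cintN//; exact: cintegrableN. Qed.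

Lemma cintJ f : cintegrable f -> cI (fun x => (f x)^*) = (cI f)^*.
Proof.
move=> [fr fi]; apply: complex_eqP; rewrite ?ReJ ?ImJ /=.
- by apply: eq_Rintegral => x _; rewrite ReJ.
- by rewrite -RintN//; apply: eq_Rintegral => x _; rewrite ImJ.
Qed.

Lemma cint_real h : cI (fun x => (h x)%:C) = (rI h)%:C.
Proof. by apply: complex_eqP => //=; rewrite Rint0. Qed.

Lemma cint_sum (I : Type) (s : seq I) (F : I -> T -> R[i]) :
  (forall i, cintegrable (F i)) ->
  cI (fun x => \sum_(i <- s) F i x) = \sum_(i <- s) cI (F i).
Proof.
move=> iF; elim: s => [|i s IH].
  by rewrite big_nil -[RHS]cint0; apply: eq_cint => x; rewrite big_nil.
rewrite big_cons -IH -cintD//; last exact: cintegrable_sum.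
by apply: eq_cint => x; rewrite big_cons.
Qed.

Lemma cint_ae f g : cmeasurable f -> cmeasurable g -> {ae mu, forall x, f x = g x} ->
  cI f = cI g.
Proof.
move=> [fr fi] [gr gi] fg; congr (_ +i* _); apply: Rint_ae => //;
  by apply: filterS fg => x /= ->.
Qed.

(** Multiplication by the conjugate of the integral makes the integral real, and a real part is at
    most the modulus. *)
Lemma normc_cint f : cintegrable f -> normc (cI f) <= rI (fun x => normc (f x)).
Proof.
move=> fi; have [c0|c0] := eqVneq (cI f) 0.
  by rewrite c0 normc0 Rint_ge0// => x; exact: normc_ge0.
have cp : 0 < normc (cI f).
  rewrite lt_neqAle normc_ge0 andbT eq_sym.
  by apply: contraNneq c0 => /Normc.eq0_normc ->.
have E : (normc (cI f) ^+ 2)%:C = cI (fun x => (cI f)^* * f x).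
  by rewrite cintZ// mulrC mulJ.
have ceq : normc (cI f) * normc (cI f) = rI (fun x => Re ((cI f)^* * f x)).
  by rewrite -expr2 -[LHS]/(Re (normc (cI f) ^+ 2)%:C) E.
rewrite -(ler_pM2l cp) ceq -RintZ; last exact: rintegrable_normc.
apply: le_Rint.
- by case: (cintegrableZ ((cI f)^*) fi).
- by apply: rintegrableZ; exact: rintegrable_normc.
- move=> x; apply: (le_trans (ler_norm _)); apply: (le_trans (Re_le_normc _)).
  by rewrite Normc.normcM normcJ.
Qed.

(** * Square-integrable functions *)

Lemma Lfun2P h : h \in Lfun mu 2%:E <->
  measurable_fun setT h /\ rintegrable (fun x => h x ^+ 2).
Proof.
split => [h2|[mh ih]].
  split; last exact: Lfun2_integrable_sqr.
  by have /set_mem := sub_Lfun_mfun h2.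
apply/andP; split; first exact/mem_set.
apply/mem_set; rewrite /= /finite_norm unlock; apply: poweR_lty.
have /integrableP[_] := ih.
congr (_ < _)%E; apply: eq_integral => x _ /=.
by rewrite powR_mulrn// real_normK ?num_real// ger0_norm ?sqr_ge0.
Qed.

Lemma cLfun2P f : f \in cLfun mu 2%:E <->
  cmeasurable f /\ rintegrable (fun x => normc (f x) ^+ 2).
Proof.
split => [/andP[/Lfun2P[fr ir] /Lfun2P[fi ii]]|[[fr fi] n2]].
  split; first by [].
  rewrite (_ : (fun x => _) = fun x => Re (f x) ^+ 2 + Im (f x) ^+ 2).
    exact: rintegrableD.
  by apply/funext => x; rewrite normc_sqr.
apply/andP; split; apply/Lfun2P; split => //; apply: (le_rintegrable _ n2).
- exact: measurable_funX.
- by move=> x; rewrite normc_sqr ger0_norm ?sqr_ge0// lerDl sqr_ge0.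
- exact: measurable_funX.
- by move=> x; rewrite normc_sqr ger0_norm ?sqr_ge0// lerDr sqr_ge0.
Qed.

Lemma cintegrable_mul f g : f \in cLfun mu 2%:E -> g \in cLfun mu 2%:E ->
  cintegrable (fun x => f x * g x).
Proof.
move=> /cLfun2P[mf f2] /cLfun2P[mg g2].
apply: (@le_cintegrable _ (fun x => normc (f x) ^+ 2 + normc (g x) ^+ 2)).
- exact: cmeasurableM.
- exact: rintegrableD.
- move=> x; rewrite Normc.normcM.
  have := normc_ge0 (f x); have := normc_ge0 (g x); nra.
Qed.

Lemma cLfun2J f : f \in cLfun mu 2%:E -> (fun x => (f x)^*) \in cLfun mu 2%:E.
Proof.
move=> /cLfun2P[mf f2]; apply/cLfun2P; split; first exact: cmeasurableJ.
by under eq_fun do rewrite normcJ.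
Qed.

Lemma le_cLfun2 f h : cmeasurable f -> rintegrable h ->
  (forall x, normc (f x) ^+ 2 <= h x) -> f \in cLfun mu 2%:E.
Proof.
move=> mf ih fh; apply/cLfun2P; split => //.
apply: (le_rintegrable _ ih); first exact: measurable_normc_sqr.
by move=> x; rewrite ger0_norm ?sqr_ge0.
Qed.

End complex_integrals.

Section L2_space.
Context d (T : measurableType d) (R : realType) (mu : {measure set T -> \bar R}).
Local Notation L2 := (L2 mu).
Local Notation L2f := (L2fun mu).
Implicit Types (u v w : L2) (f g : T -> R[i]) (a : R[i]).
Local Notation rI h := (Rintegral mu setT h).
Local Notation cI := (cintegral mu).
Local Notation dot := (@L2inner _ _ _ mu).
Local Notation nm := (hnorm dot).

(** A chosen representative of a class; algebraic identities between representatives hold only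
    almost everywhere. *)
Definition rp u : T -> R[i] := \val (repr u).

Lemma rp_cLfun2 u : rp u \in cLfun mu 2%:E. Proof. exact: (valP (repr u)). Qed.

Lemma rp_cmeasurable u : cmeasurable (rp u).
Proof. by have /cLfun2P[] := rp_cLfun2 u. Qed.

Lemma pi_ae (f g : L2f) : \pi_(L2) f = \pi_(L2) g <->
  {ae mu, forall x, \val f x = \val g x}.
Proof.
split=> [/eqP|fg].
- rewrite -[_ == _]Quotient.idealrBE => /asboolP; apply: filterS => x /=.
  by rewrite !fctE => /eqP; rewrite subr_eq0 => /eqP.
- apply/eqP; rewrite -[_ == _]Quotient.idealrBE; apply/asboolP; apply: filterS fg => x /= fgx.
  by rewrite !fctE fgx subrr.
Qed.

Lemma rp_pi (f : L2f) : {ae mu, forall x, rp (\pi_(L2) f) x = \val f x}.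
Proof. by apply/pi_ae; rewrite reprK. Qed.

Lemma rp_toL2 f : f \in cLfun mu 2%:E -> {ae mu, forall x, rp (toL2 mu f) x = f x}.
Proof.
move=> f2; have := rp_pi (insubd (0 : L2f) f); apply: filterS => x ->.
by rewrite val_insubd f2.
Qed.

Lemma L2_eqP u v : {ae mu, forall x, rp u x = rp v x} <-> u = v.
Proof.
split=> [uv|->]; last exact: nearW.
by rewrite -[u]reprK -[v]reprK; apply/pi_ae.
Qed.

Lemma rpD u v : {ae mu, forall x, rp (u + v) x = rp u x + rp v x}.
Proof.
have -> : u + v = \pi_(L2) (repr u + repr v) by rewrite raddfD/= !reprK.
exact: rp_pi.
Qed.

Lemma rpZ a u : {ae mu, forall x, rp (a *: u) x = a * rp u x}.
Proof. exact: rp_pi. Qed.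

Lemma rp0 : {ae mu, forall x, rp 0 x = 0}.
Proof.
have -> : (0 : L2) = \pi_(L2) 0 by rewrite raddf0.
exact: rp_pi.
Qed.

Lemma rpN u : {ae mu, forall x, rp (- u) x = - rp u x}.
Proof. by rewrite -scaleN1r; apply: filterS (rpZ (-1) u) => x ->; rewrite mulN1r. Qed.

Lemma rpB u v : {ae mu, forall x, rp (u - v) x = rp u x - rp v x}.
Proof. by apply: filterS2 (rpD u (- v)) (rpN v) => x -> ->. Qed.

Lemma L2inner_rp u v : dot u v = cI (fun x => rp u x * (rp v x)^*). Proof. by []. Qed.

Lemma cintegrable_rp u v : cintegrable mu (fun x => rp u x * (rp v x)^*).
Proof. by apply: cintegrable_mul; [|apply: cLfun2J]; exact: rp_cLfun2. Qed.

Lemma rintegrable_rp u : rintegrable mu (fun x => normc (rp u x) ^+ 2).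
Proof. by have /cLfun2P[] := rp_cLfun2 u. Qed.

Lemma L2inner_ae u v f g : cmeasurable f -> cmeasurable g ->
  {ae mu, forall x, rp u x = f x} -> {ae mu, forall x, rp v x = g x} ->
  dot u v = cI (fun x => f x * (g x)^*).
Proof.
move=> mf mg uf vg; rewrite L2inner_rp; apply: cint_ae.
- exact: cintegrable_measurable (cintegrable_rp u v).
- by apply: cmeasurableM => //; exact: cmeasurableJ.
- by apply: filterS2 uf vg => x /= -> ->.
Qed.

Lemma L2inner_toL2 f g : f \in cLfun mu 2%:E -> g \in cLfun mu 2%:E ->
  dot (toL2 mu f) (toL2 mu g) = cI (fun x => f x * (g x)^*).
Proof.
move=> f2 g2; apply: L2inner_ae; rewrite ?rp_toL2//.
- by have /cLfun2P[] := f2.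
- by have /cLfun2P[] := g2.
- exact: rp_toL2.
- exact: rp_toL2.
Qed.

Lemma L2norm_sqr u : nm u ^+ 2 = rI (fun x => normc (rp u x) ^+ 2).
Proof.
have dE : dot u u = (rI (fun x => normc (rp u x) ^+ 2))%:C.
  by rewrite L2inner_rp -cint_real; apply: eq_cint => x; rewrite mulJ.
rewrite /hnorm dE sqr_sqrtr//=; apply: Rint_ge0 => x; exact: sqr_ge0.
Qed.

Lemma L2norm_ae u f : cmeasurable f -> {ae mu, forall x, rp u x = f x} ->
  nm u ^+ 2 = rI (fun x => normc (f x) ^+ 2).
Proof.
move=> mf uf; rewrite L2norm_sqr; apply: Rint_ae.
- exact/measurable_normc_sqr/rp_cmeasurable.
- exact: measurable_normc_sqr.
- by apply: filterS uf => x ->.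
Qed.

Lemma L2inner_product : inner_product dot.
Proof.
split.
- move=> a u v w.
  rewrite (@L2inner_ae _ _ (fun x => a * rp u x + rp v x) (rp w)).
  + transitivity (cI (fun x => a * (rp u x * (rp w x)^*) + rp v x * (rp w x)^*)).
      by apply: eq_cint => x; rewrite mulrDl mulrA.
    rewrite cintD; [|exact/cintegrableZ/cintegrable_rp|exact: cintegrable_rp].
    by rewrite cintZ; [|exact: cintegrable_rp].
  + apply: cmeasurableD; last exact: rp_cmeasurable.
    by apply: cmeasurableM; [exact: cmeasurable_cst|exact: rp_cmeasurable].
  + exact: rp_cmeasurable.
  + by apply: filterS2 (rpD (a *: u) v) (rpZ a u) => x -> ->.
  + exact: nearW.
- move=> u v; rewrite !L2inner_rp -cintJ; last exact: cintegrable_rp.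
  by apply: eq_cint => x; rewrite rmorphM /= conjCK mulrC.
- move=> u; rewrite L2inner_rp.
  rewrite (@eq_cint _ _ _ _ _ (fun x => (normc (rp u x) ^+ 2)%:C)); last by move=> x; rewrite mulJ.
  by rewrite cint_real lecR; apply: Rint_ge0 => x; exact: sqr_ge0.
- move=> u; rewrite L2inner_rp.
  rewrite (@eq_cint _ _ _ _ _ (fun x => (normc (rp u x) ^+ 2)%:C)); last by move=> x; rewrite mulJ.
  rewrite cint_real => /complexI => /(Rint_eq0 (rintegrable_rp u)) => h.
  apply/L2_eqP; apply: filterS2 (h (fun x => sqr_ge0 _)) rp0 => x /eqP.
  by rewrite sqrf_eq0 => /eqP/Normc.eq0_normc -> ->.
Qed.

(** * Completeness *)

(* Fatou's lemma for squares along a subsequence converging almost everywhere,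
   obtained from a summable choice of the increments. *)
Lemma L2_complete_real (f : nat -> T -> R) :
  (forall n, measurable_fun setT (f n)) ->
  (forall n m, rintegrable mu (fun x => (f n x - f m x) ^+ 2)) ->
  (forall e : R, 0 < e -> exists N, forall n m, (N <= n)%N -> (N <= m)%N ->
    rI (fun x => (f n x - f m x) ^+ 2) < e) ->
  exists g : T -> R, [/\ measurable_fun setT g,
    forall n, rintegrable mu (fun x => (f n x - g x) ^+ 2) &
    forall e : R, 0 < e -> exists N, forall n, (N <= n)%N ->
      rI (fun x => (f n x - g x) ^+ 2) <= e].
Proof.
move=> mf if2 cf.
have p8 : 0 < 8^-1 :> R by rewrite invr_gt0.
have /choice[N0 hN0] (j : nat) := cf (8^-1 ^+ j) (exprn_gt0 j p8).
(* The maximum makes the chosen indices monotone in [j]. *)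
pose K j := \max_(i < j.+1) N0 i.
have KN i j : (i <= j)%N -> (N0 i <= K j)%N.
  move=> ij; have ij1 : (i < j.+1)%N by [].
  by rewrite /K (bigD1 (Ordinal ij1))//= leq_maxl.
pose h j := f (K j).
have hh j n : (K j <= n)%N -> rI (fun x => (f n x - h j x) ^+ 2) < 8^-1 ^+ j.
  by move=> Kn; apply: hN0; [apply: leq_trans Kn; exact: KN|exact: KN].
have hd j : rI (fun x => (h j.+1 x - h j x) ^+ 2) < 8^-1 ^+ j.
  by apply: hN0; exact: KN.
(* The weight [4 ^+ j] serves twice: against [8^-1 ^+ j] it leaves the summable bound [2^-1 ^+ j]
   for the integrals, and where [S x] is finite it makes the increments [O(2^-1 ^+ j)]. *)
pose D j x : \bar R := (4 ^+ j * (h j.+1 x - h j x) ^+ 2)%:E.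
have mD j : measurable_fun setT (D j).
  apply/measurable_EFinP; apply: measurable_funM; first exact: measurable_cst.
  by apply: measurable_funX; apply: measurable_funB; exact: mf.
have D0 j x : (0 <= D j x)%E by rewrite lee_fin mulr_ge0 ?sqr_ge0// exprn_ge0.
pose S x := (\sum_(0 <= j <oo) D j x)%E.
have SI : (\int[mu]_x S x < +oo)%E.
  rewrite integral_nneseries//.
  apply: (@le_lt_trans _ _ (\sum_(0 <= j <oo) (2^-1 ^+ j)%:E)%E).
    apply: lee_nneseries => j _; first by rewrite integral_ge0// => x _; exact: D0.
    have idj := rintegrableZ (4 ^+ j) (if2 (K j.+1) (K j)).
    rewrite (Rint_EFin idj) RintZ ?if2// lee_fin.
    apply: (@le_trans _ _ (4 ^+ j * 8^-1 ^+ j)).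
      by apply: ler_wpM2l; [exact: exprn_ge0|exact/ltW/hd].
    by rewrite -exprMn (_ : 4 * 8^-1 = 2^-1)//; field.
  have gs : cvgn (series (geometric (1 : R) 2^-1)).
    by apply: is_cvg_geometric_series; rewrite ger0_norm ?invr_ge0// invf_lt1// ltr1n.
  rewrite (_ : (fun _ => _) = EFin \o series (geometric (1 : R) 2^-1)); last first.
    apply/funext => n /=; rewrite sumEFin; congr EFin; apply: eq_bigr => i _.
    by rewrite /geometric/= mul1r.
  by rewrite EFin_lim// ltry.
have mS : measurable_fun setT S by exact: ge0_emeasurable_sum.
have S0 x : (0 <= S x)%E by apply: nneseries_ge0 => j _ _; exact: D0.
pose G := [set x | (S x < +oo)%E].
have mG : measurable G by rewrite -[G]setTI; exact: emeasurable_fun_infty_o.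
have aeG : {ae mu, forall x, G x}.
  have iS : mu.-integrable setT S.
    by apply/integrableP; split => //; under eq_integral do rewrite gee0_abs//.
  apply: filterS (integrable_ae measurableT iS) => x /(_ I).
  by rewrite fin_numElt => /andP[].
(* Cutting off the null set where [S] is infinite gives a limit at every point, hence a measurable
   limit function. *)
pose hG j x := h j x * \1_G x.
have chG x : cvgn (hG ^~ x).
  have [xG|nxG] := pselect (G x); last first.
    rewrite (_ : (fun _ => _) = fun=> 0); first exact: is_cvg_cst.
    by apply/funext => j; rewrite /hG indicE memNset ?mulr0.
  rewrite (_ : (fun _ => _) = h ^~ x); last first.
    by apply/funext => j; rewrite /hG indicE mem_set ?mulr1.
  have Sfin : S x \is a fin_num by rewrite ge0_fin_numE.
  have s0 : 0 <= fine (S x) by exact: fine_ge0.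
  have Db j : `|h j.+1 x - h j x| <= Num.sqrt (fine (S x)) * 2^-1 ^+ j.
    have : (D j x <= S x)%E.
      apply: (@le_trans _ _ (\sum_(0 <= i < j.+1) D i x)%E).
        by rewrite big_nat_recr//= leeDr// sume_ge0.
      by apply: nneseries_lim_ge => i _ _; exact: D0.
    rewrite -(fineK Sfin) lee_fin => h1.
    rewrite -(@ler_pXn2r _ 2)// ?nnegrE ?mulr_ge0 ?sqrtr_ge0 ?exprn_ge0//.
    rewrite real_normK ?num_real// exprMn (sqr_sqrtr s0).
    rewrite -exprM mulnC exprM exprVn (_ : 2 ^+ 2 = 4 :> R); last by ring.
    by rewrite exprVn ler_pdivlMr ?exprn_gt0// mulrC.
  have gs : cvgn (series (geometric (Num.sqrt (fine (S x))) 2^-1)).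
    by apply: is_cvg_geometric_series; rewrite ger0_norm ?invr_ge0// invf_lt1// ltr1n.
  have cs : cvgn (series (telescope (h ^~ x))).
    apply: normed_cvg; apply: series_le_cvg gs => j.
    - exact: normr_ge0.
    - by rewrite mulr_ge0 ?sqrtr_ge0 ?exprn_ge0.
    - exact: Db.
  rewrite (_ : (fun _ => _) = fun j => h 0 x + series (telescope (h ^~ x)) j).
    by apply: is_cvgD => //; exact: is_cvg_cst.
  by apply/funext => j; rewrite -eq_sum_telescope.
pose g x := limn (hG ^~ x).
have mhG j : measurable_fun setT (hG j).
  by apply: measurable_funM; [exact: mf|exact: measurable_indic].
have mg : measurable_fun setT g.
  by apply: (measurable_fun_cvg mhG) => x _; exact: chG.
have KK i j : (i <= j)%N -> (K i <= K j)%N.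
  move=> ij; rewrite /K; apply/bigmax_leqP => k _; apply: KN.
  by rewrite (leq_trans _ ij)// -ltnS.
(* Fatou's lemma in [j] for the squares of [f n - hG j] on [G], whose integrals are below
   [8^-1 ^+ J] once [j >= J]. *)
have main J n : (K J <= n)%N ->
    rintegrable mu (fun x => (f n x - g x) ^+ 2) /\
    rI (fun x => (f n x - g x) ^+ 2) <= 8^-1 ^+ J.
  move=> Jn.
  pose F j x := (((f n x - hG j x) * \1_G x) ^+ 2)%:E.
  have mF j : measurable_fun setT (F j).
    apply/measurable_EFinP; apply: measurable_funX; apply: measurable_funM.
      by apply: measurable_funB; [exact: mf|exact: mhG].
    exact: measurable_indic.
  have F0 j x : (0 <= F j x)%E by rewrite lee_fin sqr_ge0.
  have FL x : F j x @[j --> \oo] --> (((f n x - g x) * \1_G x) ^+ 2)%:E.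
    apply: cvg_EFin; first exact: nearW.
    apply: (@cvg_comp _ _ _ _ (fun y : R => y ^+ 2)); last exact: exprn_continuous.
    by apply: cvgMl; apply: cvgB; [exact: cvg_cst|exact: chG].
  have mu0 : measurable_fun setT (fun x => ((f n x - g x) * \1_G x) ^+ 2).
    apply: measurable_funX; apply: measurable_funM; last exact: measurable_indic.
    by apply: measurable_funB; [exact: mf|exact: mg].
  have I0 : (\int[mu]_x (((f n x - g x) * \1_G x) ^+ 2)%:E <= (8^-1 ^+ J)%:E)%E.
    have fat := fatou mu measurableT mF (fun j x _ => F0 j x).
    rewrite (@eq_integral _ _ _ mu _ (fun x => limn_einf (F ^~ x))); last first.
      by move=> x _; rewrite (cvg_limn_einf_sup (FL x)).1.
    apply: (le_trans fat); rewrite limn_einf_lim.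
    apply: lime_le; first exact: is_cvg_einfs.
    exists J => // j /= Jj; apply: (@le_trans _ _ (\int[mu]_x F j x)%E).
      by apply: ereal_inf_lbound; exists j => /=.
    apply: (@le_trans _ _ (\int[mu]_x ((f n x - h j x) ^+ 2)%:E)%E).
      apply: ge0_le_integral => //.
      - apply/measurable_EFinP; apply: measurable_funX; apply: measurable_funB; exact: mf.
      - move=> x _; rewrite lee_fin /hG indicE; case: (x \in G).
          by rewrite !mulr1.
        by rewrite !mulr0 expr0n/= sqr_ge0.
    rewrite (Rint_EFin (if2 n (K j))) lee_fin ltW//.
    apply: hN0; first by apply: leq_trans Jn; exact: KN.
    by apply: KN.
  have iu : rintegrable mu (fun x => ((f n x - g x) * \1_G x) ^+ 2).
    apply/integrableP; split; first exact/measurable_EFinP.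
    rewrite (le_lt_trans _ (ltry (8^-1 ^+ J)))//; apply: le_trans I0.
    by rewrite le_eqVlt; apply/orP; left; apply/eqP/eq_integral => x _; rewrite /= ger0_norm ?sqr_ge0.
  have mfg : measurable_fun setT (fun x => (f n x - g x) ^+ 2).
    by apply: measurable_funX; apply: measurable_funB; [exact: mf|exact: mg].
  have ae : {ae mu, forall x, ((f n x - g x) * \1_G x) ^+ 2 = (f n x - g x) ^+ 2}.
    by apply: filterS aeG => x xG; rewrite indicE mem_set// mulr1.
  split; first exact: rintegrable_ae iu ae.
  by rewrite -(Rint_ae _ _ ae)// -lee_fin -Rint_EFin.
exists g; split => //.
- move=> n; have [im _] := main 0 (K 0) (leqnn _).
  apply: (@le_rintegrable _ _ _ _ _ (fun x => 2 * (f n x - f (K 0) x) ^+ 2 + 2 * (f (K 0) x - g x) ^+ 2)).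
  + by apply: measurable_funX; apply: measurable_funB; [exact: mf|exact: mg].
  + by apply: rintegrableD; apply: rintegrableZ; [exact: if2|exact: im].
  + move=> x; rewrite ger0_norm ?sqr_ge0//.
    set a := f n x; set b := f (K 0) x; set c := g x.
    rewrite -subr_ge0 (_ : _ - _ = (a - b - (b - c)) ^+ 2) ?sqr_ge0//; ring.
- move=> e e0; have q1 : 0 <= (8^-1 : R) < 1 by rewrite invr_ge0 invf_lt1 ?ltr1n// ler0n.
  have [J hJ] := exp_lt_exists q1 e0.
  exists (K J) => n /main[_ h1]; apply: (le_trans h1); exact: ltW.
Qed.

Lemma L2_complete : hcomplete dot setT.
Proof.
move=> u _ cu.
have mRe n : measurable_fun setT (fun x => Re (rp (u n) x)) by case: (rp_cmeasurable (u n)).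
have mIm n : measurable_fun setT (fun x => Im (rp (u n) x)) by case: (rp_cmeasurable (u n)).
have md n m : cmeasurable (fun x => rp (u n) x - rp (u m) x).
  by apply: cmeasurableB; exact: rp_cmeasurable.
have id n m : rintegrable mu (fun x => normc (rp (u n) x - rp (u m) x) ^+ 2).
  apply: rintegrable_ae (rintegrable_rp (u n - u m)) _; first exact: measurable_normc_sqr.
  by apply: filterS (rpB (u n) (u m)) => x ->.
have nd n m : nm (u n - u m) ^+ 2 = rI (fun x => normc (rp (u n) x - rp (u m) x) ^+ 2).
  by apply: L2norm_ae => //; exact: rpB.
have dRe n m x : (Re (rp (u n) x) - Re (rp (u m) x)) ^+ 2 <= normc (rp (u n) x - rp (u m) x) ^+ 2.
  by rewrite normc_sqr ReD ReN lerDl sqr_ge0.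
have dIm n m x : (Im (rp (u n) x) - Im (rp (u m) x)) ^+ 2 <= normc (rp (u n) x - rp (u m) x) ^+ 2.
  by rewrite normc_sqr ImD ImN lerDr sqr_ge0.
have iRe n m : rintegrable mu (fun x => (Re (rp (u n) x) - Re (rp (u m) x)) ^+ 2).
  apply: (le_rintegrable _ (id n m)); first by apply: measurable_funX; exact: measurable_funB.
  by move=> x; rewrite ger0_norm ?sqr_ge0.
have iIm n m : rintegrable mu (fun x => (Im (rp (u n) x) - Im (rp (u m) x)) ^+ 2).
  apply: (le_rintegrable _ (id n m)); first by apply: measurable_funX; exact: measurable_funB.
  by move=> x; rewrite ger0_norm ?sqr_ge0.
have sm e : 0 < e -> exists N, forall n m, (N <= n)%N -> (N <= m)%N -> nm (u n - u m) ^+ 2 < e.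
  move=> e0; have [|N hN] := cu (Num.sqrt e); first by rewrite sqrtr_gt0.
  exists N => n m Nn Nm; rewrite -[e](sqr_sqrtr (ltW e0)) ltr_pXn2r// ?nnegrE ?hnorm_ge0 ?sqrtr_ge0//.
  exact: hN.
have [a [ma ia ha]] := L2_complete_real mRe iRe (fun e e0 => let: ex_intro N hN := sm e e0 in
  ex_intro _ N (fun n m Nn Nm => le_lt_trans (le_Rint (iRe n m) (id n m) (dRe n m))
    (eq_ind _ (fun z => z < e) (hN n m Nn Nm) _ (nd n m)))).
have [b [mb ib hb]] := L2_complete_real mIm iIm (fun e e0 => let: ex_intro N hN := sm e e0 in
  ex_intro _ N (fun n m Nn Nm => le_lt_trans (le_Rint (iIm n m) (id n m) (dIm n m))
    (eq_ind _ (fun z => z < e) (hN n m Nn Nm) _ (nd n m)))).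
pose f x : R[i] := a x +i* b x.
have mf : cmeasurable f by split.
have E n x : normc (rp (u n) x - f x) ^+ 2 =
    (Re (rp (u n) x) - a x) ^+ 2 + (Im (rp (u n) x) - b x) ^+ 2.
  by rewrite normc_sqr ReD ReN ImD ImN.
have f2 : f \in cLfun mu 2%:E.
  apply: (@le_cLfun2 _ _ _ _ _ (fun x => 2 * normc (rp (u 0) x) ^+ 2 +
    2 * ((Re (rp (u 0) x) - a x) ^+ 2 + (Im (rp (u 0) x) - b x) ^+ 2))) => //.
    by apply: rintegrableD; apply: rintegrableZ; [exact: rintegrable_rp|exact: rintegrableD].
  move=> x; rewrite -E !normc_sqr ReD ReN ImD ImN.
  set p := Re _; set q := Re _; set r := Im _; set s := Im _.
  rewrite -subr_ge0 (_ : _ - _ = (2 * q - p) ^+ 2 + (2 * s - r) ^+ 2); last by ring.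
  by rewrite addr_ge0 ?sqr_ge0.
exists (toL2 mu f) => // e e0.
have e2 : 0 < e ^+ 2 / 4 by rewrite divr_gt0// exprn_gt0.
have [N hN] := ha _ e2; have [M hM] := hb _ e2.
exists (maxn N M) => n; rewrite geq_max => /andP[/hN h1 /hM h2].
rewrite -(@ltr_pXn2r _ 2)// ?nnegrE ?hnorm_ge0 ?(ltW e0)//.
rewrite (@L2norm_ae _ (fun x => rp (u n) x - f x)).
- under eq_Rintegral do rewrite E.
  by rewrite RintD//; move: h1 h2 e2; lra.
- by apply: cmeasurableB => //; exact: rp_cmeasurable.
- by apply: filterS2 (rpB (u n) (toL2 mu f)) (rp_toL2 f2) => x -> ->.
Qed.

End L2_space.

(** * Haar measure *)

Section topology.
Context (R : realType).

(** The form in which compactness is used throughout: each point proposes its own neighbourhood.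
    Finite lists ordered by inclusion form a filter, and the near-covering property along it
    produces a list that serves all points. *)
Lemma finite_cover (X : topologicalType) (A : set X) (U : X -> set X) : compact A ->
  (forall x, A x -> nbhs x (U x)) ->
  exists2 s : seq X, (forall y, y \in s -> A y) &
    forall x, A x -> exists2 y, y \in s & U y x.
Proof.
move=> /compact_near_coveringP cA AU.
pose F : set_system (seq X) := filter_from setT (fun s : seq X => [set t : seq X | {subset s <= t}]).
have FF : Filter F.
  apply: filter_fromT_filter; first by exists [::].
  move=> s t; exists (s ++ t) => u /= h; split=> x xs; apply: h; rewrite mem_cat xs ?orbT//.
pose P (t : seq X) x := exists y, [/\ y \in t, A y & U y x].
have [|s _ hs] := cA _ F P FF.
  move=> x Ax; exists (U x, [set t : seq X | {subset [:: x] <= t}]).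
    by split; [exact: AU|exists [:: x]].
  by move=> [y t] [/= Uxy xt]; exists x; split => //; apply: xt; rewrite inE.
exists [seq y <- s | `[< A y >]].
  by move=> y; rewrite mem_filter => /andP[/asboolP].
move=> x Ax; have [//|y [ys Ay Uy]] := hs s _ x Ax.
by exists y => //; rewrite mem_filter ys andbT; exact/asboolP.
Qed.

Lemma cvg_normcP (I : Type) (F : set_system I) (FF : Filter F) (f : I -> R[i]) (l : R[i]) :
  (f x : R[i]^o) @[x --> F] --> (l : R[i]^o) <->
  forall e : R, 0 < e -> \forall x \near F, normc (f x - l) < e.
Proof.
split=> [/cvgrPdist_lt h e e0|h].
  have e0' : (0 : R[i]) < e%:C by rewrite ltcR.
  by apply: filterS (h _ e0') => x; rewrite normr_normc ltcR normc_distC.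
apply/cvgrPdist_lt => e e0; have eE := ge0_complexE (ltW e0).
have e1 : 0 < Re e by rewrite -ltcR -eE.
by apply: filterS (h _ e1) => x hx; rewrite eE normr_normc ltcR normc_distC.
Qed.

Lemma cvg_ReIm (I : Type) (F : set_system I) (FF : Filter F) (f : I -> R[i]) (l : R[i]) :
  (f x : R[i]^o) @[x --> F] --> (l : R[i]^o) ->
  (Re (f x) @[x --> F] --> Re l) /\ (Im (f x) @[x --> F] --> Im l).
Proof.
move=> /cvg_normcP h; split; apply/cvgrPdist_lt => e /h; apply: filterS => x;
  apply: le_lt_trans; rewrite distrC.
- by have := Re_le_normc (f x - l); rewrite ReD ReN.
- by have := Im_le_normc (f x - l); rewrite ImD ImN.
Qed.

End topology.

Section haar.
Context (R : realType) (X : PreTopologicalZmodule.type) (hausdorffX : hausdorff_space X).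
Context (mu : {measure set (borel X) -> \bar R}) (hmu : haar_measure mu).
Implicit Types (A U : set (borel X)).
Local Notation rI h := (Rintegral mu setT h).

Lemma open_borel (U : set X) : open U -> measurable (U : set (borel X)).
Proof. by move=> oU; apply: sub_gen_smallest. Qed.

Lemma closed_borel (U : set X) : closed U -> measurable (U : set (borel X)).
Proof. by move=> cU; rewrite -[U]setCK; apply: measurableC; apply: open_borel; exact: closed_openC. Qed.

Lemma compact_borel (U : set X) : compact U -> measurable (U : set (borel X)).
Proof. by move=> cU; apply: closed_borel; exact: compact_closed. Qed.

Lemma continuous_borel (f : X -> R) : continuous f -> measurable_fun setT (f : borel X -> R).
Proof.
move=> /continuousP cf; apply: (measurability _ (RGenOpens.measurableE R)).
move=> _ [_ [a [b ->] <-]]; rewrite setTI; apply: open_borel.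
exact/cf/interval_open.
Qed.

Lemma continuous_cborel (f : X -> R[i]) : continuous (f : X -> R[i]^o) ->
  cmeasurable (f : borel X -> R[i]).
Proof.
by move=> cf; split; apply: continuous_borel => x; have [] := cvg_ReIm _ (cf x).
Qed.

Lemma haar_compact (K : set X) : compact K -> (mu K < +oo)%E.
Proof. by case: hmu => _ h _ _ _; exact: h. Qed.

Lemma rintegrable_indic A : measurable A -> (mu A < +oo)%E -> rintegrable mu (\1_A : _ -> R).
Proof. move=> mA fA; apply/integrableP; split; first by apply/measurable_EFinP; exact: measurable_indic.
have -> : (\int[mu]_x `|(EFin \o \1_A) x|)%E = (\int[mu]_x (\1_A x)%:E)%E.
  by apply: eq_integral => x _; rewrite /= ger0_norm.
by rewrite integral_indic// setIT. Qed.

Lemma Rint_indic A : measurable A -> rI (\1_A) = fine (mu A).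
Proof. by move=> mA; rewrite /Rintegral integral_indic// setIT. Qed.

Lemma le_measure_borel A B : measurable A -> measurable (B : set (borel X)) -> A `<=` B ->
  (mu A <= mu B)%E.
Proof. by move=> mA mB AB; apply: (le_measure mu) => //; exact/mem_set. Qed.

Lemma outer_regular A (e : R) : measurable A -> (mu A < +oo)%E -> 0 < e ->
  exists U : set X, [/\ open U, A `<=` U & (mu (U `\` A) < e%:E)%E].
Proof.
move=> mA fA e0; case: hmu => _ _ /(_ A mA) hA _ _.
have fA' : mu A \is a fin_num by rewrite ge0_fin_numE.
have := @lb_ereal_inf_adherent _ [set mu U | U in [set U : set X | open U /\ A `<=` U]] e e0.
rewrite -hA => /(_ fA')[_ [U [oU AU] <-]] hU; exists U; split => //.
have mU := open_borel oU.
rewrite measureD//; last by rewrite (lt_trans hU)// -(fineK fA') -EFinD ltry.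
rewrite setIidr// lteBlDr//.
by rewrite addeC.
Qed.

Lemma measureU_lt A (B : set (borel X)) (a b : R) : measurable A -> measurable B ->
  (mu A < a%:E)%E -> (mu B < b%:E)%E -> (mu (A `|` B) < (a + b)%:E)%E.
Proof.
move=> mA mB Aa Bb; apply: (le_lt_trans (measureU2 mu mA mB)).
by rewrite EFinD; apply: lteD.
Qed.

(** Haar measure is inner regular on open sets by definition. Take [U] open around [A], [V] open
    around [U \ A] with little measure, and [K] compact filling most of [U]; then [K \ V] is compact
    and lies in [A]. *)
Lemma inner_regular A (e : R) : measurable A -> (mu A < +oo)%E -> 0 < e ->
  exists K : set X, [/\ compact K, K `<=` A & (mu (A `\` K) < e%:E)%E].
Proof.
move=> mA fA e0; have e2 : 0 < e / 2 by rewrite divr_gt0.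
have e4 : 0 < e / 4 by rewrite divr_gt0.
have [U [oU AU hU]] := outer_regular mA fA e4.
have mU := open_borel oU.
have mUA : measurable (U `\` A : set (borel X)) by exact: measurableD.
have fUA : (mu (U `\` A) < +oo)%E by rewrite (lt_trans hU)// ltry.
have fU : (mu U < +oo)%E.
  rewrite -(setDUK AU) (@lt_trans _ _ ((fine (mu A) + 1) + e / 4)%:E) ?ltry//.
  apply: measureU_lt => //; rewrite -[ltLHS]fineK ?ge0_fin_numE// lte_fin.
  by rewrite ltrDl.
have [V [oV UAV hV]] := outer_regular mUA fUA e4.
have mV := open_borel oV.
have hV2 : (mu V < (e / 2)%:E)%E.
  rewrite -(setDUK UAV) (_ : e / 2 = e / 4 + e / 4); last by field.
  by apply: measureU_lt => //; exact: measurableD.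
case: (hmu) => _ _ _ /(_ U oU) hUK _.
have fU' : mu U \is a fin_num by rewrite ge0_fin_numE.
have := @ub_ereal_sup_adherent _ [set mu K | K in [set K : set X | compact K /\ K `<=` U]] _ e2.
rewrite -hUK => /(_ fU')[_ [K [cK KU] <-]] hK.
have clK := compact_closed hausdorffX cK.
exists (K `&` ~` V); split.
- apply: (subclosed_compact _ cK); last exact: subIsetl.
  by apply: closedI => //; exact: open_closedC.
- by move=> x [Kx nVx]; apply: contrapT => nAx; apply: nVx; apply: UAV; split => //; exact: KU.
- have mK := compact_borel cK.
  have fK : mu K \is a fin_num by rewrite ge0_fin_numE// haar_compact.
  apply: (@le_lt_trans _ _ (mu ((U `\` K) `|` V))).
    apply: le_measure_borel.
    + by apply: measurableD => //; apply: measurableI => //; exact: measurableC.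
    + by apply: measurableU => //; exact: measurableD.
    + move=> x [Ax nx]; have [Vx|nVx] := pselect (V x); [by right|left].
      by split; [exact: AU|move=> Kx; apply: nx].
  have hUK2 : (mu (U `\` K) < (e / 2)%:E)%E.
    rewrite measureD// setIidr// lteBlDr// addeC -lteBlDr//.
  by rewrite [e]splitr; apply: measureU_lt => //; exact: measurableD.
Qed.

(** The substitute for sigma-finiteness: on any measurable set, an integrable function carries all
    but [e] of its mass on a compact subset. Every later approximation argument starts here. *)
Lemma L1_regular (h : borel X -> R) A (e : R) : rintegrable mu h -> (forall x, 0 <= h x) ->
  measurable A -> 0 < e ->
  exists K : set X, [/\ compact K, K `<=` A & rI (fun x => h x * \1_(A `\` K) x) < e].
Proof.
move=> ih h0 mA e0.
have mh := rintegrable_measurable ih.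
(* The lower cutoff makes [B n] of finite measure by Markov's inequality; the upper one makes [h]
   bounded there, so that a small set has small integral. *)
pose B n : set (borel X) := A `&` (h @^-1` `]n.+1%:R^-1, n.+1%:R[%classic).
have mB n : measurable (B n).
  by apply: measurableI => //; rewrite -[X in measurable X]setTI; apply: mh.
have fB n : (mu (B n) < +oo)%E.
  have n0 : 0 < n.+1%:R^-1 :> R by rewrite invr_gt0.
  have : (n.+1%:R^-1%:E * mu (B n) <= (rI h)%:E)%E.
    rewrite -Rint_EFin// -[X in (_ * mu X)%E]setIT -integral_indic// -ge0_integralZl_EFin//; last first.
      by apply/measurable_EFinP; exact: measurable_indic.
    apply: ge0_le_integral => //.
    - by apply/measurable_EFinP; apply: measurable_funM; [exact: measurable_cst|exact: measurable_indic].
    - exact/measurable_EFinP.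
    - move=> x _; rewrite lee_fin indicE; case: (boolP (x \in B n)) => [/set_mem|_]; last by rewrite mulr0.
      by rewrite mulr1 => -[_ /=]; rewrite in_itv/= => /andP[/ltW].
  move=> h1; rewrite ltNge; apply/negP; rewrite leye_eq => /eqP E.
  by move: h1; rewrite E gt0_muley ?lte_fin.
have [_ cvI] : rintegrable mu (fun=> 0) /\ rI (fun x => h x * \1_(A `\` B n) x) @[n --> \oo] --> rI (fun=> 0).
  apply: (dominated_Rint _ _ ih).
  - by move=> n; apply: measurable_funM => //; apply: measurable_indic; exact: measurableD.
  - move=> x; apply/cvgrPdist_lt => eps eps0.
    have [hx0|hx] := eqVneq (h x) 0; first by apply: nearW => n; rewrite hx0 mul0r subrr normr0.
    have hp : 0 < h x by rewrite lt_neqAle eq_sym hx h0.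
    have [d' d0' dl'] := null_seq R.
    exists (maxn (Num.bound (h x)^-1) (Num.bound (h x))) => // n /=; rewrite geq_max => /andP[n1 n2].
    rewrite indicE memNset ?mulr0 ?subrr ?normr0// => -[Ax]; apply; split => //=.
    rewrite in_itv/=; apply/andP; split.
      rewrite invf_plt ?posrE//; apply: (lt_le_trans (archi_boundP _)); first by rewrite invr_ge0.
      by rewrite ler_nat ltnW.
    apply: (lt_le_trans (archi_boundP _)) => //; by rewrite ler_nat ltnW.
  - move=> n x; rewrite normrM !ger0_norm// ?ler_piMr//.
rewrite Rint0 in cvI.
have e2 : 0 < e / 2 by rewrite divr_gt0.
have /cvgrPdist_lt/(_ _ e2)[n _ /(_ n (leqnn _))] := cvI.
rewrite sub0r normrN => /(le_lt_trans (ler_norm _)) hn.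
(* On [B n] the function is below [n.+1], so the part of [B n] outside [K] contributes at most
   [e / 2]. *)
have e3 : 0 < e / 2 / n.+1%:R by rewrite !divr_gt0.
have [K [cK KB hK]] := inner_regular (mB n) (fB n) e3.
have mK := compact_borel cK.
have mBK : measurable (B n `\` K : set (borel X)) by exact: measurableD.
have fBK : (mu (B n `\` K) < +oo)%E by rewrite (lt_trans hK)// ltry.
exists K; split => //; first by move=> x /KB[].
apply: (@le_lt_trans _ _ (rI (fun x => h x * \1_(A `\` B n) x + n.+1%:R * \1_(B n `\` K) x))).
  apply: le_Rint.
  - apply: (le_rintegrable _ ih).
      by apply: measurable_funM => //; apply: measurable_indic; exact: measurableD.
    by move=> x; rewrite normrM !ger0_norm// ?ler_piMr//.
  - apply: rintegrableD.
      apply: (le_rintegrable _ ih).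
        by apply: measurable_funM => //; apply: measurable_indic; exact: measurableD.
      by move=> x; rewrite normrM !ger0_norm// ?ler_piMr//.
    by apply: rintegrableZ; exact: rintegrable_indic.
  - move=> x; rewrite !indicE.
    have [AKx|nAKx] := pselect ((A `\` K) x); last first.
      by rewrite (memNset nAKx) mulr0 addr_ge0// mulr_ge0// ler0n.
    rewrite (mem_set AKx) mulr1; case: AKx => Ax nKx.
    have [Bx|nBx] := pselect (B n x).
      rewrite memNset ?mulr0 ?add0r; last by case.
      rewrite mem_set ?mulr1; last by split.
      by case: Bx => _ /=; rewrite in_itv/= => /andP[_ /ltW].
    rewrite mem_set ?mulr1; last by split.
    by rewrite lerDl mulr_ge0// ler0n.
rewrite RintD; last 2 first.
- apply: (le_rintegrable _ ih).
    by apply: measurable_funM => //; apply: measurable_indic; exact: measurableD.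
  move=> x; rewrite normrM !ger0_norm// ?ler_piMr//.
- by apply: rintegrableZ; exact: rintegrable_indic.
rewrite RintZ ?rintegrable_indic// Rint_indic//.
have : fine (mu (B n `\` K)) < e / 2 / n.+1%:R by rewrite -lte_fin fineK// ge0_fin_numE.
rewrite ltr_pdivlMr// [_ * n.+1%:R]mulrC; move: hn; lra.
Qed.

(** * Translation invariance *)

Context (translation : forall a : X, continuous (fun x : X => x + a)).

Lemma measurable_translation (a : X) :
  measurable_fun setT ((fun x : X => x + a) : borel X -> borel X).
Proof.
apply: (@measurability _ _ (borel X) (borel X) setT _ (open : set (set X))) => //.
move=> _ [U oU <-]; rewrite setTI; apply: open_borel.
by have /continuousP := translation (a := a); apply.
Qed.

Lemma pushforward_translation (a : X) A : measurable A ->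
  pushforward mu ((fun x : X => x + a) : borel X -> borel X) A = mu A.
Proof.
move=> mA; case: hmu => _ _ _ _ /(_ (- a) A mA) <-; rewrite /pushforward; congr (mu _).
apply/seteqP; split=> x /=; first by move=> Ax; exists (x + a) => //; rewrite addrK.
by move=> [y Ay <-]; rewrite subrK.
Qed.

Lemma measurable_shift (h : borel X -> R) (a : X) : measurable_fun setT h ->
  measurable_fun setT (fun x : borel X => h ((x : X) + a)).
Proof. by move=> mh; apply: (measurableT_comp mh); exact: measurable_translation. Qed.

Lemma rintegrable_shift (h : borel X -> R) (a : X) : rintegrable mu h ->
  rintegrable mu (fun x : borel X => h ((x : X) + a)).
Proof.
move=> /integrableP[/measurable_EFinP mh ih]; apply/integrableP; split.
  by apply/measurable_EFinP; exact: measurable_shift.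
have ma : measurable_fun setT (fun x => `|(h x)%:E|%E).
  by apply: measurableT_comp => //; exact/measurable_EFinP.
have H := @ge0_integral_pushforward _ _ _ _ _ _ (measurable_translation a) mu setT _
  measurableT ma (fun x _ => abse_ge0 _).
rewrite (eq_measure_integral mu) in H; last first;
  [by move=> ? A mA _; exact: pushforward_translation|exact: measurable_translation|].
by rewrite -[X in (X < _)%E]H.
Qed.

Lemma Rint_shift (h : borel X -> R) (a : X) : rintegrable mu h ->
  rI (fun x : borel X => h ((x : X) + a)) = rI h.
Proof.
move=> ih; have mh := rintegrable_measurable ih.
have me : measurable_fun setT (EFin \o h) by exact/measurable_EFinP.
have H := @integral_pushforward _ _ _ _ _ _ (measurable_translation a) mu setT _
  me (rintegrable_shift a ih) measurableT.
rewrite (eq_measure_integral mu) in H; last first;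
  [by move=> ? A mA _; exact: pushforward_translation|exact: measurable_translation|].
by congr fine; rewrite -[LHS]H.
Qed.

Lemma cmeasurable_shift (f : borel X -> R[i]) (a : X) : cmeasurable f ->
  cmeasurable (fun x : borel X => f ((x : X) + a)).
Proof. by move=> [fr fi]; split; [exact: (measurable_shift a fr)|exact: (measurable_shift a fi)]. Qed.

Lemma cintegrable_shift (f : borel X -> R[i]) (a : X) : cintegrable mu f ->
  cintegrable mu (fun x : borel X => f ((x : X) + a)).
Proof. by move=> [fr fi]; split; [exact: (rintegrable_shift a fr)|exact: (rintegrable_shift a fi)]. Qed.

Lemma cint_shift (f : borel X -> R[i]) (a : X) : cintegrable mu f ->
  cintegral mu (fun x : borel X => f ((x : X) + a)) = cintegral mu f.
Proof.
move=> [fr fi]; congr (_ +i* _); [exact: (Rint_shift a fr)|exact: (Rint_shift a fi)].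
Qed.

Lemma cLfun2_shift (f : borel X -> R[i]) (a : X) : f \in cLfun mu 2%:E ->
  (fun x : borel X => f ((x : X) + a)) \in cLfun mu 2%:E.
Proof.
move=> /cLfun2P[mf f2]; apply/cLfun2P; split; first exact: cmeasurable_shift.
exact: (rintegrable_shift a f2).
Qed.

(** Finitely many translates of [U] cover any compact set. Were [U] null, all compact sets would be
    null, and so would the whole group, by inner regularity on the open set [setT]. *)
Lemma haar_open_gt0 (U : set X) : open U -> U !=set0 -> (0 < mu U)%E.
Proof.
move=> oU [u Uu]; rewrite lt_neqAle measure_ge0 andbT eq_sym; apply/eqP => U0.
case: (hmu) => mT _ _ /(_ setT openT) hT _.
have : exists2 K : set X, compact K & (0 < mu K)%E.
  apply: contrapT => nK; move: mT; rewrite hT ltNge => /negP; apply.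
  apply: ub_ereal_sup => _ [K [cK _] <-]; rewrite leNgt; apply/negP => K0.
  by apply: nK; exists K.
move=> [K cK]; apply/negP; rewrite -leNgt.
have [|s _ hs] := @finite_cover X K (fun x => [set y | U (y + (u - x))]) cK.
  move=> x _; apply: translation; rewrite addrCA subrr addr0.
  exact: open_nbhs_nbhs.
have mV x : measurable ([set y | U (y + (u - x))] : set (borel X)).
  by apply: open_borel; have /continuousP := @translation (u - x); apply.
have V0 x : mu [set y | U (y + (u - x))] = 0.
  by rewrite -[RHS]U0 -(pushforward_translation (u - x) (open_borel oU)).
apply: (@le_trans _ _ (mu (\big[setU/set0]_(x <- s) [set y | U (y + (u - x))]))).
  apply: le_measure_borel; first exact: compact_borel.
    by apply: bigsetU_measurable => x _.
  by move=> x /hs[y ys Uy]; rewrite -bigcup_seq; exists y.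
elim: s {hs} => [|x s IH]; first by rewrite big_nil measure0.
rewrite big_cons; apply: (le_trans (measureU2 _ _ _)) => //.
  by apply: bigsetU_measurable => y _.
by rewrite -[leRHS]add0e; apply: leeD => //; rewrite le_eqVlt; apply/orP; left; apply/eqP; exact: V0.
Qed.

End haar.

(** * The dual group *)

Section dual_topology.
Context (R : realType) (G : topologicalZmodType)
  (hausdorffG : hausdorff_space G) (locally_compactG : locally_compact [set: G]).
Local Notation Gd := (dual R G).
Implicit Types (xi eta : Gd) (x y : G).

Lemma normc_char xi x : normc (xi x) = 1.
Proof. by have := char_norm xi x; rewrite normr_normc => /complexI. Qed.

Lemma char0 xi : xi 0 = 1.
Proof.
have : xi 0 != 0 by rewrite -normr_eq0 char_norm oner_eq0.
by move=> /mulfI; apply; rewrite -charD addr0 mulr1.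
Qed.

Lemma charN xi x : xi (- x) = (xi x)^*.
Proof.
have h : xi x * xi (- x) = xi x * (xi x)^*.
  by rewrite -charD subrr char0 mulJ normc_char expr1n.
have : xi x != 0 by rewrite -normr_eq0 char_norm oner_eq0.
by move=> /mulfI; apply.
Qed.

Lemma charB xi x y : xi (x - y) = xi x * (xi y)^*.
Proof. by rewrite charD charN. Qed.

Lemma dualDE xi eta x : (xi + eta) x = xi x * eta x. Proof. by []. Qed.
Lemma nbhs_dualP xi (A : set Gd) : nbhs xi A <->
  exists (K : set G) (e : R), [/\ compact K, 0 < e &
    forall eta, (forall x, K x -> normc (eta x - xi x) < e) -> A eta].
Proof.
have cxi : continuous (xi : G -> R[i]^o) by exact: char_continuous.
split.
- rewrite nbhsE => -[B [[Q oQ <-] Qxi] BA].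
  pose D := [set Ke : set G * R | compact Ke.1 /\ 0 < Ke.2].
  pose F : set_system (G -> R[i]^o) := filter_from D
    (fun Ke => [set g | forall x, Ke.1 x -> normc (g x - xi x) < Ke.2]).
  have FF : Filter F.
    apply: filter_from_filter.
      by exists (set0, 1); split => //=; exact: compact0.
    move=> [K e] [L f] [/= cK e0] [/= cL f0]; exists (K `|` L, Num.min e f).
      by split=> /=; [exact: compactU|rewrite lt_min e0].
    move=> g /= hg; split=> x Kx; have := hg x; rewrite lt_min.
      by move=> /(_ (or_introl Kx))/andP[].
    by move=> /(_ (or_intror Kx))/andP[].
  have : {compact-open, F --> (xi : G -> R[i]^o)}.
    apply/(@compact_open_fam_compactP G (R[i]^o : puniformType) xi F cxi FF)/fam_cvgP => K cK.
    move=> P /uniform_nbhs[E [+ EP]]; rewrite -entourage_ballE => -[e /= e0 eE].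
    have eR := ge0_complexE (ltW e0).
    exists (K, Re e); first by split => //=; rewrite -ltcR -eR.
    move=> g /= hg; apply: EP => y Ky; apply: eE; rewrite /= /ball/=.
    by rewrite eR normr_normc ltcR normc_distC; exact: hg.
  move=> /(_ Q (open_nbhs_nbhs (conj oQ Qxi)))[[K e] [/= cK e0] KQ].
  exists K, e; split => // eta h; apply: BA; apply: KQ => /= x; exact: h.
- move=> [K [e [cK e0 KA]]].
  have e0' : (0 : R[i]) < e%:C by rewrite ltcR.
  pose F : set_system (G -> R[i]^o) := nbhs (xi : {compact-open, G -> R[i]^o}).
  have FF : Filter F := @nbhs_filter {compact-open, G -> R[i]^o} (xi : {compact-open, G -> R[i]^o}).
  have Fxi : {compact-open, F --> (xi : G -> R[i]^o)} by [].
  have /(@compact_open_fam_compactP G (R[i]^o : puniformType) xi F cxi FF) fc := Fxi.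
  have nK := @fam_nbhs _ _ compact K _ (xi : {family compact, G -> R[i]^o})
    (entourage_ball _ (PosNum e0')) cK.
  have := @initial_continuous _ _ (fun eta : Gd => (eta : {compact-open, G -> R[i]^o})) xi _ (fc _ nK).
  move=> nxi; apply: (filterS _ (nxi : nbhs xi _)) => eta /= h; apply: KA => x Kx; have := h x Kx.
  by rewrite /ball/= normr_normc ltcR normc_distC.
Qed.

Lemma hausdorff_dual : hausdorff_space Gd.
Proof.
move=> xi eta cl; apply: dual_eq; apply/funext => x; apply: subr0_eq.
apply: normc_eq0_eps => e e0; have e2 : 0 < e / 2 by rewrite divr_gt0.
have nb (z : Gd) : nbhs z [set y : Gd | normc (y x - z x) < e / 2].
  apply/nbhs_dualP; exists [set x], (e / 2); split => //; first exact: compact_set1.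
  by move=> y /(_ x erefl).
have [y [/= h1 h2]] := cl _ _ (nb xi) (nb eta).
have := le_normcD (xi x - y x) (y x - eta x); rewrite addrA subrK normc_distC.
by move: h1 h2; lra.
Qed.

Lemma translation_dual (a : Gd) : continuous (fun xi : Gd => xi + a).
Proof.
move=> xi A /nbhs_dualP[K [e [cK e0 KA]]]; apply/nbhs_dualP; exists K, e; split => // eta h.
apply: KA => x Kx; rewrite !dualDE -mulrBl Normc.normcM normc_char mulr1; exact: h.
Qed.

Lemma translation_group (a : G) : continuous (fun x : G => x + a).
Proof.
move=> x; apply: (@cvg_comp _ _ _ (fun x => (x, a)) (fun z => z.1 + z.2) _ (nbhs (x, a))).
  by apply: cvg_pair; [exact: cvg_id|exact: cvg_cst].
exact: (@add_continuous G (x, a)).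
Qed.

Lemma eval_dual_continuous (x : G) : continuous (fun xi : Gd => xi x : R[i]^o).
Proof.
move=> xi; apply/(cvg_normcP (nbhs_filter xi)) => e e0; apply/nbhs_dualP; exists [set x], e; split => //.
  exact: compact_set1.
by move=> eta /(_ x erefl).
Qed.

(* A compact set of characters is equicontinuous, since it is covered by
   finitely many compact-open neighbourhoods of its points on a compact
   neighbourhood of [y]. *)
Lemma equicontinuous_dual (L : set Gd) (y : G) (e : R) : compact L -> 0 < e ->
  \forall x \near y, forall xi, L xi -> normc (xi x - xi y) < e.
Proof.
move=> cL e0; have e3 : 0 < e / 3 by rewrite divr_gt0.
have [//|K yK' [cK _]] := @locally_compactG y; rewrite withinET in yK'.
have [|s sL hs] := @finite_cover Gd L (fun xi => [set eta | forall x, K x -> normc (eta x - xi x) < e / 3]) cL.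
  by move=> xi _; apply/nbhs_dualP; exists K, (e / 3); split.
have near_s : \forall x \near y, forall xi, xi \in s -> normc (xi x - xi y) < e / 3.
  elim: s {sL hs} => [|xi s IH]; first exact: nearW.
  have /cvg_normcP/(_ _ e3) h : (xi x : R[i]^o) @[x --> y] --> (xi y : R[i]^o).
    exact: char_continuous.
  apply: filterS2 h IH => x h1 h2 eta; rewrite inE => /orP[/eqP->//|]; exact: h2.
have yK := nbhs_singleton yK'.
apply: filterS2 near_s yK' => x hx Kx xi /hs[eta es /= h].
have h1 := hx _ es; have h2 := h x Kx; have h3 := h y yK.
have := le_normcD (xi x - eta x) (eta x - xi y).
have := le_normcD (eta x - eta y) (eta y - xi y).
rewrite !addrA !subrK (normc_distC (eta y)); lra.
Qed.

End dual_topology.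

(** * Fourier integrals of integrable functions *)

Section fourier_L1.
Context (R : realType) (G : topologicalZmodType)
  (hausdorffG : hausdorff_space G) (locally_compactG : locally_compact [set: G])
  (m : {measure set (borel G) -> \bar R}) (haar_m : haar_measure m)
  (mh : {measure set (borel (dual R G)) -> \bar R}) (haar_mh : haar_measure mh).
Local Notation Gd := (dual R G).
Local Notation bG := (borel G).
Local Notation bD := (borel Gd).
Local Notation rI mu h := (Rintegral mu setT h).
Local Notation cI := cintegral.
Local Notation fourier := (fourier m).
Implicit Types (u : bG -> R[i]) (w : bD -> R[i]).

Lemma cmeasurable_char (xi : Gd) : cmeasurable (fun x : bG => xi (x : G)).
Proof. apply: (continuous_cborel (f := fun x : G => xi x)); exact: char_continuous. Qed.

Lemma cmeasurable_eval (x : G) : cmeasurable (fun xi : bD => (xi : Gd) x).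
Proof. apply: (continuous_cborel (f := fun xi : Gd => xi x)); exact: eval_dual_continuous. Qed.

Lemma cintegrable_char u (xi : Gd) : cintegrable m u ->
  cintegrable m (fun x : bG => u x * (xi (x : G))^*).
Proof.
move=> iu; apply: (cintegrableM_bounded iu (C := 1)).
- exact/cmeasurableJ/cmeasurable_char.
- by move=> x; rewrite normcJ normc_char.
Qed.

Lemma cintegrable_eval w (x : G) : cintegrable mh w ->
  cintegrable mh (fun xi : bD => w xi * (xi : Gd) x).
Proof.
move=> iw; apply: (cintegrableM_bounded iw (C := 1)); first exact: cmeasurable_eval.
by move=> xi; rewrite normc_char.
Qed.

(** The integral of the inversion formula, for an integrable function on the dual group. *)
Definition cofourier w (x : G) : R[i] := cI mh (fun xi : bD => w xi * (xi : Gd) x).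

Lemma normc_fourier u (xi : Gd) : cintegrable m u ->
  normc (fourier u xi) <= rI m (fun x => normc (u x)).
Proof.
move=> iu; apply: (le_trans (normc_cint (cintegrable_char xi iu))).
apply: le_Rint; [exact/rintegrable_normc/cintegrable_char|exact: rintegrable_normc|].
by move=> x; rewrite Normc.normcM normcJ normc_char mulr1.
Qed.

Lemma normc_cofourier w (x : G) : cintegrable mh w ->
  normc (cofourier w x) <= rI mh (fun xi => normc (w xi)).
Proof.
move=> iw; apply: (le_trans (normc_cint (cintegrable_eval x iw))).
apply: le_Rint; [exact/rintegrable_normc/cintegrable_eval|exact: rintegrable_normc|].
by move=> xi; rewrite Normc.normcM normc_char mulr1.
Qed.

(** The common estimate behind the continuity of both transforms and the local form of Fubini's
    theorem: the factors differ by at most [d] on [K], and trivially by at most 2 off [K], where [f]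
    has mass at most [e]. *)
Lemma cint_unimodular_dist (X : PreTopologicalZmodule.type)
  (mu : {measure set (borel X) -> \bar R}) (f p q : borel X -> R[i]) (K : set (borel X)) (d e : R) :
  cintegrable mu f -> cmeasurable p -> cmeasurable q ->
  (forall x, normc (p x) <= 1) -> (forall x, normc (q x) <= 1) ->
  measurable K -> 0 <= d ->
  (forall x, K x -> normc (p x - q x) <= d) ->
  rI mu (fun x => normc (f x) * \1_(setT `\` K) x) <= e ->
  normc (cI mu (fun x => f x * p x) - cI mu (fun x => f x * q x)) <=
    d * rI mu (fun x => normc (f x)) + 2 * e.
Proof.
move=> iff mp mq p1 q1 mK d0 pq fe.
have ifp := cintegrableM_bounded iff mp p1; have ifq := cintegrableM_bounded iff mq q1.
have nf := rintegrable_normc iff.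
have iK : rintegrable mu (fun x => normc (f x) * \1_(setT `\` K) x).
  apply: (le_rintegrable _ nf).
    apply: measurable_funM; first exact: rintegrable_measurable nf.
    by apply: measurable_indic; exact: measurableD.
  move=> x; rewrite normrM !ger0_norm ?normc_ge0// ler_piMr ?normc_ge0//.
rewrite -cintB//; apply: (le_trans (normc_cint (cintegrableB ifp ifq))).
apply: (@le_trans _ _ (rI mu (fun x => d * normc (f x) + 2 * (normc (f x) * \1_(setT `\` K) x)))).
  apply: le_Rint; first exact/rintegrable_normc/cintegrableB.
    by apply: rintegrableD; exact: rintegrableZ.
  move=> x; rewrite -mulrBr Normc.normcM indicE.
  have [Kx|nKx] := pselect (K x).
    rewrite memNset ?mulr0 ?addr0; last by case.
    by rewrite mulrC; apply: ler_wpM2r; [exact: normc_ge0|exact: pq].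
  rewrite mem_set ?mulr1//.
  have : normc (p x - q x) <= 2.
    apply: (le_trans (le_normcD _ _)); rewrite normcN.
    by rewrite -[2]/(1 + 1) lerD.
  have := normc_ge0 (f x); nra.
rewrite RintD; [|exact: rintegrableZ|exact: rintegrableZ].
by rewrite !RintZ// lerD2l; apply: ler_wpM2l.
Qed.

Lemma fourier_continuous u : cintegrable m u -> continuous (fun xi : Gd => fourier u xi : R[i]^o).
Proof.
move=> iu xi; apply/(cvg_normcP (nbhs_filter xi)) => e e0.
pose M := rI m (fun x => normc (u x)) + 1.
have M0 : 0 < M by rewrite ltr_wpDl// Rint_ge0// => x; exact: normc_ge0.
have e4 : 0 < e / 4 by rewrite divr_gt0.
have [K [cK _ hK]] := L1_regular hausdorffG haar_m (rintegrable_normc iu)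
  (fun x => normc_ge0 _) measurableT e4.
have d0 : 0 < e / 2 / M by rewrite !divr_gt0.
apply/nbhs_dualP; exists K, (e / 2 / M); split => // eta h /=.
apply: (@le_lt_trans _ _ (e / 2 / M * rI m (fun x => normc (u x)) + 2 * (e / 4))).
  apply: (cint_unimodular_dist (K := K) iu _ _ _ _ _ (ltW d0) _ (ltW hK)).
  - exact/cmeasurableJ/cmeasurable_char.
  - exact/cmeasurableJ/cmeasurable_char.
  - by move=> x; rewrite normcJ normc_char.
  - by move=> x; rewrite normcJ normc_char.
  - exact: compact_borel.
  - by move=> x /h /ltW; rewrite -rmorphB normcJ.
have MM : e / 2 / M * M = e / 2 by rewrite divfK// gt_eqF.
move: MM d0; rewrite {2}/M mulrDr mulr1; lra.
Qed.

Lemma cmeasurable_fourier u : cintegrable m u -> cmeasurable (fourier u : bD -> R[i]).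
Proof. by move=> iu; apply: continuous_cborel; exact: fourier_continuous. Qed.

(** The characters in a compact set that carries most of [w] are equicontinuous at [x]; this is
    where local compactness of [G] enters. *)
Lemma cofourier_continuous w : cintegrable mh w -> continuous (cofourier w : G -> R[i]^o).
Proof.
move=> iw x; apply/(cvg_normcP (nbhs_filter x)) => e e0.
pose M := rI mh (fun xi => normc (w xi)) + 1.
have M0 : 0 < M by rewrite ltr_wpDl// Rint_ge0// => xi; exact: normc_ge0.
have e4 : 0 < e / 4 by rewrite divr_gt0.
have [L [cL _ hL]] := L1_regular (@hausdorff_dual _ _) haar_mh (rintegrable_normc iw)
  (fun x => normc_ge0 _) measurableT e4.
have d0 : 0 < e / 2 / M by rewrite !divr_gt0.
have := equicontinuous_dual locally_compactG x cL d0; apply: filterS => y hy.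
apply: (@le_lt_trans _ _ (e / 2 / M * rI mh (fun x => normc (w x)) + 2 * (e / 4))).
  apply: (cint_unimodular_dist (K := L) iw _ _ _ _ _ (ltW d0) _ (ltW hL)).
  - exact: cmeasurable_eval.
  - exact: cmeasurable_eval.
  - by move=> xi; rewrite normc_char.
  - by move=> xi; rewrite normc_char.
  - by apply: compact_borel => //; exact: hausdorff_dual.
  - by move=> xi /hy /ltW.
have MM : e / 2 / M * M = e / 2 by rewrite divfK// gt_eqF.
move: MM d0; rewrite {2}/M mulrDr mulr1; lra.
Qed.

Lemma cintegrable_fourier_mul u w : cintegrable m u -> cintegrable mh w ->
  cintegrable mh (fun xi => w xi * fourier u xi).
Proof.
move=> iu iw; apply: (cintegrableM_bounded iw) => [|xi]; first exact: cmeasurable_fourier.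
exact: normc_fourier.
Qed.

Lemma cmeasurable_cofourierN w : cintegrable mh w ->
  cmeasurable (fun x : bG => cofourier w (- (x : G))).
Proof.
move=> iw; apply: (continuous_cborel (f := fun x : G => cofourier w (- x))).
move=> x; apply: (@cvg_comp _ _ _ (fun x => - x) (cofourier w) _ (nbhs (- x))).
  exact: opp_continuous.
exact: cofourier_continuous.
Qed.

Lemma cintegrable_cofourier_mul u w : cintegrable m u -> cintegrable mh w ->
  cintegrable m (fun x : bG => u x * cofourier w (- (x : G))).
Proof.
move=> iu iw; apply: (cintegrableM_bounded iu) => [|x]; first exact: cmeasurable_cofourierN.
exact: normc_cofourier.
Qed.

(** The difference between the two iterated integrals of [w xi], [u x] and the conjugate of [xi x].
    It is additive in [u], bounded by twice the product of the L^1 norms, and small when [u] lives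
    where the relevant characters are nearly constant; this forces it to vanish. *)
Let defect w u := cI mh (fun xi => w xi * fourier u xi) -
  cI m (fun x : bG => u x * cofourier w (- (x : G))).

Lemma fourierD u v (xi : bD) : cintegrable m u -> cintegrable m v ->
  fourier (fun x => u x + v x) xi = fourier u xi + fourier v xi.
Proof.
move=> iu iv; rewrite -cintD; [|exact: cintegrable_char|exact: cintegrable_char].
by apply: eq_cint => x; rewrite mulrDl.
Qed.

Lemma fourierZ (a : R[i]) u (xi : bD) : cintegrable m u ->
  fourier (fun x => a * u x) xi = a * fourier u xi.
Proof.
by move=> iu; rewrite -cintZ; [apply: eq_cint => x; rewrite mulrA|exact: cintegrable_char].
Qed.

Lemma fourierB u v (xi : bD) : cintegrable m u -> cintegrable m v ->
  fourier (fun x => u x - v x) xi = fourier u xi - fourier v xi.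
Proof.
move=> iu iv; rewrite -cintB; [|exact: cintegrable_char|exact: cintegrable_char].
by apply: eq_cint => x; rewrite mulrBl.
Qed.

Let defectD w u v : cintegrable mh w -> cintegrable m u -> cintegrable m v ->
  defect w (fun x => u x + v x) = defect w u + defect w v.
Proof.
move=> iw iu iv; rewrite /defect addrACA -opprD; congr (_ - _).
- rewrite -cintD; [|exact: cintegrable_fourier_mul|exact: cintegrable_fourier_mul].
  by apply: eq_cint => xi; rewrite fourierD// mulrDr.
- rewrite -cintD; [|exact: cintegrable_cofourier_mul|exact: cintegrable_cofourier_mul].
  by apply: eq_cint => x; rewrite mulrDl.
Qed.

Let defect_le w u : cintegrable mh w -> cintegrable m u ->
  normc (defect w u) <= 2 * rI mh (fun xi => normc (w xi)) * rI m (fun x => normc (u x)).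
Proof.
move=> iw iu; apply: (le_trans (le_normcD _ _)); rewrite normcN.
have h1 : normc (cI mh (fun xi => w xi * fourier u xi)) <=
    rI mh (fun xi => normc (w xi)) * rI m (fun x => normc (u x)).
  apply: (le_trans (normc_cint (cintegrable_fourier_mul iu iw))).
  rewrite mulrC -RintZ; last exact: rintegrable_normc.
  apply: le_Rint; [exact/rintegrable_normc/cintegrable_fourier_mul| |].
    by apply: rintegrableZ; exact: rintegrable_normc.
  move=> xi; rewrite Normc.normcM mulrC; apply: ler_wpM2r; first exact: normc_ge0.
  exact: normc_fourier.
have h2 : normc (cI m (fun x : bG => u x * cofourier w (- (x : G)))) <=
    rI mh (fun xi => normc (w xi)) * rI m (fun x => normc (u x)).
  apply: (le_trans (normc_cint (cintegrable_cofourier_mul iu iw))).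
  rewrite -RintZ; last exact: rintegrable_normc.
  apply: le_Rint; [exact/rintegrable_normc/cintegrable_cofourier_mul| |].
    by apply: rintegrableZ; exact: rintegrable_normc.
  move=> x; rewrite Normc.normcM mulrC; apply: ler_wpM2r; first exact: normc_ge0.
  exact: normc_cofourier.
by move: h1 h2; lra.
Qed.

Definition indicM (A : set bG) u : bG -> R[i] := fun x => (\1_A x)%:C * u x.

Lemma cintegrable_indicM (A : set bG) u : measurable A -> cintegrable m u ->
  cintegrable m (indicM A u).
Proof.
move=> mA iu; apply: (le_cintegrable _ (rintegrable_normc iu)).
  rewrite /indicM; apply: cmeasurableM; last exact: cintegrable_measurable iu.
  by apply: cmeasurable_real; exact: measurable_indic.
move=> x; rewrite /indicM Normc.normcM normc_real indicE.
by case: (x \in A); rewrite ?normr1 ?mul1r// normr0 mul0r normc_ge0.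
Qed.

Lemma normc_indicM (A : set bG) u x : normc (indicM A u x) = \1_A x * normc (u x).
Proof. by rewrite /indicM Normc.normcM normc_real ger0_norm. Qed.

Lemma indicM_split (A : set bG) u : u = fun x => indicM A u x + indicM (~` A) u x.
Proof.
apply/funext => x; rewrite /indicM !indicE in_setC; case: (x \in A);
by rewrite ?mul1r ?mul0r ?addr0 ?add0r.
Qed.

Lemma Rint_indicM_split (A : set bG) u : measurable A -> cintegrable m u ->
  rI m (fun x => normc (u x)) =
  rI m (fun x => normc (indicM A u x)) + rI m (fun x => normc (indicM (~` A) u x)).
Proof.
move=> mA iu; rewrite -RintD; last 2 first.
- exact/rintegrable_normc/cintegrable_indicM.
- by apply/rintegrable_normc/cintegrable_indicM => //; exact: measurableC.
apply: eq_Rintegral => x _; rewrite !normc_indicM !indicE in_setC; case: (x \in A);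
by rewrite ?mul1r ?mul0r ?addr0 ?add0r.
Qed.

(* Where all the characters of [L] are within [d] of their value at [y], both
   iterated integrals are close to the same product. *)
Let defect_small w u (L : set Gd) (y : G) (A : set bG) (d e : R) : cintegrable mh w -> cintegrable m u ->
  compact L -> 0 <= d -> measurable A ->
  (forall x, A x -> forall xi, L xi -> normc (xi (x : G) - xi y) <= d) ->
  rI mh (fun xi => normc (w xi) * \1_(setT `\` L) xi) <= e ->
  (forall x, ~ A x -> u x = 0) ->
  normc (defect w u) <=
    2 * (d * rI mh (fun xi => normc (w xi)) + 2 * e) * rI m (fun x => normc (u x)).
Proof.
move=> iw iu cL d0 mA hA we uA.
have mL : measurable (L : set bD) by apply: compact_borel => //; exact: hausdorff_dual.
pose c0 := cofourier w (- y).
have h2 : normc (cI m (fun x : bG => u x * cofourier w (- (x : G))) - c0 * cI m u) <=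
    (d * rI mh (fun xi => normc (w xi)) + 2 * e) * rI m (fun x => normc (u x)).
  rewrite -cintZ// -cintB; [|exact: cintegrable_cofourier_mul|exact: cintegrableZ].
  apply: (le_trans (normc_cint _)).
    by apply: cintegrableB; [exact: cintegrable_cofourier_mul|exact: cintegrableZ].
  rewrite -RintZ; last exact: rintegrable_normc.
  apply: le_Rint.
  - by apply/rintegrable_normc/cintegrableB; [exact: cintegrable_cofourier_mul|exact: cintegrableZ].
  - by apply: rintegrableZ; exact: rintegrable_normc.
  - move=> x; rewrite [c0 * _]mulrC -mulrBr Normc.normcM mulrC.
    have [Ax|nAx] := pselect (A x); last by rewrite uA// normc0 !mulr0.
    apply: ler_wpM2r; first exact: normc_ge0.
    apply: (cint_unimodular_dist (K := L) iw) => //.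
    + exact: cmeasurable_eval.
    + exact: cmeasurable_eval.
    + by move=> xi; rewrite normc_char.
    + by move=> xi; rewrite normc_char.
    + by move=> xi Lxi; rewrite !charN -rmorphB normcJ; exact: hA.
have h1 : normc (cI mh (fun xi => w xi * fourier u xi) - c0 * cI m u) <=
    (d * rI mh (fun xi => normc (w xi)) + 2 * e) * rI m (fun x => normc (u x)).
  pose N := rI m (fun x => normc (u x)).
  have nw := rintegrable_normc iw.
  have iL : rintegrable mh (fun x => normc (w x) * \1_(setT `\` L) x).
    apply: (le_rintegrable _ nw).
      apply: measurable_funM; first exact: rintegrable_measurable nw.
      by apply: measurable_indic; exact: measurableD.
    by move=> x; rewrite normrM !ger0_norm ?normc_ge0// ler_piMr ?normc_ge0.
  have ic : cintegrable mh (fun xi : bD => (w xi * (xi : Gd) (- y)) * cI m u).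
    by under eq_fun do rewrite mulrC; apply: cintegrableZ; exact: cintegrable_eval.
  have -> : c0 * cI m u = cI mh (fun xi : bD => (w xi * (xi : Gd) (- y)) * cI m u).
    by rewrite mulrC -cintZ; [apply: eq_cint => xi; rewrite mulrC|exact: cintegrable_eval].
  rewrite -cintB//; last exact: cintegrable_fourier_mul.
  apply: (le_trans (normc_cint _)); first by apply: cintegrableB => //; exact: cintegrable_fourier_mul.
  apply: (@le_trans _ _ (rI mh (fun xi => d * N * normc (w xi) + 2 * N * (normc (w xi) * \1_(setT `\` L) xi)))).
    apply: le_Rint.
    - by apply/rintegrable_normc/cintegrableB => //; exact: cintegrable_fourier_mul.
    - by apply: rintegrableD; exact: rintegrableZ.
    move=> xi; rewrite -mulrA -mulrBr Normc.normcM.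
    have -> : fourier u xi - (xi : Gd) (- y) * cI m u =
        cI m (fun x : bG => u x * (((xi : Gd) (x : G))^* - ((xi : Gd) y)^*)).
      rewrite charN -cintZ// -cintB; [|exact: cintegrable_char|exact: cintegrableZ].
      by apply: eq_cint => x; rewrite mulrBr [X in _ - X]mulrC.
    have ix : cintegrable m (fun x : bG => u x * (((xi : Gd) (x : G))^* - ((xi : Gd) y)^*)).
      apply: (cintegrableM_bounded iu (C := 2)).
        by apply: cmeasurableB; [exact/cmeasurableJ/cmeasurable_char|exact: cmeasurable_cst].
      move=> x; apply: (le_trans (le_normcD _ _)).
      by rewrite normcN !normcJ !normc_char.
    rewrite indicE; have [Lx|nLx] := pselect (L xi).
      rewrite memNset ?mulr0 ?addr0; last by case.
      rewrite mulrC; apply: ler_wpM2r; first exact: normc_ge0.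
      apply: (le_trans (normc_cint ix)); rewrite -RintZ; last exact: rintegrable_normc.
      apply: le_Rint; [exact: rintegrable_normc|by apply: rintegrableZ; exact: rintegrable_normc|].
      move=> x; rewrite Normc.normcM mulrC.
      have [Ax|nAx] := pselect (A x); last by rewrite uA// normc0 !mulr0.
      apply: ler_wpM2r; first exact: normc_ge0.
      by rewrite -rmorphB normcJ; exact: hA.
    rewrite mem_set ?mulr1//.
    have : normc (cI m (fun x : bG => u x * (((xi : Gd) (x : G))^* - ((xi : Gd) y)^*))) <= 2 * N.
      apply: (le_trans (normc_cint ix)); rewrite -RintZ; last exact: rintegrable_normc.
      apply: le_Rint; [exact: rintegrable_normc|by apply: rintegrableZ; exact: rintegrable_normc|].
      move=> x; rewrite Normc.normcM mulrC; apply: ler_wpM2r; first exact: normc_ge0.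
      apply: (le_trans (le_normcD _ _)).
      by rewrite normcN !normcJ !normc_char.
    have N0 : 0 <= N by apply: Rint_ge0 => x; exact: normc_ge0.
    have := mulr_ge0 (mulr_ge0 d0 N0) (normc_ge0 (w xi)).
    move=> t1 t2; have := ler_wpM2l (normc_ge0 (w xi)) t2; lra.
  rewrite RintD; [|exact: rintegrableZ|exact: rintegrableZ].
  rewrite !RintZ// -/N.
  have N0 : 0 <= N by apply: Rint_ge0 => x; exact: normc_ge0.
  have := ler_wpM2l N0 we; lra.
have -> : defect w u = (cI mh (fun xi => w xi * fourier u xi) - c0 * cI m u) -
    (cI m (fun x : bG => u x * cofourier w (- (x : G))) - c0 * cI m u).
  by rewrite opprB addrA subrK.
apply: (le_trans (le_normcD _ _)); rewrite normcN; move: h1 h2; lra.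
Qed.

(** Neither Haar measure need be sigma-finite. Off a compact set [K] the function [u] has little
    mass, and [K] is covered by finitely many open sets on each of which all characters of a compact
    set [L], carrying most of [w], vary by less than [d]. *)
Lemma fourier_fubini u w : cintegrable m u -> cintegrable mh w ->
  cI mh (fun xi => w xi * fourier u xi) = cI m (fun x : bG => u x * cofourier w (- (x : G))).
Proof.
move=> iu iw; apply: subr0_eq; rewrite -/(defect w u); apply: normc_eq0_eps => e e0.
pose M := rI mh (fun xi => normc (w xi)); pose N := rI m (fun x => normc (u x)).
have M0 : 0 <= M by apply: Rint_ge0 => x; exact: normc_ge0.
have N0 : 0 <= N by apply: Rint_ge0 => x; exact: normc_ge0.
(* [D] dominates [2 * M * N + 4 * N + 2 * M], the sum of the coefficients of [d] in [h1] and [h2]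
   below. *)
pose D := 6 * M + 6 * N + 2 * M * N + 1.
have D0 : 0 < D by rewrite ltr_wpDl// !addr_ge0// ?mulr_ge0.
pose d := e / D; have d0 : 0 < d by rewrite divr_gt0.
have [K [cK _ hK]] := L1_regular hausdorffG haar_m (rintegrable_normc iu)
  (fun x => normc_ge0 _) measurableT d0.
have [L [cL _ hL]] := L1_regular (@hausdorff_dual _ _) haar_mh (rintegrable_normc iw)
  (fun x => normc_ge0 _) measurableT d0.
pose U (y : G) : set G := interior [set x | forall xi, L xi -> normc (xi x - xi y) < d].
have mU y : measurable (U y : set bG) by apply: open_borel; exact: open_interior.
have mK : measurable (K : set bG) by apply: compact_borel.
have [|s _ hs] := @finite_cover _ K U cK.
  move=> x _; rewrite /U; apply: open_nbhs_nbhs; split; first exact: open_interior.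
  exact: equicontinuous_dual.
(* The part of [v] on one open set of the cover is split off at a time. L^1 norms of disjoint parts
   add up, so the bound does not depend on the number of pieces. *)
have small (t : seq G) (v : bG -> R[i]) : cintegrable m v ->
    (forall x : bG, v x != 0 -> exists2 y, y \in t & U y (x : G)) ->
    normc (defect w v) <= 2 * (d * M + 2 * d) * rI m (fun x => normc (v x)).
  elim: t v => [|y t IH] v iv hv.
    have v0 : v = fun=> 0.
      by apply/funext => x; apply/eqP; apply/negPn/negP => /hv[].
    apply: (le_trans (defect_le iw iv)).
    have -> : rI m (fun x => normc (v x)) = 0.
      by rewrite -(Rint0 m); apply: eq_Rintegral => x _; rewrite v0 normc0.
    by rewrite !mulr0.
  rewrite [X in defect w X](indicM_split (U y)) defectD//; last 2 first.
  - exact: cintegrable_indicM.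
  - by apply: cintegrable_indicM => //; exact: measurableC.
  apply: (le_trans (le_normcD _ _)).
  rewrite (Rint_indicM_split (mU y) iv) mulrDr; apply: lerD.
    apply: (defect_small (L := L) (y := y) (A := U y)) => //.
    - exact: cintegrable_indicM.
    - exact: ltW.
    - by move=> x /interior_subset h xi Lxi; exact/ltW/h.
    - exact: ltW.
    - by move=> x nUx; rewrite /indicM indicE memNset// mul0r.
  apply: IH; first by apply: cintegrable_indicM => //; exact: measurableC.
  move=> x; rewrite /indicM indicE in_setC mulf_eq0 negb_or => /andP[+ /hv[z]].
  rewrite inE => + /orP[/eqP->|zt Uz]; last by exists z.
  have [_|nUx] := boolP (x \in (U y : set bG)); first by rewrite eqxx.
  by move=> _ /mem_set Ux; move/negP: nUx.
rewrite (indicM_split (K : set bG) u) defectD//; last 2 first.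
- exact: cintegrable_indicM.
- by apply: cintegrable_indicM => //; exact: measurableC.
apply: (le_trans (le_normcD _ _)).
have h1 : normc (defect w (indicM K u)) <= 2 * (d * M + 2 * d) * N.
  apply: (le_trans (small s _ _ _)).
  - exact: cintegrable_indicM.
  - move=> x; rewrite /indicM indicE; have [Kx _|nKx] := pselect ((K : set bG) x); first exact: hs.
    by rewrite memNset// mul0r eqxx.
  - apply: ler_wpM2l; first by rewrite mulr_ge0// addr_ge0// mulr_ge0// ltW.
    rewrite /N (Rint_indicM_split mK iu) lerDl; apply: Rint_ge0 => x; exact: normc_ge0.
have h2 : normc (defect w (indicM (~` K) u)) <= 2 * M * d.
  apply: (le_trans (defect_le iw _)); first by apply: cintegrable_indicM => //; exact: measurableC.
  apply: ler_wpM2l; first by rewrite mulr_ge0.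
  apply: le_trans (ltW hK); rewrite le_eqVlt; apply/orP; left; apply/eqP.
  by apply: eq_Rintegral => x _; rewrite normc_indicM mulrC setTD.
have dD : d * D = e by rewrite divfK// gt_eqF.
move: h1 h2 dD; rewrite /D; have := mulr_ge0 (ltW d0) M0; have := mulr_ge0 (ltW d0) N0; lra.
Qed.

End fourier_L1.

(** * Uniqueness of the Fourier transform *)

Section step_function.
Context (R : realType).
Implicit Types (r t x : R).

Lemma bernoulli x n : -1 <= x -> 1 + n%:R * x <= (1 + x) ^+ n.
Proof.
move=> x1; elim: n => [|n IH]; first by rewrite mul0r addr0 expr0.
have x0 : 0 <= 1 + x by lra.
have := ler_wpM2l x0 IH; rewrite -exprS; apply: le_trans.
have := mulr_ge0 (ler0n R n) (sqr_ge0 x); rewrite -natr1; nra.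
Qed.

(** Decay of [r ^+ n] with an explicit constant: [r (2 - r) <= 1], and Bernoulli's inequality bounds
    [(2 - r) ^+ n] below. *)
Lemma expr_le_inv r n : 0 <= r <= 1 -> n%:R * (1 - r) * r ^+ n <= 1.
Proof.
move=> /andP[r0 r1].
have h : r ^+ n * (1 + (1 - r)) ^+ n <= 1.
  by rewrite -exprMn exprn_ile1// ?mulr_ge0//; nra.
have b : 1 + n%:R * (1 - r) <= (1 + (1 - r)) ^+ n by apply: bernoulli; lra.
have rn : 0 <= r ^+ n by exact: exprn_ge0.
have := ler_wpM2l rn b; nra.
Qed.

Definition step n t := ((1 - t ^+ (n.+1 * n.+1)) ^+ (2 ^ (n.+1 * n.+1))) ^+ n.+1.

Lemma step_ge0_le1 n t : 0 <= t <= 1 -> 0 <= step n t <= 1.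
Proof.
move=> /andP[t0 t1]; rewrite /step.
have h1 : 0 <= 1 - t ^+ (n.+1 * n.+1) by rewrite subr_ge0 exprn_ile1.
have h2 : 1 - t ^+ (n.+1 * n.+1) <= 1 by rewrite gerBl exprn_ge0.
by rewrite !exprn_ge0//= !exprn_ile1// ?exprn_ge0.
Qed.

(* The exponents are those of Brosowski and Deutsch; the outermost one also
   fixes the limit at [t = 1 / 2]. *)
Lemma step_cvg t : 0 <= t <= 1 -> step n t @[n --> \oo] --> ((t < 1 / 2)%R%:R : R).
Proof.
move=> t01; have /andP[t0 t1] := t01.
have base n : 0 <= 1 - t ^+ (n.+1 * n.+1) <= 1.
  by rewrite subr_ge0 exprn_ile1//= gerBl exprn_ge0.
have [th|th] := ltP t (1 / 2).
  have d0 : 0 < 1 - 2 * t by lra.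
  have c1 : (1 - (1 - 2 * t)^-1 * harmonic n) @[n --> \oo] --> (1 : R).
      rewrite [X in _ --> X](_ : 1 = 1 - (1 - 2 * t)^-1 * 0 :> R); last by rewrite mulr0 subr0.
    by apply: cvgB; [exact: cvg_cst|apply: cvgM; [exact: cvg_cst|exact: cvg_harmonic]].
  (* Two uses of Bernoulli's inequality give [1 - step n t <= n.+1 * (2 t) ^+ N]. As [N] is the
     square of [n.+1], [expr_le_inv] absorbs the factor and leaves a multiple of [1 / n.+1]. *)
  apply: (@squeeze_cvgr _ _ _ _ (fun n => 1 - (1 - 2 * t)^-1 * harmonic n) (fun=> 1)) => //; last exact: cvg_cst.
  apply: nearW => n; have /andP[_ ->] := step_ge0_le1 n t01; rewrite andbT.
  set N := (n.+1 * n.+1)%N; have /andP[b0 b1] := base n; rewrite -/N in b0 b1.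
  have h1 : 1 - (2 * t) ^+ N <= (1 - t ^+ N) ^+ (2 ^ N).
    have := @bernoulli (- t ^+ N) (2 ^ N); rewrite natrX mulrN -exprMn; apply; lra.
  have b2 : (1 - t ^+ N) ^+ (2 ^ N) <= 1 by exact: exprn_ile1.
  have b3 : 0 <= (1 - t ^+ N) ^+ (2 ^ N) by exact: exprn_ge0.
  have h2 : 1 - n.+1%:R * (2 * t) ^+ N <= step n t.
    have := @bernoulli ((1 - t ^+ N) ^+ (2 ^ N) - 1) n.+1; rewrite [1 + (_ - 1)]addrC subrK -/(step n t).
    have b4 : -1 <= (1 - t ^+ N) ^+ (2 ^ N) - 1 by lra.
    move=> /(_ b4); apply: le_trans.
    by have := ler_wpM2l (ler0n R n.+1) h1; lra.
  apply: le_trans h2; rewrite lerD2l lerN2 /harmonic/= -invfM -[leRHS]mul1r ler_pdivlMr ?mulr_gt0//.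
  have : N%:R * (1 - 2 * t) * (2 * t) ^+ N <= 1 by apply: expr_le_inv; lra.
  by apply: le_trans; rewrite natrM le_eqVlt; apply/orP; left; apply/eqP; ring.
apply: (@squeeze_cvgr _ _ _ _ (fun=> 0) harmonic); [|exact: cvg_cst|exact: cvg_harmonic].
apply: nearW => n; have /andP[-> _] := step_ge0_le1 n t01; rewrite /=.
set N := (n.+1 * n.+1)%N; have /andP[b0 b1] := base n; rewrite -/N in b0 b1.
set b := (1 - t ^+ N) ^+ (2 ^ N).
have b3 : 0 <= b by exact: exprn_ge0.
have tN : 1 <= (2 ^ N)%:R * t ^+ N.
  by rewrite natrX -exprMn exprn_ege1//; lra.
have h : b * (1 + t ^+ N) ^+ (2 ^ N) <= 1.
  rewrite -exprMn exprn_ile1//; have := sqr_ge0 (t ^+ N); nra.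
have h' := @bernoulli (t ^+ N) (2 ^ N).
(* Here [(1 + t ^+ N) ^+ (2 ^ N)] is at least [1 + (2 t) ^+ N >= 2], and its product with [b] is at
   most 1. The bound is only [1 / 2], uniformly in [n]; the outer exponent sends it to 0. *)
have bh : b <= 1 / 2.
  have /h' : -1 <= t ^+ N by apply: le_trans (exprn_ge0 _ t0); rewrite lerN10.
  nra.
rewrite /step -/N -/b /harmonic/=.
apply: (@le_trans _ _ ((1 / 2) ^+ n.+1)); first by rewrite lerXn2r// nnegrE//; lra.
rewrite div1r exprVn lef_pV2 ?posrE ?exprn_gt0//.
by rewrite -natrX ler_nat ltnW// ltn_expl.
Qed.
End step_function.

Lemma measurable_lt_set d (T : measurableType d) (R : realType) (f g : T -> R) :
  measurable_fun setT f -> measurable_fun setT g -> measurable [set x | f x < g x].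
Proof.
move=> mf mg; have := measurable_fun_ltr mf mg measurableT (Y := [set true]) I.
by rewrite setTI; congr measurable; apply/funext => x.
Qed.

Lemma indic_in (T : Type) (R : realType) (A : set T) x : A x -> \1_A x = 1 :> R.
Proof. by move=> Ax; rewrite indicE mem_set. Qed.

Lemma indic_out (T : Type) (R : realType) (A : set T) x : ~ A x -> \1_A x = 0 :> R.
Proof. by move=> Ax; rewrite indicE memNset. Qed.

Lemma indic_ge0_le1 (T : Type) (R : realType) (A : set T) x : 0 <= (\1_A x : R) <= 1.
Proof. by rewrite indicE; case: (_ \in _); rewrite ?lexx ?ler01. Qed.

Lemma normr_indicM_le (T : Type) (R : realType) (A : set T) x (r : R) : 0 <= r -> `|\1_A x * r| <= r.
Proof.
have /andP[i0 i1] := indic_ge0_le1 R A x.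
by move=> r0; rewrite normrM !ger0_norm// ler_piMl.
Qed.

Section uniqueness.
Context (R : realType) (G : topologicalZmodType)
  (mh : {measure set (borel (dual R G)) -> \bar R}) (haar_mh : haar_measure mh).
Local Notation Gd := (dual R G).
Local Notation bD := (borel Gd).
Local Notation rI h := (Rintegral mh setT h).
Local Notation cI := (cintegral mh).
Implicit Types (w p q : bD -> R[i]) (f g : bD -> R) (A B : set bD) (x y : G).

Definition annihilating w := cintegrable mh w /\ forall x, cofourier mh w x = 0.

(** Stone-Weierstrass in disguise. The bounded functions that preserve the integrable functions with
    zero transform form an algebra; it contains the characters, since multiplying by one translates
    the transform, and its real members are closed under bounded pointwise limits. It thus contains
    enough indicator functions to separate compact sets. *)
Definition multiplier p :=
  [/\ cmeasurable p, exists C : R, forall xi, normc (p xi) <= C &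
    forall w, annihilating w -> annihilating (fun xi => w xi * p xi)].

Lemma annihilatingZ (c : R[i]) w : annihilating w -> annihilating (fun xi => c * w xi).
Proof.
move=> [iw w0]; split=> [|x]; first exact: cintegrableZ.
rewrite /cofourier (@eq_cint _ _ _ _ _ (fun xi => c * (w xi * (xi : Gd) x))) => [|xi]; last by rewrite mulrA.
by rewrite cintZ; [rewrite [X in c * X](w0 x) mulr0|exact: cintegrable_eval].
Qed.

Lemma annihilatingD w p : annihilating w -> annihilating p -> annihilating (fun xi => w xi + p xi).
Proof.
move=> [iw w0] [ip p0]; split=> [|x]; first exact: cintegrableD.
rewrite /cofourier (@eq_cint _ _ _ _ _ (fun xi => w xi * (xi : Gd) x + p xi * (xi : Gd) x)) => [|xi]; last by rewrite mulrDl.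
rewrite cintD; [|exact: cintegrable_eval|exact: cintegrable_eval].
by have := w0 x; have := p0 x; rewrite /cofourier => -> ->; rewrite addr0.
Qed.

Lemma multiplier_cst (c : R[i]) : multiplier (fun=> c).
Proof.
split; [exact: cmeasurable_cst|by exists (normc c)|].
by move=> w; under eq_fun do rewrite mulrC; exact: annihilatingZ.
Qed.

Lemma multiplierD p q : multiplier p -> multiplier q -> multiplier (fun xi => p xi + q xi).
Proof.
move=> [mp [C pC] hp] [mq [D qD] hq]; split; first exact: cmeasurableD.
  by exists (C + D) => xi; apply: (le_trans (le_normcD _ _)); exact: lerD.
by move=> w aw; under eq_fun do rewrite mulrDr; apply: annihilatingD; [exact: hp|exact: hq].
Qed.

Lemma multiplierM p q : multiplier p -> multiplier q -> multiplier (fun xi => p xi * q xi).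
Proof.
move=> [mp [C pC] hp] [mq [D qD] hq]; split; first exact: cmeasurableM.
  by exists (C * D) => xi; rewrite Normc.normcM ler_pM// normc_ge0.
by move=> w aw; under eq_fun do rewrite mulrA; apply: hq; exact: hp.
Qed.

Lemma multiplierX p n : multiplier p -> multiplier (fun xi => p xi ^+ n).
Proof.
move=> mp; elim: n => [|n IH]; first exact: multiplier_cst.
by under eq_fun do rewrite exprS; exact: multiplierM.
Qed.

Lemma multiplier_eval x : multiplier (fun xi => (xi : Gd) x).
Proof.
split; [exact: cmeasurable_eval|by exists 1 => xi; rewrite normc_char|].
move=> w [iw w0]; split=> [|y]; first exact: cintegrable_eval.
rewrite /cofourier (@eq_cint _ _ _ _ _ (fun xi => w xi * (xi : Gd) (x + y))); first exact: w0.
by move=> xi; rewrite charD mulrA.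
Qed.

Definition real_multiplier f := multiplier (fun xi => (f xi)%:C).

Lemma real_multiplier_cst (c : R) : real_multiplier (fun=> c).
Proof. exact: multiplier_cst. Qed.

Lemma real_multiplierD f g : real_multiplier f -> real_multiplier g -> real_multiplier (fun xi => f xi + g xi).
Proof. by move=> mf mg; rewrite /real_multiplier; under eq_fun do rewrite rmorphD; exact: multiplierD. Qed.

Lemma real_multiplierM f g : real_multiplier f -> real_multiplier g -> real_multiplier (fun xi => f xi * g xi).
Proof. by move=> mf mg; rewrite /real_multiplier; under eq_fun do rewrite rmorphM; exact: multiplierM. Qed.

Lemma real_multiplierX f n : real_multiplier f -> real_multiplier (fun xi => f xi ^+ n).
Proof. by move=> mf; rewrite /real_multiplier; under eq_fun do rewrite rmorphXn; exact: multiplierX. Qed.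

Lemma real_multiplierB f g : real_multiplier f -> real_multiplier g -> real_multiplier (fun xi => f xi - g xi).
Proof.
move=> mf mg; apply: real_multiplierD => //; under eq_fun do rewrite -mulN1r.
by apply: real_multiplierM => //; exact: real_multiplier_cst.
Qed.

Lemma real_multiplier_measurable f : real_multiplier f -> measurable_fun setT f.
Proof. by move=> [[mf _] _ _]. Qed.

(** Dominated convergence with majorant [2 * C * normc (w xi)]. This leads from polynomials in real
    multipliers to indicator functions. *)
Lemma real_multiplier_lim (f_ : nat -> bD -> R) f (C : R) :
  (forall n, real_multiplier (f_ n)) -> (forall n xi, `|f_ n xi| <= C) ->
  (forall xi, f_ n xi @[n --> \oo] --> f xi) -> real_multiplier f.
Proof.
move=> mf fC cf.
have mf_ n := real_multiplier_measurable (mf n).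
have mef : measurable_fun setT f by apply: (measurable_fun_cvg mf_) => xi _; exact: cf.
have fC' xi : `|f xi| <= C.
  have cn : `|f_ n xi| @[n --> \oo] --> `|f xi| by apply: cvg_norm; exact: cf.
  by apply: (ler_cvg_to cn (cvg_cst C)); apply: nearW => n; exact: fC.
have mcf : cmeasurable (fun xi => (f xi)%:C) by exact: cmeasurable_real.
split => //; first by exists C => xi; rewrite normc_real.
move=> w [iw w0]; have iwf : cintegrable mh (fun xi => w xi * (f xi)%:C).
  by apply: (cintegrableM_bounded iw (C := C)) => // xi; rewrite normc_real.
split=> [//|x]; apply: normc_eq0_eps => e e0.
pose h n xi := normc (w xi) * `|f_ n xi - f xi|.
have mw := measurable_normc (cintegrable_measurable iw).
have mh' n : measurable_fun setT (h n).
  apply: measurable_funM => //; apply: measurableT_comp => //; exact: measurable_funB.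
have hC n xi : `|h n xi| <= 2 * C * normc (w xi).
  rewrite /h normrM normr_id (ger0_norm (normc_ge0 _)) mulrC; apply: ler_wpM2r; first exact: normc_ge0.
  by apply: (le_trans (ler_normB _ _)); have := fC n xi; have := fC' xi; lra.
have ch xi : h n xi @[n --> \oo] --> (0 : R).
  have -> : 0 = normc (w xi) * `|0 : R| by rewrite normr0 mulr0.
  by apply: cvgM; [exact: cvg_cst|apply: cvg_norm; apply/subr_cvg0; exact: cf].
have [_] := dominated_Rint mh' ch (rintegrableZ (2 * C) (rintegrable_normc iw)) hC.
rewrite Rint0 => /cvgr0Pnorm_lt/(_ _ e0)[N _ /(_ N (leqnn N)) hN].
have := mf N => -[_ _ /(_ w (conj iw w0))[iwn /(_ x) wn0]].
have {}hN : rI (h N) < e.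
  by apply: le_lt_trans hN; exact: ler_norm.
rewrite -[X in normc X]subr0 -wn0.
rewrite -cintB; [|exact: cintegrable_eval|exact: cintegrable_eval].
apply: (le_trans (normc_cint _)).
  by apply: cintegrableB; exact: cintegrable_eval.
apply: le_trans (ltW hN); rewrite le_eqVlt; apply/orP; left; apply/eqP.
apply: eq_Rintegral => xi _; rewrite -mulrBl Normc.normcM normc_char mulr1 -mulrBr Normc.normcM.
by rewrite -rmorphB normc_real distrC.
Qed.

Lemma real_multiplier_Re (a : R[i]) x : real_multiplier (fun xi : bD => Re (a * (xi : Gd) x)).
Proof.
rewrite /real_multiplier (_ : (fun xi : bD => _) = fun xi : bD => (2^-1)%:C * (a * (xi : Gd) x + a^* * (xi : Gd) (- x))).
  apply: multiplierM; first exact: multiplier_cst.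
  by apply: multiplierD; apply: multiplierM; [exact: multiplier_cst|exact: multiplier_eval|
    exact: multiplier_cst|exact: multiplier_eval].
apply/funext => xi; rewrite charN; set b := (xi : Gd) x.
by case: a b => a1 a2 [b1 b2]; apply: complex_eqP => /=; field.
Qed.

Definition separating A := measurable A /\ real_multiplier (\1_A).

Lemma separatingC A : separating A -> separating (~` A).
Proof.
move=> [mA rA]; split; first exact: measurableC.
rewrite (_ : \1_(~` A) = fun xi => 1 - \1_A xi); last first.
  by apply/funext => xi; rewrite !indicE in_setC; case: (_ \in _); rewrite /= ?subrr ?subr0.
by apply: real_multiplierB => //; exact: real_multiplier_cst.
Qed.

Lemma separatingI A B : separating A -> separating B -> separating (A `&` B).
Proof.
move=> [mA rA] [mB rB]; split; first exact: measurableI.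
rewrite (_ : \1_(A `&` B) = fun xi => \1_A xi * \1_B xi); last by rewrite indicI.
exact: real_multiplierM.
Qed.

Lemma separatingU A B : separating A -> separating B -> separating (A `|` B).
Proof.
move=> sA sB; rewrite -(setCK (A `|` B)) setCU; apply: separatingC.
by apply: separatingI; exact: separatingC.
Qed.

Lemma separating0 : separating set0.
Proof. by split => //; rewrite indic0; exact: real_multiplier_cst. Qed.

Lemma separating_lt f : real_multiplier f -> (forall xi, 0 <= f xi <= 1) ->
  separating [set xi | f xi < 1 / 2].
Proof.
move=> rf f01; have mf := real_multiplier_measurable rf; split.
  exact: (measurable_lt_set mf (measurable_cst _)).
apply: (@real_multiplier_lim (fun n xi => step n (f xi)) _ 1).
- move=> n; apply: real_multiplierX; apply: real_multiplierX; apply: real_multiplierB.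
    exact: real_multiplier_cst.
  exact: real_multiplierX.
- by move=> n xi; have /andP[h1 h2] := step_ge0_le1 n (f01 xi); rewrite ger0_norm.
- by move=> xi; rewrite indicE mem_setE; exact: step_cvg.
Qed.

(** At a point [x] where the characters differ, the real function [g], suitably rotated, differs at
    [xi] and [eta] by [al ^+ 2]. The separating set is where [g] exceeds the midpoint [c]. *)
Lemma separate_points (xi eta : Gd) : xi <> eta ->
  exists A, [/\ separating A, nbhs xi (A : set Gd) & nbhs eta (~` A : set Gd)].
Proof.
move=> xe; have [x hx] : exists x, xi x != eta x.
  apply: contrapT => h; apply: xe; apply: dual_eq; apply/funext => x.
  by apply/eqP/negPn/negP => hx; apply: h; exists x.
pose a := (xi x - eta x)^*; pose al := normc a.
have al0 : 0 < al.
  by rewrite lt0r normc_ge0 andbT /al /a normcJ; apply: contra_neq hx => /Normc.eq0_normc/subr0_eq.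
pose g (z : bD) := Re (a * (z : Gd) x).
have gal z : `|g z| <= al.
  by apply: (le_trans (Re_le_normc _)); rewrite Normc.normcM normc_char mulr1.
have gxe : g xi - g eta = al ^+ 2.
  by rewrite /g -ReN -ReD -mulrBr -[X in a * X]conjcK -/a mulJ.
pose c := (g xi + g eta) / 2.
have cal : `|c| <= al.
  rewrite /c normrM (ger0_norm (_ : 0 <= 2^-1))//.
  by have := ler_normD (g xi) (g eta); have := gal xi; have := gal eta; lra.
(* Since [|g - c| <= 2 al], dividing by [4 al] brings the values into the unit interval required by
   [separating_lt], with the midpoint sent to [1 / 2]. *)
pose t z := 1 / 2 - (4 * al)^-1 * (g z - c).
have al4 : 0 < (4 * al)^-1 by rewrite invr_gt0 mulr_gt0.
have tE z : (t z < 1 / 2) = (c < g z).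
  by rewrite /t gtrBl pmulr_rgt0// subr_gt0.
have rt : real_multiplier t.
  apply: real_multiplierB; first exact: real_multiplier_cst.
  apply: real_multiplierM; first exact: real_multiplier_cst.
  by apply: real_multiplierB; [exact: real_multiplier_Re|exact: real_multiplier_cst].
have t01 z : 0 <= t z <= 1.
  have h : (4 * al)^-1 * (4 * al) = 1 by rewrite mulVf// gt_eqF// mulr_gt0.
  have : `|g z - c| <= 2 * al.
    by apply: (le_trans (ler_normB _ _)); have := gal z; lra.
  rewrite ler_norml => /andP[h1 h2].
  have := ler_wpM2l (ltW al4) h1; have := ler_wpM2l (ltW al4) h2; rewrite /t; move: h; lra.
exists [set z | t z < 1 / 2]; split; first exact: separating_lt.
  apply/nbhs_dualP; exists [set x], (al / 2); split; [exact: compact_set1|by rewrite divr_gt0|].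
  move=> z /(_ x erefl) hz; rewrite /= tE.
  have : `|g z - g xi| <= al * normc ((z : Gd) x - xi x).
    by rewrite /g -ReN -ReD -mulrBr -Normc.normcM; exact: Re_le_normc.
  rewrite ler_norml => /andP[h _]; move: h gxe; rewrite /c.
  have := ltr_pM2l al0; move=> /(_ (normc ((z : Gd) x - xi x)) (al / 2)).
  rewrite hz => h; rewrite expr2; lra.
apply/nbhs_dualP; exists [set x], (al / 2); split; [exact: compact_set1|by rewrite divr_gt0|].
move=> z /(_ x erefl) hz; rewrite /= tE; apply/negP; rewrite -leNgt.
have : `|g z - g eta| <= al * normc ((z : Gd) x - eta x).
  by rewrite /g -ReN -ReD -mulrBr -Normc.normcM; exact: Re_le_normc.
rewrite ler_norml => /andP[_ h]; move: h gxe; rewrite /c.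
have := ltr_pM2l al0; move=> /(_ (normc ((z : Gd) x - eta x)) (al / 2)).
rewrite hz => h; rewrite expr2; lra.
Qed.

(** The usual two rounds: a point of [C] is separated from [D] by a finite intersection, then [C]
    from [D] by a finite union. Outside [C] and [D] the choice functions take the harmless value
    [set0]. *)
Lemma separate_compacts (C D : set Gd) : compact C -> compact D -> C `&` D = set0 ->
  exists A, [/\ separating A, C `<=` A & D `&` A = set0].
Proof.
move=> cC cD CD0.
have sepD (xi : Gd) : exists A, separating A /\ (C xi -> nbhs xi (A : set Gd) /\ D `&` A = set0).
  have [Cxi|nC] := pselect (C xi); last by exists set0; split=> //; exact: separating0.
  have sep1 (eta : Gd) : exists A, separating A /\ (D eta -> nbhs xi (A : set Gd) /\ nbhs eta (~` A : set Gd)).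
    have [De|nD] := pselect (D eta); last by exists set0; split=> //; exact: separating0.
    have [|A [sA h1 h2]] := @separate_points xi eta; last by exists A.
    by move=> xe; have : (C `&` D) xi; [split => //; rewrite xe|rewrite CD0].
  have /choice[A hA] := sep1.
  have [s sD hs] := @finite_cover Gd D (fun eta => ~` A eta) cD (fun eta De => ((hA eta).2 De).2).
  have [B [sB nB hB]] : exists B, [/\ separating B, nbhs xi (B : set Gd) & forall eta, eta \in s -> B `<=` A eta].
    elim: s sD {hs} => [|eta s IH] sD.
      exists setT; split => //; last exact: filterT.
      by rewrite -setC0; apply: separatingC; exact: separating0.
    have [|B [sB nB hB]] := IH; first by move=> y ys; apply: sD; rewrite inE ys orbT.
    have [sA /(_ (sD _ (mem_head _ _)))[nA _]] := hA eta.
    exists (A eta `&` B); split; [exact: separatingI|exact: filterI|].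
    move=> y; rewrite inE => /orP[/eqP->|ys]; first exact: subIsetl.
    by move=> z [_ /(hB _ ys)].
  exists B; split => // _; split => //; rewrite -subset0 => z [Dz Bz].
  by have [y ys nAz] := hs z Dz; exact: nAz (hB y ys z Bz).
have /choice[A hA] := sepD.
have [s sC hs] := @finite_cover Gd C A cC (fun xi Cx => ((hA xi).2 Cx).1).
have [B [sB hB DB]] : exists B, [/\ separating B, forall xi, xi \in s -> A xi `<=` B & D `&` B = set0].
  elim: s sC {hs} => [|xi s IH] sC.
    by exists set0; split => //; [exact: separating0|rewrite setI0].
  have [|B [sB hB DB]] := IH; first by move=> y ys; apply: sC; rewrite inE ys orbT.
  have [sA /(_ (sC _ (mem_head _ _)))[_ DA]] := hA xi.
  exists (A xi `|` B); split; [exact: separatingU| |by rewrite setIUr DA DB setU0].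
  move=> y; rewrite inE => /orP[/eqP->|ys]; first exact: subsetUl.
  by move=> z /(hB _ ys); right.
by exists B; split => // z /hs[y ys Az]; exact: hB _ ys _ Az.
Qed.

(** Let [P] be the set where [Re (w xi) > 0]. A separating set [A] agrees with [P] on compact sets
    carrying all but [e] of the mass of [w], and the integral of [w] over [A] vanishes, being a
    transform evaluated at 0. Hence the integral of [Re w] over [P] is at most [e]. *)
Lemma annihilating_Re_le0 w : annihilating w -> {ae mh, forall xi, Re (w xi) <= 0}.
Proof.
move=> aw; have [iw w0] := aw; have [[mRe _] [rRe _]] := (cintegrable_measurable iw, iw).
pose P : set bD := [set xi | 0 < Re (w xi)].
have mP : measurable P by exact: (measurable_lt_set (measurable_cst _) mRe).
pose f xi := Re (w xi) * \1_P xi.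
have rf : rintegrable mh f.
  apply: (le_rintegrable _ (rintegrable_norm rRe)).
    by apply: measurable_funM => //; exact: measurable_indic.
  by move=> xi; rewrite normrM ler_piMr// indicE; case: (_ \in _); rewrite ?normr1 ?normr0.
have f0 xi : 0 <= f xi.
  rewrite /f indicE; have [h|h] := pselect (P xi); first by rewrite mem_set// mulr1 ltW.
  by rewrite memNset// mulr0.
suff Rf : rI f = 0.
  have := Rint_eq0 rf f0 Rf; apply: filterS => xi; rewrite /f indicE.
  have [h|h _] := pselect (P xi); first by rewrite mem_set// mulr1 => ->.
  by rewrite leNgt; apply/negP.
apply/eqP; rewrite eq_le Rint_ge0// andbT; apply: le_epsilon => e e0; rewrite add0r.
have e2 : 0 < e / 2 by rewrite divr_gt0.
have rn := rintegrable_normc iw.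
have [C [cC CP hC]] := L1_regular (@hausdorff_dual _ _) haar_mh rn (fun=> normc_ge0 _) mP e2.
have [D [cD DP hD]] := L1_regular (@hausdorff_dual _ _) haar_mh rn (fun=> normc_ge0 _) (measurableC mP) e2.
have [|A [[mA [_ _ /(_ w aw)[iwA /(_ 0) wA0]]] CA DA]] := separate_compacts cC cD.
  by rewrite -subset0 => z [/CP h /DP].
have mC : measurable (C : set bD) by apply: compact_borel => //; exact: hausdorff_dual.
have mD : measurable (D : set bD) by apply: compact_borel => //; exact: hausdorff_dual.
have rind (B : set bD) : measurable B -> rintegrable mh (fun xi => normc (w xi) * \1_B xi).
  move=> mB; apply: (le_rintegrable _ rn).
    by apply: measurable_funM; [exact: rintegrable_measurable rn|exact: measurable_indic].
  by move=> xi; rewrite normrM !ger0_norm ?normc_ge0// ler_piMr// ?normc_ge0// indicE; case: (_ \in _).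
have r1 := rind _ (measurableD mP mC); have r2 := rind _ (measurableD (measurableC mP) mD).
have RA : rI (fun xi => Re (w xi * (\1_A xi)%:C)) = 0.
  move: wA0 => /(congr1 (@Re _)); rewrite /cofourier/= => <-; apply: eq_Rintegral => xi _.
  by rewrite char0 mulr1.
have [rA _] := iwA.
rewrite -[leRHS]add0r -RA -(lerBlDl); apply: (@le_trans _ _ (rI (fun xi => normc (w xi) * \1_(P `\` C) xi) + rI (fun xi => normc (w xi) * \1_(~` P `\` D) xi))); last by move: hC hD; lra.
rewrite -RintB// -RintD//; apply: le_Rint; [exact: rintegrableB|exact: rintegrableD|].
move=> xi; rewrite /f.
have hn := le_trans (ler_norm _) (Re_le_normc (w xi)).
have hn' : - Re (w xi) <= normc (w xi) by apply: le_trans (Re_le_normc _); rewrite -normrN ler_norm.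
have wn := normc_ge0 (w xi).
have -> : Re (w xi * (\1_A xi)%:C) = Re (w xi) * \1_A xi by rewrite ReM /= mulr0 subr0.
have ind0 (B : set bD) : \1_B xi = 0 :> R \/ \1_B xi = 1 :> R.
  by rewrite indicE; case: (_ \in _); [right|left].
have [Pxi|nP] := pselect (P xi).
  rewrite (indic_in _ Pxi) (@indic_out _ _ (~` P `\` D)); last by case.
  have Pxi' : 0 < Re (w xi) by [].
  have [Cxi|nC] := pselect (C xi).
    by rewrite (indic_in _ (CA _ Cxi)) indic_out; [lra|case].
  rewrite (@indic_in _ _ (P `\` C))//.
  by have [->|->] := ind0 A; lra.
rewrite (indic_out _ nP) (@indic_out _ _ (P `\` C)); last by case.
have [Dxi|nD] := pselect (D xi).
  rewrite (@indic_out _ _ A); last by move=> Axi; have : (D `&` A) xi by []; rewrite DA.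
  by have [->|->] := ind0 (~` P `\` D); lra.
rewrite (@indic_in _ _ (~` P `\` D))//.
by have [->|->] := ind0 A; lra.
Qed.

(** The preceding inequality for the four multiples of [w] by [1], [-1], [i] and [-i] kills both
    real and imaginary parts. *)
Theorem cofourier_inj w : cintegrable mh w -> (forall x, cofourier mh w x = 0) ->
  {ae mh, forall xi, w xi = 0}.
Proof.
move=> iw w0; have aw : annihilating w by [].
have h1 := annihilating_Re_le0 aw.
have h2 := annihilating_Re_le0 (annihilatingZ (-1) aw).
have h3 := annihilating_Re_le0 (annihilatingZ 'i aw).
have h4 := annihilating_Re_le0 (annihilatingZ (- 'i) aw).
apply: filterS2 (filterI h1 h2) (filterI h3 h4) => xi [a1 a2] [a3 a4].
move: a2 a3 a4; rewrite !ReM /= => a2 a3 a4.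
by apply: complex_eqP => /=; apply/eqP; rewrite eq_le; apply/andP; split; lra.
Qed.
End uniqueness.

(** * The Plancherel transform *)

Lemma hcvgP (R : realType) (V : lmodType R[i]) (dot : V -> V -> R[i]) (ip : inner_product dot) (u : nat -> V) v :
  hcvg dot u v <-> hnorm dot (u n - v) @[n --> \oo] --> (0 : R).
Proof.
split=> [h|/cvgr0Pnorm_lt h e e0].
- apply/cvgr0Pnorm_lt => e /h[N hN]; exists N => // n /= Nn.
  by rewrite ger0_norm ?hnorm_ge0//; exact: hN.
- have [N _ hN] := h _ e0; exists N => n Nn; exact: le_lt_trans (ler_norm _) (hN n Nn).
Qed.

(** Polarization: norms of sums determine real parts, and the real part for [i u] is the imaginary
    part up to sign. *)
Lemma isometry_dot (R : realType) (V W : lmodType R[i]) (dV : V -> V -> R[i]) (dW : W -> W -> R[i])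
  (iV : inner_product dV) (iW : inner_product dW) (f : V -> W) :
  (forall a u v, f (a *: u + v) = a *: f u + f v) ->
  (forall u, hnorm dW (f u) = hnorm dV u) -> forall u v, dW (f u) (f v) = dV u v.
Proof.
move=> fl fi u v.
have fD w w' : f (w + w') = f w + f w' by rewrite -[in LHS](scale1r w) fl scale1r.
have f0 : f 0 = 0 by apply: (hnorm_eq0 iW); rewrite fi (hnorm0 iV).
have fZ a w : f (a *: w) = a *: f w by rewrite -[a *: w]addr0 fl f0 addr0.
have re w w' : Re (dW (f w) (f w')) = Re (dV w w').
  have := hnormD_sqr iW (f w) (f w'); rewrite -fD !fi (hnormD_sqr iV); lra.
apply: complex_eqP; first exact: re.
by have := re ('i *: u) v; rewrite fZ (dotZl iW) (dotZl iV) !ReM /=; lra.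
Qed.

Lemma hcvg_lin (R : realType) (V : lmodType R[i]) (dot : V -> V -> R[i]) (ip : inner_product dot) (a : R[i]) (s t : nat -> V) x y :
  hcvg dot s x -> hcvg dot t y -> hcvg dot (fun n => a *: s n + t n) (a *: x + y).
Proof.
move=> cs ct e e0; pose M := normc a + 1.
have M0 : 0 < M by rewrite ltr_wpDl// normc_ge0.
have e1 : 0 < e / 2 / M by rewrite !divr_gt0.
have e2 : 0 < e / 2 by rewrite divr_gt0.
have [n1 h1] := cs _ e1; have [n2 h2] := ct _ e2; exists (n1 + n2)%N => n nn.
have {}h1 := h1 n (leq_trans (leq_addr _ _) nn).
have {}h2 := h2 n (leq_trans (leq_addl _ _) nn).
have -> : a *: s n + t n - (a *: x + y) = a *: (s n - x) + (t n - y).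
  by rewrite scalerBr opprD addrACA.
apply: (le_lt_trans (hnormD ip _ _)); rewrite (hnormZ ip).
have MM : e / 2 / M * M = e / 2 by rewrite divfK// gt_eqF.
have := ler_wpM2l (normc_ge0 a) (ltW h1); have := divr_gt0 e2 M0.
move: MM; rewrite {2}/M; lra.
Qed.

Lemma eq_sqr (R : realType) (a b : R) : 0 <= a -> 0 <= b -> a ^+ 2 = b ^+ 2 -> a = b.
Proof. by move=> a0 b0 /eqP; rewrite eqrXn2// => /eqP. Qed.

Section isometric_limits.
Context (R : realType) (V W : lmodType R[i]) (dV : V -> V -> R[i]) (dW : W -> W -> R[i])
  (iV : inner_product dV) (iW : inner_product dW).
Implicit Types (s t : nat -> V) (p q : nat -> W).

Lemma hcvg_cauchy s x : hcvg dV s x -> cauchy_seq dV s.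
Proof.
move=> cs e e0; have e2 : 0 < e / 2 by rewrite divr_gt0.
have [N hN] := cs _ e2; exists N => n k /hN h1 /hN h2.
by have := hnorm_dist iV (s n) x (s k); rewrite (hnorm_distC iV x); lra.
Qed.

Lemma hcvg_norm s p x y : (forall n, hnorm dV (s n) = hnorm dW (p n)) ->
  hcvg dV s x -> hcvg dW p y -> hnorm dV x = hnorm dW y.
Proof.
move=> sp cs cp; apply/eqP; rewrite eq_le; apply/andP; split; apply: le_epsilon => e e0;
have e2 : 0 < e / 2 by rewrite divr_gt0.
- have [n1 h1] := cs _ e2; have [n2 h2] := cp _ e2; pose n := (n1 + n2)%N.
  have := h1 n (leq_addr _ _); have := h2 n (leq_addl _ _).
  have := hnorm_le_dist iV x (s n); have := hnorm_le_dist iW (p n) y.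
  by rewrite (hnorm_distC iV x) sp; lra.
- have [n1 h1] := cs _ e2; have [n2 h2] := cp _ e2; pose n := (n1 + n2)%N.
  have := h1 n (leq_addr _ _); have := h2 n (leq_addl _ _).
  have := hnorm_le_dist iV (s n) x; have := hnorm_le_dist iW y (p n).
  by rewrite (hnorm_distC iW y) sp; lra.
Qed.

Lemma hcvg_isometric s t p q x y z : (forall n, hnorm dW (p n - q n) = hnorm dV (s n - t n)) ->
  hcvg dV s x -> hcvg dV t x -> hcvg dW p y -> hcvg dW q z -> y = z.
Proof.
move=> st cs ct cp cq; apply: subr0_eq; apply: (hnorm_eq0_eps iW) => e e0.
have e4 : 0 < e / 4 by rewrite divr_gt0.
have [n1 h1] := cs _ e4; have [n2 h2] := cp _ e4; have [n3 h3] := ct _ e4; have [n4 h4] := cq _ e4.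
pose n := (n1 + n2 + n3 + n4)%N.
have := h1 n (leq_trans (leq_addr n2 _) (leq_trans (leq_addr n3 _) (leq_addr n4 _))).
have := h2 n (leq_trans (leq_addl n1 _) (leq_trans (leq_addr n3 _) (leq_addr n4 _))).
have := h3 n (leq_trans (leq_addl (n1 + n2) _) (leq_addr n4 _)).
have := h4 n (leq_addl _ _).
have := hnorm_dist iW y (p n) z; have := hnorm_dist iW (p n) (q n) z.
have := hnorm_dist iV (s n) x (t n).
by rewrite (hnorm_distC iW y (p n)) (hnorm_distC iV x (t n)) st; lra.
Qed.
End isometric_limits.

Section toL2_linear.
Context d (T : measurableType d) (R : realType) (mu : {measure set T -> \bar R}).
Implicit Types (f g : T -> R[i]).

Lemma cLfun2_lin (a : R[i]) f g : f \in cLfun mu 2%:E -> g \in cLfun mu 2%:E ->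
  (fun x => a * f x + g x) \in cLfun mu 2%:E.
Proof.
move=> Lf Lg; have [_ h] := cLfun2_submod_closed mu; exact: (h a f g Lf Lg).
Qed.

Lemma toL2_lin (a : R[i]) f g : f \in cLfun mu 2%:E -> g \in cLfun mu 2%:E ->
  toL2 mu (fun x => a * f x + g x) = a *: toL2 mu f + toL2 mu g.
Proof.
move=> Lf Lg; apply/L2_eqP.
apply: filterS3 (rp_toL2 (cLfun2_lin a Lf Lg)) (rpD (a *: toL2 mu f) (toL2 mu g))
  (filterI (rpZ a (toL2 mu f)) (filterI (rp_toL2 Lf) (rp_toL2 Lg))) => x -> -> [-> [-> ->]] //.
Qed.

Lemma toL2B f g : f \in cLfun mu 2%:E -> g \in cLfun mu 2%:E ->
  toL2 mu (fun x => f x - g x) = toL2 mu f - toL2 mu g.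
Proof.
move=> Lf Lg; rewrite addrC -scaleN1r -toL2_lin//; congr toL2.
by apply/funext => x; rewrite mulN1r addrC.
Qed.

Lemma toL2_rp (u : L2 mu) : toL2 mu (rp u) = u.
Proof. by apply/L2_eqP; apply: rp_toL2; exact: rp_cLfun2. Qed.

Lemma hnorm_toL2 f : f \in cLfun mu 2%:E ->
  hnorm (@L2inner _ _ _ mu) (toL2 mu f) ^+ 2 = Rintegral mu setT (fun x => normc (f x) ^+ 2).
Proof.
by move=> Lf; apply: L2norm_ae; [have /cLfun2P[] := Lf|exact: rp_toL2].
Qed.

Lemma toL2_dist f g : f \in cLfun mu 2%:E -> g \in cLfun mu 2%:E ->
  rintegrable mu (fun x => normc (f x - g x) ^+ 2) /\
  hnorm (@L2inner _ _ _ mu) (toL2 mu f - toL2 mu g) ^+ 2 =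
    Rintegral mu setT (fun x => normc (f x - g x) ^+ 2).
Proof.
move=> Lf Lg; have Lfg : (fun x => f x - g x) \in cLfun mu 2%:E.
  rewrite (_ : (fun x => f x - g x) = fun x => -1 * g x + f x); first exact: cLfun2_lin.
  by apply/funext => x; rewrite mulN1r addrC.
by split; [have [] := (cLfun2P mu _).1 Lfg|rewrite -toL2B// hnorm_toL2].
Qed.

Lemma toL2_ae f g : f \in cLfun mu 2%:E -> g \in cLfun mu 2%:E ->
  {ae mu, forall x, f x = g x} -> toL2 mu f = toL2 mu g.
Proof.
move=> Lf Lg fg; apply/L2_eqP.
by apply: filterS3 (rp_toL2 Lf) (rp_toL2 Lg) fg => x -> ->.
Qed.

(** Truncation to [A n], where the modulus exceeds [1 / n.+1]: there [|f| <= n.+1 |f|^2], which is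
    integrable. *)
Lemma L1L2_dense (f : L2 mu) : exists u : nat -> T -> R[i],
  (forall n, cintegrable mu (u n) /\ u n \in cLfun mu 2%:E) /\
  hcvg (@L2inner _ _ _ mu) (fun n => toL2 mu (u n)) f.
Proof.
pose A n : set T := [set x | n.+1%:R^-1 < normc (rp f x)].
have mr := measurable_normc (rp_cmeasurable f).
have mA n : measurable (A n) by exact: (measurable_lt_set (measurable_cst _) mr).
pose u n x := (\1_(A n) x)%:C * rp f x.
have mu_ n : cmeasurable (u n).
  by apply: cmeasurableM; [apply: cmeasurable_real; exact: measurable_indic|exact: rp_cmeasurable].
have nu n x : normc (u n x) = \1_(A n) x * normc (rp f x).
  by rewrite Normc.normcM normc_real ger0_norm.
have L2u n : u n \in cLfun mu 2%:E.
  apply: (le_cLfun2 (mu_ n) (rintegrable_rp f)) => x; rewrite nu exprMn.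
  by apply: ler_piMl; rewrite ?sqr_ge0// indicE; case: (_ \in _); rewrite ?expr1n ?expr0n.
have L1u n : cintegrable mu (u n).
  apply: (le_cintegrable (mu_ n) (rintegrableZ n.+1%:R (rintegrable_rp f))) => x; rewrite nu.
  have [Ax|nA] := pselect (A n x); last by rewrite indic_out// mul0r mulr_ge0// sqr_ge0.
  rewrite indic_in// mul1r expr2 mulrA ler_peMl ?normc_ge0//.
  by rewrite mulrC -ler_pdivrMr// mul1r ltW.
exists u; split=> // e e0.
pose h n x := (1 - \1_(A n) x) * normc (rp f x) ^+ 2.
have mh n : measurable_fun setT (h n).
  apply: measurable_funM; last exact: measurable_normc_sqr (rp_cmeasurable f).
  by apply: measurable_funB => //; exact: measurable_indic.
have ch x : h n x @[n --> \oo] --> (0 : R).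
  have [z|nz] := eqVneq (normc (rp f x)) 0.
    by rewrite /h z; under eq_fun do rewrite expr0n mulr0; exact: cvg_cst.
  have p : 0 < normc (rp f x) by rewrite lt0r nz normc_ge0.
  have := @cvg_harmonic R => /cvgr0Pnorm_lt/(_ _ p)[N _ hN].
  apply: (@cvg_near_cst _ R^o); exists N => // n /= Nn.
  rewrite /h indic_in ?subrr ?mul0r//.
  by apply: le_lt_trans (hN n Nn); rewrite /harmonic/= ler_norm.
have hb n x : `|h n x| <= normc (rp f x) ^+ 2.
  rewrite /h normrM (ger0_norm (sqr_ge0 _)); apply: ler_piMl; rewrite ?sqr_ge0//.
  by rewrite indicE; case: (_ \in _); rewrite ?subrr ?subr0 ?normr0 ?normr1.
have [_] := dominated_Rint mh ch (rintegrable_rp f) hb; rewrite Rint0 => /cvgr0Pnorm_lt hc.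
have e2 : 0 < e ^+ 2 by rewrite exprn_gt0.
have [N _ hN] := hc _ e2; exists N => n Nn.
have nu0 := hnorm_ge0 (@L2inner _ _ _ mu) (toL2 mu (u n) - f).
rewrite -(ltr_pXn2r (ltn0Sn 1)) ?nnegrE ?(ltW e0)//.
apply: le_lt_trans (hN n Nn); apply: le_trans (ler_norm _).
rewrite le_eqVlt; apply/orP; left; apply/eqP.
rewrite (@L2norm_ae _ _ _ _ _ (fun x => u n x - rp f x)).
- apply: eq_Rintegral => x _; rewrite /h /u; have [Ax|nA] := pselect (A n x).
    by rewrite indic_in// mul1r subrr normc0 subrr mul0r expr0n.
  by rewrite indic_out// mul0r sub0r normcN subr0 mul1r.
- by apply: cmeasurableB => //; exact: rp_cmeasurable.
- by apply: filterS2 (rpB (toL2 mu (u n)) f) (rp_toL2 (L2u n)) => x -> ->.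
Qed.

End toL2_linear.

Section plancherel.
Context (R : realType) (G : topologicalZmodType)
  (hausdorffG : hausdorff_space G) (locally_compactG : locally_compact [set: G])
  (m : {measure set (borel G) -> \bar R}) (haar_m : haar_measure m)
  (mh : {measure set (borel (dual R G)) -> \bar R}) (dual_haar_mh : dual_haar_measure m mh).
Local Notation Gd := (dual R G).
Local Notation bG := (borel G).
Local Notation bD := (borel Gd).
Local Notation rI mu h := (Rintegral mu setT h).
Local Notation cI := cintegral.
Local Notation fourier := (fourier m).
Local Notation fourier2 := (@fourier2 R G m mh).
Local Notation dotG := (@L2inner _ _ _ m).
Local Notation dotD := (@L2inner _ _ _ mh).
Local Notation nmG := (hnorm dotG).
Local Notation nmD := (hnorm dotD).
Local Notation ipG := (L2inner_product m).
Local Notation ipD := (L2inner_product mh).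
Implicit Types (u v : bG -> R[i]) (f g : L2 m) (w : L2 mh).
Let haar_mh : haar_measure mh. Proof. by case: dual_haar_mh. Qed.

Definition L1L2 u := cintegrable m u /\ u \in cLfun m 2%:E.

Lemma L1L2_lin (a : R[i]) u v : L1L2 u -> L1L2 v -> L1L2 (fun x => a * u x + v x).
Proof.
move=> [iu Lu] [iv Lv]; split; last exact: cLfun2_lin.
by apply: cintegrableD => //; exact: cintegrableZ.
Qed.

Lemma fourier_lin (a : R[i]) u v : L1L2 u -> L1L2 v ->
  fourier (fun x => a * u x + v x) = (fun xi => a * fourier u xi + fourier v xi).
Proof.
move=> [iu Lu] [iv Lv]; apply/funext => xi.
by rewrite fourierD ?fourierZ//; exact: cintegrableZ.
Qed.

(** The normalization of [mh] is an equality of extended reals; the finiteness of the right-hand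
    side makes the transform square-integrable. *)
Lemma plancherel_L1L2 u : L1L2 u -> fourier u \in cLfun mh 2%:E /\
  rI mh (fun xi => normc (fourier u xi) ^+ 2) = rI m (fun x => normc (u x) ^+ 2).
Proof.
move=> [iu Lu]; case: dual_haar_mh => _ pl _.
have /(_ Lu) e := pl u ((cLfun1P m u).2 iu).
have [mu_ ru] := (cLfun2P m u).1 Lu.
have mf : cmeasurable (fourier u : bD -> R[i]) by exact: cmeasurable_fourier.
split; last by rewrite /Rintegral e.
apply/cLfun2P; split => //; apply/integrableP; split.
  by apply/measurable_EFinP; exact: measurable_normc_sqr.
have -> : (\int[mh]_xi `|(EFin \o (fun x => (normc (fourier u x) ^+ 2)%R)) xi| = \int[mh]_xi (normc (fourier u xi) ^+ 2)%:E)%E.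
  by apply: eq_integral => xi _; rewrite /= ger0_norm ?sqr_ge0.
by rewrite e Rint_EFin// ltry.
Qed.

Lemma fourier_cLfun2 u : L1L2 u -> fourier u \in cLfun mh 2%:E.
Proof. by move=> /plancherel_L1L2[]. Qed.

Lemma fourier_dist u v : L1L2 u -> L1L2 v ->
  nmD (toL2 mh (fourier u) - toL2 mh (fourier v)) = nmG (toL2 m u - toL2 m v).
Proof.
move=> Du Dv; have [iu Lu] := Du; have [iv Lv] := Dv.
rewrite -toL2B ?fourier_cLfun2// -toL2B//.
apply: eq_sqr; [exact: hnorm_ge0|exact: hnorm_ge0|].
have Duv : L1L2 (fun x => u x - v x).
  by have := L1L2_lin (-1) Dv Du; congr L1L2; apply/funext => x; rewrite mulN1r addrC.
have -> : (fun xi => fourier u xi - fourier v xi) = fourier (fun x => u x - v x).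
  by apply/funext => xi; rewrite fourierB.
have [L2f e2] := plancherel_L1L2 Duv.
by rewrite (hnorm_toL2 L2f) e2 hnorm_toL2//; case: Duv.
Qed.

Lemma is_fourier2P f w : is_fourier2 f w <-> exists u : nat -> bG -> R[i],
  [/\ forall n, L1L2 (u n), hcvg dotG (fun n => toL2 m (u n)) f &
    hcvg dotD (fun n => toL2 mh (fourier (u n))) w].
Proof.
split=> -[u].
- move=> [Lu _ cu cf]; exists u; split.
  + by move=> n; have [/cLfun1P] := Lu n.
  + by apply/(hcvgP ipG).
  + by apply/(hcvgP ipD).
- move=> [Du cu cf]; exists u; split.
  + by move=> n; have [? ?] := Du n; split => //; apply/cLfun1P.
  + by move=> n; exact: fourier_cLfun2.
  + by apply/(hcvgP ipG).
  + by apply/(hcvgP ipD).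
Qed.

Lemma is_fourier2_unique f w w' : is_fourier2 f w -> is_fourier2 f w' -> w = w'.
Proof.
move=> /is_fourier2P[u [Du cu cw]] /is_fourier2P[v [Dv cv cw']].
by apply: (hcvg_isometric ipG ipD _ cu cv cw cw') => n; rewrite fourier_dist.
Qed.

Lemma is_fourier2_exists f : exists w, is_fourier2 f w.
Proof.
have [u [Du cu]] := L1L2_dense f.
have cy : cauchy_seq dotD (fun n => toL2 mh (fourier (u n))).
  move=> e /(hcvg_cauchy ipG cu)[N hN]; exists N => n k Nn Nk; rewrite fourier_dist//.
  exact: hN.
have [//|w _ cw] := L2_complete _ cy.
by exists w; apply/is_fourier2P; exists u.
Qed.

Lemma fourier2_spec f : is_fourier2 f (fourier2 f).
Proof. by have [w hw] := is_fourier2_exists f; rewrite /fourier2; apply: xgetPex; exists w. Qed.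

Lemma fourier2E f w : is_fourier2 f w -> fourier2 f = w.
Proof. by move=> h; apply: is_fourier2_unique (fourier2_spec f) h. Qed.

Lemma fourier2_toL2 u : L1L2 u -> fourier2 (toL2 m u) = toL2 mh (fourier u).
Proof.
move=> Du; apply: fourier2E; apply/is_fourier2P; exists (fun=> u); split => // e e0;
  by exists 0%N => n _; rewrite subrr ?(hnorm0 ipG) ?(hnorm0 ipD).
Qed.

Lemma fourier2_lin (a : R[i]) f g : fourier2 (a *: f + g) = a *: fourier2 f + fourier2 g.
Proof.
apply: fourier2E; apply/is_fourier2P.
have /is_fourier2P[u [Du cu cw]] := fourier2_spec f.
have /is_fourier2P[v [Dv cv cw']] := fourier2_spec g.
exists (fun n x => a * u n x + v n x); split.
- by move=> n; exact: L1L2_lin.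
- rewrite (_ : (fun n => _) = fun n => a *: toL2 m (u n) + toL2 m (v n)); first exact: (hcvg_lin ipG).
  by apply/funext => n; have [_ ?] := Du n; have [_ ?] := Dv n; rewrite toL2_lin.
- rewrite (_ : (fun n => _) = fun n => a *: toL2 mh (fourier (u n)) + toL2 mh (fourier (v n))).
    exact: (hcvg_lin ipD).
  by apply/funext => n; rewrite fourier_lin// toL2_lin//; exact: fourier_cLfun2.
Qed.

Lemma hnorm_fourier2 f : nmD (fourier2 f) = nmG f.
Proof.
have /is_fourier2P[u [Du cu cw]] := fourier2_spec f.
apply: (hcvg_norm ipD ipG _ cw cu) => n.
apply: eq_sqr; [exact: hnorm_ge0|exact: hnorm_ge0|].
have [e1 e2] := plancherel_L1L2 (Du n); have [_ e3] := Du n.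
by rewrite !hnorm_toL2.
Qed.

Lemma dot_fourier2 f g : dotD (fourier2 f) (fourier2 g) = dotG f g.
Proof. exact: (isometry_dot ipG ipD fourier2_lin hnorm_fourier2). Qed.

Lemma fourier_shift u (a : G) (xi : Gd) : cintegrable m u ->
  fourier (fun x : bG => u ((x : G) + a)) xi = xi a * fourier u xi.
Proof.
move=> iu; rewrite /fourier -cintZ; last exact: cintegrable_char.
rewrite -(cint_shift haar_m (@translation_group G) a (f := fun x : bG => xi a * (u x * (xi (x : G))^*))).
  apply: eq_cint => x; rewrite charD rmorphM mulrCA; congr (_ * _).
  by rewrite mulrCA mulJ normc_char expr1n mulr1.
by apply: cintegrableZ; exact: cintegrable_char.
Qed.

Lemma L1L2_shift u (a : G) : L1L2 u -> L1L2 (fun x : bG => u ((x : G) + a)).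
Proof.
move=> [iu Lu]; split; [apply: (cintegrable_shift haar_m)|apply: (cLfun2_shift haar_m)] => //;
exact: translation_group.
Qed.

(** Restrict [xi] itself to an open set [U] inside a compact neighbourhood of 0: the transform at
    [xi] is [m U], which is positive. *)
Lemma fourier_nonzero (xi : Gd) : exists2 u, L1L2 u & fourier u xi != 0.
Proof.
have [//|K K0 [cK _]] := @locally_compactG (0 : G); rewrite withinET in K0.
pose U := interior K.
have oU : open U by exact: open_interior.
have U0 : U 0 by exact: nbhs_singleton (nbhs_interior K0).
have mU : measurable (U : set bG) by exact: open_borel.
have mK : measurable (K : set bG) by exact: compact_borel.
have Uoo : (m U < +oo)%E.
  apply: le_lt_trans (haar_compact haar_m cK).
  by apply: le_measure_borel => //; exact: interior_subset.
have Upos : (0 < m U)%E by apply: (haar_open_gt0 hausdorffG haar_m (@translation_group G) oU); exists 0.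
have iU := rintegrable_indic mU Uoo.
pose u (x : bG) := (\1_(U : set bG) x)%:C * xi (x : G).
have nu x : normc (u x) = \1_(U : set bG) x.
  by rewrite Normc.normcM normc_char mulr1 normc_real ger0_norm.
have mu_ : cmeasurable u.
  apply: cmeasurableM; last exact: cmeasurable_char.
  by apply: cmeasurable_real; exact: measurable_indic.
exists u.
  split; first by apply: (le_cintegrable mu_ iU) => x; rewrite nu.
  apply: (le_cLfun2 mu_ iU) => x; rewrite nu indicE.
  by case: (_ \in _); rewrite ?expr1n ?expr0n.
have -> : fourier u xi = (fine (m U))%:C.
  rewrite -Rint_indic// -cint_real; apply: eq_cint => x.
  by rewrite /u -mulrA mulJ normc_char expr1n mulr1.
apply/eqP => /(congr1 (@Re _)) /= h; move: Upos.
by rewrite -(@fineK _ (m U)) ?h ?ltxx// ge0_fin_numE.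
Qed.

(** Orthogonality to the transforms of all translates of [u] says that [w] times the conjugate of
    [fourier u] has zero transform, so this product vanishes almost everywhere. Finitely many [u]
    have no common zero of their transforms on a given compact set; hence [w] vanishes there, and
    compact sets exhaust its mass. *)
Lemma fourier_orthogonal w : (forall u, L1L2 u -> dotD w (toL2 mh (fourier u)) = 0) -> w = 0.
Proof.
move=> wu.
have prod0 u : L1L2 u -> {ae mh, forall xi, rp w xi * (fourier u xi)^* = 0}.
  move=> Du; have Lf := fourier_cLfun2 Du.
  apply: (cofourier_inj haar_mh); first by apply: cintegrable_mul; [exact: rp_cLfun2|exact: cLfun2J].
  move=> a; rewrite -[a]opprK; have := wu _ (L1L2_shift (- a) Du) => <-.
  have Dua := L1L2_shift (- a) Du.
  rewrite (@L2inner_ae _ _ _ _ _ _ (rp w) (fourier (fun x : bG => u ((x : G) - a)))).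
  - apply: eq_cint => xi; rewrite fourier_shift; last by case: Du.
    by rewrite (charN xi (- a)) rmorphM mulrA mulrAC.
  - exact: rp_cmeasurable.
  - by have /cLfun2P[] := fourier_cLfun2 Dua.
  - exact: aeW.
  - exact: rp_toL2 (fourier_cLfun2 Dua).
apply: (hnorm_eq0 ipD); apply/eqP; rewrite -sqrf_eq0 L2norm_sqr.
rewrite eq_le Rint_ge0 ?andbT => [|xi]; last exact: sqr_ge0.
apply: le_epsilon => e e0; rewrite add0r.
have [K [cK _ hK]] := L1_regular (@hausdorff_dual _ _) haar_mh (rintegrable_rp w) (fun=> sqr_ge0 _) measurableT e0.
have /choice[u Pu] : forall xi : Gd, exists u, L1L2 u /\ fourier u xi != 0.
  by move=> xi; have [u] := fourier_nonzero xi; exists u.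
have [|s _ hs] := @finite_cover _ K (fun xi => [set eta | fourier (u xi) eta != 0]) cK.
  move=> xi _; have [[iu _] fu] := Pu xi.
  have p : 0 < normc (fourier (u xi) xi).
    by rewrite lt0r normc_ge0 andbT; apply: contra_neq fu => /Normc.eq0_normc.
  have cf : (fourier (u xi) eta : R[i]^o) @[eta --> xi] --> (fourier (u xi) xi : R[i]^o).
    exact: fourier_continuous.
  have := (cvg_normcP (nbhs_filter xi) _ _).1 cf _ p.
  by apply: filterS => eta h; apply/eqP => z; move: h; rewrite z sub0r normcN ltxx.
have aeK : {ae mh, forall xi : bD, K xi -> rp w xi = 0}.
  have : {ae mh, forall xi : bD, forall eta, eta \in s -> rp w xi * (fourier (u eta) xi)^* = 0}.
    elim: s {hs} => [|eta s IH]; first exact: aeW.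
    apply: filterS2 IH (prod0 _ (Pu eta).1) => xi h1 h2 z; rewrite inE => /orP[/eqP->//|]; exact: h1.
  apply: filterS => xi h Kxi; have [eta es /= fe] := hs xi Kxi.
  by have /eqP := h eta es; rewrite mulf_eq0 conjc_eq0 (negbTE fe) orbF => /eqP.
have mK : measurable (K : set bD) by apply: compact_borel => //; exact: hausdorff_dual.
have mw := measurable_normc_sqr (rp_cmeasurable w).
apply: le_trans (ltW hK); rewrite le_eqVlt; apply/orP; left; apply/eqP; apply: Rint_ae => //.
  by apply: measurable_funM => //; apply: measurable_indic; exact: measurableD.
have : {ae mh, forall xi : bD, normc (rp w xi) ^+ 2 = normc (rp w xi) ^+ 2 * \1_(setT `\` (K : set bD)) xi}.
  apply: filterS aeK => xi h; have [Kxi|nK] := pselect (K xi).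
    by rewrite h// normc0 expr0n mul0r.
  by rewrite indic_in ?mulr1.
by [].
Qed.

(** Needed to produce the reproducing kernel from its transform. The range of an isometry is
    complete, and the component of [w] orthogonal to it vanishes by [fourier_orthogonal]. *)
Lemma fourier2_surj w : exists f, fourier2 f = w.
Proof.
pose W : set (L2 mh) := range fourier2.
have f0 : fourier2 0 = 0 by apply: (hnorm_eq0 ipD); rewrite hnorm_fourier2 (hnorm0 ipG).
have sW : subspace W.
  split; first by exists 0.
  by move=> a _ _ [f _ <-] [g _ <-]; exists (a *: f + g) => //; rewrite fourier2_lin.
have cW : hcomplete dotD W.
  move=> s Ws cs.
  have /choice[t ht] : forall n, exists f, fourier2 f = s n.
    by move=> n; have [f _ <-] := Ws n; exists f.
  have dt f g : nmD (fourier2 f - fourier2 g) = nmG (f - g).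
    by rewrite -hnorm_fourier2 addrC -scaleN1r -fourier2_lin scaleN1r addrC.
  have ct : cauchy_seq dotG t.
    by move=> e /cs[N hN]; exists N => n k Nn Nk; rewrite -dt !ht; exact: hN.
  have [//|f _ cf] := L2_complete _ ct.
  exists (fourier2 f); first by exists f.
  by move=> e /cf[N hN]; exists N => n Nn; rewrite -ht dt; exact: hN.
have [_ [f _ <-] h] := projection_exists ipD sW cW w.
exists f; apply/esym/subr0_eq; apply: fourier_orthogonal => u Du.
by rewrite -fourier2_toL2//; apply: h; exists (toL2 m u).
Qed.

Lemma plancherel_dot u v : L1L2 u -> L1L2 v ->
  cI m (fun x => u x * (v x)^*) = cI mh (fun xi => fourier u xi * (fourier v xi)^*).
Proof.
move=> Du Dv; rewrite -L2inner_toL2; [|by case: Du|by case: Dv].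
by rewrite -dot_fourier2 !fourier2_toL2// L2inner_toL2//; exact: fourier_cLfun2.
Qed.

Lemma fourier_modulation u (gamma xi : Gd) :
  fourier (fun x : bG => (gamma (x : G))^* * u x) xi = fourier u (xi + gamma).
Proof.
apply: eq_cint => x; rewrite dualDE rmorphM [X in X * _]mulrC -mulrA; congr (_ * _).
exact: mulrC.
Qed.

Lemma modulation_cLfun2 u (gamma : Gd) : u \in cLfun m 2%:E ->
  (fun x : bG => (gamma (x : G))^* * u x) \in cLfun m 2%:E.
Proof.
move=> /cLfun2P[mu_ r2]; apply: (le_cLfun2 _ r2) => [|x].
  by apply: cmeasurableM => //; exact/cmeasurableJ/cmeasurable_char.
by rewrite Normc.normcM normcJ normc_char mul1r.
Qed.

Lemma fourier2_modulation f (gamma : Gd) :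
  fourier2 (toL2 m (fun x : bG => (gamma (x : G))^* * rp f x)) =
  toL2 mh (fun xi : bD => rp (fourier2 f) ((xi : Gd) + gamma)).
Proof.
have tD := @translation_dual R G.
apply: fourier2E; apply/is_fourier2P.
have /is_fourier2P[u [Du cu cw]] := fourier2_spec f.
have L2s w : (fun xi : bD => rp w ((xi : Gd) + gamma)) \in cLfun mh 2%:E.
  by apply: (cLfun2_shift haar_mh) => //; exact: rp_cLfun2.
have Dm n : L1L2 (fun x : bG => (gamma (x : G))^* * u n x).
  have [iu Lu] := Du n; split; last exact: modulation_cLfun2.
  by under eq_fun do rewrite mulrC; exact: cintegrable_char.
exists (fun n x => (gamma (x : G))^* * u n x); split => // e e0.
- have [N hN] := cu e e0; exists N => n /hN; congr (_ < _).
  have [_ Lu] := Du n; have [_ Lm] := Dm n; have Lf := rp_cLfun2 f; rewrite -{1}(toL2_rp f).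
  apply: eq_sqr; [exact: hnorm_ge0|exact: hnorm_ge0|].
  apply: etrans (toL2_dist Lu Lf).2 (etrans _ (esym (toL2_dist Lm (modulation_cLfun2 gamma Lf)).2)).
  apply: eq_Rintegral => x _.
  by rewrite -mulrBr Normc.normcM normcJ normc_char mul1r.
- have [N hN] := cw e e0; exists N => n /hN; congr (_ < _).
  have Lu := fourier_cLfun2 (Du n); have Lf := rp_cLfun2 (fourier2 f).
  have Lm := fourier_cLfun2 (Dm n); rewrite -{1}(toL2_rp (fourier2 f)).
  apply: eq_sqr; [exact: hnorm_ge0|exact: hnorm_ge0|].
  have [ri e1] := toL2_dist Lu Lf.
  apply: etrans e1 (etrans _ (esym (toL2_dist Lm (L2s (fourier2 f))).2)).
  rewrite -(Rint_shift haar_mh tD gamma ri); apply: eq_Rintegral => xi _.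
  by rewrite fourier_modulation.
Qed.

End plancherel.

(** * Reproducing kernels of band-limited functions *)

Section conjugation.
Context (R : realType).
Implicit Types (z w : R[i]).
Lemma conjM z w : (z * w)^* = z^* * w^*. Proof. exact: rmorphM. Qed.
Lemma conjK z : z^*^* = z. Proof. exact: conjcK. Qed.
Lemma conj_realC (x : R) : (x%:C)^* = x%:C. Proof. by apply: complex_eqP; rewrite /= ?oppr0. Qed.
End conjugation.

Section evaluation.
Context (R : realType) (G : PreTopologicalZmodule.type) (V : lmodType R[i]) (dot : V -> V -> R[i])
  (ip : inner_product dot) (K : G -> V).
Local Notation nm := (hnorm dot).
Implicit Types (f g : V) (y z : G).

(** Elements of [L2] are classes and have no values; the inner product with the kernel supplies a
    continuous function, shown by [rp_evaluation] to represent [f]. *)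
Definition evaluation f y : R[i] := dot f (K y).

Lemma normc_evaluation (c : R) (hnorm_kernel : forall y, nm (K y) ^+ 2 = c) f y :
  normc (evaluation f y) ^+ 2 <= c * nm f ^+ 2.
Proof.
rewrite -(hnorm_kernel y) -exprMn lerXn2r ?nnegrE ?normc_ge0 ?mulr_ge0 ?hnorm_ge0//.
by rewrite mulrC; exact: (cauchy_schwarz ip).
Qed.

Context (kernel_continuous : forall y (e : R), 0 < e -> \forall z \near y, nm (K z - K y) < e).

Lemma evaluation_continuous f : continuous (evaluation f : G -> R[i]^o).
Proof.
move=> y; apply/(cvg_normcP (nbhs_filter y)) => e e0.
pose M := nm f + 1; have M0 : 0 < M by rewrite ltr_wpDl// hnorm_ge0.
have := kernel_continuous y (divr_gt0 e0 M0); apply: filterS => z hz.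
rewrite /evaluation -(dotBr ip); apply: (le_lt_trans (cauchy_schwarz ip _ _)).
have := ler_wpM2l (hnorm_ge0 dot f) (ltW hz); have := divr_gt0 e0 M0.
have : e / M * M = e by rewrite divfK// gt_eqF.
rewrite {2}/M; set a := e / M; set b := nm f; set b' := nm _; nra.
Qed.

Lemma cmeasurable_evaluation f : cmeasurable (fun x : borel G => evaluation f (x : G)).
Proof. by apply: (continuous_cborel (f := evaluation f)); exact: evaluation_continuous. Qed.
End evaluation.

Section reproducing_kernel.
Context (R : realType) (G : topologicalZmodType)
  (hausdorffG : hausdorff_space G) (locally_compactG : locally_compact [set: G])
  (m : {measure set (borel G) -> \bar R}) (haar_m : haar_measure m)
  (mh : {measure set (borel (dual R G)) -> \bar R}) (dual_haar_mh : dual_haar_measure m mh)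
  (F : set (borel (dual R G))) (mF : measurable F) (F_fin : (0 < mh F < +oo)%E).
Local Notation Gd := (dual R G).
Local Notation bG := (borel G).
Local Notation bD := (borel Gd).
Local Notation rI mu h := (Rintegral mu setT h).
Local Notation cI := cintegral.
Local Notation fourier := (fourier m).
Local Notation cofourier := (cofourier mh).
Local Notation dotG := (@L2inner _ _ _ m).
Local Notation dotD := (@L2inner _ _ _ mh).
Local Notation nmG := (hnorm dotG).
Local Notation nmD := (hnorm dotD).
Local Notation ipG := (L2inner_product m).
Local Notation ipD := (L2inner_product mh).
Local Notation c := (fine (mh F)).
Implicit Types (u v : bG -> R[i]) (f g : L2 m) (w : L2 mh) (x y z : G).
Let haar_mh : haar_measure mh. Proof. by case: dual_haar_mh. Qed.

(* The Plancherel transform is kept abstract, since the unifier would otherwise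
   unfold it when comparing transforms of different functions. *)
Context (fourier2 : L2 m -> L2 mh)
  (fourier2_lin : forall (a : R[i]) f g, fourier2 (a *: f + g) = a *: fourier2 f + fourier2 g)
  (hnorm_fourier2 : forall f, nmD (fourier2 f) = nmG f)
  (fourier2_toL2 : forall u, L1L2 m u -> fourier2 (toL2 m u) = toL2 mh (fourier u)).

Local Notation H := [set f | {ae mh, forall xi : bD, ~ F xi -> rp (fourier2 f) xi = 0}].

Let dot_fourier2 f g : dotD (fourier2 f) (fourier2 g) = dotG f g.
Proof. exact: (isometry_dot ipG ipD). Qed.

Lemma bandwidth_gt0 : 0 < c.
Proof. by apply: fine_gt0. Qed.
Let c0 : 0 <= c. Proof. exact: ltW bandwidth_gt0. Qed.

Let iF : rintegrable mh (\1_F : bD -> R).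
Proof. by apply: rintegrable_indic => //; case/andP: F_fin. Qed.

Let fourier2B f g : fourier2 (f - g) = fourier2 f - fourier2 g.
Proof. by rewrite addrC -scaleN1r fourier2_lin scaleN1r addrC. Qed.

Lemma band_limited_subspace : subspace H.
Proof.
split=> [|a f g Hf Hg].
  have f0 : fourier2 0 = 0 by rewrite -(subrr (0 : L2 m)) fourier2B subrr.
  rewrite /= f0; by have := rp0 mh; apply: filterS => xi ->.
rewrite /= fourier2_lin.
have h : {ae mh, forall xi : bD, rp (a *: fourier2 f + fourier2 g) xi = a * rp (fourier2 f) xi + rp (fourier2 g) xi}.
  by apply: filterS2 (rpD (a *: fourier2 f) (fourier2 g)) (rpZ a (fourier2 f)) => xi -> ->.
apply: filterS3 Hf Hg h => xi h1 h2 -> nF.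
by rewrite (h1 nF) (h2 nF) mulr0 addr0.
Qed.

(** The transform of the limit [v] carries off [F] at most the mass of the transform of [s N - v],
    which tends to 0 by isometry. *)
Lemma band_limited_complete : hcomplete dotG H.
Proof.
move=> s Hs cs; have [//|v _ cv] := L2_complete _ cs; exists v => //.
have rv := rintegrable_rp (fourier2 v).
have mv := measurable_normc_sqr (rp_cmeasurable (fourier2 v)).
have mCF : measurable_fun setT (\1_(~` F) : bD -> R) by apply: measurable_indic; exact: measurableC.
have rind (h : bD -> R) : (forall xi, 0 <= h xi) -> rintegrable mh h -> rintegrable mh (fun xi => h xi * \1_(~` F) xi).
  move=> h0 rh; apply: (le_rintegrable _ rh).
    by apply: measurable_funM => //; exact: rintegrable_measurable rh.
  by move=> xi; rewrite normrM !ger0_norm// ler_piMr// indicE; case: (_ \in _).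
have e0 : rI mh (fun xi => normc (rp (fourier2 v) xi) ^+ 2 * \1_(~` F) xi) = 0.
  apply/eqP; rewrite eq_le Rint_ge0 ?andbT => [|xi]; last by rewrite mulr_ge0// sqr_ge0.
  apply: le_epsilon => e e0; rewrite add0r.
  pose d := Num.sqrt e; have d0 : 0 < d by rewrite sqrtr_gt0.
  have [N hN] := cv _ d0; have {}hN := hN N (leqnn N).
  have <- : d ^+ 2 = e by rewrite sqr_sqrtr// ltW.
  apply: (@le_trans _ _ (nmG (s N - v) ^+ 2)); last first.
    by rewrite lerXn2r// ?nnegrE ?hnorm_ge0 ?(ltW d0)// ltW.
  rewrite -hnorm_fourier2 fourier2B L2norm_sqr.
  have rs := rintegrable_rp (fourier2 (s N) - fourier2 v).
  apply: (@le_trans _ _ (rI mh (fun xi => normc (rp (fourier2 (s N) - fourier2 v) xi) ^+ 2 * \1_(~` F) xi))).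
    rewrite le_eqVlt; apply/orP; left; apply/eqP; apply: Rint_ae.
    - by apply: measurable_funM.
    - by apply: measurable_funM => //; exact: measurable_normc_sqr (rp_cmeasurable _).
    - have HN := Hs N.
      apply: filterS2 (rpB (fourier2 (s N)) (fourier2 v)) HN => xi -> h.
      have [Fxi|nF] := pselect (F xi); first by rewrite indic_out ?mulr0//; case.
      by rewrite (h nF) sub0r normcN.
  apply: le_Rint => // [|xi]; first by apply: rind => // xi; exact: sqr_ge0.
  by rewrite ler_piMr ?sqr_ge0// indicE; case: (_ \in _).
have := Rint_eq0 (rind _ (fun xi => sqr_ge0 _) rv) (fun xi => mulr_ge0 (sqr_ge0 _) (ler0n _ _)) e0.
apply: filterS => xi h nF; move: h; rewrite indic_in// mulr1 => /eqP.
by rewrite sqrf_eq0 => /eqP /Normc.eq0_normc.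
Qed.

(** The transform of the section at [y] of the kernel, [x] being sent to the integral over [F] of
    [xi (x - y)]. *)
Definition kernel_hat y : bD -> R[i] := fun xi => (\1_F xi)%:C * ((xi : Gd) y)^*.

Lemma normc_kernel_hat y xi : normc (kernel_hat y xi) = \1_F xi.
Proof. by rewrite Normc.normcM normcJ normc_char mulr1 normc_real ger0_norm. Qed.

Let indic_sqr (xi : bD) : \1_F xi ^+ 2 = \1_F xi :> R.
Proof. by rewrite indicE; case: (_ \in _); rewrite ?expr1n ?expr0n. Qed.

Lemma kernel_hat_cLfun2 y : kernel_hat y \in cLfun mh 2%:E.
Proof.
apply: (le_cLfun2 _ iF) => [|xi]; last by rewrite normc_kernel_hat indic_sqr.
by apply: cmeasurableM; [apply: cmeasurable_real; exact: measurable_indic|exact/cmeasurableJ/cmeasurable_eval].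
Qed.

Context (kernel : G -> L2 m)
  (fourier2_kernel : forall y, fourier2 (kernel y) = toL2 mh (kernel_hat y)).

Lemma kernel_in y : H (kernel y).
Proof.
rewrite /= fourier2_kernel; have := rp_toL2 (kernel_hat_cLfun2 y).
by apply: filterS => xi -> nF; rewrite /kernel_hat indic_out// mul0r.
Qed.

Local Notation evaluation := (evaluation dotG kernel).

Lemma evaluation_cofourier f y :
  evaluation f y = cofourier (fun xi => (\1_F xi)%:C * rp (fourier2 f) xi) y.
Proof.
rewrite /evaluation -dot_fourier2 fourier2_kernel.
rewrite (@L2inner_ae _ _ _ _ _ _ (rp (fourier2 f)) (kernel_hat y)).
- by apply: eq_cint => xi; rewrite /kernel_hat conjM conj_realC conjK mulrA [X in X * _]mulrC.
- exact: rp_cmeasurable.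
- by have /cLfun2P[] := kernel_hat_cLfun2 y.
- exact: aeW.
- exact: rp_toL2 (kernel_hat_cLfun2 y).
Qed.

Lemma dot_kernel y z : dotG (kernel y) (kernel z) = cofourier (fun xi => (\1_F xi)%:C) (z - y).
Proof.
rewrite -dot_fourier2 !fourier2_kernel L2inner_toL2 ?kernel_hat_cLfun2//.
apply: eq_cint => xi; rewrite /kernel_hat conjM conj_realC conjK charB.
rewrite mulrACA -[X in X * _]rmorphM -expr2 indic_sqr; congr (_ * _); exact: mulrC.
Qed.

Lemma hnorm_kernel y : nmG (kernel y) ^+ 2 = c.
Proof.
rewrite (hnorm_sqr ipG) dot_kernel subrr -Rint_indic//; apply: eq_Rintegral => xi _.
by rewrite char0 mulr1.
Qed.

(** Since all kernels have squared norm [c], the squared distance is [2 (c - Re <K_z, K_y>)], and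
    the inner product is a Fourier integral in [y - z]. *)
Lemma kernel_continuous y (e : R) : 0 < e -> \forall z \near y, nmG (kernel z - kernel y) < e.
Proof.
move=> e0; have e2 : 0 < e ^+ 2 / 2 by rewrite divr_gt0 ?exprn_gt0.
have iF' : cintegrable mh (fun xi : bD => (\1_F xi)%:C) by exact: cintegrable_real.
have cc : (cofourier (fun xi => (\1_F xi)%:C) (y - z) : R[i]^o) @[z --> y] -->
    (cofourier (fun xi => (\1_F xi)%:C) (y - y) : R[i]^o).
  have := cofourier_continuous locally_compactG haar_mh iF'.
  move=> h; apply: (@cvg_comp _ _ _ (fun z => y - z) (cofourier _) _ (nbhs (y - y))); last exact: h.
  apply: (@cvg_comp _ _ _ (fun z : G => (y, - z)) (fun z : G * G => z.1 + z.2) _ (nbhs (y, - y))).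
    by apply: cvg_pair; [exact: cvg_cst|exact: opp_continuous].
  exact: (@add_continuous G (y, - y)).
have := (cvg_normcP (nbhs_filter y) _ _).1 cc _ e2; apply: filterS => z hz.
rewrite -(ltr_pXn2r (ltn0Sn 1)) ?nnegrE ?hnorm_ge0 ?(ltW e0)//.
rewrite (hnormB_sqr ipG) !hnorm_kernel dot_kernel.
have h := le_lt_trans (le_trans (ler_norm _) (Re_le_normc _)) hz.
have cy : Re (cofourier (fun xi => (\1_F xi)%:C) (y - y)) = c.
  by rewrite -dot_kernel -(hnorm_sqr ipG) hnorm_kernel.
have := le_lt_trans (Re_le_normc _) hz; rewrite ltr_norml ReD ReN cy => /andP[h1 h2].
rewrite -[X in _ < X](_ : 2 * (e ^+ 2 / 2) = e ^+ 2); last by field.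
move: h1; lra.
Qed.

Let normc_evaluation := normc_evaluation ipG hnorm_kernel.
Let evaluation_continuous := evaluation_continuous ipG kernel_continuous.
Let cmeasurable_evaluation := cmeasurable_evaluation ipG kernel_continuous.

Let finite_indic (h : bG -> R) (e : R) : rintegrable m h -> 0 < e ->
  measurable [set x | e < `|h x|] /\ rintegrable m (\1_[set x | e < `|h x|] : bG -> R).
Proof.
move=> rh e0; have mhh := rintegrable_measurable rh.
have mB : measurable [set x | e < `|h x|].
  by apply: (measurable_lt_set (measurable_cst _)); exact: measurableT_comp.
split => //; apply: (le_rintegrable _ (rintegrableZ e^-1 (rintegrable_norm rh))).
  exact: measurable_indic.
move=> x; rewrite ger0_norm//; have [Bx|nB] := pselect ([set x | e < `|h x|] x).
  by rewrite indic_in// -(ler_pM2l e0) mulr1 mulVKf ?gt_eqF// ltW.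
by rewrite indic_out// mulr_ge0// invr_ge0 ltW.
Qed.

(** The pairing with [u] is moved to the dual group, where [f] may be multiplied by the indicator of
    [F], and back by [fourier_fubini]; the conjugations fit the sign convention of that lemma. *)
Let evaluation_weak f u : H f -> L1L2 m u ->
  cI m (fun x => rp f x * (u x)^*) = cI m (fun x : bG => evaluation f (x : G) * (u x)^*).
Proof.
move=> Hf Du; have [iu Lu] := Du; have Lfu := fourier_cLfun2 hausdorffG haar_m dual_haar_mh Du.
pose w (xi : bD) := (\1_F xi)%:C * rp (fourier2 f) xi.
have iw : cintegrable mh w.
  apply: cintegrable_mul (rp_cLfun2 _); apply: (le_cLfun2 _ iF) => [|xi].
    by apply: cmeasurable_real; exact: measurable_indic.
  by rewrite normc_real ger0_norm// indic_sqr.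
have wJ x : cofourier (fun xi => (w xi)^*) (- x) = (cofourier w x)^*.
  rewrite /cofourier -cintJ; last exact: cintegrable_eval.
  by apply: eq_cint => xi; rewrite conjM charN.
transitivity (dotG f (toL2 m u)).
  rewrite (@L2inner_ae _ _ _ _ _ _ (rp f) u)//; first exact: rp_cmeasurable.
  - by have /cLfun2P[] := Lu.
  - exact: aeW.
  - exact: rp_toL2.
rewrite -dot_fourier2 (fourier2_toL2 Du).
rewrite (@L2inner_ae _ _ _ _ _ _ w (fourier u)); last 4 first.
- exact: cintegrable_measurable iw.
- by have /cLfun2P[] := Lfu.
- apply: filterS Hf => xi h; rewrite /w; have [Fxi|nF] := pselect (F xi).
    by rewrite indic_in// mul1r.
  by rewrite indic_out// mul0r; exact: h.
- exact: rp_toL2.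
have iwu : cintegrable mh (fun xi => (w xi)^* * fourier u xi).
  exact: (cintegrable_fourier_mul hausdorffG haar_m iu (cintegrableJ iw)).
rewrite -[LHS]conjK -cintJ; last first.
  by have := cintegrableJ iwu; congr cintegrable; apply/funext => xi; rewrite conjM conjK.
rewrite (@eq_cint _ _ _ _ _ (fun xi => (w xi)^* * fourier u xi)) => [|xi]; last by rewrite conjM conjK.
rewrite (fourier_fubini hausdorffG locally_compactG haar_m haar_mh iu (cintegrableJ iw)).
rewrite -cintJ.
  by apply: eq_cint => x; rewrite conjM wJ conjK mulrC evaluation_cofourier.
exact: (cintegrable_cofourier_mul locally_compactG haar_mh iu (cintegrableJ iw)).
Qed.

(** The weak identity is tested with [u], the difference of the two functions cut off to the set
    where [|h| > e]. That set has finite measure and [evaluation f] is bounded, so that [u] is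
    admissible, and the integral of its squared modulus vanishes. *)
Let rp_evaluation_gt f (h : bG -> R) (e : R) : H f -> rintegrable m h -> 0 < e ->
  {ae m, forall x : bG, e < `|h x| -> rp f x = evaluation f (x : G)}.
Proof.
move=> Hf rh e0; have [mB rB] := finite_indic rh e0; set B := [set x | _] in mB rB.
have mD : cmeasurable (fun x : bG => rp f x - evaluation f (x : G)).
  by apply: cmeasurableB; [exact: rp_cmeasurable|exact: cmeasurable_evaluation].
have mu_ : cmeasurable (fun x : bG => (\1_B x)%:C * (rp f x - evaluation f (x : G))).
  by apply: cmeasurableM => //; apply: cmeasurable_real; exact: measurable_indic.
have rb : rintegrable m (fun x => 2 * normc (rp f x) ^+ 2 + 2 * (c * nmG f ^+ 2) * \1_B x).
  by apply: rintegrableD; apply: rintegrableZ => //; exact: rintegrable_rp.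
have nu x : normc ((\1_B x)%:C * (rp f x - evaluation f (x : G))) ^+ 2 <=
    2 * normc (rp f x) ^+ 2 + 2 * (c * nmG f ^+ 2) * \1_B x.
  rewrite Normc.normcM normc_real ger0_norm//.
  have [Bx|nB] := pselect (B x); last first.
    by rewrite indic_out// mul0r mulr0 addr0 expr0n/= mulr_ge0// sqr_ge0.
  rewrite indic_in// mul1r mulr1.
  have := le_normcD (rp f x) (- evaluation f x); rewrite normcN.
  have := normc_evaluation f x; have := normc_ge0 (rp f x - evaluation f x).
  set p := normc _; set q := normc _; set r := normc _; move=> p0 r2 pqr.
  have := sqr_ge0 (q - r); have : p ^+ 2 <= (q + r) ^+ 2.
    by apply: lerXn2r; rewrite ?nnegrE; lra.
  by rewrite sqrrB sqrrD; lra.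
pose u (x : bG) := (\1_B x)%:C * (rp f x - evaluation f (x : G)).
have Lu : u \in cLfun m 2%:E by exact: (le_cLfun2 mu_ rb).
have Du : L1L2 m u.
  split => //; have [_ r2] := (cLfun2P m u).1 Lu.
  apply: (le_cintegrable mu_ (rintegrableD rB r2)) => x.
  have [Bx|nB] := pselect (B x); last first.
    by rewrite {1}/u indic_out// mul0r normc0 add0r sqr_ge0.
  rewrite (indic_in _ Bx); set t := normc _; have -> : normc (u x) = t.
    by rewrite /u /t indic_in.
  by have := sqr_ge0 (t - 1); rewrite sqrrB; have := sqr_ge0 t; rewrite /t; lra.
have := evaluation_weak Hf Du => hw.
have i1 : cintegrable m (fun x => rp f x * (u x)^*).
  by apply: cintegrable_mul; [exact: rp_cLfun2|exact: cLfun2J].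
have i2 : cintegrable m (fun x : bG => evaluation f (x : G) * (u x)^*).
  have iu := cintegrableJ Du.1; have Mf : forall x : bG, normc (evaluation f (x : G)) <= c * nmG f ^+ 2 + 1.
    move=> x; have := normc_evaluation f x; have := sqr_ge0 (normc (evaluation f x) - 1).
    by rewrite sqrrB; have := sqr_ge0 (normc (evaluation f x)); lra.
  by have := cintegrableM_bounded iu (cmeasurable_evaluation f) Mf; congr cintegrable; apply/funext => x; rewrite mulrC.
have : cI m (fun x : bG => ((normc (u x)) ^+ 2)%:C) = 0.
  rewrite -(subrr (cI m (fun x => rp f x * (u x)^*))) {2}hw -cintB//; apply: eq_cint => x.
  rewrite -mulrBl -mulJ /u; set t := rp f x - _; have [Bx|nB] := pselect (B x).
    by rewrite indic_in// mul1r.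
  by rewrite indic_out// !mul0r conj_realC mulr0.
rewrite cint_real => /complexI h0.
have [_ r2] := (cLfun2P m u).1 Lu.
have := Rint_eq0 r2 (fun=> sqr_ge0 _) h0; apply: filterS => x /eqP; rewrite sqrf_eq0 => /eqP/Normc.eq0_normc; rewrite /u => + Bx.
by rewrite indic_in// mul1r => /subr0_eq.
Qed.

Let rp_evaluation_int f (h : bG -> R) : H f -> rintegrable m h ->
  {ae m, forall x : bG, h x != 0 -> rp f x = evaluation f (x : G)}.
Proof.
move=> Hf rh.
have : {ae m, forall x : bG, forall n : nat, n.+1%:R^-1 < `|h x| -> rp f x = evaluation f (x : G)}.
  by apply: ae_foralln => n; apply: rp_evaluation_gt.
apply: filterS => x hx; rewrite -normr_gt0 => h0.
have := @cvg_harmonic R => /cvgr0Pnorm_lt/(_ _ h0)[N _ /(_ N (leqnn N))] hN.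
by apply: (hx N); apply: le_lt_trans hN; exact: ler_norm.
Qed.

(* By inner regularity on open sets, [evaluation f] is supported by a
   sigma-finite set. *)
Lemma rp_evaluation f : H f -> {ae m, forall x : bG, rp f x = evaluation f (x : G)}.
Proof.
move=> Hf; pose U n : set G := [set x | n.+1%:R^-1 < normc (evaluation f x)].
have oU n : open (U n).
  rewrite openE => x Ux; have e0 : 0 < normc (evaluation f x) - n.+1%:R^-1 by rewrite subr_gt0.
  have ce : (evaluation f y : R[i]^o) @[y --> x] --> (evaluation f x : R[i]^o) by exact: evaluation_continuous.
  have := (cvg_normcP (nbhs_filter x) _ _).1 ce _ e0; apply: filterS => y hy.
  have := le_normcD (evaluation f x - evaluation f y) (evaluation f y); rewrite subrK normc_distC => h.
  have {}h : n.+1%:R^-1 < normc (evaluation f y) by move: (n.+1%:R^-1) hy h {Ux e0} => r; lra.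
  exact: h.
have mU n : measurable (U n : set bG) by exact: open_borel.
have rrp := rintegrable_rp f.
have on_set (A : set bG) : measurable A -> (m A < +oo)%E ->
    {ae m, forall x : bG, A x -> rp f x = evaluation f (x : G)}.
  move=> mA Aoo; have := rp_evaluation_int Hf (rintegrable_indic mA Aoo).
  by apply: filterS => x h Ax; apply: h; rewrite indic_in// oner_neq0.
(* Markov's inequality is available for [rp f] only, and agreement with [evaluation f] is so far
   known on sets of finite measure. It is therefore applied on compact subsets of the open set
   [U n]. *)
have Uoo n : (m (U n : set bG) < +oo)%E.
  pose C := n.+1%:R ^+ 2 * nmG f ^+ 2; apply: (@le_lt_trans _ _ C%:E); last exact: ltry.
  have [_ _ _ -> // _] := haar_m; apply: ge_ereal_sup => _ [K [cK KU] <-].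
  have mK : measurable (K : set bG) by exact: compact_borel.
  have Koo := haar_compact haar_m cK.
  have rK : rintegrable m (\1_(K : set bG) : bG -> R) by exact: rintegrable_indic.
  rewrite -(@fineK _ (m K)) ?ge0_fin_numE// lee_fin -Rint_indic//.
  rewrite /C L2norm_sqr -RintZ//.
  have me : measurable_fun setT (fun x : bG => n.+1%:R ^+ 2 * (normc (rp f x) ^+ 2 * \1_(K : set bG) x)).
    apply: measurable_funM => //; apply: measurable_funM; last exact: measurable_indic.
    exact: measurable_normc_sqr (rp_cmeasurable f).
  have me' : measurable_fun setT (fun x : bG => n.+1%:R ^+ 2 * (normc (evaluation f (x : G)) ^+ 2 * \1_(K : set bG) x)).
    apply: measurable_funM => //; apply: measurable_funM; last exact: measurable_indic.
    exact: measurable_normc_sqr (cmeasurable_evaluation f).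
  have le1 x : normc (rp f x) ^+ 2 * \1_(K : set bG) x <= normc (rp f x) ^+ 2.
    by rewrite ler_piMr ?sqr_ge0// indicE; case: (_ \in _).
  have r1 : rintegrable m (fun x : bG => n.+1%:R ^+ 2 * (normc (rp f x) ^+ 2 * \1_(K : set bG) x)).
    apply: (le_rintegrable me (rintegrableZ (n.+1%:R ^+ 2) rrp)) => x.
    rewrite ger0_norm; last first.
      exact: mulr_ge0 (sqr_ge0 _) (mulr_ge0 (sqr_ge0 _) (ler0n _ _)).
    by apply: ler_wpM2l; [exact: sqr_ge0|exact: le1].
  have ae1 : {ae m, forall x : bG, n.+1%:R ^+ 2 * (normc (rp f x) ^+ 2 * \1_(K : set bG) x) =
      n.+1%:R ^+ 2 * (normc (evaluation f (x : G)) ^+ 2 * \1_(K : set bG) x)}.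
    apply: filterS (on_set _ mK Koo) => x h; have [Kx|nK] := pselect ((K : set bG) x); first by rewrite (h Kx).
    by rewrite indic_out// !mulr0.
  apply: (@le_trans _ _ (rI m (fun x : bG => n.+1%:R ^+ 2 * (normc (rp f x) ^+ 2 * \1_(K : set bG) x)))).
    rewrite (Rint_ae me me' ae1); apply: le_Rint => //; first exact: rintegrable_ae ae1.
    move=> x; have [Kx|nK] := pselect ((K : set bG) x); last by rewrite indic_out// !mulr0.
    rewrite indic_in// mulr1 -exprMn.
    have := KU _ Kx; rewrite /U /= => h.
    rewrite -[leLHS](expr1n _ 2) lerXn2r ?nnegrE ?mulr_ge0 ?normc_ge0//.
    by rewrite mulrC -ler_pdivrMr// mul1r ltW.
  apply: le_Rint => //; first exact: rintegrableZ.
  by move=> x; apply: ler_wpM2l; [exact: sqr_ge0|exact: le1].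
have h1 : {ae m, forall x : bG, forall n, U n (x : G) -> rp f x = evaluation f (x : G)}.
  by apply: ae_foralln => n; exact: on_set.
(* The sets [U n] cover the points where the evaluation is nonzero; [h2] deals with those where
   [rp f] is nonzero. *)
have h2 := rp_evaluation_int Hf rrp.
apply: filterS2 h1 h2 => x h1 h2.
have [z|nz] := eqVneq (normc (evaluation f (x : G))) 0; last first.
  have p : 0 < normc (evaluation f (x : G)) by rewrite lt0r nz normc_ge0.
  have := @cvg_harmonic R => /cvgr0Pnorm_lt/(_ _ p)[N _ /(_ N (leqnn N))] hN.
  by apply: (h1 N); apply: le_lt_trans hN; exact: ler_norm.
have [z'|nz'] := eqVneq (normc (rp f x)) 0.
  by rewrite (Normc.eq0_normc z) (Normc.eq0_normc z').
by apply: h2; rewrite expf_neq0.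
Qed.

Lemma evaluation_cLfun2 f : H f -> (fun x : bG => evaluation f (x : G)) \in cLfun m 2%:E.
Proof.
move=> Hf; apply/cLfun2P; split; first exact: cmeasurable_evaluation.
apply: (rintegrable_ae _ (rintegrable_rp f)).
  exact: measurable_normc_sqr (cmeasurable_evaluation f).
by apply: filterS (rp_evaluation Hf) => x ->.
Qed.

Lemma dot_evaluation f g : H f -> H g ->
  dotG f g = cI m (fun x : bG => evaluation f (x : G) * (evaluation g (x : G))^*).
Proof.
move=> Hf Hg; apply: L2inner_ae; [exact: cmeasurable_evaluation|exact: cmeasurable_evaluation| |];
exact: rp_evaluation.
Qed.

Context (fourier2_modulation : forall f (gamma : Gd),
  fourier2 (toL2 m (fun x : bG => (gamma (x : G))^* * rp f x)) =
  toL2 mh (fun xi : bD => rp (fourier2 f) ((xi : Gd) + gamma))).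

Let toL2_shift (w : bD -> R[i]) (gamma : Gd) : w \in cLfun mh 2%:E ->
  toL2 mh (fun xi : bD => rp (toL2 mh w) ((xi : Gd) + gamma)) =
  toL2 mh (fun xi : bD => w ((xi : Gd) + gamma)).
Proof.
move=> Lw; have tD := @translation_dual R G; have Lr := rp_cLfun2 (toL2 mh w).
apply: subr0_eq; apply: (hnorm_eq0 ipD); apply: eq_sqr; [exact: hnorm_ge0|exact: lexx|].
apply: etrans (toL2_dist (cLfun2_shift haar_mh tD gamma Lr) (cLfun2_shift haar_mh tD gamma Lw)).2 _.
have [ri e1] := toL2_dist Lr Lw.
rewrite (Rint_shift haar_mh tD gamma ri) -e1 toL2_rp subrr (hnorm0 ipD).
by rewrite expr0n.
Qed.

Let shift (gamma : Gd) : set bD := [set xi | F ((xi : Gd) + gamma)].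

Definition autocorrelation (gamma : Gd) : R :=
  fine (mh (F `&` [set xi | F ((xi : Gd) + gamma)])).

Let mshift (gamma : Gd) : measurable (shift gamma).
Proof.
have := measurable_translation (@translation_dual R G) gamma measurableT mF.
by rewrite setTI.
Qed.

(** Multiplying by the conjugate of [gamma] translates the transform, so that on the dual group the
    integrand becomes the indicator of [F] times a translate of it. In other words, [<B K_y, K_y>]
    is a constant times the conjugate of [gamma y] when [B] compresses multiplication by that
    conjugate. *)
Lemma kernel_modulation (gamma : Gd) y :
  cI m (fun x : bG => (gamma (x : G))^* *
    (evaluation (kernel y) (x : G) * (evaluation (kernel y) (x : G))^*)) =
  (gamma y)^* * (autocorrelation gamma)%:C.
Proof.
have tD := @translation_dual R G.
have Lk := rp_cLfun2 (kernel y); have Lh := kernel_hat_cLfun2 y.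
transitivity (dotG (toL2 m (fun x : bG => (gamma (x : G))^* * rp (kernel y) x)) (kernel y)).
  rewrite (@L2inner_ae _ _ _ _ _ _ (fun x : bG => (gamma (x : G))^* * evaluation (kernel y) (x : G))
    (fun x : bG => evaluation (kernel y) (x : G))).
  - by apply: eq_cint => x; rewrite mulrA.
  - by apply: cmeasurableM; [exact/cmeasurableJ/cmeasurable_char|exact: cmeasurable_evaluation].
  - exact: cmeasurable_evaluation.
  - by apply: filterS2 (rp_toL2 (modulation_cLfun2 gamma Lk)) (rp_evaluation (kernel_in y)) => x -> ->.
  - exact: rp_evaluation (kernel_in y).
rewrite -dot_fourier2 fourier2_modulation fourier2_kernel toL2_shift//.
rewrite L2inner_toL2//; last exact: cLfun2_shift.
rewrite /autocorrelation -/(shift gamma) -Rint_indic; last by apply: measurableI.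
rewrite -cint_real -cintZ; last first.
  apply: cintegrable_real; apply: rintegrable_indic; first exact: measurableI.
  apply: le_lt_trans (proj2 (andP F_fin)); apply: le_measure_borel => //; exact: measurableI.
apply: eq_cint => xi; rewrite /kernel_hat dualDE !conjM conj_realC conjK.
have bb : ((xi : Gd) y)^* * (xi : Gd) y = 1 by rewrite mulrC mulJ normc_char expr1n.
have -> : \1_(F `&` shift gamma) xi = \1_F ((xi : Gd) + gamma) * \1_F xi :> R.
  by rewrite indicI /= mulrC.
transitivity ((gamma y)^* * ((\1_F ((xi : Gd) + gamma))%:C * (\1_F xi)%:C) * (((xi : Gd) y)^* * (xi : Gd) y)).
  by ring.
by rewrite bb mulr1 rmorphM.
Qed.

Lemma autocorrelation_ge0_le (gamma : Gd) : 0 <= autocorrelation gamma <= c.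
Proof.
rewrite /autocorrelation -/(shift gamma) fine_ge0 ?measure_ge0//=; have mI := measurableI _ _ mF (mshift gamma).
have h : (mh (F `&` shift gamma) <= mh F)%E.
  by apply: le_measure_borel => //; exact: subIsetl.
apply: fine_le => //; rewrite ge0_fin_numE//; last by case/andP: F_fin.
by apply: le_lt_trans h _; case/andP: F_fin.
Qed.

(** By [kernel_modulation] at 0 it is the Fourier transform of an integrable function, the squared
    modulus of the kernel at 0. *)
Lemma measurable_autocorrelation : measurable_fun setT (autocorrelation : bD -> R).
Proof.
have r2 : rintegrable m (fun x : bG => normc (evaluation (kernel 0) (x : G)) ^+ 2).
  by have [] := (cLfun2P m _).1 (evaluation_cLfun2 (kernel_in 0)).
have ir : cintegrable m (fun x : bG => (normc (evaluation (kernel 0) (x : G)) ^+ 2)%:C) by exact: cintegrable_real.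
have [mRe _] := cmeasurable_fourier hausdorffG haar_m ir.
rewrite (_ : (autocorrelation : bD -> R) = fun xi : bD => Re (fourier (fun x : bG => (normc (evaluation (kernel 0) (x : G)) ^+ 2)%:C) xi))//.
apply/funext => gamma; rewrite -[LHS]/(Re (autocorrelation gamma)%:C).
have := kernel_modulation gamma 0; rewrite char0 conj_realC mul1r => <-.
by congr Re; apply: eq_cint => x; rewrite mulJ mulrC.
Qed.

(** The left-hand side is the measure of the points of [F] that translation by [gamma] moves out of
    [F]; their translates lie in the symmetric difference. *)
Lemma autocorrelation_defect (gamma : Gd) :
  c - autocorrelation gamma <= fine (mh ([set xi + gamma | xi in (F : set Gd)] `+` F)).
Proof.
have mI := measurableI _ _ mF (mshift gamma).
have mFD : measurable (F `\` shift gamma) by exact: measurableD.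
set D := (_ `+` _); have tD := @translation_dual R G.
have Dpre : [set xi + gamma | xi in (F : set Gd)] = [set xi : Gd | F (xi - gamma)].
  apply/seteqP; split=> [_ [xi Fxi <-]|xi /= Fxi]; first by rewrite /= addrK.
  by exists (xi - gamma) => //; rewrite subrK.
have mS : measurable ([set xi + gamma | xi in (F : set Gd)] : set bD).
  rewrite Dpre; have := measurable_translation tD (- gamma) measurableT mF.
  by rewrite setTI.
have mD : measurable (D : set bD) by apply: measurableU; exact: measurableD.
have Foo : (mh F < +oo)%E by case/andP: F_fin.
pose S : set bD := [set xi + gamma | xi in (F : set Gd)].
have Soo : (mh S < +oo)%E.
  by have [_ _ _ _ ->] := haar_mh.
have Doo : (mh (D : set bD) < +oo)%E.
  apply: le_lt_trans (lte_add_pinfty Soo Foo).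
  have h : (mh (S `|` F) <= mh S + mh F)%E by exact: measureU2.
  by apply: le_trans h; apply: le_measure_borel => //; [exact: measurableU|move=> xi [[]|[]]; [left|right]].
have h1 : mh F = (mh (F `\` shift gamma) + mh (F `&` shift gamma))%E.
  exact: measureDI.
have h2 : (mh (F `\` shift gamma) <= mh (D : set bD))%E.
  rewrite -(pushforward_translation haar_mh gamma mD); apply: le_measure_borel => //.
    by have := measurable_translation tD gamma measurableT mD; rewrite setTI.
  by move=> xi [Fxi nF]; left; split => //; exists xi.
have f1 : mh (F `\` shift gamma) \is a fin_num.
  by rewrite ge0_fin_numE//; exact: le_lt_trans h2 Doo.
have f2 : mh (F `&` shift gamma) \is a fin_num.
  rewrite ge0_fin_numE//; apply: le_lt_trans Foo; apply: le_measure_borel => //; exact: subIsetl.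
rewrite h1 fineD// /autocorrelation -/(shift gamma) addrK; apply: fine_le => //.
by rewrite ge0_fin_numE.
Qed.

End reproducing_kernel.

(** * Traces in a reproducing kernel space *)

Lemma le_cint d (T : measurableType d) (R : realType) (mu : {measure set T -> \bar R})
    (f : T -> R[i]) (g : T -> R) :
  cmeasurable f -> rintegrable mu g -> (forall x, normc (f x) <= g x) ->
  normc (cintegral mu f) <= Rintegral mu setT g.
Proof.
move=> mf ig fg; have iff := le_cintegrable mf ig fg.
by apply: (le_trans (normc_cint iff)); apply: le_Rint => //; exact: rintegrable_normc.
Qed.

Lemma Rint_sum_in d (T : measurableType d) (R : realType) (mu : {measure set T -> \bar R})
    (I : eqType) (s : seq I) (F : I -> T -> R) :
  (forall i, i \in s -> rintegrable mu (F i)) -> rintegrable mu (fun x => \sum_(i <- s) F i x) /\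
  Rintegral mu setT (fun x => \sum_(i <- s) F i x) = \sum_(i <- s) Rintegral mu setT (F i).
Proof.
elim: s => [|i s IH] iF.
  under eq_fun do rewrite big_nil; rewrite big_nil Rint0; split => //; exact: rintegrable0.
have [|i1 e1] := IH; first by move=> j js; apply: iF; rewrite inE js orbT.
have i2 := iF i (mem_head _ _).
under eq_fun do rewrite big_cons; rewrite big_cons -e1 -RintD//.
by split => //; exact: rintegrableD.
Qed.

Lemma projB (R : realType) (V : lmodType R[i]) (dot : V -> V -> R[i]) (ip : inner_product dot) (A : {fset V}) u v : proj dot A (u - v) = proj dot A u - proj dot A v.
Proof.
rewrite /proj /comb -sumrB; apply: eq_bigr => e _.
by rewrite (dotBl ip) scalerBl.
Qed.

(** * Bounded operators and manipulations of unordered sums *)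

Section bounded_operators.
Context (R : realType) (V : lmodType R[i]) (dot : V -> V -> R[i])
  (H : set V) (sH : subspace H) (B : V -> V) (bB : bounded_operator dot H B).
Local Notation nm := (hnorm dot).
Implicit Types (u v : V) (A : {fset V}).

Lemma operator_in u : H u -> H (B u).
Proof. by case: bB => h _ _; exact: h. Qed.

Lemma operatorD u v : H u -> H v -> B (u + v) = B u + B v.
Proof. by move=> Hu Hv; case: bB => _ h _; rewrite -[in LHS](scale1r u) h// scale1r. Qed.

Lemma operator0 : B 0 = 0.
Proof. by have := operatorD sH.1 sH.1; rewrite addr0 -[LHS]addr0 => /addrI/esym. Qed.

Lemma operatorZ (a : R[i]) u : H u -> B (a *: u) = a *: B u.
Proof.
by move=> Hu; have B0 := operator0; case: bB => _ h _; rewrite -[in LHS](addr0 (a *: u)) (h a u 0 Hu sH.1) B0 addr0.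
Qed.

Lemma operatorB u v : H u -> H v -> B (u - v) = B u - B v.
Proof.
move=> Hu Hv; have HNv := subspaceZ (-1) sH Hv.
by rewrite -scaleN1r operatorD// operatorZ// scaleN1r.
Qed.

Lemma operator_comb A (a : V -> R[i]) : [set` A] `<=` H ->
  B (comb A a) = \sum_(e <- A) a e *: B e.
Proof.
move=> AH; rewrite /comb; have : forall e, e \in (A : seq V) -> H e by move=> e /AH.
elim: (A : seq V) => [|e s IH] hs; first by rewrite !big_nil operator0.
have He : H e by apply: hs; exact: mem_head.
have Hs i : i \in s -> H i by move=> si; apply: hs; rewrite inE si orbT.
rewrite !big_cons operatorD; last 2 first.
- exact: subspaceZ.
- by apply: (subspace_sum sH) => i si; apply: subspaceZ => //; exact: Hs.
by rewrite operatorZ// IH.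
Qed.

Lemma operator_norm : exists2 C : R, 0 <= C & forall u, H u -> nm (B u) <= C * nm u.
Proof.
case: bB => _ _ [C hC]; exists `|C| => // u Hu; apply: (le_trans (hC u Hu)).
by apply: ler_wpM2r; [exact: hnorm_ge0|exact: ler_norm].
Qed.

End bounded_operators.

Lemma eq_has_sum (R : realType) (V : lmodType R[i]) (E : set V) (a b : V -> R[i]) s :
  (forall e, E e -> a e = b e) -> has_sum E a s -> has_sum E b s.
Proof.
move=> ab /has_sumP h; apply/has_sumP => eps /h[A0 A0E hA]; exists A0 => // A AE A0A.
rewrite (_ : \sum_(e <- A) b e = \sum_(e <- A) a e); first exact: hA.
by apply: eq_big_seq => e eA; rewrite ab//; exact: AE.
Qed.

Lemma has_sum_real (R : realType) (V : lmodType R[i]) (E : set V) (a : V -> R) s :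
  has_sum E (fun e => (a e)%:C) s -> has_sum E (fun e => (a e)%:C) (Re s)%:C.
Proof.
move=> /has_sumP h; apply/has_sumP => eps /h[A0 A0E hA]; exists A0 => // A AE A0A.
apply: le_lt_trans (hA A AE A0A); rewrite -rmorph_sum -rmorphB normc_real.
by have := Re_le_normc ((\sum_(e <- A) a e)%:C - s); rewrite ReD ReN.
Qed.

Lemma has_sumB (R : realType) (V : lmodType R[i]) (E : set V) (a b : V -> R[i]) s t :
  has_sum E a s -> has_sum E b t -> has_sum E (fun e => a e - b e) (s - t).
Proof.
move=> /has_sumP ha /has_sumP hb; apply/has_sumP => eps e0.
have e2 : 0 < eps / 2 by rewrite divr_gt0.
have [A1 A1E h1] := ha _ e2; have [A2 A2E h2] := hb _ e2.
exists (A1 `|` A2)%fset => [e /=|A AE A12]; first by rewrite in_fsetU => /orP[/A1E|/A2E].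
have {}h1 : normc (\sum_(e <- A) a e - s) < eps / 2.
  by apply: h1 => // e eA; apply: A12; rewrite in_fsetU eA.
have {}h2 : normc (\sum_(e <- A) b e - t) < eps / 2.
  by apply: h2 => // e eA; apply: A12; rewrite in_fsetU eA orbT.
rewrite sumrB opprB addrCA -addrA addrA [X in normc X](_ : _ = (\sum_(e <- A) a e - s) - (\sum_(e <- A) b e - t)).
  by have := le_normcD (\sum_(e <- A) a e - s) (- (\sum_(e <- A) b e - t)); rewrite normcN; lra.
by rewrite opprB; ring.
Qed.

Lemma has_sum_le (R : realType) (V : lmodType R[i]) (E : set V) (a : V -> R[i]) s (C : R) :
  has_sum E a s -> (forall A : {fset V}, [set` A] `<=` E -> normc (\sum_(e <- A) a e) <= C) -> normc s <= C.
Proof.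
move=> /has_sumP h hC; apply: le_epsilon => eps /h[A AE hA].
have {}hA := hA A AE (fun e => id); have := hC A AE.
have := le_normcD (s - \sum_(e <- A) a e) (\sum_(e <- A) a e).
by rewrite subrK normc_distC; lra.
Qed.

Lemma comp_bounded_operator (R : realType) (V : lmodType R[i]) (dot : V -> V -> R[i]) (H : set V) (S T : V -> V) :
  bounded_operator dot H S -> bounded_operator dot H T -> bounded_operator dot H (S \o T).
Proof.
move=> bS bT; have [SH Sl _] := bS; have [TH Tl [D hD]] := bT.
have [C C0 hC] := operator_norm bS; split.
- by move=> u Hu; apply: SH; exact: TH.
- by move=> a u v Hu Hv /=; rewrite Tl// Sl//; exact: TH.
- exists (C * D) => u Hu; apply: (le_trans (hC _ (TH _ Hu))).
  by rewrite -mulrA; apply: ler_wpM2l => //; exact: hD.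
Qed.

(** * The trace formula in a reproducing kernel space *)

Section rkhs.
Context (R : realType) (G : PreTopologicalZmodule.type) (hausdorffG : hausdorff_space G)
  (m : {measure set (borel G) -> \bar R}) (haar_m : haar_measure m).
Context (V : lmodType R[i]) (dot : V -> V -> R[i]) (ip : inner_product dot)
  (H : set V) (sH : subspace H) (cH : hcomplete dot H)
  (K : G -> V) (KH : forall y, H (K y)) (c : R)
  (hnorm_K : forall y, hnorm dot (K y) ^+ 2 = c)
  (K_continuous : forall y (e : R), 0 < e -> \forall z \near y, hnorm dot (K z - K y) < e).
Local Notation bG := (borel G).
Local Notation nm := (hnorm dot).
Local Notation ev := (evaluation dot K).
Local Notation cI := (cintegral m).
Local Notation rI h := (Rintegral m setT h).
Implicit Types (f g u v : V) (E : set V) (A : {fset V}) (y z : G) (h : bG -> R).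

Let k := nm (K 0).
Let k0 : 0 <= k. Proof. exact: hnorm_ge0. Qed.
Let k2 : k ^+ 2 = c. Proof. exact: hnorm_K. Qed.
Let nK y : nm (K y) = k.
Proof. by apply: eq_sqr; [exact: hnorm_ge0|exact: k0|rewrite k2; exact: hnorm_K]. Qed.
Let c0 : 0 <= c. Proof. by rewrite -k2 sqr_ge0. Qed.

Lemma evaluation_le f y : normc (ev f y) <= k * nm f.
Proof. by rewrite -(nK y) mulrC; exact: (cauchy_schwarz ip). Qed.

Let mev f : cmeasurable (fun y : bG => ev f (y : G)).
Proof. exact: (cmeasurable_evaluation ip K_continuous). Qed.

(** Finitely many kernels [K y] are [eps / 2]-dense among those of [L], and the remainder of a
    projection never exceeds the norm of what is projected. *)
Lemma proj_uniform E (L : set G) (eps : R) : hilbert_basis dot H E -> compact L -> 0 < eps ->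
  exists2 A0 : {fset V}, [set` A0] `<=` E & forall A, [set` A] `<=` E -> {subset A0 <= A} ->
    forall y, L y -> nm (K y - proj dot A (K y)) < eps.
Proof.
move=> bE cL e0; have e2 : 0 < eps / 2 by rewrite divr_gt0.
have [_ oE _] := bE.
have /choice[N hN] : forall y, exists A0 : {fset V}, [set` A0] `<=` E /\
    forall A, [set` A] `<=` E -> {subset A0 <= A} -> nm (K y - proj dot A (K y)) < eps / 2.
  by move=> y; have [A0 ? ?] := parseval_proj ip sH cH bE (KH y) e2; exists A0.
have [|s _ hs] := @finite_cover _ L (fun y => [set z | nm (K z - K y) < eps / 2]) cL.
  by move=> y _; exact: K_continuous.
have [A0 A0E hA0] : exists2 A0 : {fset V}, [set` A0] `<=` E & forall y, y \in s -> {subset N y <= A0}.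
  elim: s {hs} => [|y s [A0 A0E hA0]]; first by exists fset0 => // e.
  exists (N y `|` A0)%fset.
    by move=> e /=; rewrite in_fsetU => /orP[/(hN y).1|/A0E].
  move=> z; rewrite inE => /orP[/eqP->|zs] e ez; rewrite in_fsetU ?ez//.
  by rewrite (hA0 z zs _ ez) orbT.
exists A0 => // A AE A0A z Lz; have [y ys /= zy] := hs z Lz.
have h1 : nm (K y - proj dot A (K y)) < eps / 2.
  by apply: (hN y).2 => // e ey; apply: A0A; exact: hA0 ey.
have h2 := hnorm_sub_proj_le ip (K z - K y) oE AE.
have -> : K z - proj dot A (K z) = (K y - proj dot A (K y)) + ((K z - K y) - proj dot A (K z - K y)).
  by rewrite (projB ip) opprB addrACA [K y + _]addrC subrK [- proj _ _ _ + _]addrC -addrA; congr (_ + _); rewrite addrC subrK.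
by have := hnormD ip (K y - proj dot A (K y)) ((K z - K y) - proj dot A (K z - K y)); lra.
Qed.

Section trace_formula.
Context (B : V -> V) (bB : bounded_operator dot H B).

Lemma kernel_form_continuous : continuous (fun y : G => dot (B (K y)) (K y) : R[i]^o).
Proof.
move=> y; apply/(cvg_normcP (nbhs_filter y)) => e e0.
have [C C0 hC] := operator_norm bB.
pose M := 2 * C * k + 1; have M0 : 0 < M by rewrite ltr_wpDl// !mulr_ge0.
have := K_continuous y (divr_gt0 e0 M0); apply: filterS => z hz.
have Hzy : H (K z - K y) by apply: (subspaceB sH).
have -> : dot (B (K z)) (K z) - dot (B (K y)) (K y) =
    dot (B (K z - K y)) (K z) + dot (B (K y)) (K z - K y).
  by rewrite (operatorB sH bB)// (dotBl ip) (dotBr ip) addrA subrK.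
apply: (le_lt_trans (le_normcD _ _)).
have h1 : normc (dot (B (K z - K y)) (K z)) <= C * nm (K z - K y) * k.
  apply: (le_trans (cauchy_schwarz ip _ _)); rewrite nK; apply: ler_wpM2r => //; exact: hC.
have h2 : normc (dot (B (K y)) (K z - K y)) <= C * k * nm (K z - K y).
  apply: (le_trans (cauchy_schwarz ip _ _)); apply: ler_wpM2r; first exact: hnorm_ge0.
  by rewrite -(nK y); exact: hC.
have : e / M * (2 * C * k + 1) = e by rewrite divfK// gt_eqF.
move: (divr_gt0 e0 M0) h1 h2 hz; have Ck := mulr_ge0 C0 k0.
set n := nm (K z - K y); move: (e / M) => a a0 h1 h2 hz.
have := ler_wpM2l Ck (ltW hz); lra.
Qed.

Let mB : cmeasurable (fun y : bG => dot (B (K (y : G))) (K (y : G))).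
Proof. exact: (continuous_cborel kernel_form_continuous). Qed.

Lemma kernel_form_le : exists2 C : R, 0 <= C & forall y, normc (dot (B (K y)) (K y)) <= C * c.
Proof.
have [C C0 hC] := operator_norm bB; exists C => // y.
apply: (le_trans (cauchy_schwarz ip _ _)); rewrite nK -k2 expr2 mulrA.
by apply: ler_wpM2r => //; rewrite -(nK y); exact: hC.
Qed.

Lemma sum_evaluation E A y : hilbert_basis dot H E -> [set` A] `<=` E ->
  \sum_(e <- A) ev (B e) y * (ev e y)^* = dot (B (proj dot A (K y))) (K y).
Proof.
move=> [EH oE _] AE; rewrite /proj (operator_comb sH bB); last by move=> e /AE /EH.
rewrite (dot_suml ip); apply: eq_bigr => e _.
by rewrite (dotZl ip) mulrC /evaluation -(dotC ip).
Qed.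

Lemma cintegrable_ev h f g : rintegrable m h ->
  cintegrable m (fun y : bG => (h y)%:C * (ev f (y : G) * (ev g (y : G))^*)).
Proof.
move=> ih; apply: (cintegrableM_bounded (cintegrable_real ih) (C := k * nm f * (k * nm g))).
  by apply: cmeasurableM => //; exact: cmeasurableJ.
by move=> y; rewrite Normc.normcM normcJ ler_pM ?normc_ge0// evaluation_le.
Qed.

(** Over a finite set [A] the integrand at [y] is [h y] times [<B P_A K_y, K_y>], which converges
    uniformly on compact sets, while [h] has little mass elsewhere. It is used three times: [B] the
    functional calculus gives the trace, [B] the identity the total mass of the densities, and [B]
    the compression of a conjugate character the transform of the eigenvalue density. *)
Lemma trace_formula E h : hilbert_basis dot H E -> rintegrable m h ->
  has_sum E (fun e => cI (fun y : bG => (h y)%:C * (ev (B e) (y : G) * (ev e (y : G))^*)))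
    (cI (fun y : bG => (h y)%:C * dot (B (K (y : G))) (K (y : G)))).
Proof.
move=> bE ih; apply/has_sumP => eps e0.
have [EH oE _] := bE; have [C C0 hC] := operator_norm bB.
pose N := rI (fun y => `|h y|); have N0 : 0 <= N by apply: Rint_ge0.
(* The error is at most [C * k * d * N] on [L] and [C * c * d] off [L]. *)
pose M := C * k * N + C * c + 1.
have M0 : 0 < M by rewrite ltr_wpDl// addr_ge0// ?mulr_ge0.
pose d := eps / M; have d0 : 0 < d by rewrite divr_gt0.
have inh := rintegrable_norm ih.
have [L [cL _ hL]] := L1_regular hausdorffG haar_m inh (fun x => normr_ge0 _) measurableT d0.
have [A0 A0E hA0] := proj_uniform bE cL d0.
exists A0 => // A AE A0A.
have iT : cintegrable m (fun y : bG => (h y)%:C * dot (B (K (y : G))) (K (y : G))).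
  have [C' _ hC'] := kernel_form_le.
  exact: (cintegrableM_bounded (cintegrable_real ih) mB hC').
rewrite -cint_sum; last by move=> e; exact: cintegrable_ev.
rewrite -cintB//; last by apply: cintegrable_sum => e; exact: cintegrable_ev.
have Hp y : H (proj dot A (K y)) by exact: proj_subspace sH EH AE.
have mL : measurable (L : set bG) by exact: compact_borel.
have iL : rintegrable m (fun y => `|h y| * \1_(setT `\` (L : set bG)) y).
  apply: (le_rintegrable _ inh).
    apply: measurable_funM; first exact: rintegrable_measurable inh.
    by apply: measurable_indic; exact: measurableD.
  by move=> y; rewrite ger0_norm ?mulr_ge0// ler_piMr// indicE; case: (_ \in _).
apply: (@le_lt_trans _ _ (rI (fun y => C * k * d * `|h y| + C * c * (`|h y| * \1_(setT `\` (L : set bG)) y)))).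
  apply: le_cint.
  - apply: cmeasurableB; last exact: cintegrable_measurable iT.
    by apply: (@cintegrable_measurable _ _ _ m); apply: cintegrable_sum => e; exact: cintegrable_ev.
  - by apply: rintegrableD; apply: rintegrableZ.
  move=> y; rewrite -mulr_sumr (sum_evaluation _ bE AE) -mulrBr -(dotBl ip) -(operatorB sH bB)//.
  rewrite Normc.normcM normc_real.
  have Hd : H (proj dot A (K y) - K y) by apply: (subspaceB sH).
  have h1 : normc (dot (B (proj dot A (K y) - K y)) (K y)) <= C * nm (K y - proj dot A (K y)) * k.
    apply: (le_trans (cauchy_schwarz ip _ _)); rewrite nK; apply: ler_wpM2r => //.
    by rewrite (hnorm_distC ip (K y)); exact: hC.
  have hy := normr_ge0 (h y).
  have [Ly|nL] := pselect ((L : set bG) y).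
    rewrite indic_out ?mulr0 ?addr0; last by case.
    rewrite mulrC; apply: ler_wpM2r => //; apply: (le_trans h1); rewrite mulrAC.
    by apply: ler_wpM2l; [exact: mulr_ge0|exact/ltW/(hA0 A)].
  rewrite indic_in// mulr1.
  have h2 : normc (dot (B (proj dot A (K y) - K y)) (K y)) <= C * c.
    apply: (le_trans h1); rewrite -k2 expr2 mulrA; apply: ler_wpM2r => //.
    by apply: ler_wpM2l => //; rewrite -(nK y); exact: (hnorm_sub_proj_le ip _ oE AE).
  have := ler_wpM2l hy h2; have := mulr_ge0 (mulr_ge0 (mulr_ge0 C0 k0) (ltW d0)) hy; lra.
rewrite RintD; [|exact: rintegrableZ|exact: rintegrableZ].
rewrite !RintZ// -/N.
have dM : d * M = eps by rewrite divfK// gt_eqF.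
have := ler_wpM2l (mulr_ge0 C0 c0) (ltW hL); move: dM; rewrite /M; lra.
Qed.

End trace_formula.

(** * Toeplitz operators *)

Section toeplitz.
Context (evaluation_cLfun2 : forall f, H f -> (fun y : bG => ev f (y : G)) \in cLfun m 2%:E)
  (dot_evaluation : forall f g, H f -> H g ->
    dot f g = cI (fun y : bG => ev f (y : G) * (ev g (y : G))^*)).
Context (sigma : bG -> R) (sigma1 : rintegrable m sigma)
  (T : V -> V) (bT : bounded_operator dot H T)
  (dotT : forall f g, H f -> H g ->
    dot (T f) g = cI (fun y : bG => (sigma y)%:C * (ev f (y : G) * (ev g (y : G))^*))).

Lemma toeplitz_selfadjoint u v : H u -> H v -> dot (T u) v = dot u (T v).
Proof.
move=> Hu Hv; rewrite [RHS](dotC ip) !dotT// -cintJ; last exact: cintegrable_ev.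
by apply: eq_cint => y; rewrite !conjM conj_realC conjK [X in _ = _ * X]mulrC.
Qed.

(* [u] orthogonal to finitely many [K y] is small on a compact set carrying most
   of the mass of [sigma]. *)
Lemma toeplitz_compact : compact_operator dot H T.
Proof.
move=> eps e0; pose N := rI (fun y => `|sigma y|); have N0 : 0 <= N by apply: Rint_ge0.
pose M := k * N + c + 1; have M0 : 0 < M by rewrite ltr_wpDl// addr_ge0// mulr_ge0.
have d0 : 0 < eps / M by rewrite divr_gt0.
have dM : eps / M * (k * N + c + 1) = eps by rewrite divfK// gt_eqF.
move: (eps / M) d0 dM => d d0 dM.
have inh := rintegrable_norm sigma1.
have [L [cL _ hL]] := L1_regular hausdorffG haar_m inh (fun x => normr_ge0 _) measurableT d0.
have [|s _ hs] := @finite_cover _ L (fun y => [set z | nm (K z - K y) < d]) cL.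
  by move=> y _; exact: K_continuous.
exists (map K s) => [_ /mapP[y _ ->]//|u Hu us].
have HTu := operator_in bT Hu.
suff : nm (T u) ^+ 2 <= eps * nm u * nm (T u).
  have [->|nz] := eqVneq (nm (T u)) 0; first by rewrite mulr_ge0 ?hnorm_ge0// ltW.
  by rewrite expr2 ler_pM2r// lt0r nz hnorm_ge0.
have small y : L y -> normc (ev u y) <= d * nm u.
  move=> /hs[z zs /= yz]; rewrite /evaluation -[K y](subrK (K z)) (dotDr ip).
  rewrite (us (K z)) ?map_f// addr0 mulrC; apply: (le_trans (cauchy_schwarz ip _ _)).
  by apply: ler_wpM2l; [exact: hnorm_ge0|exact: ltW].
have mL : measurable (L : set bG) by exact: compact_borel.
have iL : rintegrable m (fun y => `|sigma y| * \1_(setT `\` (L : set bG)) y).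
  apply: (le_rintegrable _ inh).
    apply: measurable_funM; first exact: rintegrable_measurable inh.
    by apply: measurable_indic; exact: measurableD.
  by move=> y; rewrite ger0_norm ?mulr_ge0// ler_piMr// indicE; case: (_ \in _).
rewrite (hnorm_sqr ip); apply: (le_trans (ler_norm _)); apply: (le_trans (Re_le_normc _)).
rewrite dotT//.
set U := nm u; set W := nm (T u).
have U0 : 0 <= U by exact: hnorm_ge0. have W0 : 0 <= W by exact: hnorm_ge0.
apply: (@le_trans _ _ (rI (fun y => d * U * (k * W) * `|sigma y| + c * U * W * (`|sigma y| * \1_(setT `\` (L : set bG)) y)))).
  apply: le_cint.
  - exact: cintegrable_measurable (cintegrable_ev _ _ sigma1).
  - by apply: rintegrableD; exact: rintegrableZ.
  move=> y; rewrite Normc.normcM normc_real Normc.normcM normcJ mulrC.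
  have h1 : normc (ev (T u) y) <= k * W by exact: evaluation_le.
  have h2 : normc (ev u y) <= k * U by exact: evaluation_le.
  have hy := normr_ge0 (sigma y).
  have [Ly|nL] := pselect ((L : set bG) y).
    rewrite indic_out ?mulr0 ?addr0; last by case.
    by apply: ler_wpM2r => //; apply: ler_pM; rewrite ?normc_ge0//; exact: small.
  rewrite indic_in// mulr1; have := ler_pM (normc_ge0 _) (normc_ge0 _) h2 h1.
  rewrite mulrACA -expr2 k2 => h; have := ler_wpM2r hy h.
  by have := mulr_ge0 (mulr_ge0 (mulr_ge0 (ltW d0) U0) (mulr_ge0 k0 W0)) hy; lra.
rewrite RintD; [|exact: rintegrableZ|exact: rintegrableZ].
rewrite !RintZ// -/N.
have cUW : 0 <= c * (U * W) by rewrite !mulr_ge0.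
have := ler_wpM2l cUW (ltW hL).
have := mulr_ge0 (ltW d0) (mulr_ge0 U0 W0).
have -> : eps * U * W = d * (k * N + c + 1) * (U * W) by rewrite dM; ring.
lra.
Qed.

Lemma toeplitz_spectral : exists2 E, hilbert_basis dot H E &
  exists lam : V -> R, forall e, E e -> T e = (lam e)%:C *: e.
Proof. exact: (spectral_theorem ip sH bT toeplitz_selfadjoint toeplitz_compact cH). Qed.

Context (E : set V) (bE : hilbert_basis dot H E) (lam : V -> R)
  (TE : forall e, E e -> T e = (lam e)%:C *: e).
Let EH e : E e -> H e. Proof. by case: bE => h _ _; exact: h. Qed.
Let oE : orthonormal dot E. Proof. by case: bE. Qed.

Lemma dot_toeplitz_basis u e : H u -> E e -> dot (T u) e = (lam e)%:C * dot u e.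
Proof.
move=> Hu Ee; rewrite toeplitz_selfadjoint//; last exact: EH.
by rewrite TE// (dotZr ip) conj_realC.
Qed.

Definition density e (y : bG) : R := normc (ev e (y : G)) ^+ 2.

Lemma density_ge0 e y : 0 <= density e y. Proof. exact: sqr_ge0. Qed.

Lemma measurable_density e : measurable_fun setT (density e).
Proof. exact: measurable_normc_sqr. Qed.

Lemma density_le e y : E e -> density e y <= c.
Proof.
move=> Ee; have := normc_evaluation ip hnorm_K e y.
by rewrite (hnorm_orthonormal ip oE Ee) expr1n mulr1.
Qed.

Lemma sum_density_le A (y : bG) : [set` A] `<=` E -> \sum_(e <- A) density e y <= c.
Proof.
move=> AE; have := bessel ip (K (y : G)) oE AE; rewrite hnorm_K; apply: le_trans.
apply: ler_sum => e _; rewrite /density /evaluation (dotC ip (K (y : G)) e) normcJ.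
exact: lexx.
Qed.

Lemma rintegrable_density e : E e -> rintegrable m (density e).
Proof. by move=> Ee; have [] := (cLfun2P m _).1 (evaluation_cLfun2 (EH Ee)). Qed.

Lemma Rint_density e : E e -> rI (density e) = 1.
Proof.
move=> Ee; have := dot_evaluation (EH Ee) (EH Ee); rewrite oE// eqxx.
rewrite (@eq_cint _ _ _ _ _ (fun y : bG => (density e y)%:C)) => [|y]; last by rewrite mulJ.
by rewrite cint_real => /(congr1 (@Re _)).
Qed.

Lemma rintegrable_densityM e h : E e -> rintegrable m h -> rintegrable m (fun y => h y * density e y).
Proof.
move=> Ee ih; apply: (le_rintegrable _ (rintegrableZ c (rintegrable_norm ih))).
  by apply: measurable_funM; [exact: rintegrable_measurable ih|exact: measurable_density].
move=> y; rewrite normrM (ger0_norm (density_ge0 e y)) mulrC.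
by apply: ler_wpM2r => //; exact: density_le.
Qed.

Lemma eigenvalueE e : E e -> lam e = rI (fun y => sigma y * density e y).
Proof.
move=> Ee; have := dotT (EH Ee) (EH Ee); rewrite TE// (dotZl ip) oE// eqxx mulr1.
rewrite (@eq_cint _ _ _ _ _ (fun y : bG => (sigma y * density e y)%:C)) => [|y].
  by rewrite cint_real => /complexI.
by rewrite mulJ -rmorphM.
Qed.

Lemma has_sum_density h : rintegrable m h ->
  has_sum E (fun e => (rI (fun y => h y * density e y))%:C) (c * rI h)%:C.
Proof.
move=> ih; have bid : bounded_operator dot H id by split => //; exists 1 => u _; rewrite mul1r.
have := trace_formula bid bE ih.
rewrite (@eq_cint _ _ _ _ _ (fun y : bG => (c * h y)%:C)) => [|y].
  rewrite cint_real RintZ//; apply: eq_has_sum => e Ee.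
  by rewrite -cint_real; apply: eq_cint => y; rewrite mulJ -rmorphM.
by rewrite (dot_self ip) hnorm_K -rmorphM mulrC.
Qed.

Lemma sum_Rint_density_le A h : [set` A] `<=` E -> rintegrable m h -> (forall y, 0 <= h y) ->
  \sum_(e <- A) rI (fun y => h y * density e y) <= c * rI h.
Proof.
move=> AE ih h0.
have [|iS <-] := @Rint_sum_in _ _ _ m _ (A : seq V) (fun e y => h y * density e y).
  by move=> e /AE Ee; exact: rintegrable_densityM.
rewrite -RintZ//; under eq_Rintegral do rewrite -mulr_sumr.
have mS : measurable_fun setT (fun y : bG => h y * \sum_(e <- A) density e y).
  apply: measurable_funM; first exact: rintegrable_measurable ih.
  by apply: measurable_sum => e; exact: measurable_density.
have hle y : h y * \sum_(e <- A) density e y <= c * h y.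
  by rewrite [leRHS]mulrC; apply: ler_wpM2l => //; exact: sum_density_le.
apply: le_Rint => //; last exact: rintegrableZ.
apply: (le_rintegrable mS (rintegrableZ c ih)) => y; rewrite ger0_norm//.
by rewrite mulr_ge0// sumr_ge0// => e _; exact: density_ge0.
Qed.

Lemma eigenvalue_ge a e : E e -> (forall y, a <= sigma y) -> a <= lam e.
Proof.
move=> Ee ha; rewrite eigenvalueE// -[a]mulr1 -(Rint_density Ee) -RintZ ?rintegrable_density//.
apply: le_Rint => [||y]; [by apply: rintegrableZ; exact: rintegrable_density|exact: rintegrable_densityM|].
by apply: ler_wpM2r => //; exact: density_ge0.
Qed.

Lemma eigenvalue_le a e : E e -> (forall y, sigma y <= a) -> lam e <= a.
Proof.
move=> Ee ha; rewrite eigenvalueE// -[a]mulr1 -(Rint_density Ee) -RintZ ?rintegrable_density//.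
apply: le_Rint => [||y]; [exact: rintegrable_densityM|by apply: rintegrableZ; exact: rintegrable_density|].
by apply: ler_wpM2r => //; exact: density_ge0.
Qed.

Lemma normr_eigenvalue_le e : E e -> `|lam e| <= rI (fun y => `|sigma y| * density e y).
Proof.
move=> Ee; rewrite eigenvalueE//; apply: (le_trans (le_norm_Rint (rintegrable_densityM Ee sigma1))).
rewrite le_eqVlt; apply/orP; left; apply/eqP; apply: eq_Rintegral => y _.
by rewrite normrM (ger0_norm (density_ge0 e y)).
Qed.

Lemma sum_eigenvalue_le A : [set` A] `<=` E -> \sum_(e <- A) `|lam e| <= c * rI (fun y => `|sigma y|).
Proof.
move=> AE; apply: le_trans (sum_Rint_density_le AE (rintegrable_norm sigma1) (fun y => normr_ge0 _)).
rewrite big_seq [leRHS]big_seq; apply: ler_sum => e eA; apply: normr_eigenvalue_le; exact: AE.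
Qed.

Lemma eigenvalue_bounded e : E e -> `|lam e| <= c * rI (fun y => `|sigma y|).
Proof.
move=> Ee; have := @sum_eigenvalue_le [fset e]%fset; rewrite big_seq_fset1; apply.
by move=> x /=; rewrite in_fset1 => /eqP ->.
Qed.

Section trace.
Context (psi : R -> R) (C : R) (C0 : 0 <= C) (psiC : forall e, E e -> `|psi (lam e)| <= C)
  (B : V -> V) (bB : bounded_operator dot H B)
  (dotB : forall u e, H u -> E e -> dot (B u) e = (psi (lam e))%:C * dot u e).

Let S := T \o B.
Let bS : bounded_operator dot H S. Proof. exact: comp_bounded_operator. Qed.

Let dotS u e : H u -> E e -> dot (S u) e = (lam e * psi (lam e))%:C * dot u e.
Proof.
move=> Hu Ee; rewrite /S /= dot_toeplitz_basis//; last exact: operator_in bB _ Hu.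
by rewrite dotB// mulrA rmorphM.
Qed.

Let phi e := `|lam e * psi (lam e)|.
Let M := c * rI (fun y => `|sigma y|) * C.
Let M0 : 0 <= M. Proof. by rewrite !mulr_ge0//; apply: Rint_ge0. Qed.
Let phiM e : E e -> `|phi e| <= M.
Proof.
by move=> Ee; rewrite normr_id normrM ler_pM//; [exact: eigenvalue_bounded|exact: psiC].
Qed.

Lemma sum_trace_le A : [set` A] `<=` E -> \sum_(e <- A) `|lam e * psi (lam e)| <= M.
Proof.
move=> AE; apply: (@le_trans _ _ (\sum_(e <- A) `|lam e| * C)).
  rewrite big_seq [leRHS]big_seq; apply: ler_sum => e /AE Ee.
  by rewrite normrM; apply: ler_wpM2l => //; exact: psiC.
by rewrite -mulr_suml; apply: ler_wpM2r => //; exact: sum_eigenvalue_le.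
Qed.

(** The absolute value of [S] is the diagonal operator with entries [|lam e * psi (lam e)|]. They
    are summable because [psi] is bounded on the eigenvalues and [sum_e |lam e|] is at most [c]
    times the L^1 norm of [sigma]. *)
Lemma toeplitz_trace_class : trace_class dot H S.
Proof.
have Ad u e : E e -> dot (diagonal dot H E phi u) e = (phi e)%:C * dot u e.
  exact: (dot_diagonal ip sH cH bE M0 phiM).
have AH u : H (diagonal dot H E phi u) by exact: (diagonal_in ip sH cH bE M0 phiM).
split => //; exists (diagonal dot H E phi); split.
- exact: (diagonal_positive ip sH cH bE M0 phiM (fun e _ => normr_ge0 _)).
- move=> u v Hu Hv; apply: (parseval_eq ip sH cH bE) => //; try exact: (operator_in bS).
  move=> e Ee; rewrite !Ad// !dotS// !conjM !conj_realC mulrACA [RHS]mulrACA -!rmorphM.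
  by congr (_%:C * _); rewrite -!expr2 real_normK// num_real.
- exists E => //; have [s [hs _ _]] := has_sum_ge0 (a := phi) (C := M) (fun e _ => normr_ge0 _) sum_trace_le.
  exists s%:C; apply: eq_has_sum hs => e Ee.
  by rewrite Ad// oE// eqxx mulr1.
Qed.

(** By definition of [T], the diagonal entries of [T B] in any basis are integrals of [sigma]
    against products of evaluations; [trace_formula] sums them to a value free of the basis, which
    the basis of eigenvectors then expresses by eigenvalues. *)
Lemma toeplitz_traceE : exists t : R, trace dot H S = t%:C /\
  has_sum E (fun e => (lam e * psi (lam e))%:C) t%:C.
Proof.
set t := cI (fun y : bG => (sigma y)%:C * dot (B (K (y : G))) (K (y : G))).
have tr E' : hilbert_basis dot H E' -> has_sum E' (fun e => dot (S e) e) t.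
  move=> bE'; have := trace_formula bB bE' sigma1; apply: eq_has_sum => e E'e.
  have He : H e by case: bE' => h _ _; exact: h.
  by rewrite /S /= dotT//; exact: operator_in bB _ He.
have hE : has_sum E (fun e => (lam e * psi (lam e))%:C) t.
  by apply: eq_has_sum (tr E bE) => e Ee; rewrite dotS ?oE ?eqxx ?mulr1//; exact: EH.
exists (Re t); split; last exact: has_sum_real.
rewrite (has_sum_unique (has_sum_real hE) hE); exact: traceE bE tr.
Qed.

End trace.

(** * Variances, the error of the trace, and the second moment *)

Section second_moment.
Context (c_gt0 : 0 < c) (sigma2 : rintegrable m (fun y => sigma y ^+ 2)).
Let N1 := rI (fun y => `|sigma y|).
Let N2 := rI (fun y => sigma y ^+ 2).

Let rvar e : E e -> rintegrable m (fun y => (lam e - sigma y) ^+ 2 * density e y) /\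
  rI (fun y => (lam e - sigma y) ^+ 2 * density e y) =
    rI (fun y => sigma y ^+ 2 * density e y) - lam e ^+ 2.
Proof.
move=> Ee; have i1 := rintegrableZ (lam e ^+ 2) (rintegrable_density Ee).
have i2 := rintegrableZ (2 * lam e) (rintegrable_densityM Ee sigma1).
have i3 := rintegrable_densityM Ee sigma2.
have e1 : (fun y => (lam e - sigma y) ^+ 2 * density e y) = (fun y =>
    (lam e ^+ 2 * density e y - 2 * lam e * (sigma y * density e y)) + sigma y ^+ 2 * density e y).
  by apply/funext => y; ring.
rewrite e1; split; first by apply: rintegrableD => //; exact: rintegrableB.
rewrite RintD//; last exact: rintegrableB.
rewrite RintB// RintZ ?RintZ//; [|exact: rintegrable_densityM|exact: rintegrable_density].
by rewrite -eigenvalueE// Rint_density//; ring.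
Qed.

Lemma eigenvalue_sqr_le e : E e -> lam e ^+ 2 <= rI (fun y => sigma y ^+ 2 * density e y).
Proof.
move=> Ee; rewrite -subr_ge0 -(rvar Ee).2; apply: Rint_ge0 => y.
by rewrite mulr_ge0 ?sqr_ge0 ?density_ge0.
Qed.

Lemma sum_eigenvalue_sqr_le A : [set` A] `<=` E -> \sum_(e <- A) lam e ^+ 2 <= c * N2.
Proof.
move=> AE; apply: le_trans (sum_Rint_density_le AE sigma2 (fun y => sqr_ge0 _)).
rewrite big_seq [leRHS]big_seq; apply: ler_sum => e eA; apply: eigenvalue_sqr_le; exact: AE.
Qed.

Context (L : R) (hL : has_sum E (fun e => (lam e ^+ 2)%:C) L%:C).

(** A variance is a mean of [sigma ^+ 2] minus [lam e ^+ 2]. As variances are nonnegative, [A] may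
    be enlarged until the squares of the eigenvalues over it nearly reach [L]. *)
Lemma sum_variance_le A : [set` A] `<=` E ->
  \sum_(e <- A) rI (fun y => (lam e - sigma y) ^+ 2 * density e y) <= c * N2 - L.
Proof.
move=> AE; apply: le_epsilon => eps e0.
have /has_sumP/(_ _ e0)[A0 A0E hA0] := hL.
pose A' := (A0 `|` A)%fset.
have A'E : [set` A'] `<=` E by move=> e /=; rewrite in_fsetU => /orP[/A0E|/AE].
have sub0 : {subset A0 <= A'} by move=> e eA; rewrite in_fsetU eA.
have subA : {subset A <= A'} by move=> e eA; rewrite in_fsetU eA orbT.
have := hA0 A' A'E sub0; rewrite -rmorph_sum -rmorphB normc_real ltr_norml => /andP[h _].
have var0 e : E e -> 0 <= rI (fun y => (lam e - sigma y) ^+ 2 * density e y).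
  by move=> _; apply: Rint_ge0 => y; rewrite mulr_ge0 ?sqr_ge0 ?density_ge0.
apply: (le_trans (sum_fset_le var0 AE A'E subA)).
have -> : \sum_(e <- A') rI (fun y => (lam e - sigma y) ^+ 2 * density e y) =
    \sum_(e <- A') rI (fun y => sigma y ^+ 2 * density e y) - \sum_(e <- A') lam e ^+ 2.
  by rewrite -sumrB; apply: eq_big_seq => e /A'E Ee; rewrite (rvar Ee).2.
have := sum_Rint_density_le A'E sigma2 (fun y => sqr_ge0 _); rewrite -/N2; lra.
Qed.

(** For each [e] the error is the mean of [sigma * (psi (lam e) - psi sigma)] under the density of
    [e]. Young's inequality splits [C |sigma| |lam e - sigma|] into [eta sigma^2] and a multiple
    [C^2 / (4 eta)] of the variance. *)
Lemma trace_estimate (psi : R -> R) (t eps C eta : R) :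
  rintegrable m (fun y => sigma y * psi (sigma y)) -> 0 <= eps -> 0 <= C -> 0 < eta ->
  (forall e y, E e -> `|psi (lam e) - psi (sigma y)| <=
     eps * (1 + `|lam e| + `|sigma y|) + C * `|lam e - sigma y|) ->
  has_sum E (fun e => (lam e * psi (lam e))%:C) t%:C ->
  `|t - c * rI (fun y => sigma y * psi (sigma y))| <=
    c * (eps * (N1 + 2 * N2) + eta * N2) + C ^+ 2 / (4 * eta) * (c * N2 - L).
Proof.
move=> ih eps0 C0 eta0 hpsi ht.
have := has_sumB ht (has_sum_density ih); rewrite -rmorphB => hd.
rewrite -normc_real; apply: (has_sum_le hd) => A AE.
under eq_bigr do rewrite -rmorphB; rewrite -rmorph_sum normc_real.
apply: (le_trans (ler_norm_sum _ _ _)).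
pose D := C ^+ 2 / (4 * eta); have D0 : 0 <= D by rewrite divr_ge0 ?sqr_ge0// mulr_ge0// ltW.
have term e : E e -> `|lam e * psi (lam e) - rI (fun y => sigma y * psi (sigma y) * density e y)| <=
    eps * rI (fun y => `|sigma y| * density e y) +
    (2 * eps + eta) * rI (fun y => sigma y ^+ 2 * density e y) +
    D * rI (fun y => (lam e - sigma y) ^+ 2 * density e y).
  move=> Ee; have i1 := rintegrable_densityM Ee sigma1; have i2 := rintegrable_densityM Ee ih.
  have i3 := rintegrable_densityM Ee (rintegrable_norm sigma1).
  have i4 := rintegrable_densityM Ee sigma2; have [i5 _] := rvar Ee.
  have i6 := rintegrable_density Ee.
  have -> : lam e * psi (lam e) = rI (fun y => psi (lam e) * (sigma y * density e y)).
    by rewrite RintZ// -eigenvalueE// mulrC.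
  rewrite -RintB//; last exact: rintegrableZ.
  apply: (le_trans (le_norm_Rint _)); first by apply: rintegrableB => //; exact: rintegrableZ.
  (* From [|sigma| |lam e| <= (sigma^2 + lam^2) / 2] come the coefficients [3 / 2 * eps] and
     [eps / 2]; since [lam e ^+ 2] is at most the mean of [sigma ^+ 2], they combine into
     [2 * eps]. *)
  apply: (@le_trans _ _ (rI (fun y => (eps * (`|sigma y| * density e y) +
      (3 / 2 * eps + eta) * (sigma y ^+ 2 * density e y)) +
      (D * ((lam e - sigma y) ^+ 2 * density e y) + eps / 2 * lam e ^+ 2 * density e y)))); last first.
    rewrite RintD; [|by apply: rintegrableD; exact: rintegrableZ|by apply: rintegrableD; exact: rintegrableZ].
    rewrite RintD; [|exact: rintegrableZ|exact: rintegrableZ].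
    rewrite RintD; [|exact: rintegrableZ|exact: rintegrableZ].
    rewrite !RintZ// Rint_density// mulr1.
    by have := ler_wpM2l eps0 (eigenvalue_sqr_le Ee); lra.
  apply: le_Rint.
  - by apply: rintegrable_norm; apply: rintegrableB => //; exact: rintegrableZ.
  - by apply: rintegrableD; apply: rintegrableD; exact: rintegrableZ.
  move=> y; have b0 := density_ge0 e y.
  have -> : psi (lam e) * (sigma y * density e y) - sigma y * psi (sigma y) * density e y =
      sigma y * (psi (lam e) - psi (sigma y)) * density e y by ring.
  rewrite normrM (ger0_norm b0) normrM.
  have -> : eps * (`|sigma y| * density e y) + (3 / 2 * eps + eta) * (sigma y ^+ 2 * density e y) +
      (D * ((lam e - sigma y) ^+ 2 * density e y) + eps / 2 * lam e ^+ 2 * density e y) =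
      (eps * `|sigma y| + (3 / 2 * eps + eta) * sigma y ^+ 2 + D * (lam e - sigma y) ^+ 2 +
        eps / 2 * lam e ^+ 2) * density e y by ring.
  apply: ler_wpM2r => //; apply: (le_trans (ler_wpM2l (normr_ge0 _) (hpsi e y Ee))).
  rewrite -[sigma y ^+ 2]real_normK ?num_real// -[lam e ^+ 2]real_normK ?num_real//.
  rewrite -[(lam e - sigma y) ^+ 2]real_normK ?num_real//.
  set s := `|sigma y|; set l := `|lam e|; set r := `|lam e - sigma y|.
  have h1 : eps * (s * l) <= eps * ((s ^+ 2 + l ^+ 2) / 2).
    by apply: ler_wpM2l => //; have := sqr_ge0 (s - l); rewrite sqrrB; lra.
  have h2 : C * (s * r) <= eta * s ^+ 2 + D * r ^+ 2.
    have e4 : 0 < 4 * eta by rewrite mulr_gt0.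
    have h : 0 <= (2 * eta * s - C * r) ^+ 2 / (4 * eta) by rewrite divr_ge0 ?sqr_ge0// ltW.
    have eh : (2 * eta * s - C * r) ^+ 2 / (4 * eta) = eta * s ^+ 2 + D * r ^+ 2 - C * (s * r).
      by rewrite /D; field; rewrite gt_eqF.
    by move: h; rewrite eh; lra.
  move: h1 h2; lra.
apply: (@le_trans _ _ (\sum_(e <- A) (eps * rI (fun y => `|sigma y| * density e y) +
    (2 * eps + eta) * rI (fun y => sigma y ^+ 2 * density e y) +
    D * rI (fun y => (lam e - sigma y) ^+ 2 * density e y)))).
  by rewrite big_seq [leRHS]big_seq; apply: ler_sum => e eA; apply: term; exact: AE.
rewrite !big_split /= -!mulr_sumr.
have s1 := ler_wpM2l eps0 (sum_Rint_density_le AE (rintegrable_norm sigma1) (fun y => normr_ge0 _)).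
have ee : 0 <= 2 * eps + eta by rewrite addr_ge0 ?mulr_ge0// ltW.
have s2 := ler_wpM2l ee (sum_Rint_density_le AE sigma2 (fun y => sqr_ge0 _)).
have s3 := ler_wpM2l D0 (sum_variance_le AE).
move: s1 s2 s3; rewrite -/N1 -/N2 -/D; lra.
Qed.

(** A finite partial sum of the Berezin symbol [<T K_y, K_y>]. *)
Definition eigen_density A (y : bG) : R := \sum_(e <- A) lam e * density e y.

Lemma eigen_densityP A : [set` A] `<=` E ->
  rintegrable m (eigen_density A) /\ rI (fun y => sigma y * eigen_density A y) = \sum_(e <- A) lam e ^+ 2.
Proof.
move=> AE; split.
  have [|h _] := @Rint_sum_in _ _ _ m _ (A : seq V) (fun e y => lam e * density e y); last exact: h.
  by move=> e /AE Ee; apply: rintegrableZ; exact: rintegrable_density.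
have [|_ h] := @Rint_sum_in _ _ _ m _ (A : seq V) (fun e y => lam e * (sigma y * density e y)).
  by move=> e /AE Ee; apply: rintegrableZ; exact: rintegrable_densityM.
transitivity (rI (fun y => \sum_(e <- A) lam e * (sigma y * density e y))).
  apply: eq_Rintegral => y _; rewrite /eigen_density mulr_sumr; apply: eq_bigr => e _.
  by rewrite mulrCA.
rewrite h; apply: eq_big_seq => e /AE Ee.
by rewrite RintZ; [rewrite -eigenvalueE// expr2|exact: rintegrable_densityM].
Qed.

(** Jensen's inequality for the weights [density e y], of total at most [c]: the square is at most
    [c * sum_e lam e ^+ 2 * density e y], whose integral is at most [c ^+ 2 * N2]. *)
Lemma eigen_density_sqr A : [set` A] `<=` E ->
  rintegrable m (fun y => eigen_density A y ^+ 2) /\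
  rI (fun y => eigen_density A y ^+ 2) <= c ^+ 2 * N2.
Proof.
move=> AE; have [iG _] := eigen_densityP AE.
have [|iS eS] := @Rint_sum_in _ _ _ m _ (A : seq V) (fun e y => lam e ^+ 2 * density e y).
  by move=> e /AE Ee; apply: rintegrableZ; exact: rintegrable_density.
have le1 y : eigen_density A y ^+ 2 <= c * \sum_(e <- A) lam e ^+ 2 * density e y.
  set q := \sum_(e <- A) _; have pE : eigen_density A y = \sum_(e <- A) lam e * density e y by [].
  move: (eigen_density A y) pE => p pE.
  (* Expanding and using that the densities add up to at most [c] gives
     [0 <= c ^+ 2 * q - c * p ^+ 2]. *)
  have : 0 <= \sum_(e <- A) (c * lam e - p) ^+ 2 * density e y.
    by apply: sumr_ge0 => e _; rewrite mulr_ge0 ?sqr_ge0 ?density_ge0.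
  have -> : \sum_(e <- A) (c * lam e - p) ^+ 2 * density e y =
      c ^+ 2 * q - 2 * c * p * p + p ^+ 2 * \sum_(e <- A) density e y.
    have -> : 2 * c * p * p = \sum_(e <- A) 2 * c * p * (lam e * density e y) by rewrite -mulr_sumr -pE.
    rewrite /q !mulr_sumr -sumrB -big_split /=.
    by apply: eq_bigr => e _; ring.
  have := ler_wpM2l (sqr_ge0 p) (sum_density_le y AE) => h1 h2.
  by rewrite -(ler_pM2l c_gt0); move: h1 h2; lra.
have r2 : rintegrable m (fun y => eigen_density A y ^+ 2).
  apply: (le_rintegrable _ (rintegrableZ c iS)).
    by apply: measurable_funX; exact: rintegrable_measurable iG.
  by move=> y; rewrite ger0_norm ?sqr_ge0.
split => //; apply: (@le_trans _ _ (rI (fun y => c * \sum_(e <- A) lam e ^+ 2 * density e y))).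
  by apply: le_Rint => //; exact: rintegrableZ.
rewrite RintZ// eS expr2 -mulrA; apply: ler_wpM2l => //.
apply: le_trans (sum_eigenvalue_sqr_le AE); rewrite le_eqVlt; apply/orP; left; apply/eqP.
apply: eq_big_seq => e /AE Ee; rewrite RintZ; last exact: rintegrable_density.
by rewrite Rint_density// mulr1.
Qed.

Context (L1 : R) (L1_ge : forall A, [set` A] `<=` E -> \sum_(e <- A) `|lam e| <= L1).

(** The full series of the [lam e * x e] sums to [W] times the transform of [sigma], and each
    [|x e|] is at most 1. The missing part is thus bounded by the tail of the series of the
    [|lam e|], uniformly in [p]. *)
Lemma eigen_density_fourier (p : bG -> R[i]) (Bp : V -> V) (W : R) A : cmeasurable p ->
  (forall y, normc (p y) <= 1) -> bounded_operator dot H Bp ->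
  (forall f g, H f -> H g -> dot (Bp f) g = cI (fun y : bG => p y * (ev f (y : G) * (ev g (y : G))^*))) ->
  (forall y : bG, dot (Bp (K (y : G))) (K (y : G)) = p y * W%:C) -> [set` A] `<=` E ->
  normc (cI (fun y => (eigen_density A y)%:C * p y) - W%:C * cI (fun y => (sigma y)%:C * p y)) <=
    L1 - \sum_(e <- A) `|lam e|.
Proof.
move=> mp p1 bB dotB BK AE.
have ipr (h : bG -> R) : rintegrable m h -> cintegrable m (fun y => (h y)%:C * p y).
  by move=> ih; exact: (cintegrableM_bounded (cintegrable_real ih) mp p1).
pose x e := cI (fun y => (density e y)%:C * p y).
have x1 e : E e -> normc (x e) <= 1.
  move=> Ee; rewrite -(Rint_density Ee); apply: le_cint; [|exact: rintegrable_density|].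
    exact: cintegrable_measurable (ipr _ (rintegrable_density Ee)).
  move=> y; rewrite Normc.normcM normc_real ger0_norm ?density_ge0//.
  by rewrite ler_piMr ?density_ge0.
(* [trace_formula] for [Bp] and [sigma]: its terms are [<T (Bp e), e> = lam e * <Bp e, e>], and its
   value is the integral of [sigma * p * W]. *)
have hs : has_sum E (fun e => (lam e)%:C * x e) (W%:C * cI (fun y => (sigma y)%:C * p y)).
  rewrite -cintZ; last exact: ipr.
  have := trace_formula bB bE sigma1.
  rewrite (@eq_cint _ _ _ _ _ (fun y : bG => W%:C * ((sigma y)%:C * p y))) => [|y]; last first.
    by rewrite BK mulrA mulrC.
  apply: eq_has_sum => e Ee; have He := EH Ee; have HBe := operator_in bB He.
  rewrite -dotT// dot_toeplitz_basis// dotB//; congr (_ * _); apply: eq_cint => y.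
  by rewrite mulJ mulrC.
have -> : cI (fun y => (eigen_density A y)%:C * p y) = \sum_(e <- A) (lam e)%:C * x e.
  have : forall e, e \in (A : seq V) -> E e by move=> e /AE.
  rewrite /eigen_density; elim: (A : seq V) => [|e s IH] sE.
    rewrite big_nil -(cint0 m); apply: eq_cint => y; by rewrite big_nil mul0r.
  have sE' i : i \in s -> E i by move=> si; apply: sE; rewrite inE si orbT.
  have Ee := sE e (mem_head _ _).
  rewrite big_cons -IH// -cintZ; last exact/ipr/rintegrable_density.
  have [|is_ _] := @Rint_sum_in _ _ _ m _ s (fun e y => lam e * density e y).
    by move=> i /sE' Ei; apply: rintegrableZ; exact: rintegrable_density.
  rewrite -cintD; [|exact/cintegrableZ/ipr/rintegrable_density|exact: ipr].
  by apply: eq_cint => y; rewrite big_cons rmorphD rmorphM mulrDl mulrA.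
apply: le_epsilon => eps e0; have /has_sumP/(_ _ e0)[A0 A0E hA0] := hs.
pose A' := (A0 `|` A)%fset.
have A'E : [set` A'] `<=` E by move=> e /=; rewrite in_fsetU => /orP[/A0E|/AE].
have sub0 : {subset A0 <= A'} by move=> e eA; rewrite in_fsetU eA.
have {}hA0 := hA0 A' A'E sub0.
have split_sum (U : zmodType) (a : V -> U) : \sum_(e <- A') a e = \sum_(e <- A) a e + \sum_(e <- (A' `\` A)%fset) a e.
  rewrite (big_fsetID _ (mem A)) /=; congr (_ + _); apply: eq_fbigl => e;
    rewrite !inE /=; by case: (e \in A); case: (e \in A0).
have := le_normcD (\sum_(e <- A) (lam e)%:C * x e - \sum_(e <- A') (lam e)%:C * x e)
  (\sum_(e <- A') (lam e)%:C * x e - W%:C * cI (fun y => (sigma y)%:C * p y)).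
rewrite addrA subrK => h; apply: (le_trans h); apply: lerD; last exact: ltW.
rewrite normc_distC split_sum addrC addKr; apply: (le_trans (normc_sum _ _ _)).
have := L1_ge A'E; rewrite split_sum -lerBrDl; apply: le_trans.
rewrite big_seq [leRHS]big_seq; apply: ler_sum => e; rewrite in_fsetD => /andP[_ eA'].
rewrite Normc.normcM normc_real -[leRHS]mulr1; apply: ler_wpM2l => //; apply: x1; exact: A'E.
Qed.

End second_moment.
End toeplitz.
End rkhs.

(** * Compressions and the second moment *)

Section projection_operator.
Context (R : realType) (V : lmodType R[i]) (dot : V -> V -> R[i]) (ip : inner_product dot)
  (H : set V) (sH : subspace H) (cH : hcomplete dot H).
Local Notation nm := (hnorm dot).
Local Notation P := (orthogonal_projection dot H).
Implicit Types (u v g : V).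

Lemma projection_in u : H (P u).
Proof. by have [] := orthogonal_projectionP ip sH cH u. Qed.

Lemma dot_projection u g : H g -> dot (P u) g = dot u g.
Proof.
move=> Hg; have [_ h] := orthogonal_projectionP ip sH cH u.
by apply/esym/subr0_eq; rewrite -(dotBl ip); exact: h.
Qed.

Lemma projection_lin (a : R[i]) u v : P (a *: u + v) = a *: P u + P v.
Proof.
have Hl := sH.2 a _ _ (projection_in u) (projection_in v).
have Hw := subspaceB sH (projection_in (a *: u + v)) Hl.
apply: subr0_eq; apply: (hnorm_eq0 ip); apply/eqP; rewrite -sqrf_eq0 (hnorm_sqr ip).
rewrite {1}(dotBl ip) (dot_linl ip) !dot_projection// (dot_linl ip).
by rewrite subrr.
Qed.

Lemma projection_le u : nm (P u) <= nm u.
Proof.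
have [->|nz] := eqVneq (nm (P u)) 0; first exact: hnorm_ge0.
have p0 : 0 < nm (P u) by rewrite lt0r nz hnorm_ge0.
rewrite -(ler_pM2r p0) -expr2 (hnorm_sqr ip) dot_projection; last exact: projection_in.
by apply: (le_trans (ler_norm _)); apply: (le_trans (Re_le_normc _)); exact: (cauchy_schwarz ip).
Qed.
End projection_operator.

Section compression.
Context d (X : measurableType d) (R : realType) (mu : {measure set X -> \bar R}).
Local Notation dot := (@L2inner _ _ _ mu).
Local Notation nm := (hnorm dot).
Local Notation ip := (L2inner_product mu).
Context (H : set (L2 mu)) (sH : subspace H) (cH : hcomplete dot H)
  (p : X -> R[i]) (C : R) (hp : forall f, H f -> (fun x => p x * rp f x) \in cLfun mu 2%:E /\
    nm (toL2 mu (fun x => p x * rp f x)) <= C * nm f).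
Implicit Types (f g u v : L2 mu).

(** One construction for the Toeplitz operator and for the compressed multiplications by conjugate
    characters; [hp] asks for boundedness on [H] only, so that [p] itself may be unbounded. *)
Definition compression f : L2 mu :=
  orthogonal_projection dot H (toL2 mu (fun x => p x * rp f x)).

Lemma compression_bounded : bounded_operator dot H compression.
Proof.
split=> [u _|a u v Hu Hv|]; first exact: (projection_in ip).
- have [Lu _] := hp Hu; have [Lv _] := hp Hv.
  have [Luv _] := hp (sH.2 a u v Hu Hv).
  have e : toL2 mu (fun x => p x * rp (a *: u + v) x) =
      a *: toL2 mu (fun x => p x * rp u x) + toL2 mu (fun x => p x * rp v x).
    apply: etrans (toL2_lin a Lu Lv); apply: toL2_ae => //; first exact: cLfun2_lin.
    by apply: filterS2 (rpD (a *: u) v) (rpZ a u) => x -> ->; rewrite mulrDr mulrCA.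
  rewrite /compression e; exact: (projection_lin ip sH cH a (toL2 mu (fun x => p x * rp u x)) (toL2 mu (fun x => p x * rp v x))).
- exists C => u Hu; apply: (le_trans (projection_le ip sH cH _)); by have [] := hp Hu.
Qed.

Lemma dot_compression f g : H f -> H g ->
  dot (compression f) g = cintegral mu (fun x => p x * rp f x * (rp g x)^*).
Proof.
move=> Hf Hg; have [Lf _] := hp Hf; apply: etrans (dot_projection ip sH cH _ Hg) _.
rewrite (@L2inner_ae _ _ _ _ _ _ (fun x => p x * rp f x) (rp g))//.
- by have /cLfun2P[] := Lf.
- exact: rp_cmeasurable.
- exact: rp_toL2.
- exact: aeW.
Qed.

End compression.

(** * The lower limit of the second moment *)

Section second_moment_limit.
Context (R : realType) (G : topologicalZmodType)
  (hausdorffG : hausdorff_space G) (locally_compactG : locally_compact [set: G])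
  (m : {measure set (borel G) -> \bar R}) (haar_m : haar_measure m)
  (mh : {measure set (borel (dual R G)) -> \bar R}) (dual_haar_mh : dual_haar_measure m mh).
Local Notation Gd := (dual R G).
Local Notation bG := (borel G).
Local Notation bD := (borel Gd).
Local Notation rI mu h := (Rintegral mu setT h).
Local Notation cI := cintegral.
Local Notation fourier := (fourier m).
Let haar_mh : haar_measure mh. Proof. by case: dual_haar_mh. Qed.

Context (sigma : bG -> R) (sigma1 : rintegrable m sigma)
  (sigma2 : rintegrable m (fun x => sigma x ^+ 2)).
Let N2 := rI m (fun x => sigma x ^+ 2).
Let hat := fourier (fun x => (sigma x)%:C).

Let L1L2_real (g : bG -> R) : rintegrable m g -> rintegrable m (fun x => g x ^+ 2) ->
  L1L2 m (fun x => (g x)%:C).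
Proof.
move=> g1 g2; split; first exact: cintegrable_real.
apply: (le_cLfun2 _ g2) => [|x]; first by apply: cmeasurable_real; exact: rintegrable_measurable g1.
by rewrite normc_real real_normK// num_real.
Qed.

Let Dsigma : L1L2 m (fun x => (sigma x)%:C). Proof. exact: L1L2_real. Qed.
Let mhat : cmeasurable (hat : bD -> R[i]).
Proof. by apply: cmeasurable_fourier => //; case: Dsigma. Qed.
Let rhat : rintegrable mh (fun xi => normc (hat xi) ^+ 2).
Proof. by have := fourier_cLfun2 hausdorffG haar_m dual_haar_mh Dsigma => /cLfun2P[]. Qed.

Lemma Rint_hat_sqr : rI mh (fun xi => normc (hat xi) ^+ 2) = N2.
Proof.
have [_ ->] := plancherel_L1L2 hausdorffG haar_m dual_haar_mh Dsigma.
by apply: eq_Rintegral => x _; rewrite normc_real real_normK// num_real.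
Qed.

(* Approximants [g] of the Berezin symbol of the operator, tested against
   [sigma] on the Fourier side. *)
Lemma second_moment_lower (c L theta : R) (W : bD -> R) (A : set bD) : 0 < c -> 0 < theta ->
  measurable A -> (mh A < +oo)%E -> measurable_fun setT W -> (forall xi, 0 <= W xi <= c) ->
  (forall rho : R, 0 < rho -> exists g : bG -> R, [/\ rintegrable m g, rintegrable m (fun x => g x ^+ 2),
     rI m (fun x => g x ^+ 2) <= c ^+ 2 * N2, rI m (fun x => sigma x * g x) <= L &
     forall xi, normc (fourier (fun x => (g x)%:C) xi - (W xi)%:C * hat xi) <= rho]) ->
  rI mh (fun xi => \1_A xi * normc (hat xi) ^+ 2 * W xi) <= L + c * (theta * N2 / 2 +
    rI mh (fun xi => \1_(~` A) xi * normc (hat xi) ^+ 2) / (2 * theta)).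
Proof.
move=> c_gt0 th0 mA Aoo mW Wc hg.
have mhat2 := measurable_normc_sqr mhat; have mnh := measurable_normc mhat.
have ind01 (B : set bD) xi := indic_ge0_le1 R B xi.
have rA : rintegrable mh (\1_A : bD -> R) by exact: rintegrable_indic.
have hat1 xi : normc (hat xi) <= rI m (fun x => normc (sigma x)%:C).
  by apply: normc_fourier; case: Dsigma.
have rAh : rintegrable mh (fun xi => \1_A xi * normc (hat xi)).
  apply: (le_rintegrable _ (rintegrableZ (rI m (fun x => normc (sigma x)%:C)) rA)).
    by apply: measurable_funM => //; exact: measurable_indic.
  move=> xi; have /andP[i0 _] := ind01 A xi.
  by rewrite ger0_norm ?mulr_ge0 ?normc_ge0// mulrC; apply: ler_wpM2r.
have rCh : rintegrable mh (fun xi => \1_(~` A) xi * normc (hat xi) ^+ 2).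
  apply: (le_rintegrable _ rhat).
    by apply: measurable_funM => //; apply: measurable_indic; exact: measurableC.
  by move=> xi; apply: normr_indicM_le; exact: sqr_ge0.
have rAW : rintegrable mh (fun xi => \1_A xi * normc (hat xi) ^+ 2 * W xi).
  apply: (le_rintegrable _ (rintegrableZ c rhat)).
    by apply: measurable_funM => //; apply: measurable_funM => //; exact: measurable_indic.
  move=> xi; have /andP[w0 w1] := Wc xi.
  rewrite normrM (ger0_norm w0) mulrC; apply: ler_pM => //.
  by apply: normr_indicM_le; exact: sqr_ge0.
pose Q := rI mh (fun xi => \1_A xi * normc (hat xi)).
have Q0 : 0 <= Q by apply: Rint_ge0 => xi; rewrite mulr_ge0 ?normc_ge0//; case/andP: (ind01 A xi).
apply: le_epsilon => e e0; pose rho := e / (Q + 1).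
have Q1 : 0 < Q + 1 by rewrite ltr_wpDl.
have rho0 : 0 < rho by rewrite divr_gt0.
have [g [g1 g2 gN gL gW]] := hg _ rho0.
have Dg := L1L2_real g1 g2; pose ghat := fourier (fun x => (g x)%:C).
have [Lgh gh2] := plancherel_L1L2 hausdorffG haar_m dual_haar_mh Dg.
have rgh : rintegrable mh (fun xi => normc (ghat xi) ^+ 2) by have /cLfun2P[] := Lgh.
have Lsh := fourier_cLfun2 hausdorffG haar_m dual_haar_mh Dsigma.
have iprod : cintegrable mh (fun xi => ghat xi * (hat xi)^*).
  by apply: cintegrable_mul => //; exact: cLfun2J.
have e1 : rI mh (fun xi => Re (ghat xi * (hat xi)^*)) = rI m (fun x => sigma x * g x).
  have := plancherel_dot hausdorffG haar_m dual_haar_mh Dg Dsigma.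
  rewrite (@eq_cint _ _ _ _ _ (fun x => (sigma x * g x)%:C)) => [|x]; last first.
    by rewrite conj_realC -rmorphM mulrC.
  by rewrite cint_real => /(congr1 (@Re _)) /= ->.
(* The scale of Young's inequality: as the squared norm of [g] is at most [c ^+ 2 * N2], the term
   [tau / 2 * |g|^2] becomes [c * (theta * N2 / 2)], of the order of [c]. *)
pose tau := theta / c; have tau0 : 0 < tau by rewrite divr_gt0.
(* On [A] the transform of [g] is replaced by [W * hat] up to [rho], at a cost finite because [A]
   has finite measure. Off [A] nothing is known of it beyond its L^2 norm, and Young's inequality is
   used. *)
have key : rI mh (fun xi => (\1_A xi * normc (hat xi) ^+ 2 * W xi - rho * (\1_A xi * normc (hat xi))) -
    (tau / 2 * normc (ghat xi) ^+ 2 + (2 * tau)^-1 * (\1_(~` A) xi * normc (hat xi) ^+ 2))) <=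
    rI mh (fun xi => Re (ghat xi * (hat xi)^*)).
  apply: le_Rint; last 1 first.
  - move=> xi; set s := hat xi; set q := ghat xi.
    have t2 : 0 < (2 * tau)^-1 by rewrite invr_gt0 mulr_gt0.
    have [Axi|nA] := pselect (A xi).
      rewrite indic_in// indic_out ?mul1r ?mul0r ?mulr0 ?addr0; last by move=> /(_ Axi).
      have hq : normc (q - (W xi)%:C * s) <= rho by exact: gW.
      move: s q hq => s q hq.
      have -> : q * s^* = (q - (W xi)%:C * s) * s^* + (W xi * normc s ^+ 2)%:C.
        by rewrite mulrBl -mulrA mulJ -rmorphM subrK.
      rewrite ReD [X in _ <= _ + X]/=; have := Re_le_normc ((q - (W xi)%:C * s) * s^*).
      rewrite Normc.normcM normcJ ler_norml => /andP[h _].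
      have := ler_wpM2r (normc_ge0 s) hq; have := mulr_ge0 (ltW tau0) (sqr_ge0 (normc q)).
      move: h; lra.
    rewrite indic_out// indic_in// !mul0r mulr0 subr0 mul1r sub0r.
    move: s q => s q; have := Re_le_normc (q * s^*); rewrite Normc.normcM normcJ ler_norml => /andP[h _].
    apply: le_trans h; rewrite lerN2.
    have := mulr_ge0 (ltW t2) (sqr_ge0 (tau * normc q - normc s)).
    have -> : (2 * tau)^-1 * (tau * normc q - normc s) ^+ 2 =
        tau / 2 * normc q ^+ 2 + (2 * tau)^-1 * normc s ^+ 2 - normc q * normc s.
      by field; rewrite gt_eqF.
    lra.
  - apply: rintegrableB; [apply: rintegrableB => //; exact: rintegrableZ|].
    by apply: rintegrableD; exact: rintegrableZ.
  - by have [] := iprod.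
move: key; rewrite e1 RintB; last 2 first.
- by apply: rintegrableB => //; exact: rintegrableZ.
- by apply: rintegrableD; exact: rintegrableZ.
rewrite RintB//; last exact: rintegrableZ.
rewrite RintD; [|exact: rintegrableZ|exact: rintegrableZ].
rewrite !RintZ// -/Q gh2.
have -> : rI m (fun x => normc (g x)%:C ^+ 2) = rI m (fun x => g x ^+ 2).
  by apply: eq_Rintegral => x _; rewrite normc_real real_normK// num_real.
have -> : (2 * tau)^-1 = c / (2 * theta).
  by rewrite /tau; field; rewrite !gt_eqF.
have tg : tau / 2 * rI m (fun x => g x ^+ 2) <= c * (theta * N2 / 2).
  have -> : c * (theta * N2 / 2) = tau / 2 * (c ^+ 2 * N2) by rewrite /tau; field; rewrite gt_eqF.
  by apply: ler_wpM2l => //; rewrite divr_ge0// ltW.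
have rQ : rho * Q <= e.
  have : rho * (Q + 1) = e by rewrite divfK// gt_eqF.
  by rewrite mulrDr mulr1; move: rho0; lra.
move=> key; move: (rI mh (fun xi => \1_(~` A) xi * normc (hat xi) ^+ 2)) key => z key.
move: gL tg rQ key; lra.
Qed.

Lemma second_moment_limit (c L : nat -> R) (W : nat -> bD -> R) :
  (forall N, 0 < c N) -> (forall N, measurable_fun setT (W N)) ->
  (forall N xi, 0 <= W N xi <= c N) ->
  (forall xi, W N xi / c N @[N --> \oo] --> (1 : R)) ->
  (forall N (rho : R), 0 < rho -> exists g : bG -> R, [/\ rintegrable m g, rintegrable m (fun x => g x ^+ 2),
     rI m (fun x => g x ^+ 2) <= c N ^+ 2 * N2, rI m (fun x => sigma x * g x) <= L N &
     forall xi, normc (fourier (fun x => (g x)%:C) xi - (W N xi)%:C * hat xi) <= rho]) ->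
  forall e : R, 0 < e -> \forall N \near \oo, N2 - e < L N / c N.
Proof.
move=> c0 mW Wc W1 hg e e0.
have N20 : 0 <= N2 by apply: Rint_ge0 => x; exact: sqr_ge0.
(* Four errors of [e / 4]: the term [theta * N2 / 2], the mass of [hat] off [K], that mass divided
   by [2 * theta], and the dominated convergence of [W N / c N] to 1 on [K]. *)
pose theta := e / (2 * (N2 + 1)); have d0 : 0 < 2 * (N2 + 1) by rewrite mulr_gt0// ltr_wpDl.
have th0 : 0 < theta by rewrite divr_gt0.
have thN : theta * N2 / 2 <= e / 4.
  have : theta * (2 * (N2 + 1)) = e by rewrite divfK// gt_eqF.
  by move: th0; lra.
pose eps := Num.min (e / 4) (theta * e / 2).
have e4 : 0 < e / 4 by rewrite divr_gt0.
have te2 : 0 < theta * e / 2 by rewrite divr_gt0// mulr_gt0.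
have eps0 : 0 < eps by rewrite /eps lt_min e4.
have [K [cK _ hK]] := L1_regular (@hausdorff_dual _ _) haar_mh rhat (fun=> sqr_ge0 _) measurableT eps0.
have mK : measurable (K : set bD) by apply: compact_borel => //; exact: hausdorff_dual.
have Koo := haar_compact haar_mh cK.
have mhat2 := measurable_normc_sqr mhat.
pose f N xi := \1_(K : set bD) xi * normc (hat xi) ^+ 2 * (W N xi / c N).
have mf N : measurable_fun setT (f N).
  apply: measurable_funM; first by apply: measurable_funM => //; exact: measurable_indic.
  by apply: measurable_funM.
have cf xi : f N xi @[N --> \oo] --> (\1_(K : set bD) xi * normc (hat xi) ^+ 2).
  rewrite -[X in _ --> X]mulr1; apply: cvgM; [exact: cvg_cst|exact: W1].
have W01 N xi : 0 <= W N xi / c N <= 1.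
  by have /andP[w0 w1] := Wc N xi; rewrite divr_ge0 ?(ltW (c0 N))//= ler_pdivrMr// mul1r.
have fb N xi : `|f N xi| <= normc (hat xi) ^+ 2.
  have /andP[w0 w1] := W01 N xi; rewrite /f normrM (ger0_norm w0) -[leRHS]mulr1.
  by apply: ler_pM => //; apply: normr_indicM_le; exact: sqr_ge0.
have [rKh cv] := dominated_Rint mf cf rhat fb.
have split_int : N2 = rI mh (fun xi => \1_(K : set bD) xi * normc (hat xi) ^+ 2) +
    rI mh (fun xi => \1_(~` (K : set bD)) xi * normc (hat xi) ^+ 2).
  rewrite -Rint_hat_sqr -RintD//.
    apply: eq_Rintegral => xi _; rewrite -mulrDl !indicE in_setC.
    by case: (_ \in _); rewrite ?addr0 ?add0r mul1r.
  apply: (le_rintegrable _ rhat).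
    by apply: measurable_funM => //; apply: measurable_indic; exact: measurableC.
  by move=> xi; apply: normr_indicM_le; exact: sqr_ge0.
have tail : rI mh (fun xi => \1_(~` (K : set bD)) xi * normc (hat xi) ^+ 2) < eps.
  apply: le_lt_trans hK; rewrite le_eqVlt; apply/orP; left; apply/eqP.
  by apply: eq_Rintegral => xi _; rewrite setTD mulrC.
move: tail split_int; set z := rI mh (fun xi => \1_(~` (K : set bD)) xi * _).
set z' := rI mh (fun xi => \1_(K : set bD) xi * _) => tail split_int.
have e8 : 0 < e / 4 by rewrite divr_gt0.
move: cv => /cvgrPdist_lt/(_ _ e8); apply: filterS => N; rewrite -/z' => hN.
have low := second_moment_lower (c0 N) th0 mK Koo (mW N) (Wc N) (hg N).
have fE : rI mh (f N) = rI mh (fun xi => \1_(K : set bD) xi * normc (hat xi) ^+ 2 * W N xi) / c N.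
  rewrite [RHS]mulrC -RintZ.
    by apply: eq_Rintegral => xi _; rewrite /f; ring.
  apply: (le_rintegrable _ (rintegrableZ (c N) rhat)).
    by apply: measurable_funM => //; apply: measurable_funM => //; exact: measurable_indic.
  move=> xi; have := ler_wpM2l (ltW (c0 N)) (fb N xi); rewrite /f -{1}(gtr0_norm (c0 N)) -normrM.
  by apply: le_trans; rewrite le_eqVlt; apply/orP; left; apply/eqP; congr `|_|; field; rewrite gt_eqF.
have : rI mh (f N) <= L N / c N + (theta * N2 / 2 + z / (2 * theta)).
  rewrite fE ler_pdivrMr// mulrDl divfK ?gt_eqF// [X in _ + X]mulrC; exact: low.
have zt : z / (2 * theta) < e / 4.
  have t2 : 0 < 2 * theta by rewrite mulr_gt0.
  have eps2 : eps <= theta * e / 2 by rewrite /eps ge_min lexx orbT.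
  by rewrite ltr_pdivrMr//; apply: (lt_le_trans tail); apply: (le_trans eps2); lra.
have : eps <= e / 4 by rewrite /eps ge_min lexx.
move: hN tail; rewrite ltr_norml => /andP[_ hN]; move: hN split_int thN zt; lra.
Qed.

End second_moment_limit.

(** * Polynomial approximation *)

Section continuous_functions.
Context (R : realType).
Implicit Types (f : R -> R) (M : R).

(** Uniform continuity with a bound linear in [|s - t|], so that it can be compared with a variance.
    Points closer than the radius of the finite cover give oscillation below [eps]; for the others
    [C] makes [C |s - t|] exceed twice a bound of [f]. *)
Lemma lipschitz_up_to f M (eps : R) : continuous f -> 0 < eps ->
  exists2 C : R, 0 <= C & forall s t, `|s| <= M -> `|t| <= M -> `|f s - f t| <= eps + C * `|s - t|.
Proof.
move=> cf e0; have e2 : 0 < eps / 2 by rewrite divr_gt0.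
have /choice[d hd] : forall y, exists d : R, 0 < d /\ forall z, `|z - y| < 2 * d -> `|f z - f y| < eps / 2.
  move=> y; have := cf y => /cvgrPdist_lt/(_ _ e2)[r /= r0 hr].
  exists (r / 2); split; first by rewrite divr_gt0.
  move=> z hz; rewrite distrC; apply: hr; rewrite /ball_/= distrC; lra.
have cM : compact [set x : R | `|x| <= M].
  rewrite (_ : [set x | _] = `[- M, M]%classic); first exact: segment_compact.
  by apply/seteqP; split=> x /=; rewrite in_itv /= ler_norml.
have [|s _ hs] := @finite_cover _ _ (fun y => [set z | `|z - y| < d y]) cM.
  move=> y _; have [d0 _] := hd y; apply/nbhs_ballP; exists (d y) => // z.
  by rewrite /ball/= distrC.
pose B := \sum_(y <- s) (`|f y| + eps); pose C := \sum_(y <- s) (2 * B / d y).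
have sum_ge (F : R -> R) y : (forall z, 0 <= F z) -> y \in s -> F y <= \sum_(z <- s) F z.
  move=> F0; elim: s {B C hs} => // z s IH; rewrite inE big_cons => /orP[/eqP->|ys].
    by rewrite lerDl sumr_ge0.
  by apply: (le_trans (IH ys)); rewrite lerDr.
have B0 : 0 <= B by apply: sumr_ge0 => y _; rewrite addr_ge0// ltW.
have fB x : `|x| <= M -> `|f x| <= B.
  move=> xM; have [y ys /= xy] := hs x xM; have [d0 h] := hd y.
  have /h fxy : `|x - y| < 2 * d y by lra.
  have := sum_ge (fun y => `|f y| + eps) y (fun z => addr_ge0 (normr_ge0 _) (ltW e0)) ys.
  by have := ler_normD (f x - f y) (f y); rewrite subrK -/B; lra.
have Cy y : 0 <= 2 * B / d y by rewrite divr_ge0 ?mulr_ge0// ltW//; case: (hd y).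
exists C; first by apply: sumr_ge0 => y _; exact: Cy.
move=> x t xM tM; have [y ys /= xy] := hs x xM; have [d0 h] := hd y.
have CyC : 2 * B / d y <= C by apply: (sum_ge (fun y => 2 * B / d y)).
have C0 := le_trans (Cy y) CyC.
have [lt|ge] := ltP `|x - t| (d y).
  have /h h1 : `|x - y| < 2 * d y by lra.
  have /h h2 : `|t - y| < 2 * d y.
    by have := ler_distD x t y; rewrite (distrC t x); lra.
  have := ler_distD (f y) (f x) (f t); rewrite (distrC (f y)).
  by have := mulr_ge0 C0 (normr_ge0 (x - t)); lra.
have h1 : 2 * B <= C * `|x - t|.
  apply: (@le_trans _ _ (2 * B / d y * d y)); first by rewrite divfK// gt_eqF.
  by apply: ler_pM => //; exact: ltW.
by have := ler_normB (f x) (f t); have := fB x xM; have := fB t tM; lra.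
Qed.

(* Bernstein polynomials, by Pascal's rule: [bernstein n g] is
   [sum_k 'C(n, k) g k X^k (1 - X)^(n - k)]. *)
Fixpoint bernstein n (g : nat -> R) : {poly R} :=
  if n is n'.+1 then 'X * bernstein n' (g \o S) + (1 - 'X) * bernstein n' g else (g 0)%:P.

Lemma bernsteinS n g (x : R) :
  (bernstein n.+1 g).[x] = x * (bernstein n (g \o S)).[x] + (1 - x) * (bernstein n g).[x].
Proof. by rewrite /= !hornerE. Qed.

Lemma bernstein_lin n g h (a x : R) :
  (bernstein n (fun k => a * g k + h k)).[x] = a * (bernstein n g).[x] + (bernstein n h).[x].
Proof.
elim: n g h => [|n IH] g h; first by rewrite /= !hornerC.
have e : (fun k => a * g k + h k) \o S = fun k => a * (g \o S) k + (h \o S) k by [].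
by rewrite !bernsteinS e !IH; ring.
Qed.

Lemma bernstein_cst n (a x : R) : (bernstein n (fun=> a)).[x] = a.
Proof.
elim: n => [|n IH]; first by rewrite /= hornerC.
by rewrite bernsteinS (_ : (fun=> a) \o S = fun=> a)// IH; ring.
Qed.

Lemma le_bernstein n g h (x : R) : 0 <= x <= 1 -> (forall k, (k <= n)%N -> g k <= h k) ->
  (bernstein n g).[x] <= (bernstein n h).[x].
Proof.
move=> /andP[x0 x1]; elim: n g h => [|n IH] g h gh; first by rewrite /= !hornerC; exact: gh.
rewrite !bernsteinS; apply: lerD; apply: ler_wpM2l => //; rewrite ?subr_ge0//; apply: IH => k kn.
  exact: gh.
by apply: gh; exact: leqW.
Qed.

Lemma bernstein_id n (x : R) : (bernstein n (fun k => k%:R)).[x] = n%:R * x.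
Proof.
elim: n => [|n IH]; first by rewrite /= hornerC mul0r.
rewrite bernsteinS (_ : (fun k => k%:R) \o S = fun k => 1 * k%:R + 1 :> R); last first.
  by apply/funext => k /=; rewrite mul1r natr1.
by rewrite bernstein_lin bernstein_cst IH -natr1; ring.
Qed.

Lemma bernstein_sqr n (x : R) :
  (bernstein n (fun k => k%:R ^+ 2)).[x] = n%:R ^+ 2 * x ^+ 2 + n%:R * x * (1 - x).
Proof.
elim: n => [|n IH]; first by rewrite /= hornerC expr0n /= !mul0r addr0.
rewrite bernsteinS (_ : (fun k => k%:R ^+ 2) \o S = fun k => 1 * k%:R ^+ 2 + (2 * k%:R + 1) :> R); last first.
  by apply/funext => k /=; rewrite -natr1; ring.
by rewrite bernstein_lin bernstein_lin bernstein_cst bernstein_id IH -natr1; ring.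
Qed.

(** Bernstein's proof: the operator is monotone and its second central moment is [x (1 - x) / N]. *)
Lemma weierstrass_unit f (eps : R) : continuous f -> 0 < eps ->
  exists p : {poly R}, forall x, 0 <= x <= 1 -> `|p.[x] - f x| <= eps.
Proof.
move=> cf e0; have e3 : 0 < eps / 3 by rewrite divr_gt0.
have [C C0 hC] := lipschitz_up_to 1 cf e3.
pose D := C ^+ 2 / (4 * (eps / 3)); have D0 : 0 <= D by rewrite divr_ge0 ?sqr_ge0// mulr_ge0// ltW.
have [n hn] : exists n : nat, D / n.+1%:R <= eps / 3.
  have D1 : 0 < D + 1 by rewrite ltr_wpDl.
  have := @cvg_harmonic R => /cvgr0Pnorm_lt/(_ _ (divr_gt0 e3 D1))[N _ /(_ N (leqnn N))] hN.
  exists N; have := le_lt_trans (ler_norm _) hN; rewrite /harmonic/= ltr_pdivlMr// => h.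
  have i0 : 0 <= N.+1%:R^-1 :> R by rewrite invr_ge0.
  by rewrite mulrC; move: (N.+1%:R^-1) h i0 => r h i0; lra.
exists (bernstein n.+1 (fun k => f (k%:R / n.+1%:R))) => x x01; have /andP[x0 x1] := x01.
have n0 : 0 < n.+1%:R :> R by rewrite ltr0n.
pose N := n.+1%:R : R; have NN : N != 0 by rewrite gt_eqF.
(* A quadratic majorant of [|f (k / N) - f x|], from [lipschitz_up_to] and
   [C u <= eps / 3 + D u^2]. *)
pose q k := 2 * (eps / 3) + D * (k%:R / N - x) ^+ 2.
have qE : (bernstein n.+1 q).[x] <= eps.
  have -> : q = fun k => D / N ^+ 2 * k%:R ^+ 2 + (- (2 * D * x / N) * k%:R + (D * x ^+ 2 + 2 * (eps / 3))).
    by apply/funext => k; rewrite /q; field.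
  rewrite bernstein_lin bernstein_lin bernstein_cst bernstein_sqr bernstein_id -/N.
  have -> : D / N ^+ 2 * (N ^+ 2 * x ^+ 2 + N * x * (1 - x)) + (- (2 * D * x / N) * (N * x) + (D * x ^+ 2 + 2 * (eps / 3))) =
      D / N * (x * (1 - x)) + 2 * (eps / 3) by field.
  have xx : x * (1 - x) <= 1 by nra.
  have DN : 0 <= D / N by rewrite divr_ge0// ltW.
  apply: (@le_trans _ _ (D / N + 2 * (eps / 3))); last by move: hn; rewrite -/N; move: (D / N) => r; lra.
  by rewrite lerD2r -[leRHS]mulr1; exact: ler_wpM2l.
have fq k : (k <= n.+1)%N -> `|f (k%:R / N) - f x| <= q k.
  move=> kn; have kN : 0 <= k%:R / N <= 1.
    by rewrite divr_ge0//= ?(ltW n0)// ler_pdivrMr// mul1r ler_nat.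
  have /andP[k0 k1] := kN.
  have kk : `|k%:R / N| <= 1 by rewrite ger0_norm.
  have xx : `|x| <= 1 by rewrite ger0_norm.
  apply: (le_trans (hC _ _ kk xx)).
  rewrite /q -[(_ - x) ^+ 2]real_normK ?num_real//; set u := `|_|.
  have e4 : 0 < 4 * (eps / 3) by rewrite mulr_gt0.
  have : 0 <= (2 * (eps / 3) - C * u) ^+ 2 / (4 * (eps / 3)) by rewrite divr_ge0 ?sqr_ge0// ltW.
  have -> : (2 * (eps / 3) - C * u) ^+ 2 / (4 * (eps / 3)) = eps / 3 + D * u ^+ 2 - C * u.
    by rewrite /D; field; rewrite gt_eqF.
  lra.
rewrite ler_norml; apply/andP; split.
- have : (bernstein n.+1 (fun k => -1 * q k + f x)).[x] <= (bernstein n.+1 (fun k => f (k%:R / N))).[x].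
    apply: le_bernstein => // k /fq; rewrite ler_norml => /andP[h _]; move: h; lra.
  by rewrite bernstein_lin bernstein_cst -/N; move: qE; lra.
- have : (bernstein n.+1 (fun k => f (k%:R / N))).[x] <= (bernstein n.+1 (fun k => 1 * q k + f x)).[x].
    apply: le_bernstein => // k /fq; rewrite ler_norml => /andP[_ h]; move: h; lra.
  by rewrite bernstein_lin bernstein_cst -/N; move: qE; lra.
Qed.

Lemma weierstrass f M (eps : R) : continuous f -> 0 < eps ->
  exists p : {poly R}, forall x, `|x| <= M -> `|p.[x] - f x| < eps.
Proof.
move=> cf e0; have e2 : 0 < eps / 2 by rewrite divr_gt0.
pose M' := `|M| + 1; have M0 : 0 < M' by rewrite ltr_wpDl.
pose g t := f (2 * M' * t - M').
have cg : continuous g.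
  move=> t; apply: (@cvg_comp _ _ _ (fun t => 2 * M' * t - M') f _ (nbhs (2 * M' * t - M'))); last exact: cf.
  by apply: cvgB; [apply: cvgM; [exact: cvg_cst|exact: cvg_id]|exact: cvg_cst].
have [p hp] := weierstrass_unit cg e2.
exists (p \Po ((2 * M')^-1 *: 'X + (1 / 2)%:P)) => x xM.
rewrite horner_comp !hornerE; set t := (X in p.[X]).
have tx : 2 * M' * t - M' = x by rewrite /t; field; rewrite gt_eqF.
have xM' : `|x| <= M' by apply: (le_trans xM); rewrite /M'; have := ler_norm M; lra.
have t01 : 0 <= t <= 1.
  move: xM'; rewrite ler_norml -tx => /andP[h1 h2].
  by apply/andP; split; rewrite -(ler_pM2l M0); lra.
by have := hp t t01; rewrite /g tx; lra.
Qed.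

(** [psi] is continuous on [I] only; composed with the retraction onto [I] it becomes continuous on
    the line. *)
Lemma continuous_comp_within f (g : R -> R) (A : set R) :
  {within A, continuous f} -> continuous g -> (forall x, A (g x)) -> continuous (f \o g).
Proof.
move=> /subspace_continuousP cf cg gA x.
apply: (@cvg_comp _ _ _ g f _ (within A (nbhs (g x)))); last exact: cf.
move=> B wB; have h : nbhs x (g @^-1` (fun y => A y -> B y)) by exact: cg x _ wB.
by apply: filterS h => y h; exact: h (gA y).
Qed.

End continuous_functions.

(** * Integrals of possibly non-measurable functions *)

Import HBNNSimple.

(** Outside the interval [I] the function [psi] is arbitrary, so [sigma * psi(sigma)] may fail to be
    measurable; hence [f] and [g] are arbitrary here. A simple function below [f], cut off to the
    complement of a measurable null set, lies below [g] and has the same integral. *)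
Lemma ge0_integral_ae d (T : measurableType d) (R : realType) (mu : {measure set T -> \bar R})
    (f g : T -> \bar R) : (forall x, (0 <= f x)%E) -> (forall x, (0 <= g x)%E) ->
  {ae mu, forall x, f x = g x} -> (\int[mu]_x f x <= \int[mu]_x g x)%E.
Proof.
move=> f0 g0 [N [mN N0 hN]].
rewrite [leLHS]ge0_integralTE// [leRHS]ge0_integralTE//=.
apply: ge_ereal_sup => _ [h hf <-].
have mNC : measurable (~` N) by exact: measurableC.
pose h' := proj_nnsfun h mNC.
have h'E x : h' x = h x * \1_(~` N) x by [].
have -> : sintegral mu h = sintegral mu h'.
  rewrite -!integralT_nnsfun; apply: ae_eq_integral => //.
  - by apply/measurable_EFinP.
  - by apply/measurable_EFinP.
  exists N; split => // x /= nx; apply: contrapT => xN; apply: nx => _.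
  by apply: (congr1 EFin); apply: esym; rewrite -[LHS]/(h' x) h'E indic_in ?mulr1.
apply: ereal_sup_ubound; exists h' => // x; rewrite -[X in (X%:E <= _)%E]/(h' x) h'E.
have [Nx|nN] := pselect (N x).
  by rewrite indic_out ?mulr0//; exact: g0.
rewrite indic_in ?mulr1//.
have -> : g x = f x by apply: contrapT => fg; apply: nN; apply: hN => /esym.
exact: hf.
Qed.

Lemma eq_ge0_integral_ae d (T : measurableType d) (R : realType) (mu : {measure set T -> \bar R})
    (f g : T -> \bar R) : (forall x, (0 <= f x)%E) -> (forall x, (0 <= g x)%E) ->
  {ae mu, forall x, f x = g x} -> (\int[mu]_x f x = \int[mu]_x g x)%E.
Proof.
move=> f0 g0 fg; apply/eqP; rewrite eq_le !ge0_integral_ae//.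
by apply: filterS fg.
Qed.

Lemma eq_integral_ae d (T : measurableType d) (R : realType) (mu : {measure set T -> \bar R})
    (f g : T -> R) : {ae mu, forall x, f x = g x} ->
  (\int[mu]_x (f x)%:E = \int[mu]_x (g x)%:E)%E.
Proof.
move=> fg; rewrite [LHS]integralE [RHS]integralE; congr (_ - _)%E; apply: eq_ge0_integral_ae => //.
  by apply: filterS fg => x fx; rewrite !funeposE fx.
by apply: filterS fg => x fx; rewrite !funenegE fx.
Qed.

(** * The symbol *)

Section clamp.
Context (R : realType).
Implicit Types (I : set R) (cl psi : R -> R).

(* [cl] is the nearest-point retraction of the line onto the closed interval [I]. *)
Definition clamp I cl := [/\ continuous cl, forall x, I (cl x) &
  forall x y, I y -> (x < cl x -> cl x <= y) /\ (cl x < x -> y <= cl x)].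

Lemma clamp_id I cl x : clamp I cl -> I x -> cl x = x.
Proof.
move=> [_ _ h] Ix; have [h1 h2] := h x x Ix.
by case: (ltgtP x (cl x)) => [/[dup]/h1|/[dup]/h2|//]; rewrite leNgt => /negP.
Qed.

Lemma clamp_dist I cl x y : clamp I cl -> I y -> `|cl x - x| <= `|y - x|.
Proof.
move=> [_ _ h] Iy; have [h1 h2] := h x y Iy.
case: (ltgtP x (cl x)) => [lt|lt|<-]; last by rewrite subrr normr0.
- have h3 := h1 lt; rewrite !ger0_norm ?subr_ge0//; last 2 first.
  + exact: le_trans (ltW lt) h3.
  + exact: ltW.
  by rewrite lerD2r.
- have h3 := h2 lt; rewrite (distrC _ x) (distrC y x) !ger0_norm ?subr_ge0//; last 2 first.
  + exact: le_trans h3 (ltW lt).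
  + exact: ltW.
  by rewrite lerD2l lerN2.
Qed.

(** Membership in a closed interval reduces to its one-sided bounds. Eigenvalues satisfy these,
    being means of [sigma]. *)
Lemma clamp_mem I cl x : clamp I cl ->
  (forall a, (forall y, I y -> a <= y) -> a <= x) -> (forall b, (forall y, I y -> y <= b) -> x <= b) -> I x.
Proof.
move=> [_ mem h] lo hi; suff <- : cl x = x by [].
apply/eqP; rewrite eq_le; apply/andP; split; rewrite leNgt; apply/negP => lt; move: (lt); rewrite ltNge => /negP; apply.
- by apply: lo => y Iy; have [h1 _] := h x y Iy; exact: h1.
- by apply: hi => y Iy; have [_ h2] := h x y Iy; exact: h2.
Qed.

Lemma clamp_segment (a b : R) : a <= b -> clamp `[a, b] (fun x => Num.max a (Num.min x b)).
Proof.
move=> ab; split=> [x|x|x y].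
- apply: (@continuous_max _ _ (fun=> a) (fun x => Num.min x b) x); first exact: cvg_cst.
  by apply: (@continuous_min _ _ id (fun=> b) x); [exact: cvg_id|exact: cvg_cst].
- by rewrite /= in_itv /= le_max lexx /= ge_max ab /= ge_min lexx orbT.
- rewrite /= in_itv /= => /andP[ay yb].
  by case: (leP x b) => xb; [case: (leP a x) => ax|case: (leP a b) => ?]; split => ?; lra.
Qed.

Lemma clamp_half_line : clamp `[0, +oo[ (fun x : R => Num.max x 0).
Proof.
split=> [x|x|x y].
- by apply: (@continuous_max _ _ id (fun=> 0) x); [exact: cvg_id|exact: cvg_cst].
- by rewrite /= in_itv /= andbT le_max lexx orbT.
- rewrite /= in_itv /= andbT => y0.
  by case: (leP x 0) => x0; split => ?; lra.
Qed.

(** The weight [1 + |s| + |t|] allows linear growth on an unbounded interval. It is affordable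
    because, after multiplication by [sigma], only [|sigma|] and [sigma ^+ 2] have to be
    integrated. *)
Definition almost_lipschitz I psi := forall eps : R, 0 < eps -> exists2 C : R, 0 <= C &
  forall s t, I s -> I t -> `|psi s - psi t| <= eps * (1 + `|s| + `|t|) + C * `|s - t|.

Lemma almost_lipschitz_segment I psi M : continuous psi -> (forall x, I x -> `|x| <= M) ->
  almost_lipschitz I psi.
Proof.
move=> cp IM eps e0; have [C C0 hC] := lipschitz_up_to M cp e0; exists C => // s t Is It.
apply: (le_trans (hC _ _ (IM _ Is) (IM _ It))); rewrite lerD2r.
have := mulr_ge0 (ltW e0) (normr_ge0 s); have := mulr_ge0 (ltW e0) (normr_ge0 t); lra.
Qed.

(** Beyond some [X] the function is within [eps / 2 * x] of the Lipschitz function [l * x]; below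
    [X] the compact case applies. A pair on both sides of [X] is joined through [X]. *)
Lemma almost_lipschitz_half_line psi (l : R) : continuous psi -> psi x / x @[x --> +oo] --> l ->
  almost_lipschitz `[0, +oo[ psi.
Proof.
move=> cp pl eps e0; have e2 : 0 < eps / 2 by rewrite divr_gt0.
have [X X0 hX] : exists2 X : R, 0 < X & forall x, X <= x -> `|psi x - l * x| <= eps / 2 * x.
  have /cvgrPdist_le/(_ _ e2)[X [_ hX]] := pl.
  exists (Num.max X 0 + 1); first by rewrite ltr_wpDl// le_max lexx orbT.
  move=> x Xx; have XX : X <= Num.max X 0 by rewrite le_max lexx.
  have X0 : 0 <= Num.max X 0 by rewrite le_max lexx orbT.
  have x0 : 0 < x by lra.
  have /hX : X < x by lra.
  have -> : psi x - l * x = - (l - psi x / x) * x by field; rewrite gt_eqF.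
  by rewrite normrM normrN (gtr0_norm x0) ler_pM2r.
have [C1 C10 hC1] := lipschitz_up_to X cp e2.
exists (C1 + `|l|); first by rewrite addr_ge0.
have tri (a b c : R) : `|a - c| <= `|a - b| + `|b - c| by exact: ler_distD.
have large s t : X <= s -> X <= t -> `|psi s - psi t| <= eps / 2 * (s + t) + `|l| * `|s - t|.
  move=> /hX hs /hX ht; rewrite -normrM.
  have := tri (psi s) (l * s) (psi t); have := tri (l * s) (l * t) (psi t).
  by rewrite -[l * s - l * t]mulrBr (distrC (l * t)); lra.
suff le s t : 0 <= s -> s <= t -> `|psi s - psi t| <= eps * (1 + `|s| + `|t|) + (C1 + `|l|) * `|s - t|.
  move=> s t; rewrite /= !in_itv /= !andbT => s0 t0.
  have [st|/ltW ts] := leP s t; first exact: le.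
  by have := le t s t0 ts; rewrite (distrC (psi t)) (distrC t) -addrA (addrC `|t|) addrA.
move=> s0 st; have t0 := le_trans s0 st.
have d0 : 0 <= `|s - t| by [].
have p1 := mulr_ge0 C10 d0; have p2 := mulr_ge0 (normr_ge0 l) d0.
have es := mulr_ge0 (ltW e0) s0; have et := mulr_ge0 (ltW e0) t0.
rewrite (ger0_norm s0) (ger0_norm t0).
have [Xs|sX] := leP X s; first by have := large s t Xs (le_trans Xs st); lra.
have sX' : `|s| <= X by rewrite ger0_norm// ltW.
have [tX|Xt] := leP t X.
  by have := hC1 s t sX'; rewrite (ger0_norm t0) => /(_ tX); lra.
have XX : `|X| <= X by rewrite gtr0_norm.
have h1 := hC1 s X sX' XX; have h2 := large X t (lexx _) (ltW Xt).
have h3 := tri (psi s) (psi X) (psi t).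
have st' : `|s - t| = t - s by rewrite distrC ger0_norm// subr_ge0.
have sXe : `|s - X| = X - s by rewrite distrC ger0_norm// subr_ge0 ltW.
have Xte : `|X - t| = t - X by rewrite distrC ger0_norm// subr_ge0 ltW.
rewrite {}st' {}sXe {}Xte in h1 h2 h3 p1 p2 *.
have : C1 * (X - s) <= C1 * (t - s) by rewrite ler_wpM2l// lerD2r ltW.
have : `|l| * (t - X) <= `|l| * (t - s) by rewrite ler_wpM2l// lerD2l lerN2 ltW.
have : eps * X <= eps * t by rewrite ler_pM2l// ltW.
lra.
Qed.

End clamp.

Section toeplitz_band.
Context (R : realType) (G : PreTopologicalZmodule.type) (hausdorffG : hausdorff_space G)
  (m : {measure set (borel G) -> \bar R}) (haar_m : haar_measure m).
Context (V : lmodType R[i]) (dot : V -> V -> R[i]) (ip : inner_product dot)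
  (H : set V) (sH : subspace H) (cH : hcomplete dot H)
  (K : G -> V) (KH : forall y, H (K y)) (c : R) (c_gt0 : 0 < c)
  (hnorm_K : forall y, hnorm dot (K y) ^+ 2 = c)
  (K_continuous : forall y (e : R), 0 < e -> \forall z \near y, hnorm dot (K z - K y) < e).
Local Notation bG := (borel G).
Local Notation nm := (hnorm dot).
Local Notation ev := (evaluation dot K).
Local Notation rI h := (Rintegral m setT h).
Local Notation cI h := (cintegral m h).
Context (evaluation_cLfun2 : forall f, H f -> (fun y : bG => ev f (y : G)) \in cLfun m 2%:E)
  (dot_evaluation : forall f g, H f -> H g ->
    dot f g = cI (fun y : bG => ev f (y : G) * (ev g (y : G))^*)).
Context (sigma : bG -> R) (sigma1 : rintegrable m sigma)
  (sigma2 : rintegrable m (fun y => sigma y ^+ 2))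
  (T : V -> V) (bT : bounded_operator dot H T)
  (dotT : forall f g, H f -> H g ->
    dot (T f) g = cI (fun y : bG => (sigma y)%:C * (ev f (y : G) * (ev g (y : G))^*))).
Context (I : set R) (cl : R -> R) (clI : clamp I cl) (sigmaI : forall y, I (sigma y))
  (psi : R -> R) (psi_continuous : continuous (psi \o cl)).
Context (D : Type) (p : D -> bG -> R[i]) (Bp : D -> V -> V) (W : D -> R)
  (mp : forall d, cmeasurable (p d)) (p1 : forall d y, normc (p d y) <= 1)
  (bBp : forall d, bounded_operator dot H (Bp d))
  (dotBp : forall d f g, H f -> H g ->
    dot (Bp d f) g = cI (fun y : bG => p d y * (ev f (y : G) * (ev g (y : G))^*)))
  (BpK : forall d (y : bG), dot (Bp d (K (y : G))) (K (y : G)) = p d y * (W d)%:C).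
Let N1 := rI (fun y => `|sigma y|).
Let N2 := rI (fun y => sigma y ^+ 2).

(** All that the limit needs about one space of band-limited functions, with basis and eigenvalues
    hidden: [t] is the trace and [L] the sum of the squared eigenvalues. *)
Lemma toeplitz_band : exists t L : R, let S := T \o functional_calculus dot H psi T in
  [/\ trace_class dot H S, trace dot H S = t%:C,
    forall eps C eta : R, rintegrable m (fun y => sigma y * psi (sigma y)) ->
      0 <= eps -> 0 <= C -> 0 < eta ->
      (forall x y, I x -> I y -> `|psi x - psi y| <= eps * (1 + `|x| + `|y|) + C * `|x - y|) ->
      `|t - c * rI (fun y => sigma y * psi (sigma y))| <=
        c * (eps * (N1 + 2 * N2) + eta * N2) + C ^+ 2 / (4 * eta) * (c * N2 - L) &
    forall rho : R, 0 < rho -> exists g : bG -> R,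
      [/\ rintegrable m g, rintegrable m (fun y => g y ^+ 2),
        rI (fun y => g y ^+ 2) <= c ^+ 2 * N2, rI (fun y => sigma y * g y) <= L &
        forall d, normc (cI (fun y => (g y)%:C * p d y) -
          (W d)%:C * cI (fun y => (sigma y)%:C * p d y)) <= rho]].
Proof.
have [E bE [lam TE]] := toeplitz_spectral hausdorffG haar_m ip sH cH KH hnorm_K K_continuous sigma1 bT dotT.
have EH e : E e -> H e by case: bE => h _ _; exact: h.
have TH u : H u -> H (T u) by case: bT => h _ _; exact: h.
pose M := c * N1.
have lamM e : E e -> `|lam e| <= M.
  exact: (eigenvalue_bounded ip hnorm_K K_continuous sigma1 dotT bE TE).
have dotTe u e : H u -> E e -> dot (T u) e = (lam e)%:C * dot u e.
  exact: (dot_toeplitz_basis ip hnorm_K K_continuous sigma1 dotT bE TE).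
have lamI e : E e -> I (lam e).
  move=> Ee; apply: (clamp_mem clI) => a ha.
    by apply: (eigenvalue_ge ip hnorm_K K_continuous evaluation_cLfun2 dot_evaluation sigma1 dotT bE TE Ee) => y; exact: ha.
  by apply: (eigenvalue_le ip hnorm_K K_continuous evaluation_cLfun2 dot_evaluation sigma1 dotT bE TE Ee) => y; exact: ha.
have [C0 C00 hC0] := lipschitz_up_to M psi_continuous (@ltr01 R).
have psi_cl x : I x -> psi x = (psi \o cl) x by move=> Ix /=; rewrite (clamp_id clI).
(* A bound of [psi \o cl] on [[-M, M]], by comparison with its value at 0. *)
pose C := 1 + C0 * M + `|(psi \o cl) 0|.
have M0 : 0 <= M by rewrite mulr_ge0// ?(ltW c_gt0)//; exact: Rint_ge0.
have CC : 0 <= C by rewrite !addr_ge0// mulr_ge0.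
have psiC e : E e -> `|psi (lam e)| <= C.
  move=> Ee; rewrite (psi_cl _ (lamI _ Ee)); have lM := lamM _ Ee.
  have := hC0 (lam e) 0 lM; rewrite normr0 subr0 => /(_ M0) h.
  have h2 : C0 * `|lam e| <= C0 * M by exact: ler_wpM2l.
  have := ler_normD ((psi \o cl) (lam e) - (psi \o cl) 0) ((psi \o cl) 0); rewrite subrK /C.
  by move: h h2; lra.
(* A point outside [I] is at distance at least [|cl x - x|] from every eigenvalue. So the spectrum
   stays in [I], where [psi] coincides with the continuous [psi \o cl] and can be approximated by
   polynomials. *)
have spec_dist x : spectrum dot H T x%:C -> I x /\ `|x| <= M.
  move=> sx; split; apply: contrapT => nx.
  - have d0 : 0 < `|cl x - x|.
      rewrite normr_gt0 subr_eq0; apply/eqP => e; apply: nx; rewrite -e.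
      by case: clI.
    apply: (spectrum_dist ip sH cH bE TH dotTe d0) sx => e Ee.
    by apply: (clamp_dist _ clI); exact: lamI.
  - move/negP: nx; rewrite -ltNge -subr_gt0 => d0.
    apply: (spectrum_dist ip sH cH bE TH dotTe d0) sx => e Ee.
    have := lamM _ Ee; have := ler_normD (x - lam e) (lam e); rewrite subrK distrC; lra.
have fcE u : H u -> functional_calculus dot H psi T u = diagonal dot H E (psi \o lam) u.
  apply: (functional_calculusE ip sH cH bE TH dotTe CC psiC) => eps e0.
  have [q hq] := weierstrass M psi_continuous e0; exists q => x /spec_dist[Ix xM].
  by rewrite psi_cl//; exact: hq.
have dB := diagonal_bounded ip sH cH bE CC psiC.
have bB : bounded_operator dot H (functional_calculus dot H psi T).
  have [h1 h2 [C' h3]] := dB; split.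
  - by move=> u Hu; rewrite fcE//; exact: h1.
  - by move=> a u v Hu Hv; rewrite !fcE//; [exact: h2|exact: sH.2].
  - by exists C' => u Hu; rewrite fcE//; exact: h3.
have dotB u e : H u -> E e -> dot (functional_calculus dot H psi T u) e = (psi (lam e))%:C * dot u e.
  by move=> Hu Ee; rewrite fcE//; exact: (dot_diagonal ip sH cH bE CC psiC).
have [t [tr ht]] := toeplitz_traceE hausdorffG haar_m ip sH cH KH hnorm_K K_continuous sigma1 dotT bE TE bB dotB.
have [L [hL _ leL]] := has_sum_ge0 (fun e (_ : E e) => sqr_ge0 (lam e))
  (sum_eigenvalue_sqr_le ip hnorm_K K_continuous evaluation_cLfun2 dot_evaluation sigma1 dotT bE TE sigma2).
exists t, L; split.
- exact: (toeplitz_trace_class ip sH cH hnorm_K K_continuous sigma1 bT dotT bE TE CC psiC bB dotB).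
- exact: tr.
- move=> eps A eta ispsi e0 A0 eta0 est.
  apply: (trace_estimate hausdorffG haar_m ip sH cH KH hnorm_K K_continuous evaluation_cLfun2 dot_evaluation sigma1 dotT bE TE sigma2 hL ispsi e0 A0 eta0 _ ht).
  by move=> e y Ee; apply: est; [exact: lamI|exact: sigmaI].
- move=> rho rho0.
  have [L1 [hL1 _ leL1]] := has_sum_ge0 (fun e (_ : E e) => normr_ge0 (lam e))
    (sum_eigenvalue_le ip hnorm_K K_continuous sigma1 dotT bE TE).
  have [A AE hA] : exists2 A : {fset V}, [set` A] `<=` E & L1 - \sum_(e <- A) `|lam e| <= rho.
    have /has_sumP/(_ _ rho0)[A AE /(_ A AE)] := hL1; rewrite -rmorph_sum -rmorphB normc_real distrC => h.
    by exists A => //; apply: (le_trans (ler_norm _)); apply: ltW; apply: h.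
  exists (eigen_density dot K lam A).
  have [iA eA] := eigen_densityP ip hnorm_K K_continuous evaluation_cLfun2 sigma1 dotT bE TE AE.
  have [i2 l2] := eigen_density_sqr ip hnorm_K K_continuous evaluation_cLfun2 dot_evaluation sigma1 dotT bE TE c_gt0 sigma2 AE.
  split => //; first by rewrite eA; exact: leL.
  move=> d; apply: le_trans hA.
  exact: (eigen_density_fourier hausdorffG haar_m ip sH cH KH hnorm_K K_continuous evaluation_cLfun2 dot_evaluation sigma1 dotT bE TE leL1 (mp d) (p1 d) (bBp d) (dotBp d) (BpK d) AE).
Qed.

End toeplitz_band.

(** * The limit of the traces *)

Section toeplitz_bands.
Context (R : realType) (G : topologicalZmodType)
  (hausdorffG : hausdorff_space G) (locally_compactG : locally_compact [set: G])
  (m : {measure set (borel G) -> \bar R}) (haar_m : haar_measure m)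
  (mh : {measure set (borel (dual R G)) -> \bar R}) (dual_haar_mh : dual_haar_measure m mh)
  (F : set (borel (dual R G))) (mF : measurable F) (F_fin : (0 < mh F < +oo)%E).
Local Notation Gd := (dual R G).
Local Notation bG := (borel G).
Local Notation bD := (borel Gd).
Local Notation rI mu h := (Rintegral mu setT h).
Local Notation cI := cintegral.
Local Notation fourier := (fourier m).
Local Notation dot := (@L2inner _ _ _ m).
Local Notation nm := (hnorm dot).
Local Notation ip := (L2inner_product m).
Local Notation c := (fine (mh F)).
Context (fourier2 : L2 m -> L2 mh)
  (fourier2_lin : forall (a : R[i]) f g, fourier2 (a *: f + g) = a *: fourier2 f + fourier2 g)
  (hnorm_fourier2 : forall f, hnorm (@L2inner _ _ _ mh) (fourier2 f) = nm f)
  (fourier2_toL2 : forall u, L1L2 m u -> fourier2 (toL2 m u) = toL2 mh (fourier u))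
  (kernel : G -> L2 m)
  (fourier2_kernel : forall y, fourier2 (kernel y) = toL2 mh (kernel_hat F y))
  (fourier2_modulation : forall f (gamma : Gd),
    fourier2 (toL2 m (fun x : bG => (gamma (x : G))^* * rp f x)) =
    toL2 mh (fun xi : bD => rp (fourier2 f) ((xi : Gd) + gamma))).
Local Notation H := [set f | {ae mh, forall xi : bD, ~ F xi -> rp (fourier2 f) xi = 0}].
Local Notation ev := (evaluation dot kernel).
Let sH : subspace H := band_limited_subspace F fourier2_lin.
Let cH : hcomplete dot H := band_limited_complete mF fourier2_lin hnorm_fourier2.
Let hnorm_K := hnorm_kernel mF F_fin fourier2_lin hnorm_fourier2 fourier2_kernel.
Let K_continuous := kernel_continuous locally_compactG dual_haar_mh mF F_fin fourier2_lin
  hnorm_fourier2 fourier2_kernel.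
Let mev f : cmeasurable (fun y : bG => ev f (y : G)) :=
  cmeasurable_evaluation ip K_continuous f.
Let rp_ev f : H f -> {ae m, forall x : bG, rp f x = ev f (x : G)}.
Proof.
exact: (rp_evaluation hausdorffG locally_compactG haar_m dual_haar_mh mF F_fin fourier2_lin
  hnorm_fourier2 fourier2_toL2 fourier2_kernel).
Qed.
Let KH y : H (kernel y) := kernel_in mF F_fin fourier2_kernel y.

(** A merely square-integrable symbol acts boundedly on [H], because the kernel bounds [|f|^2]
    pointwise by [c |f|^2], the latter being the squared norm. *)
Lemma multiplier_bounded (q : bG -> R) : measurable_fun setT q ->
  rintegrable m (fun x => q x ^+ 2) -> forall f, H f ->
  (fun x => (q x)%:C * rp f x) \in cLfun m 2%:E /\
  nm (toL2 m (fun x => (q x)%:C * rp f x)) <= Num.sqrt (c * rI m (fun x => q x ^+ 2)) * nm f.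
Proof.
move=> mq iq f Hf; pose h (x : bG) := (q x)%:C * ev f (x : G).
have c0 : 0 <= c by exact: fine_ge0.
have mh' : cmeasurable h by apply: cmeasurableM => //; exact: cmeasurable_real.
have hE (x : bG) : normc (h x) ^+ 2 = q x ^+ 2 * normc (ev f (x : G)) ^+ 2.
  by rewrite Normc.normcM normc_real exprMn real_normK ?num_real.
have hle (x : bG) : normc (h x) ^+ 2 <= (c * nm f ^+ 2) * q x ^+ 2.
  rewrite hE mulrC; apply: ler_wpM2r; [exact: sqr_ge0|exact: (normc_evaluation ip hnorm_K)].
have ib := rintegrableZ (c * nm f ^+ 2) iq.
have Lh : h \in cLfun m 2%:E by exact: le_cLfun2 mh' ib hle.
have hae : {ae m, forall x : bG, h x = (q x)%:C * rp f x}.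
  by apply: filterS (rp_ev Hf) => x ->.
have Lr : (fun x => (q x)%:C * rp f x) \in cLfun m 2%:E.
  have mr : cmeasurable (fun x => (q x)%:C * rp f x).
    by apply: cmeasurableM; [exact: cmeasurable_real|exact: rp_cmeasurable].
  apply/cLfun2P; split => //; apply: (rintegrable_ae _ (proj2 ((cLfun2P _ _).1 Lh))).
    exact: measurable_normc_sqr.
  by apply: filterS hae => x ->.
split => //; rewrite -(toL2_ae Lh Lr hae).
rewrite -(@ler_pXn2r _ 2)// ?nnegrE; last 2 first.
- exact: hnorm_ge0.
- by rewrite mulr_ge0 ?sqrtr_ge0//; exact: hnorm_ge0.
have N0 : 0 <= c * rI m (fun x => q x ^+ 2).
  by apply: mulr_ge0 => //; apply: Rint_ge0 => x; exact: sqr_ge0.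
rewrite exprMn (sqr_sqrtr N0).
rewrite hnorm_toL2// mulrAC -RintZ; last exact: iq.
by apply: le_Rint => //; have /cLfun2P[] := Lh.
Qed.

Let modulation_bounded (gamma : Gd) f : H f ->
  (fun x : bG => (gamma (x : G))^* * rp f x) \in cLfun m 2%:E /\
  nm (toL2 m (fun x : bG => (gamma (x : G))^* * rp f x)) <= 1 * nm f.
Proof.
move=> _; have L := modulation_cLfun2 gamma (rp_cLfun2 f); split => //.
rewrite mul1r -(@ler_pXn2r _ 2)// ?nnegrE; [|exact: hnorm_ge0|exact: hnorm_ge0].
rewrite hnorm_toL2// L2norm_sqr (_ : (fun x => _) = fun x => normc (rp f x) ^+ 2)//.
by apply/funext => x; rewrite Normc.normcM normcJ normc_char mul1r.
Qed.

Context (sigma0 sigma : bG -> R) (msigma0 : measurable_fun setT sigma0)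
  (sigma0E : {ae m, forall x, sigma0 x = sigma x})
  (sigma1 : rintegrable m sigma) (sigma2 : rintegrable m (fun y => sigma y ^+ 2)).
Context (I : set R) (cl : R -> R) (clI : clamp I cl) (sigmaI : forall y, I (sigma y))
  (psi : R -> R) (psi_continuous : continuous (psi \o cl)).
Let N1 := rI m (fun y => `|sigma y|).
Let N2 := rI m (fun y => sigma y ^+ 2).
Let T := compression H (fun x => (sigma0 x)%:C).

(** [sigma0] is the given symbol, which defines the operator; [sigma] is equal to it almost
    everywhere and takes all its values in [I]. *)
Lemma toeplitz_dual_band : exists t L : R, let S := T \o functional_calculus dot H psi T in
  [/\ trace_class dot H S, trace dot H S = t%:C,
    forall eps C eta : R, rintegrable m (fun y => sigma y * psi (sigma y)) ->
      0 <= eps -> 0 <= C -> 0 < eta ->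
      (forall x y, I x -> I y -> `|psi x - psi y| <= eps * (1 + `|x| + `|y|) + C * `|x - y|) ->
      `|t - c * rI m (fun y => sigma y * psi (sigma y))| <=
        c * (eps * (N1 + 2 * N2) + eta * N2) + C ^+ 2 / (4 * eta) * (c * N2 - L) &
    forall rho : R, 0 < rho -> exists g : bG -> R,
      [/\ rintegrable m g, rintegrable m (fun y => g y ^+ 2),
        rI m (fun y => g y ^+ 2) <= c ^+ 2 * N2, rI m (fun y => sigma y * g y) <= L &
        forall xi, normc (fourier (fun x => (g x)%:C) xi -
          (autocorrelation mh F xi)%:C * fourier (fun x => (sigma x)%:C) xi) <= rho]].
Proof.
have i0 : rintegrable m (fun x => sigma0 x ^+ 2).
  apply: (rintegrable_ae _ sigma2); first exact: measurable_funX.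
  by apply: filterS sigma0E => x ->.
have hp := multiplier_bounded msigma0 i0.
have bT : bounded_operator dot H T := compression_bounded sH cH hp.
have dotT f g : H f -> H g -> dot (T f) g =
    cI m (fun y : bG => (sigma y)%:C * (ev f (y : G) * (ev g (y : G))^*)).
  move=> Hf Hg; apply: etrans (dot_compression sH cH hp Hf Hg) _; apply: cint_ae.
  - apply: cmeasurableM; last exact/cmeasurableJ/rp_cmeasurable.
    by apply: cmeasurableM; [exact: cmeasurable_real|exact: rp_cmeasurable].
  - apply: cmeasurableM; first exact: cmeasurable_real (rintegrable_measurable sigma1).
    by apply: cmeasurableM; [exact: mev|exact/cmeasurableJ/mev].
  - by apply: filterS3 sigma0E (rp_ev Hf) (rp_ev Hg) => x -> -> ->; rewrite mulrA.
pose p (gamma : Gd) (x : bG) := (gamma (x : G))^*.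
have mp gamma : cmeasurable (p gamma) by exact/cmeasurableJ/cmeasurable_char.
have dotBp gamma f g : H f -> H g -> dot (compression H (p gamma) f) g =
    cI m (fun y : bG => p gamma y * (ev f (y : G) * (ev g (y : G))^*)).
  move=> Hf Hg; apply: etrans (dot_compression sH cH (modulation_bounded gamma) Hf Hg) _; apply: cint_ae.
  - apply: cmeasurableM; last exact/cmeasurableJ/rp_cmeasurable.
    by apply: cmeasurableM; [exact: mp|exact: rp_cmeasurable].
  - by apply: cmeasurableM; [exact: mp|apply: cmeasurableM; [exact: mev|exact/cmeasurableJ/mev]].
  - by apply: filterS2 (rp_ev Hf) (rp_ev Hg) => x -> ->; rewrite mulrA.
apply: (@toeplitz_band R G hausdorffG m haar_m _ dot ip H sH cH kernel KH c (bandwidth_gt0 F_fin)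
  hnorm_K K_continuous _ _ sigma sigma1 sigma2 T bT dotT I cl clI sigmaI psi psi_continuous
  Gd p (fun gamma => compression H (p gamma)) (autocorrelation mh F) mp _ _ dotBp).
- exact: (evaluation_cLfun2 hausdorffG locally_compactG haar_m dual_haar_mh mF F_fin fourier2_lin
  hnorm_fourier2 fourier2_toL2 fourier2_kernel).
- exact: (dot_evaluation hausdorffG locally_compactG haar_m dual_haar_mh mF F_fin fourier2_lin
  hnorm_fourier2 fourier2_toL2 fourier2_kernel).
- by move=> gamma y; rewrite normcJ normc_char.
- by move=> gamma; exact: (compression_bounded sH cH (modulation_bounded gamma)).
- move=> gamma y; rewrite dotBp//.
  exact: (kernel_modulation hausdorffG locally_compactG haar_m dual_haar_mh mF F_fin fourier2_lin
    hnorm_fourier2 fourier2_toL2 fourier2_kernel fourier2_modulation).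
Qed.

End toeplitz_bands.

(** * Reduction to a symbol with values in the interval *)

Section symbol.
Context d (X : measurableType d) (R : realType) (mu : {measure set X -> \bar R}).

Lemma clamp_symbol (I : set R) (cl : R -> R) (s : X -> R) : clamp I cl -> rintegrable mu s ->
  {ae mu, forall x, I (s x)} ->
  [/\ {ae mu, forall x, s x = cl (s x)}, rintegrable mu (cl \o s) & forall x, I ((cl \o s) x)].
Proof.
move=> clI s1 sI; have e : {ae mu, forall x, s x = cl (s x)}.
  by apply: filterS sI => x Ix; rewrite (clamp_id clI).
split=> //; last by move=> x; case: clI => _ mem _; exact: mem.
apply: (rintegrable_ae _ s1 e).
apply: measurableT_comp; last exact: rintegrable_measurable s1.
by apply: continuous_measurable_fun; case: clI.
Qed.

(** Boundedness makes both essential bounds finite, so that [fine] loses nothing; their order rests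
    on the total measure being positive. *)
Lemma ess_segment (s : X -> R) (M : R) : (0 < mu setT)%E -> {ae mu, forall x, `|s x| <= M} ->
  let a := fine (ess_inf mu (EFin \o s)) in let b := fine (ess_sup mu (EFin \o s)) in
  a <= b /\ {ae mu, forall x, a <= s x <= b}.
Proof.
move=> mu0 sM.
have h1 : (ess_sup mu (EFin \o s) <= M%:E)%E.
  by apply/ess_supP; apply: filterS sM => x /= h; rewrite lee_fin (le_trans (ler_norm _)).
have h2 : ((- M)%:E <= ess_inf mu (EFin \o s))%E.
  apply/ess_infP; apply: filterS sM => x /= h; rewrite lee_fin.
  by move: h; rewrite ler_norml => /andP[].
have h3 : (ess_inf mu (EFin \o s) <= ess_sup mu (EFin \o s))%E.
  apply: (le_trans (ess_sup_gee mu0 (ess_inf_le mu (EFin \o s)))).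
  exact: lexx.
have fa : ess_inf mu (EFin \o s) \is a fin_num.
  rewrite fin_numE; apply/andP; split.
    by apply: contraTneq h2 => ->; rewrite leeNy_eq.
  by apply: contraTneq (le_trans h3 h1) => ->; rewrite leye_eq.
have fb : ess_sup mu (EFin \o s) \is a fin_num.
  rewrite fin_numE; apply/andP; split.
    by apply: contraTneq (le_trans h2 h3) => ->; rewrite leeNy_eq.
  by apply: contraTneq h1 => ->; rewrite leye_eq.
move=> a b; split; first by rewrite -lee_fin !fineK.
apply: filterS2 (ess_inf_le mu (EFin \o s)) (ess_sup_ge mu (EFin \o s)) => x /= sa sb.
by rewrite -!lee_fin !fineK// sa sb.
Qed.

(** The almost Lipschitz bound with [eps = 1], from the base point [cl 0] of [I], gives linear
    growth of [psi]; the product with [s] is then dominated by [|s|] and [s ^+ 2]. *)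
Lemma rintegrable_symbol (I : set R) (cl psi : R -> R) (s : X -> R) : clamp I cl ->
  continuous (psi \o cl) -> almost_lipschitz I psi ->
  rintegrable mu s -> rintegrable mu (fun x => s x ^+ 2) -> (forall x, I (s x)) ->
  rintegrable mu (fun x => s x * psi (s x)).
Proof.
move=> clI cpsi al s1 s2 sI; have [C C0 hC] := al 1 ltr01.
pose y := cl 0; have Iy : I y by case: clI => _ mem _; exact: mem.
pose A := `|psi y| + 1 + `|y| + C * `|y|.
apply: (@le_rintegrable _ _ _ mu _ (fun x => A * `|s x| + (1 + C) * s x ^+ 2)).
- rewrite (_ : (fun x => _) = fun x => s x * (psi \o cl) (s x)); last first.
    by apply/funext => x /=; rewrite (clamp_id clI).
  have ms := rintegrable_measurable s1.
  by apply: measurable_funM => //; apply: measurableT_comp => //; exact: continuous_measurable_fun.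
- by apply: rintegrableD; apply: rintegrableZ => //; exact: rintegrable_norm.
- move=> x; rewrite normrM -(real_normK (num_real (s x))).
  have := hC (s x) y (sI x) Iy; set u := `|s x|; set v := `|psi (s x)|; move=> h.
  have u0 : 0 <= u := normr_ge0 _.
  have h1 : v <= `|psi (s x) - psi y| + `|psi y| by rewrite /v -{1}(subrK (psi y) (psi (s x))) ler_normD.
  have h2 : C * `|s x - y| <= C * (u + `|y|) by rewrite ler_wpM2l// ler_normB.
  have h3 : v <= A + (1 + C) * u by rewrite /A; lra.
  have := ler_wpM2l u0 h3; rewrite mulrDr; congr (_ <= _); ring.
Qed.

End symbol.

Section szego.
Context (R : realType) (G : topologicalZmodType)
  (hausdorffG : hausdorff_space G) (locally_compactG : locally_compact [set: G])
  (m : {measure set (borel G) -> \bar R}) (haar_m : haar_measure m)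
  (mh : {measure set (borel (dual R G)) -> \bar R}) (dual_haar_mh : dual_haar_measure m mh)
  (F : nat -> set (borel (dual R G))) (folnerF : folner_sequence mh F).
Local Notation Gd := (dual R G).
Local Notation bG := (borel G).
Local Notation bD := (borel Gd).
Local Notation rI mu h := (Rintegral mu setT h).
Local Notation dot := (@L2inner _ _ _ m).
Let c N := fine (mh (F N)).
Let W N : bD -> R := autocorrelation mh (F N).

Let mF N : measurable (F N). Proof. by case: folnerF. Qed.
Let F_fin N : (0 < mh (F N) < +oo)%E. Proof. by case: folnerF. Qed.
Let c_gt0 N : 0 < c N. Proof. exact: bandwidth_gt0. Qed.

Let kernel_exists N : exists kernel : G -> L2 m,
  forall y, fourier2 mh (kernel y) = toL2 mh (kernel_hat (F N) y).
Proof.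
have /choice[kernel kernelP] : forall y : G, exists k : L2 m, fourier2 mh k = toL2 mh (kernel_hat (F N) y).
  by move=> y; exact: (fourier2_surj hausdorffG locally_compactG haar_m dual_haar_mh).
by exists kernel.
Qed.

Let measurable_W N : measurable_fun setT (W N).
Proof.
have [kernel kernelP] := kernel_exists N.
exact: (measurable_autocorrelation hausdorffG locally_compactG haar_m dual_haar_mh (mF N) (F_fin N)
  (fourier2_lin hausdorffG haar_m dual_haar_mh) (hnorm_fourier2 hausdorffG haar_m dual_haar_mh)
  (fourier2_toL2 hausdorffG haar_m dual_haar_mh) kernelP
  (fourier2_modulation hausdorffG haar_m dual_haar_mh)).
Qed.

Lemma autocorrelation_limit (xi : Gd) : W N xi / c N @[N --> \oo] --> (1 : R).
Proof.
have [_ _ /(_ xi) lim0] := folnerF.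
apply/cvgrPdist_le => e e0; have /cvgrPdist_le/(_ _ e0) := lim0.
apply: filterS => N; rewrite sub0r normrN => h.
have := autocorrelation_defect dual_haar_mh (mF N) (F_fin N) xi.
have /andP[_ Wc] := autocorrelation_ge0_le (mF N) (F_fin N) xi.
rewrite -/(c N) in Wc *; rewrite -/(W N xi) in Wc * => defect.
rewrite ger0_norm; last by rewrite subr_ge0 ler_pdivrMr ?mul1r.
apply: le_trans (le_trans (ler_norm _) h).
by rewrite -[X in X - _](divff (lt0r_neq0 (c_gt0 N))) -mulrBl ler_pM2r ?invr_gt0.
Qed.

Context (sigma0 sigma : bG -> R) (msigma0 : measurable_fun setT sigma0)
  (sigma0E : {ae m, forall x, sigma0 x = sigma x})
  (sigma1 : rintegrable m sigma) (sigma2 : rintegrable m (fun y => sigma y ^+ 2)).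
Context (I : set R) (cl : R -> R) (clI : clamp I cl) (sigmaI : forall y, I (sigma y))
  (psi : R -> R) (psi_continuous : continuous (psi \o cl)) (psiI : almost_lipschitz I psi).
Let N1 := rI m (fun y => `|sigma y|).
Let N2 := rI m (fun y => sigma y ^+ 2).
Let J := rI m (fun y => sigma y * psi (sigma y)).
Let S N := toeplitz m mh (F N) sigma0 \o
  functional_calculus dot (band_limited m mh (F N)) psi (toeplitz m mh (F N) sigma0).

Let band N : exists t L : R,
  [/\ trace_class dot (band_limited m mh (F N)) (S N), trace dot (band_limited m mh (F N)) (S N) = t%:C,
    forall eps C eta : R, rintegrable m (fun y => sigma y * psi (sigma y)) ->
      0 <= eps -> 0 <= C -> 0 < eta ->
      (forall x y, I x -> I y -> `|psi x - psi y| <= eps * (1 + `|x| + `|y|) + C * `|x - y|) ->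
      `|t - c N * J| <= c N * (eps * (N1 + 2 * N2) + eta * N2) + C ^+ 2 / (4 * eta) * (c N * N2 - L) &
    forall rho : R, 0 < rho -> exists g : bG -> R,
      [/\ rintegrable m g, rintegrable m (fun y => g y ^+ 2),
        rI m (fun y => g y ^+ 2) <= c N ^+ 2 * N2, rI m (fun y => sigma y * g y) <= L &
        forall xi, normc (fourier m (fun x => (g x)%:C) xi -
          (W N xi)%:C * fourier m (fun x => (sigma x)%:C) xi) <= rho]].
Proof.
have [kernel kernelP] := kernel_exists N.
have [t [L h]] := toeplitz_dual_band hausdorffG locally_compactG haar_m dual_haar_mh (mF N) (F_fin N)
  (fourier2_lin hausdorffG haar_m dual_haar_mh) (hnorm_fourier2 hausdorffG haar_m dual_haar_mh)
  (fourier2_toL2 hausdorffG haar_m dual_haar_mh) kernelP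
  (fourier2_modulation hausdorffG haar_m dual_haar_mh)
  msigma0 sigma0E sigma1 sigma2 clI sigmaI psi_continuous.
by exists t, L.
Qed.

Lemma szego_trace_class N : trace_class dot (band_limited m mh (F N)) (S N).
Proof. by have [t [L []]] := band N. Qed.

Lemma szego_limit :
  (trace dot (band_limited m mh (F N)) (S N) / (c N)%:C : R[i]^o) @[N --> \oo] --> (J%:C : R[i]^o).
Proof.
have /choice[t /choice[L tL]] := band.
have iJ : rintegrable m (fun y => sigma y * psi (sigma y)).
  exact: rintegrable_symbol clI psi_continuous psiI sigma1 sigma2 sigmaI.
have N1_ge0 : 0 <= N1 by exact: Rint_ge0.
have N2_ge0 : 0 <= N2 by apply: Rint_ge0 => x; exact: sqr_ge0.
have Llim : forall e : R, 0 < e -> \forall N \near \oo, N2 - e < L N / c N.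
  apply: (second_moment_limit hausdorffG haar_m dual_haar_mh sigma1 sigma2 c_gt0
    (W := W)).
  - exact: measurable_W.
  - by move=> N xi; exact: autocorrelation_ge0_le.
  - exact: autocorrelation_limit.
  - by move=> N rho rho0; have [_ _ _] := tL N; exact.
apply/cvg_normcP => e e0.
(* The order of choices matters: [eps] fixes the constant [C], then [eta] fixes the factor [Q] of
   the variance, and only then is [N] taken large. Each of the three errors is at most [e / 4]. *)
pose eps := e / 4 / (N1 + 2 * N2 + 1); pose eta := e / 4 / (N2 + 1).
have e4 : 0 < e / 4 by rewrite divr_gt0.
have S1 : 0 < N1 + 2 * N2 + 1 by lra.
have S2 : 0 < N2 + 1 by lra.
have eps0 : 0 < eps by rewrite divr_gt0.
have eta0 : 0 < eta by rewrite divr_gt0.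
have [C C0 hC] := psiI eps0.
pose Q := C ^+ 2 / (4 * eta).
have Q0 : 0 <= Q by rewrite divr_ge0 ?sqr_ge0// mulr_ge0// ltW.
have Q1 : 0 < Q + 1 by lra.
apply: filterS (Llim _ (divr_gt0 e4 Q1)) => N LN.
have [_ trE est _] := tL N.
have cN := c_gt0 N; have cN0 : c N != 0 by rewrite gt_eqF.
have {}est : `|t N / c N - J| <= eps * (N1 + 2 * N2) + eta * N2 + Q * (N2 - L N / c N).
  rewrite -(ler_pM2l cN) -{1}(gtr0_norm cN) -normrM.
  have -> : c N * (t N / c N - J) = t N - c N * J by field.
  have -> : c N * (eps * (N1 + 2 * N2) + eta * N2 + Q * (N2 - L N / c N)) =
    c N * (eps * (N1 + 2 * N2) + eta * N2) + Q * (c N * N2 - L N) by field.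
  exact: (est eps C eta iJ (ltW eps0) C0 eta0 hC).
have h1 : eps * (N1 + 2 * N2 + 1) = e / 4 by rewrite divfK// gt_eqF.
have h2 : eta * (N2 + 1) = e / 4 by rewrite divfK// gt_eqF.
have h3 : Q * (N2 - L N / c N) <= e / 4.
  apply: (@le_trans _ _ (Q * (e / 4 / (Q + 1)))); first by apply: ler_wpM2l => //; lra.
  by rewrite mulrA ler_pdivrMr// mulrC ler_pM2l// lerDl.
rewrite trE -fmorph_div -rmorphB normc_real.
by lra.
Qed.

End szego.

(** Both cases of the theorem are instances, with [I] a segment or a half-line. The integrals for
    [sigma] and for [cl \o sigma] agree without measurability of the former integrand. *)
Lemma szego_ae (R : realType) (G : topologicalZmodType)
  (hausdorffG : hausdorff_space G) (locally_compactG : locally_compact [set: G])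
  (m : {measure set (borel G) -> \bar R}) (haar_m : haar_measure m)
  (mh : {measure set (borel (dual R G)) -> \bar R})
  (dual_haar_mh : dual_haar_measure m mh)
  (F : nat -> set (borel (dual R G))) (folnerF : folner_sequence mh F)
  (sigma : borel G -> R) (sigma1 : rintegrable m sigma) (psi : R -> R)
  (I : set R) (cl : R -> R) (clI : clamp I cl) (sigmaI : {ae m, forall x, I (sigma x)})
  (sigma2 : rintegrable m (fun x => (cl \o sigma) x ^+ 2))
  (psi_continuous : continuous (psi \o cl)) (psiI : almost_lipschitz I psi) :
  let H (N : nat) : set (L2 m) := band_limited m mh (F N) in
  let T (N : nat) : L2 m -> L2 m := toeplitz m mh (F N) sigma in
  let S (N : nat) : L2 m -> L2 m :=
    T N \o functional_calculus (L2inner (mu := m)) (H N) psi (T N) in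
  [/\ forall N, trace_class (L2inner (mu := m)) (H N) (S N),
      (\int[m]_x `|sigma x * psi (sigma x)|%:E < +oo)%E &
      (trace (L2inner (mu := m)) (H N) (S N) / (fine (mh (F N)))%:C : R[i]^o)
        @[N --> \oo] --> ((\int[m]_x (sigma x * psi (sigma x)))%:C : R[i]^o)].
Proof.
have [sE s1 sI] := clamp_symbol clI sigma1 sigmaI.
have isp := rintegrable_symbol clI psi_continuous psiI s1 sigma2 sI.
have msigma := rintegrable_measurable sigma1.
move=> H T S; split.
- move=> N; exact: (szego_trace_class hausdorffG locally_compactG haar_m dual_haar_mh folnerF msigma sE
    s1 sigma2 clI sI psi_continuous).
- rewrite (eq_ge0_integral_ae (g := fun x => `|(cl \o sigma) x * psi ((cl \o sigma) x)|%:E)).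
  + by have /integrableP[_] := isp.
  + by move=> x; rewrite lee_fin.
  + by move=> x; rewrite lee_fin.
  + by apply: filterS sE => x {1 2}->.
- have -> : Rintegral m setT (fun x => sigma x * psi (sigma x)) =
      Rintegral m setT (fun x => (cl \o sigma) x * psi ((cl \o sigma) x)).
    rewrite /Rintegral; congr fine; apply: eq_integral_ae.
    by apply: filterS sE => x {1 2}->.
  exact: (szego_limit hausdorffG locally_compactG haar_m dual_haar_mh folnerF msigma sE
    s1 sigma2 clI sI psi_continuous psiI).
Qed.

Theorem theorem1p3 (R : realType) (G : topologicalZmodType)
  (hausdorffG : hausdorff_space G) (locally_compactG : locally_compact [set: G])
  (m : {measure set (borel G) -> \bar R}) (haar_m : haar_measure m)
  (mh : {measure set (borel (dual R G)) -> \bar R})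
  (dual_haar_mh : dual_haar_measure m mh)
  (F : nat -> set (borel (dual R G))) (folnerF : folner_sequence mh F)
  (sigma : borel G -> R) (sigma_L1 : sigma \in Lfun m 1)
  (psi : R -> R)
  (hyp :
    ((exists M : R, {ae m, forall x, `|sigma x| <= M}) /\
     {within `[fine (ess_inf m (EFin \o sigma)), fine (ess_sup m (EFin \o sigma))],
       continuous psi}) \/
    [/\ {ae m, forall x, 0 <= sigma x},
        sigma \in Lfun m 2%:E,
        {within `[0, +oo[, continuous psi} &
        exists l : R, psi x / x @[x --> +oo] --> l]) :
  let H (N : nat) : set (L2 m) := band_limited m mh (F N) in
  let T (N : nat) : L2 m -> L2 m := toeplitz m mh (F N) sigma in
  let S (N : nat) : L2 m -> L2 m :=
    T N \o functional_calculus (L2inner (mu := m)) (H N) psi (T N) in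
  [/\ forall N, trace_class (L2inner (mu := m)) (H N) (S N),
      (\int[m]_x `|sigma x * psi (sigma x)|%:E < +oo)%E &
      (trace (L2inner (mu := m)) (H N) (S N) / (fine (mh (F N)))%:C : R[i]^o)
        @[N --> \oo] --> ((\int[m]_x (sigma x * psi (sigma x)))%:C : R[i]^o)].
Proof.
have sigma1 : rintegrable m sigma by exact/Lfun1_integrable.
have mG : (0 < m setT)%E by case: haar_m.
have [[[M sM] psi_continuous]|[s0 s2 psi_continuous [l psi_l]]] := hyp.
- have [ab sab] := ess_segment mG sM.
  move: psi_continuous sab ab; set a := fine _; set b := fine _ => psi_continuous sab ab.
  pose cl x := Num.max a (Num.min x b); have clI : clamp `[a, b]%classic cl := clamp_segment ab.
  have sI : {ae m, forall x, `[a, b]%classic (sigma x)}.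
    by apply: filterS sab => x; rewrite /= in_itv.
  have [cl_continuous cl_mem _] := clI.
  have pc : continuous (psi \o cl) := continuous_comp_within psi_continuous cl_continuous cl_mem.
  have bound x : `[a, b]%classic x -> `|x| <= `|a| + `|b|.
    rewrite /= in_itv /= ler_norml => /andP[ax xb].
    have := ler_norm (- a); rewrite normrN; have := ler_norm b.
    by have := normr_ge0 a; have := normr_ge0 b; lra.
  (* Proved for [psi \o cl], which is continuous on the line, and carried over to [psi] by
     [clamp_id]. *)
  have psiI : almost_lipschitz `[a, b]%classic psi.
    move=> eps e0; have [C C0 hC] := almost_lipschitz_segment pc bound e0.
    exists C => // s t Is It; have := hC s t Is It.
    by rewrite /= !(clamp_id clI).
  have [_ s1 sI'] := clamp_symbol clI sigma1 sI.
  apply: (szego_ae hausdorffG locally_compactG haar_m dual_haar_mh folnerF sigma1 clI sI _ pc psiI).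
  (* In case (a) square integrability follows from boundedness and integrability. *)
  apply: (le_rintegrable _ (rintegrableZ (`|a| + `|b|) (rintegrable_norm s1))).
    by apply: measurable_funX; exact: rintegrable_measurable s1.
  move=> x; rewrite normrX expr2; apply: ler_wpM2r => //; exact: bound.
- pose cl (x : R) := Num.max x 0; have clI : clamp `[0, +oo[%classic cl := clamp_half_line R.
  have sI : {ae m, forall x, `[0, +oo[%classic (sigma x)}.
    by apply: filterS s0 => x; rewrite /= in_itv /= andbT.
  have [cl_continuous cl_mem _] := clI.
  have pc : continuous (psi \o cl) := continuous_comp_within psi_continuous cl_continuous cl_mem.
  have psiI : almost_lipschitz `[0, +oo[%classic psi.
    (* The two functions agree for [x > 0], hence have the same limit at infinity. *)
    have pl : (psi \o cl) x / x @[x --> +oo] --> l.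
      apply: cvg_trans psi_l; apply: near_eq_cvg.
      exists 0; split => // x x0; rewrite /= (clamp_id clI)//=.
      by rewrite in_itv /= andbT ltW.
    move=> eps e0; have [C C0 hC] := almost_lipschitz_half_line pc pl e0.
    exists C => // s t Is It; have := hC s t Is It.
    by rewrite /= !(clamp_id clI).
  have [sE s1 sI'] := clamp_symbol clI sigma1 sI.
  apply: (szego_ae hausdorffG locally_compactG haar_m dual_haar_mh folnerF sigma1 clI sI _ pc psiI).
  have [_ i2] := (Lfun2P m sigma).1 s2.
  apply: (rintegrable_ae _ i2).
    by apply: measurable_funX; exact: rintegrable_measurable s1.
  by apply: filterS sE => x {1}->.
Qed.
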